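(* Let $u_{ts}^{\ast\star}(\mathbf{x},\mathbf{x}';\sigma_{ts}^{\ast\star})=\int_{-\infty}^{\infty}\mathcal{E}_{ts}^{\ast\star}(\mathbf{x},\mathbf{x}',\lambda)\sigma_{ts}^{\ast\star}(\lambda)\,d\lambda$ be one of the reaction field components arising from a well-posed Helmholtz problem in a layered medium (as described in the context), with source $\mathbf{x}'$ in layer $s$, target $\mathbf{x}$ in layer $t$, source center $\mathbf{x}_c$, local (target) center $\mathbf{x}_c^l$ and new local center $\tilde{\mathbf{x}}_c^l$. Let $c_0>1$ be given. Then there are functions $c^{\mathrm{ME}}(\cdot)$, $c^{\mathrm{LE}}(\cdot)$, $c^{\mathrm{M2L}}_m(\cdot)$, $c^{\mathrm{L2L}}_m(\cdot)$ ($m\in\mathbb{Z}$) having polynomial growth rates such that, for all truncation indices $P$, $M$ (positive integers): (ME) if $D_{ts}^{\ast\star}(\mathbf{x},\mathbf{x}_c)>c_0|\mathbf{x}'-\mathbf{x}_c|$, then $$\Big|u_{ts}^{\ast\star}(\mathbf{x},\mathbf{x}';\sigma_{ts}^{\ast\star})-\sum_{|p|<P}I_p^{\ast\star}(\mathbf{x},\mathbf{x}_c)M_p^{\star}(\mathbf{x}',\mathbf{x}_c)\Big|\le c^{\mathrm{ME}}(P)\left(\frac{|\mathbf{x}'-\mathbf{x}_c|}{D_{ts}^{\ast\star}(\mathbf{x},\mathbf{x}_c)}\right)^P;$$ (LE) if $D_{ts}^{\ast\star}(\mathbf{x}_c^l,\mathbf{x}')>c_0|\mathbf{x}-\mathbf{x}_c^l|$,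 then $$\Big|u_{ts}^{\ast\star}(\mathbf{x},\mathbf{x}';\sigma_{ts}^{\ast\star})-\sum_{|m|<M}L_m^{\ast\star}(\mathbf{x}_c^l,\mathbf{x}')K_m^{\ast}(\mathbf{x},\mathbf{x}_c^l)\Big|\le c^{\mathrm{LE}}(M)\left(\frac{|\mathbf{x}-\mathbf{x}_c^l|}{D_{ts}^{\ast\star}(\mathbf{x}_c^l,\mathbf{x}')}\right)^M;$$ (M2L) if $D_{ts}^{\ast\star}(\mathbf{x}_c^l,\mathbf{x}_c)>c_0|\mathbf{x}'-\mathbf{x}_c|$, then for each $m\in\mathbb{Z}$ $$\Big|L_m^{\ast\star}(\mathbf{x}_c^l,\mathbf{x}')-\sum_{|p|<P}A_{mp}^{\ast\star}(\mathbf{x}_c^l,\mathbf{x}_c)M_p^{\star}(\mathbf{x}',\mathbf{x}_c)\Big|\le c^{\mathrm{M2L}}_m(P)\left(\frac{|\mathbf{x}'-\mathbf{x}_c|}{D_{ts}^{\ast\star}(\mathbf{x}_c^l,\mathbf{x}_c)}\right)^P;$$ (L2L) if $D_{ts}^{\ast\star}(\mathbf{x}_c^l,\mathbf{x}')>c_0|\tilde{\mathbf{x}}_c^l-\mathbf{x}_c^l|$, then for each $m\in\mathbb{Z}$ $$\Big|L_m^{\ast\star}(\tilde{\mathbf{x}}_c^l,\mathbf{x}')-\sum_{|p|<P}L_p^{\ast\star}(\mathbf{x}_c^l,\mathbf{x}')K_{p-m}^{\ast}(\tilde{\mathbf{x}}_c^l,\mathbf{x}_c^l)\Big|\le c^{\mathrm{L2L}}_m(P)\left(\frac{|\tilde{\mathbf{x}}_c^l-\mathbf{x}_c^l|}{D_{ts}^{\ast\star}(\mathbf{x}_c^l,\mathbf{x}')}\right)^P.$$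 Moreover, if all the sources, targets and centers involved are contained in a given bounded box, the distances from every center to its nearby interface ($y=d_s^{\star}$ for source centers, $y=d_t^{\ast}$ for local centers) have a given nonzero lower bound, and there exist $0<\rho_m\le\rho_M$ such that $$\rho_m\le D_{ts}^{\ast\star}(\mathbf{x},\mathbf{x}_c),\ D_{ts}^{\ast\star}(\mathbf{x}_c^l,\mathbf{x}'),\ D_{ts}^{\ast\star}(\mathbf{x}_c^l,\mathbf{x}_c)\le\rho_M,$$ then the functions $c^{\mathrm{ME}}$, $c^{\mathrm{LE}}$, $c^{\mathrm{M2L}}_m$, $c^{\mathrm{L2L}}_m$ can be chosen to be determined by these bounds, without dependence on the actual positions of the source locations.
   Context: **Square root.** For $z=re^{\mathrm{i}\theta}$ with $r\ge0$, $\theta\in[-\pi,\pi)$, $\sqrt z=\sqrt r\,e^{\mathrm{i}\theta/2}$; in particular $\sqrt{\lambda^2-k^2}=-\mathrm{i}\sqrt{k^2-\lambda^2}$ for real $|\lambda|<k$. **Layered medium.** There are $L$ interfaces $y=d_l$, $0\le l\le L-1$, in $\mathbb{R}^2$, with $d_0>d_1>\dots>d_{L-1}$; interface $y=d_l$ separates layer $l$ (above) from layer $l+1$ (below). Layer $l$ has wave number $k_l>0$, $0\le l\le L$. For a source $\mathbf{x}'=(x',y')$ in layer $s$ and target $\mathbf{x}=(x,y)$ in layer $t$, the layered Green's function $G$ satisfies $\Delta G+k_t^2G=-\delta(\mathbf{x},\mathbf{x}')$ within each layer $t$, with two interface conditions at each interface $y=d_l$, each of the form $[a_tG+b_t\,\partial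 G/\partial\mathbf{n}]=0$, where $[\cdot]$ is the jump across the interface and $a_t,b_t$ are complex numbers depending on the layer index $t$ (and on which of the two conditions is considered). The reaction field is $u^{\mathrm r}=G-\delta_{t,s}\frac{\mathrm{i}}{4}H_0^{(1)}(k_s|\mathbf{x}-\mathbf{x}'|)$. **Decomposition.** When the problem is well-posed, $u^{\mathrm r}=\sum_{\ast,\star\in\{\uparrow,\downarrow\}}u_{ts}^{\ast\star}(\mathbf{x},\mathbf{x}';\sigma_{ts}^{\ast\star})$, with $$u_{ts}^{\ast\star}(\mathbf{x},\mathbf{x}';\sigma_{ts}^{\ast\star})=\int_{-\infty}^{\infty}\mathcal{E}_{ts}^{\ast\star}(\mathbf{x},\mathbf{x}',\lambda)\sigma_{ts}^{\ast\star}(\lambda)\,d\lambda,$$ $$\mathcal{E}_{ts}^{\ast\star}(\mathbf{x},\mathbf{x}',\lambda)=e^{-\sqrt{\lambda^2-k_t^2}\,\tau^{\ast}(y-d_t^{\ast})-\sqrt{\lambda^2-k_s^2}\,\tau^{\star}(y'-d_s^{\star})+\mathrm{i}\lambda(x-x')},$$ where $\tau^{\uparrow}=1$, $\tau^{\downarrow}=-1$, $d_l^{\uparrow}=d_l$ for $l\ne L$, $d_l^{\downarrow}=d_{l-1}$ for $l\ne0$ (so $\tau^{\ast}(y-d_t^{\ast})>0$, $\tau^{\star}(y'-d_s^{\star})>0$); components incoming from $y=\pm\infty$ (mark $\uparrow$ for layer $L$, mark $\downarrow$ for layer $0$) are excluded. The coefficients $\sigma_{ts}^{\ast\star}(\lambda)$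 do not depend on the coordinates of $\mathbf{x},\mathbf{x}'$; they are the solution of the linear system given, for each $\star$, each $0\le l\le L-1$ and each of the two interface conditions, by $$-c_l^-\sigma_{ls}^{\uparrow\star}-c_l^+e_l\sigma_{ls}^{\downarrow\star}+c_{l+1}^-e_{l+1}\sigma_{l+1,s}^{\uparrow\star}+c_{l+1}^+\sigma_{l+1,s}^{\downarrow\star}=v_{l,s}^{\star},$$ with $h_t=\sqrt{\lambda^2-k_t^2}$, $c_t^{\pm}=a_t\pm b_th_t$, $e_t=e^{-h_t(d_{t-1}-d_t)}$ ($d_{-1}=+\infty$, $d_L=-\infty$, so $e_0=e_L=0$), $v_{l,s}^{\uparrow}=\delta_{l,s}c_l^+/(4\pi h_l)$, $v_{l,s}^{\downarrow}=-\delta_{l+1,s}c_{l+1}^-/(4\pi h_{l+1})$. The coefficients satisfy, for every $\epsilon>0$, $\sigma_{ts}^{\ast\star}(\lambda)\ll\exp(\epsilon\lambda)$ as $\lambda\to+\infty$. **Well-posedness and real poles.** Integrals over the real line are limits, as $\epsilon_l\to0^+$, of those for perturbed wave numbers $k_l+\epsilon_l\mathrm{i}$. In a well-posed problem poles of $\sigma_{ts}^{\ast\star}$ have order at most one, $0$ is not a pole, and the perturbed pole tending to a real pole $\lambda_\nu$ stays on one side of the real axis for small perturbations. With $\sigma_\nu=\lim_{\lambda\to\lambda_\nu}(\lambda-\lambda_\nu)\sigma(\lambda)$, the integral $\int_a^b h(\lambda)\sigma(\lambda)d\lambda$ across a real pole $\lambda_\nu$ is understood as $\int_a^b\big(h(\lambda)\sigma(\lambda)-\frac{h(\lambda_\nu)\sigma_\nu}{\lambda-\lambda_\nu}\big)d\lambda+\mathrm{p.v.}\int_a^b\frac{h(\lambda_\nu)\sigma_\nu}{\lambda-\lambda_\nu}d\lambda\pm\mathrm{i}\pi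 h(\lambda_\nu)\sigma_\nu$, with sign $+$ (resp. $-$) if the perturbed pole approaches $\lambda_\nu$ from the upper (resp. lower) half plane. **Centers and expansion functions.** The source center $\mathbf{x}_c=(x_c,y_c)$ satisfies $\tau^{\star}(y_c-d_s^{\star})>0$; the local centers $\mathbf{x}_c^l=(x_c^l,y_c^l)$ and $\tilde{\mathbf{x}}_c^l=(\tilde x_c^l,\tilde y_c^l)$ satisfy $\tau^{\ast}(y_c^l-d_t^{\ast})>0$, $\tau^{\ast}(\tilde y_c^l-d_t^{\ast})>0$. Put $w_l(\lambda)=(\lambda-\sqrt{\lambda^2-k_l^2})/k_l$, and let $J_p$ be the Bessel function of the first kind. Let $(\rho_c',\theta_c')$, $(\rho^l,\theta^l)$ and $(\tilde\rho,\tilde\theta)$ be the polar coordinates of $\mathbf{x}'-\mathbf{x}_c$, $\mathbf{x}-\mathbf{x}_c^l$ and $\tilde{\mathbf{x}}_c^l-\mathbf{x}_c^l$. Define $$I_p^{\ast\star}(\mathbf{x},\mathbf{x}_c)=\int_{-\infty}^{\infty}\mathcal{E}_{ts}^{\ast\star}(\mathbf{x},\mathbf{x}_c,\lambda)\sigma_{ts}^{\ast\star}(\lambda)(-\mathrm{i}w_s(\lambda))^p\,d\lambda,\qquad M_p^{\star}(\mathbf{x}',\mathbf{x}_c)=J_p(k_s\rho_c')e^{\mathrm{i}p\tau^{\star}\theta_c'},$$ $$L_m^{\ast\star}(\mathbf{x}_c^l,\mathbf{x}')=\int_{-\infty}^{\infty}\mathcal{E}_{ts}^{\ast\star}(\mathbf{x}_c^l,\mathbf{x}',\lambda)\sigma_{ts}^{\ast\star}(\lambda)(\mathrm{i}w_t(\lambda)^{-1})^m\,d\lambda,\qquad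 K_m^{\ast}(\mathbf{x},\mathbf{x}_c^l)=J_m(k_t\rho^l)e^{\mathrm{i}m\tau^{\ast}\theta^l},$$ (so $K_{m}^{\ast}(\tilde{\mathbf{x}}_c^l,\mathbf{x}_c^l)=J_m(k_t\tilde\rho)e^{\mathrm{i}m\tau^{\ast}\tilde\theta}$), and $$A_{mp}^{\ast\star}(\mathbf{x}_c^l,\mathbf{x}_c)=\int_{-\infty}^{\infty}\mathcal{E}_{ts}^{\ast\star}(\mathbf{x}_c^l,\mathbf{x}_c,\lambda)\sigma_{ts}^{\ast\star}(\lambda)(-\mathrm{i}w_s(\lambda))^p(\mathrm{i}w_t(\lambda)^{-1})^m\,d\lambda.$$ **Polarized distance.** For $\mathbf{x}_1=(x_1,y_1)$, $\mathbf{x}_2=(x_2,y_2)$ with $\tau^{\ast}(y_1-d_t^{\ast})>0$ and $\tau^{\star}(y_2-d_s^{\star})>0$, $$D_{ts}^{\ast\star}(\mathbf{x}_1,\mathbf{x}_2)=\sqrt{(x_1-x_2)^2+\big(\tau^{\ast}(y_1-d_t^{\ast})+\tau^{\star}(y_2-d_s^{\star})\big)^2}.$$ A function $c(\cdot)$ on positive integers has polynomial growth rate if it is bounded by a polynomial.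
   Formalization: (L2L) fails for m≠0 if the new local center equals or tends to the old one, so it is asserted for m=0 or distinct centers; in the ''moreover'' part, for m≠0, c^{L2L}_m may also depend on a positive lower bound of the distance between the two local centers. *)

(* Defs.v *)
From HB Require Import structures.
From mathcomp Require Import all_boot all_order all_algebra.
From mathcomp Require Import complex.
From mathcomp Require Import all_classical all_reals all_analysis.

Set Implicit Arguments.
Unset Strict Implicit.
Unset Printing Implicit Defensive.

Import Order.TTheory GRing.Theory Num.Theory.
Import numFieldNormedType.Exports.

Local Open Scope classical_set_scope.
Local Open Scope complex_scope.
Local Open Scope ring_scope.

(* R[i] packed as a numClosedFieldType, so that the topology of numeric fields
   is inferred on it. *)
Definition CC (R : realType) : numClosedFieldType := R[i].

Section ComplexFunctions.
Variable R : realType.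
Local Notation C := (CC R).

Definition cpx (x y : R) : C := x +i* y.
Definition ofR (x : R) : C := cpx x 0.
Definition Ci : C := cpx 0 1.
Definition re (z : C) : R := complex.Re z.
Definition im (z : C) : R := complex.Im z.
Definition cabs (z : C) : R := Num.sqrt (re z ^+ 2 + im z ^+ 2).

Definition cexp (z : C) : C :=
  cpx (expR (re z) * cos (im z)) (expR (re z) * sin (im z)).

(* Argument in [-pi, pi); in particular carg z = - pi on the negative real axis.
   The value at 0 is never significant. *)
Definition carg (z : C) : R :=
  let a := acos (re z / cabs z) in if 0 < im z then a else - a.

Definition csqrt (z : C) : C :=
  ofR (Num.sqrt (cabs z)) * cexp (Ci * ofR (carg z / 2)).

(* Lebesgue integral over D of a complex-valued function of a real variable. *)
Definition cint (D : set R) (f : R -> C) : C :=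
  cpx (\int[lebesgue_measure]_(x in D) re (f x))
      (\int[lebesgue_measure]_(x in D) im (f x)).

Definition bessel_nat (n : nat) (x : R) : R :=
  limn (series (fun j : nat =>
    (-1) ^+ j / (j`! * (j + n)`!)%:R * (x / 2) ^+ (2 * j + n))).

(* Bessel function of the first kind, J_{-n} = (-1)^n J_n. *)
Definition besselJ (p : int) (x : R) : R :=
  match p with
  | Posz n => bessel_nat n x
  | Negz n => (-1) ^+ n.+1 * bessel_nat n.+1 x
  end.

(* The sum over the integers p with |p| < P, for P > 0. *)
Definition zsum (P : nat) (F : int -> C) : C :=
  F 0 + \sum_(1 <= n < P) (F n%:Z + F (- n%:Z)).

End ComplexFunctions.

Section RealPoles.
Variable R : realType.
Local Notation C := (CC R).
Implicit Types (sg : R -> C) (g : R -> C).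

(* sigma_nu = lim_{lambda -> nu} (lambda - nu) sigma(lambda), along the reals.
   It is 0 when nu is not a pole, also at an inverse square root singularity. *)
Definition pole_order_le1 sg (nu : R) : Prop :=
  cvg (ofR (x - nu) * sg x @[x --> nu^']).

Definition residue sg (nu : R) : C :=
  lim (ofR (x - nu) * sg x @[x --> nu^']).

Definition real_poles sg : set R := [set nu | residue sg nu != 0].

Definition pv (a b nu : R) (f : R -> C) : C :=
  lim (cint [set x | a <= x <= b /\ eta <= `|x - nu|] f @[eta --> 0^'+]).

(* Integral of g * sg over [a, b] across the pole nu of sg; upper says that the
   perturbed pole approaches nu from the upper half plane. *)
Definition int_across (upper : bool) sg (nu : R) g (a b : R) : C :=
  let c := g nu * residue sg nu in
  cint [set x | a <= x <= b] (fun x => g x * sg x - c / ofR (x - nu))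
  + pv a b nu (fun x => c / ofR (x - nu))
  + (if upper then 1 else -1) * (Ci R * ofR pi * c).

(* A radius for which the closed intervals centered at the points of S are
   pairwise disjoint; the integral below does not depend on its choice. *)
Definition sep_radius (S : set R) : R :=
  xget 1 [set r | 0 < r /\
    forall nu mu, S nu -> S mu -> nu != mu -> 2 * r < `|nu - mu|].

Definition real_int (side : R -> bool) sg g : C :=
  let S := real_poles sg in
  let r := sep_radius S in
  cint [set x | forall nu, S nu -> r < `|x - nu|] (fun x => g x * sg x)
  + \sum_(nu \in S) int_across (side nu) sg nu g (nu - r) (nu + r).

(* mu is a pole of f: singularities weaker than a simple pole (removable, or of
   inverse square root type) are excluded. *)
Definition complex_pole (f : C -> C) (mu : C) : Prop :=
  ~ ((z - mu) * f z @[z --> mu^'] --> (0 : C)).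

End RealPoles.

Inductive mark := Up | Down.

(* There are nint interfaces y = iface l (l < nint), layer l lies between
   iface l and iface l.-1, and wavenum l, ca _ l, cb _ l (l <= nint) are the
   data of layer l. The boolean distinguishes the two interface conditions. *)
Record medium (R : realType) := Medium {
  nint : nat;
  iface : nat -> R;
  wavenum : nat -> R;
  ca : bool -> nat -> CC R;
  cb : bool -> nat -> CC R;
  iface_decr : forall l, (l.+1 < nint)%N -> iface l.+1 < iface l;
  wavenum_gt0 : forall l, (l <= nint)%N -> 0 < wavenum l
}.

Section Medium.
Variables (R : realType) (md : medium R).
Local Notation C := (CC R).
Local Notation pt := (R * R)%type.

Definition tau (a : mark) : R := if a is Up then 1 else -1.

(* Marks of components not coming from infinity. *)
Definition mark_ok (a : mark) (t : nat) : bool :=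
  if a is Up then (t < nint md)%N else (0 < t)%N.

Definition dmark (a : mark) (t : nat) : R :=
  if a is Up then iface md t else iface md t.-1.

(* The (positive) distance tau^a (y - d_t^a) to the interface marked a. *)
Definition depth (a : mark) (t : nat) (p : pt) : R :=
  tau a * (p.2 - dmark a t).

Definition in_layer (t : nat) (p : pt) : Prop :=
  ((t < nint md)%N -> iface md t < p.2) /\ ((0 < t)%N -> p.2 < iface md t.-1).

Section System.
(* The linear system depends on lambda and on the wave numbers only through
   the values h_t = sqrt(lambda^2 - k_t^2). *)
Variable h : nat -> C.

Definition cplus (j : bool) (t : nat) : C := ca md j t + cb md j t * h t.
Definition cminus (j : bool) (t : nat) : C := ca md j t - cb md j t * h t.

Definition efac (t : nat) : C :=
  if (0 < t < nint md)%N
  then cexp (- (h t * ofR (iface md t.-1 - iface md t))) else 0.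

Definition rhs (star : mark) (s : nat) (j : bool) (l : nat) : C :=
  match star with
  | Up => if l == s then cplus j l / (4 * ofR pi * h l) else 0
  | Down => if l.+1 == s
            then - (cminus j l.+1 / (4 * ofR pi * h l.+1)) else 0
  end.

(* X a t stands for sigma_{ts}^{a star}; the two components incoming from
   infinity, which have coefficient 0 in the equations, are set to 0. *)
Definition solves (star : mark) (s : nat) (X : mark -> nat -> C) : Prop :=
  [/\ X Up (nint md) = 0, X Down 0%N = 0 &
   forall (j : bool) (l : nat), (l < nint md)%N ->
     - cminus j l * X Up l - cplus j l * efac l * X Down l
     + cminus j l.+1 * efac l.+1 * X Up l.+1 + cplus j l.+1 * X Down l.+1
     = rhs star s j l].

Definition uniquely_solvable (star : mark) (s : nat) : Prop :=
  exists X, solves star s X /\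
    forall Y, solves star s Y ->
      forall a t, (t <= nint md)%N -> Y a t = X a t.

(* The solution of the system; significant when it is unique. *)
Definition solution (star : mark) (s : nat) : mark -> nat -> C :=
  xget (fun _ _ => 0) [set X | solves star s X].

End System.

Definition hroot (kappa : nat -> C) (lam : C) (t : nat) : C :=
  csqrt (lam ^+ 2 - kappa t ^+ 2).

Definition hreal (lam : R) (t : nat) : C :=
  hroot (fun l => ofR (wavenum md l)) (ofR lam) t.

Definition sigma (s : nat) (star : mark) (t : nat) (a : mark) (lam : R) : C :=
  solution (hreal lam) star s a t.

Definition kpert (eps : nat -> R) (l : nat) : C := cpx (wavenum md l) (eps l).

(* The square roots for complex lam near the real point nu, continued
   analytically from the real axis: for perturbed wave numbers and real lam they
   are equal to hroot, but for |nu| < k_t the branch cut of hroot approaches nu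
   as the perturbation tends to 0. *)
Definition hcont (nu : R) (kappa : nat -> C) (lam : C) (t : nat) : C :=
  if `|nu| < wavenum md t then - (Ci R * csqrt (kappa t ^+ 2 - lam ^+ 2))
  else hroot kappa lam t.

Definition sigma_pert (s : nat) (star : mark) (t : nat) (a : mark)
    (nu : R) (eps : nat -> R) (lam : C) : C :=
  solution (hcont nu (kpert eps) lam) star s a t.

(* The perturbed poles tending to nu stay in the upper (resp. lower) half
   plane for small perturbations. *)
Definition approaches_from (upper : bool) (s : nat) (star : mark) (t : nat)
    (a : mark) (nu : R) : Prop :=
  exists2 r : R, 0 < r &
    forall eps : nat -> R, (forall l, (l <= nint md)%N -> 0 < eps l < r) ->
    forall mu : C, cabs (mu - ofR nu) < r ->
      complex_pole (sigma_pert s star t a nu eps) mu ->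
      if upper then 0 < im mu else im mu < 0.

Definition well_posed (s : nat) : Prop :=
  (forall star, mark_ok star s ->
     finite_set [set lam : R | ~ uniquely_solvable (hreal lam) star s]) /\
  forall star t a, mark_ok star s -> (t <= nint md)%N -> mark_ok a t ->
  let sg := sigma s star t a in
  [/\ forall nu : R, pole_order_le1 sg nu,
      ~ real_poles sg 0,
      forall nu : R, real_poles sg nu ->
        exists upper, approaches_from upper s star t a nu &
      forall e : R, 0 < e ->
        exists K : R, \forall lam \near +oo,
          cabs (sg lam) <= K * expR (e * lam)].

End Medium.

Arguments tau {R} a.

(* A reaction field component: source layer and mark, target layer and mark. *)
Record component (R : realType) (md : medium R) := Component {
  src : nat;
  srcmark : mark;
  tgt : nat;
  tgtmark : mark;
  src_le : (src <= nint md)%N;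
  tgt_le : (tgt <= nint md)%N;
  srcmark_ok : mark_ok md srcmark src;
  tgtmark_ok : mark_ok md tgtmark tgt
}.

Section Component.
Variables (R : realType) (md : medium R) (q : component md).
Local Notation C := (CC R).
Local Notation pt := (R * R)%type.
Local Notation s := (src q).
Local Notation star := (srcmark q).
Local Notation t := (tgt q).
Local Notation a := (tgtmark q).

Definition sigq : R -> C := sigma md s star t a.

(* side nu tells from which half plane the real pole nu is approached. *)
Definition pole_sides (side : R -> bool) : Prop :=
  forall nu, real_poles sigq nu ->
    approaches_from md (side nu) s star t a nu.

Definition src_depth (p : pt) : R := depth md star s p.
Definition tgt_depth (p : pt) : R := depth md a t p.

Definition dist (p p' : pt) : R :=
  Num.sqrt ((p.1 - p'.1) ^+ 2 + (p.2 - p'.2) ^+ 2).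

Definition angle (p p' : pt) : R := carg (cpx (p.1 - p'.1) (p.2 - p'.2)).

Definition polD (p1 p2 : pt) : R :=
  Num.sqrt ((p1.1 - p2.1) ^+ 2 + (tgt_depth p1 + src_depth p2) ^+ 2).

Definition kernelE (p p' : pt) (lam : R) : C :=
  cexp (- (hreal md lam t * ofR (tgt_depth p))
        - hreal md lam s * ofR (src_depth p')
        + Ci R * ofR (lam * (p.1 - p'.1))).

Definition wfun (l : nat) (lam : R) : C :=
  (ofR lam - hreal md lam l) / ofR (wavenum md l).

Variable side : R -> bool.

Definition ureact (x x' : pt) : C := real_int side sigq (kernelE x x').

Definition coefI (p : int) (x xc : pt) : C :=
  real_int side sigq (fun lam => kernelE x xc lam * (- Ci R * wfun s lam) ^ p).

Definition basisM (p : int) (x' xc : pt) : C :=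
  ofR (besselJ p (wavenum md s * dist x' xc))
  * cexp (Ci R * ofR (p%:~R * tau star * angle x' xc)).

Definition coefL (m : int) (xl x' : pt) : C :=
  real_int side sigq (fun lam => kernelE xl x' lam * (Ci R * (wfun t lam)^-1) ^ m).

Definition basisK (m : int) (x xl : pt) : C :=
  ofR (besselJ m (wavenum md t * dist x xl))
  * cexp (Ci R * ofR (m%:~R * tau a * angle x xl)).

Definition coefA (m p : int) (xl xc : pt) : C :=
  real_int side sigq (fun lam =>
    kernelE xl xc lam * (- Ci R * wfun s lam) ^ p * (Ci R * (wfun t lam)^-1) ^ m).

Variable c0 : R.

Definition ME_bound (x x' xc : pt) (c : nat -> R) : Prop :=
  c0 * dist x' xc < polD x xc ->
  forall P : nat, (0 < P)%N ->
  cabs (ureact x x' - zsum P (fun p => coefI p x xc * basisM p x' xc))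
  <= c P * (dist x' xc / polD x xc) ^+ P.

Definition LE_bound (x x' xl : pt) (c : nat -> R) : Prop :=
  c0 * dist x xl < polD xl x' ->
  forall M : nat, (0 < M)%N ->
  cabs (ureact x x' - zsum M (fun m => coefL m xl x' * basisK m x xl))
  <= c M * (dist x xl / polD xl x') ^+ M.

Definition M2L_bound (x' xc xl : pt) (m : int) (c : nat -> R) : Prop :=
  c0 * dist x' xc < polD xl xc ->
  forall P : nat, (0 < P)%N ->
  cabs (coefL m xl x' - zsum P (fun p => coefA m p xl xc * basisM p x' xc))
  <= c P * (dist x' xc / polD xl xc) ^+ P.

(* For xt = xl one has K_{p-m} = delta_{pm}, so that the bound fails for m <> 0
   and P <= |m| unless L_m vanishes; likewise c cannot be uniform as xt tends to
   xl. It is to be used with m = 0, or with a lower bound on dist xt xl. *)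
Definition L2L_bound (x' xl xt : pt) (m : int) (c : nat -> R) : Prop :=
  c0 * dist xt xl < polD xl x' ->
  forall P : nat, (0 < P)%N ->
  cabs (coefL m xt x' - zsum P (fun p => coefL p xl x' * basisK (p - m) xt xl))
  <= c P * (dist xt xl / polD xl x') ^+ P.

(* Target x, source x', source center xc, local center xl, new local center
   xt. *)
Definition admissible (x x' xc xl xt : pt) : Prop :=
  [/\ in_layer md t x, in_layer md s x', 0 < src_depth xc,
      0 < tgt_depth xl & 0 < tgt_depth xt].

End Component.

Definition in_box (R : realType) (x0 x1 y0 y1 : R) (p : R * R) : Prop :=
  x0 <= p.1 <= x1 /\ y0 <= p.2 <= y1.

Definition poly_growth (R : realType) (c : nat -> R) : Prop :=
  exists f : {poly R}, forall n, (0 < n)%N -> `|c n| <= f.[n%:R].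

(* Main.v *)
(* Put u = 1 / w_b, so that lambda = (k_b / 2) (u + 1 / u) and
   sqrt(lambda^2 - k_b^2) = (k_b / 2) (u - 1 / u). Displacing a point of layer b by
   the polar vector (rho, phi) multiplies the kernel by exp((k_b rho / 2) (Z - 1 / Z)),
   where Z = (i u)^(+-1) exp(i tau phi): this is the generating function
   sum_p J_p(k_b rho) Z^p. Interpolate between the exact kernel (s = 0) and its
   truncated expansion (s = 1) by
     exp((1 - s) (k_b rho / 2) (Z - 1 / Z)) * sum_{|p| < P} J_p(k_b s rho) Z^p.
   The recurrence of the Bessel functions makes the derivative in s telescope to four
   terms with indices close to P, hence no infinite sum occurs, and it is enough to
   bound the integral of each of these terms against sigma, uniformly in s.

   For bounded lambda, J_P = O((k_b rho / 2)^P / P!) is far smaller than needed. Near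
   the real poles, sigma is a quotient of power series in sqrt|lambda - nu|, so that
   the finite part is controlled by a Hoelder condition of exponent 1/2.

   Near infinity, Cramer's rule gives sigma as a quotient of exponential sums whose
   coefficients are convergent power series in 1 / u. A finite geometric expansion and
   the growth hypothesis reduce it to terms exp(- d u) a(1 / u) with d >= 0, for which
   int u^P exp(- u z) du = O(P! / |z|^P), z being (k_b / 2) times the complexified
   polarized distance at the parameter s, of modulus at least (k_b / 2) (D - (1 - s) rho).
   Against J_P(k_b s rho) this leaves a polynomial in P times
   (s rho / (D - (1 - s) rho))^P <= (rho / D)^P. *)

From mathcomp Require Import all_boot all_order all_algebra complex ring lra zify.
From mathcomp Require Import all_classical all_reals all_analysis measurable_realfun finmap.
Require Import Defs.

Set Implicit Arguments.
Unset Strict Implicit.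
Unset Printing Implicit Defensive.

Import Order.TTheory GRing.Theory Num.Theory.
Import numFieldNormedType.Exports.
Local Open Scope ring_scope.

(** * Complex numbers and functions *)

(** The decay required is in the polarized distance D = |z|. Absolute values under the integral only
    give powers of re z, the sum of the two depths, which is at most D and may tend to 0 for sources
    and targets near their interfaces. Hence near infinity the oscillation has to be kept: monomials
    in u are integrated by parts, and the interpolation in s is estimated through the integral of
    its derivative.

    Convergent power series are represented by polynomials with bounded weighted coefficient norms,
    so that all estimates are made on polynomials, and products, exponentials, square roots and
    inverses are obtained by explicit approximations.

    Only +oo has to be studied: sigma is even, and lambda -> - lambda replaces w by - 1 / w and
    reverses the horizontal offset. This is why the estimates are stated for both signs of the
    exponents of w at once.

    In L2L the index shift by m loses |m| powers of r / D, for which a lower bound on the distance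
    of the two local centers has to pay. *)

Section ComplexBasics.
Local Open Scope classical_set_scope.
Variable R : realType.
Local Notation C := (CC R).
Implicit Types (z w : C) (x y : R).

Lemma cx_ext z w : re z = re w -> im z = im w -> z = w.
Proof. by case: z => a b; case: w => c d /= -> ->. Qed.

Lemma reD z w : re (z + w) = re z + re w. Proof. by case: z; case: w. Qed.
Lemma imD z w : im (z + w) = im z + im w. Proof. by case: z; case: w. Qed.
Lemma reN z : re (- z) = - re z. Proof. by case: z. Qed.
Lemma imN z : im (- z) = - im z. Proof. by case: z. Qed.
Lemma reB z w : re (z - w) = re z - re w. Proof. by case: z; case: w. Qed.
Lemma imB z w : im (z - w) = im z - im w. Proof. by case: z; case: w. Qed.
Lemma reM z w : re (z * w) = re z * re w - im z * im w.
Proof. by case: z; case: w. Qed.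
Lemma imM z w : im (z * w) = re z * im w + im z * re w.
Proof. by case: z; case: w. Qed.
Lemma ofRD x y : ofR (x + y) = ofR x + ofR y.
Proof. by apply: cx_ext; rewrite ?reD ?imD //= addr0. Qed.
Lemma ofRN x : ofR (- x) = - ofR x.
Proof. by apply: cx_ext; rewrite ?reN ?imN //= oppr0. Qed.
Lemma ofRB x y : ofR (x - y) = ofR x - ofR y.
Proof. by rewrite ofRD ofRN. Qed.
Lemma ofRM x y : ofR (x * y) = ofR x * ofR y.
Proof. by apply: cx_ext; rewrite ?reM ?imM //= ?mulr0 ?mul0r ?subr0 ?addr0. Qed.
Lemma ofR0 : ofR (0 : R) = 0. Proof. by []. Qed.
Lemma ofR1 : ofR (1 : R) = 1. Proof. by []. Qed.
Lemma ofRX x n : ofR (x ^+ n) = ofR x ^+ n.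
Proof. by elim: n => [|n IH]; rewrite ?expr0 // !exprS ofRM IH. Qed.
Lemma ofR_inj : injective (@ofR R). Proof. by move=> x y [->]. Qed.
Lemma ofR_eq0 x : (ofR x == 0) = (x == 0).
Proof. by apply/eqP/eqP => [|->//]; rewrite -ofR0 => /ofR_inj. Qed.
Lemma ofRV x : ofR x^-1 = (ofR x)^-1.
Proof.
have [->|x0] := eqVneq x 0; first by rewrite invr0 ofR0 invr0.
apply: (mulfI (x := ofR x)); first by rewrite ofR_eq0.
by rewrite -ofRM !divff ?ofR_eq0.
Qed.
Lemma ofR_nat n : ofR n%:R = n%:R :> C.
Proof. by elim: n => [//|n IH]; rewrite -!natr1 ofRD IH. Qed.
Lemma reZ x z : re (ofR x * z) = x * re z.
Proof. by rewrite reM /= mul0r subr0. Qed.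
Lemma imZ x z : im (ofR x * z) = x * im z.
Proof. by rewrite imM /= mul0r addr0. Qed.

Lemma cabsE z : cabs z = ComplexField.Normc.normc z.
Proof. by case: z. Qed.
Lemma normcE z : `|z| = ofR (cabs z). Proof. by case: z. Qed.
Lemma cabs_ge0 z : 0 <= cabs z. Proof. exact: sqrtr_ge0. Qed.
Lemma cabsM z w : cabs (z * w) = cabs z * cabs w.
Proof. by rewrite !cabsE ComplexField.Normc.normcM. Qed.
Lemma cabsV z : cabs z^-1 = (cabs z)^-1.
Proof. by rewrite !cabsE ComplexField.Normc.normcV. Qed.
Lemma cabs0 : cabs (0 : C) = 0.
Proof. by rewrite cabsE ComplexField.Normc.normc0. Qed.
Lemma cabs1 : cabs (1 : C) = 1.
Proof. by rewrite cabsE ComplexField.Normc.normc1. Qed.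
Lemma cabs_eq0 z : (cabs z == 0) = (z == 0).
Proof.
apply/eqP/eqP => [|->]; last exact: cabs0.
by rewrite cabsE => /ComplexField.Normc.eq0_normc.
Qed.
Lemma cabs_gt0 z : (0 < cabs z) = (z != 0).
Proof. by rewrite lt_neqAle cabs_ge0 andbT eq_sym cabs_eq0. Qed.
Lemma cabsN z : cabs (- z) = cabs z.
Proof. by rewrite /cabs reN imN !sqrrN. Qed.
Lemma cabsX z n : cabs (z ^+ n) = cabs z ^+ n.
Proof. by elim: n => [|n IH]; rewrite ?expr0 ?cabs1 // !exprS cabsM IH. Qed.
Lemma cabs_ofR x : cabs (ofR x) = `|x|.
Proof. by rewrite /cabs /= expr0n addr0 sqrtr_sqr. Qed.
Lemma cabs_re z : `|re z| <= cabs z.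
Proof. by rewrite -sqrtr_sqr ler_sqrt ?lerDl ?sqr_ge0 // addr_ge0 ?sqr_ge0. Qed.
Lemma cabs_im z : `|im z| <= cabs z.
Proof. by rewrite -sqrtr_sqr ler_sqrt ?lerDr ?sqr_ge0 // addr_ge0 ?sqr_ge0. Qed.
Lemma lecR x y : (ofR x <= ofR y) = (x <= y).
Proof. by rewrite lecE /= eqxx. Qed.
Lemma ltcR' x y : (ofR x < ofR y) = (x < y).
Proof. by rewrite ltcE /= eqxx. Qed.
Lemma ofR_gt0 x : (0 < ofR x) = (0 < x).
Proof. by rewrite -{1}ofR0 ltcR'. Qed.
Lemma cabsD z w : cabs (z + w) <= cabs z + cabs w.
Proof. by rewrite -lecR ofRD -!normcE ler_normD. Qed.
Lemma cabsB z w : cabs (z - w) <= cabs z + cabs w.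
Proof. by rewrite (le_trans (cabsD _ _)) // cabsN. Qed.
Lemma cabs_distC z w : cabs (z - w) = cabs (w - z).
Proof. by rewrite -cabsN opprB. Qed.
Lemma cabs_le z : cabs z <= `|re z| + `|im z|.
Proof.
have zE : z = ofR (re z) + Ci R * ofR (im z).
  by apply: cx_ext; rewrite ?reD ?imD ?reM ?imM /=; ring.
rewrite {1}zE (le_trans (cabsD _ _)) // cabsM !cabs_ofR.
by rewrite /cabs /= expr0n add0r expr1n sqrtr1 mul1r.
Qed.
Lemma cabs_sum I (r : seq I) (P : pred I) (F : I -> C) :
  cabs (\sum_(i <- r | P i) F i) <= \sum_(i <- r | P i) cabs (F i).
Proof.
elim/big_rec2: _ => [|i y1 y2 _ H]; first by rewrite cabs0.
by rewrite (le_trans (cabsD _ _)) // lerD2l.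
Qed.
Lemma cabs_Ci : cabs (Ci R) = 1.
Proof. by rewrite /cabs /= expr0n add0r expr1n sqrtr1. Qed.
Lemma cabs_lerB z w : cabs z - cabs w <= cabs (z - w).
Proof. by rewrite lerBlDr -{1}(subrK w z) cabsD. Qed.

(** Positive elements of [C] are real, so the neighbourhoods of a point can be indexed by positive
    reals. *)
Lemma ccvgP (T : Type) (F : set_system T) {FF : Filter F} (f : T -> C) (l : C) :
  (f @ F --> l) <-> (forall e : R, 0 < e -> \forall t \near F, cabs (l - f t) < e).
Proof.
split=> [/cvgrPdist_lt H e e0|H].
  have /H : 0 < ofR e by rewrite ofR_gt0.
  by apply: filterS => t; rewrite normcE ltcR'.
apply/cvgrPdist_lt => e e0.
have eE : e = ofR (re e).
  move: e0; rewrite ltcE /= => /andP[/eqP h _]; apply: cx_ext => //=.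
have /H : 0 < re e by rewrite -ofR_gt0 -eE.
by apply: filterS => t; rewrite normcE [e]eE ltcR'.
Qed.

Lemma ccvg_re (T : Type) (F : set_system T) {FF : Filter F} (f : T -> C) (l : C) :
  f @ F --> l -> (fun t => re (f t)) @ F --> re l.
Proof.
move=> /ccvgP H; apply/cvgrPdist_lt => e /H; apply: filterS => t.
by apply: le_lt_trans; rewrite -reB cabs_re.
Qed.
Lemma ccvg_im (T : Type) (F : set_system T) {FF : Filter F} (f : T -> C) (l : C) :
  f @ F --> l -> (fun t => im (f t)) @ F --> im l.
Proof.
move=> /ccvgP H; apply/cvgrPdist_lt => e /H; apply: filterS => t.
by apply: le_lt_trans; rewrite -imB cabs_im.
Qed.
Lemma ccvg_reim (T : Type) (F : set_system T) {FF : Filter F} (f : T -> C) (l : C) :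
  (fun t => re (f t)) @ F --> re l -> (fun t => im (f t)) @ F --> im l ->
  f @ F --> l.
Proof.
move=> /cvgrPdist_lt H1 /cvgrPdist_lt H2; apply/ccvgP => e e0.
have e2 : 0 < e / 2 by rewrite divr_gt0.
near=> t; rewrite (le_lt_trans (cabs_le _)) // reB imB [e]splitr.
by rewrite ltrD //; near: t; [exact: H1 | exact: H2].
Unshelve. all: end_near. Qed.
Lemma ccvg_cabs (T : Type) (F : set_system T) {FF : Filter F} (f : T -> C) (l : C) :
  f @ F --> l -> (fun t => cabs (f t)) @ F --> cabs l.
Proof.
move=> /ccvgP H; apply/cvgrPdist_lt => e /H; apply: filterS => t.
apply: le_lt_trans; rewrite ler_norml cabs_lerB andbT lerNl opprB.
by rewrite cabs_distC cabs_lerB.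
Qed.
Lemma cexp0 : cexp (0 : C) = 1.
Proof. by rewrite /cexp /= expR0 cos0 sin0 mulr1 mulr0. Qed.
Lemma cexpD z w : cexp (z + w) = cexp z * cexp w.
Proof.
apply: cx_ext; rewrite ?reM ?imM /= reD imD expRD ?cosD ?sinD; ring.
Qed.
Lemma cexp_neq0 z : cexp z != 0.
Proof.
apply/eqP => H; have := cexpD z (- z); rewrite subrr cexp0 H mul0r => /eqP.
by rewrite oner_eq0.
Qed.
Lemma cexpN z : cexp (- z) = (cexp z)^-1.
Proof.
apply: (mulfI (cexp_neq0 z)).
by rewrite -cexpD subrr cexp0 divff // cexp_neq0.
Qed.
Lemma cexpX z n : cexp z ^+ n = cexp (n%:R * z).
Proof.
elim: n => [|n IH]; first by rewrite mul0r cexp0.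
by rewrite exprS IH -cexpD -nat1r mulrDl mul1r.
Qed.
Lemma cabs_cexp z : cabs (cexp z) = expR (re z).
Proof.
by rewrite /cabs /= !exprMn -mulrDr cos2Dsin2 mulr1 sqrtr_sqr ger0_norm //.
Qed.
Lemma cexp_ofR x : cexp (ofR x) = ofR (expR x).
Proof. by rewrite /cexp /= cos0 sin0 mulr1 mulr0. Qed.

End ComplexBasics.

Section ComplexDerivative.
Local Open Scope classical_set_scope.
Variable R : realType.
Local Notation C := (CC R).
Implicit Types (f g : R -> C) (x : R).

Definition cderiv f x (d : C) : Prop :=
  is_derive x 1 (fun t => re (f t)) (re d) /\
  is_derive x 1 (fun t => im (f t)) (im d).

Lemma cderiv_eq f x d d' : cderiv f x d -> d = d' -> cderiv f x d'.
Proof. by move=> ? <-. Qed.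

Lemma cderiv_cst (c : C) x : cderiv (fun _ => c) x 0.
Proof. by split; exact: is_derive_cst. Qed.

Lemma cderivD f g x a b : cderiv f x a -> cderiv g x b ->
  cderiv (fun t => f t + g t) x (a + b).
Proof.
move=> [f1 f2] [g1 g2]; split.
- rewrite reD (_ : (fun t => _) = (@re R \o f) + (@re R \o g)); first exact: is_deriveD.
  by apply/funext => t; rewrite reD.
- rewrite imD (_ : (fun t => _) = (@im R \o f) + (@im R \o g)); first exact: is_deriveD.
  by apply/funext => t; rewrite imD.
Qed.

Lemma cderivN f x a : cderiv f x a -> cderiv (fun t => - f t) x (- a).
Proof.
move=> [f1 f2]; split.
- rewrite reN (_ : (fun t => _) = - (@re R \o f)); first exact: is_deriveN.
  by apply/funext => t; rewrite reN.
- rewrite imN (_ : (fun t => _) = - (@im R \o f)); first exact: is_deriveN.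
  by apply/funext => t; rewrite imN.
Qed.

Lemma cderivB f g x a b : cderiv f x a -> cderiv g x b ->
  cderiv (fun t => f t - g t) x (a - b).
Proof. by move=> fa gb; apply: cderivD => //; exact: cderivN. Qed.

Lemma cderivM f g x a b : cderiv f x a -> cderiv g x b ->
  cderiv (fun t => f t * g t) x (a * g x + f x * b).
Proof.
move=> [f1 f2] [g1 g2]; split.
- rewrite (_ : (fun t => _) = (@re R \o f) * (@re R \o g) - (@im R \o f) * (@im R \o g)).
    apply: (is_derive_eq (is_deriveB (is_deriveM f1 g1) (is_deriveM f2 g2))).
    rewrite reD !reM /= /GRing.scale /=; ring.
  by apply/funext => t; rewrite reM.
- rewrite (_ : (fun t => _) = (@re R \o f) * (@im R \o g) + (@im R \o f) * (@re R \o g)).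
    apply: (is_derive_eq (is_deriveD (is_deriveM f1 g2) (is_deriveM f2 g1))).
    rewrite imD !imM /= /GRing.scale /=.
    by rewrite addrACA addrC [re a * _]mulrC [im a * _]mulrC addrACA addrC addrACA.
  by apply/funext => t; rewrite imM.
Qed.

Lemma cderivZ f x a (c : C) : cderiv f x a -> cderiv (fun t => c * f t) x (c * a).
Proof.
move=> fa; apply: cderiv_eq (cderivM (cderiv_cst c x) fa) _.
by rewrite mul0r add0r.
Qed.

Lemma cderiv_ofR (g : R -> R) x a : is_derive x 1 g a ->
  cderiv (fun t => ofR (g t)) x (ofR a).
Proof. by move=> ga; split => //=; exact: is_derive_cst. Qed.

Lemma cderiv_cexp f x a : cderiv f x a ->
  cderiv (fun t => cexp (f t)) x (a * cexp (f x)).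
Proof.
move=> [f1 f2]; split => /=.
- rewrite (_ : (fun t => _) = (expR \o (@re R \o f)) * (cos \o (@im R \o f))) //.
  apply: is_derive_eq; rewrite reM /= /GRing.scale /=; ring.
- rewrite (_ : (fun t => _) = (expR \o (@re R \o f)) * (sin \o (@im R \o f))) //.
  apply: is_derive_eq; rewrite imM /= /GRing.scale /=; ring.
Qed.

Lemma cderiv_sum I (r : seq I) (P : pred I) (F : I -> R -> C) (d : I -> C) x :
  (forall i, cderiv (F i) x (d i)) ->
  cderiv (fun t => \sum_(i <- r | P i) F i t) x (\sum_(i <- r | P i) d i).
Proof.
move=> H; elim: r => [|i r IH].
  by rewrite big_nil; under eq_fun do rewrite big_nil; exact: cderiv_cst.
rewrite big_cons; under eq_fun do rewrite big_cons.
by case: (P i) => //; exact: cderivD.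
Qed.

Lemma real_mvt_bound (f df : R -> R) (a b M : R) : a <= b ->
  (forall x, a <= x <= b -> is_derive x 1 f (df x)) ->
  (forall x, a <= x <= b -> `|df x| <= M) -> `|f b - f a| <= M * (b - a).
Proof.
move=> ab fd dM.
have cf : {within `[a, b], continuous f}.
  apply: derivable_within_continuous => x; rewrite in_itv => /= xab.
  by case: (fd x xab).
have [|c] := MVT_segment ab _ cf (df := df).
  move=> x xab; have h : a <= x <= b by rewrite !(itvP xab).
  exact: (fd x h).
rewrite in_itv /= => cab ->; rewrite normrM [(`|b - a|)]ger0_norm ?subr_ge0 //.
by rewrite ler_wpM2r ?subr_ge0 // dM.
Qed.

(** The real mean value theorem is applied to each of the two parts, whence the factor 2. *)
Lemma cmvt_bound f (df : R -> C) (a b M : R) : a <= b ->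
  (forall x, a <= x <= b -> cderiv f x (df x)) ->
  (forall x, a <= x <= b -> cabs (df x) <= M) ->
  cabs (f b - f a) <= 2 * M * (b - a).
Proof.
move=> ab fd dM; rewrite (le_trans (cabs_le _)) // reB imB.
rewrite -mulrA [2 * _]mulrDl mul1r lerD //.
- apply: (real_mvt_bound (f := fun t => re (f t)) (df := fun t => re (df t))) => // x xab;
  first exact: (fd x xab).1.
  by rewrite (le_trans (cabs_re _)) // dM.
- apply: (real_mvt_bound (f := fun t => im (f t)) (df := fun t => im (df t))) => // x xab;
  first exact: (fd x xab).2.
  by rewrite (le_trans (cabs_im _)) // dM.
Qed.

(** Mean value bound along the segment from [w] to [z], on which the real part stays below [M] by
    convexity. *)
Lemma cexp_lipschitz (z w : C) (M : R) : re z <= M -> re w <= M ->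
  cabs (cexp z - cexp w) <= 2 * (cabs (z - w) * expR M).
Proof.
move=> zM wM.
pose p (t : R) : C := w + ofR t * (z - w).
have dp t : cderiv p t (z - w).
  apply: cderiv_eq (cderivD (cderiv_cst w t)
    (cderivM (cderiv_ofR (is_derive_id t 1)) (cderiv_cst (z - w) t))) _.
  by rewrite mulr0 addr0 add0r ofR1 mul1r.
have := @cmvt_bound (fun t => cexp (p t)) (fun t => (z - w) * cexp (p t)) 0 1
  (cabs (z - w) * expR M) ler01 (fun t _ => cderiv_cexp (dp t)).
rewrite subr0 mulr1 /p ofR1 ofR0 mul1r mul0r addr0 (addrC w) subrK.
apply => t /andP[t0 t1]; rewrite cabsM ler_wpM2l ?cabs_ge0 // cabs_cexp ler_expR.
rewrite reD reZ reB; nra.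
Qed.

(** The derivative of exp(t z) - t z is z (exp(t z) - 1), which [cexp_lipschitz] bounds in turn; the
    two factors 2 give the constant 4. *)
Lemma cexp_quad (z : C) :
  cabs (cexp z - 1 - z) <= 4 * cabs z ^+ 2 * expR (cabs z).
Proof.
pose p (t : R) : C := ofR t * z.
have dp t : cderiv p t z.
  apply: cderiv_eq (cderivM (cderiv_ofR (is_derive_id t 1)) (cderiv_cst z t)) _.
  by rewrite mulr0 addr0 ofR1 mul1r.
have := @cmvt_bound (fun t => cexp (p t) - p t) (fun t => z * cexp (p t) - z) 0 1
  (2 * cabs z ^+ 2 * expR (cabs z)) ler01
  (fun t _ => cderivB (cderiv_cexp (dp t)) (dp t)).
rewrite subr0 mulr1 /p ofR1 ofR0 mul1r mul0r subr0 cexp0.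
rewrite (_ : cexp z - z - 1 = cexp z - 1 - z); last by ring.
move=> H; apply: (le_trans (H _)); last by rewrite !mulrA (_ : 2 * 2 = 4) //; ring.
move=> t /andP[t0 t1]; rewrite -[X in _ - X]mulr1 -mulrBr cabsM -cexp0.
have zz := cabs_ge0 z; have re0z : re (0 : C) <= cabs z by [].
have rez : re (ofR t * z) <= cabs z.
  rewrite reZ; have := cabs_re z; have := ler_norm (re z); nra.
have := cexp_lipschitz rez re0z; rewrite subr0 cabsM cabs_ofR ger0_norm // => H2.
have e0 := expR_gt0 (cabs z).
apply: (@le_trans _ _ (cabs z * (2 * (t * cabs z * expR (cabs z))))).
  by rewrite ler_wpM2l.
rewrite (_ : _ * _ = t * (2 * cabs z ^+ 2 * expR (cabs z))); last by ring.
by rewrite ler_piMl // !mulr_ge0 // ?expR_ge0 // exprn_ge0.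
Qed.

Lemma cabs_subXX (a b : C) (K : R) n : cabs a <= K -> cabs b <= K ->
  cabs (a ^+ n - b ^+ n) <= n%:R * K ^+ n.-1 * cabs (a - b).
Proof.
move=> aK bK; have K0 : 0 <= K by rewrite (le_trans (cabs_ge0 a)).
rewrite subrXX cabsM mulrC ler_wpM2r ?cabs_ge0 //.
apply: (le_trans (cabs_sum _ _ _)).
rewrite -[n%:R]/(n%:R) mulr_natl -[X in _ *+ X](card_ord n) -sumr_const.
apply: ler_sum => i _; rewrite cabsM !cabsX.
have -> : n.-1 = (n.-1 - i + i)%N by rewrite subnK // -ltnS prednK ?ltn_ord // (leq_ltn_trans _
  (ltn_ord i)).
rewrite exprD -subn1 subnAC subn1 ler_pM ?exprn_ge0 ?cabs_ge0 //.
- by rewrite addnK lerXn2r ?nnegrE ?cabs_ge0.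
- by rewrite lerXn2r ?nnegrE ?cabs_ge0.
Qed.

(** This form of the exponential suits [apx_exp]: for a polynomial p, (1 + p / n)^n is a polynomial
    whose weighted norm is at most the exponential of that of p. Both n-th roots have modulus at
    most exp(M / n), so the difference of the powers is at most n exp(M) times that of the roots,
    which is |z n - l| / n + O(1 / n^2). *)
Lemma cvg_cexp_pow (z : nat -> C) (l : C) : z @ \oo --> l ->
  (fun n => (1 + z n / n%:R) ^+ n) @ \oo --> cexp l.
Proof.
move=> zl; have nz : (fun n => cabs (z n)) @ \oo --> cabs l by exact: ccvg_cabs.
set M := cabs l + 1.
have M0 : 0 <= M by rewrite addr_ge0 ?cabs_ge0.
have zM : \forall n \near \oo, cabs (z n) <= M.
  move/cvgrPdist_lt: nz => /(_ 1 ltr01); apply: filterS => n.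
  by rewrite ltr_norml => /andP[]; rewrite ltrBlDr addrC -ltrBlDr /M; lra.
have zl0 : (fun n => cabs (z n - l)) @ \oo --> (0 : R).
  rewrite -[X in _ --> X](cabs0 R); apply: (ccvg_cabs (f := fun n => z n - l)).
  by rewrite -(subrr l); apply: cvgB => //; exact: cvg_cst.
(* The constant is 8 and not 4 because [harmonic n] is 1 / (n + 1), and 4 / n <= 8 / (n + 1). *)
have : (fun n => expR M * (cabs (z n - l) + 8 * M ^+ 2 * expR M * harmonic n))
    @ \oo --> expR M * (0 + 8 * M ^+ 2 * expR M * 0).
  apply: cvgM; first exact: cvg_cst.
  by apply: cvgD => //; apply: cvgM; [exact: cvg_cst | exact: cvg_harmonic].
rewrite mulr0 addr0 mulr0 => /cvgrPdist_lt H; apply/ccvgP => e /H He.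
near=> n; have n0 : (0 < n)%N by near: n; exists 1%N.
have nR : 0 < n%:R :> R by rewrite ltr0n.
have nC : n%:R != 0 :> C by rewrite -ofR_nat ofR_eq0 gt_eqF.
have lM : cabs l <= M by rewrite /M lerDl.
have znM : cabs (z n) <= M by near: n.
have cn (u : C) : cabs (u / n%:R) = cabs u / n%:R.
  by rewrite -ofR_nat cabsM cabsV cabs_ofR ger0_norm // ltW.
have aK : cabs (1 + z n / n%:R) <= expR (M / n%:R).
  rewrite (le_trans (cabsD _ _)) // cabs1 cn (le_trans _ (expR_ge1Dx _)) //.
  by rewrite lerD2l ler_pM2r ?invr_gt0.
have bK : cabs (cexp (l / n%:R)) <= expR (M / n%:R).
  rewrite cabs_cexp ler_expR (le_trans (ler_norm _)) // (le_trans (cabs_re _)) //.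
  by rewrite cn ler_pM2r ?invr_gt0.
have -> : cexp l = cexp (l / n%:R) ^+ n by rewrite cexpX mulrC divfK.
rewrite cabs_distC; apply: le_lt_trans (cabs_subXX n aK bK) _.
have Kn : expR (M / n%:R) ^+ n.-1 <= expR M.
  rewrite -expRM_natl ler_expR mulrA ler_pdivrMr // mulrC ler_wpM2l //.
  by rewrite ler_nat leq_pred.
have ab : cabs (1 + z n / n%:R - cexp (l / n%:R)) <=
    cabs (z n - l) / n%:R + 4 * (M / n%:R) ^+ 2 * expR M.
  rewrite (_ : _ - _ = (z n - l) / n%:R - (cexp (l / n%:R) - 1 - l / n%:R)); last first.
    by rewrite mulrBl; ring.
  rewrite (le_trans (cabsB _ _)) // cn lerD2l (le_trans (cexp_quad _)) //.
  have n1 : 1 <= n%:R :> R by rewrite ler1n.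
  have nR0 : 0 <= n%:R :> R by rewrite ltW.
  rewrite cn ler_pM ?expR_ge0 ?mulr_ge0 ?exprn_ge0 ?divr_ge0 ?cabs_ge0 //.
    by rewrite ler_pM2l // lerXn2r ?nnegrE ?divr_ge0 ?cabs_ge0 // ler_pM2r ?invr_gt0.
  by rewrite ler_expR (le_trans _ lM) // ler_pdivrMr // ler_peMr ?cabs_ge0.
have Hn : `|0 - expR M * (cabs (z n - l) + 8 * M ^+ 2 * expR M * harmonic n)| < e.
  by near: n.
move: Hn; rewrite sub0r normrN; apply: le_lt_trans; apply: le_trans (ler_norm _).
apply: (@le_trans _ _ (n%:R * expR M *
   (cabs (z n - l) / n%:R + 4 * (M / n%:R) ^+ 2 * expR M))).
  by rewrite ler_pM ?mulr_ge0 ?exprn_ge0 ?expR_ge0 ?cabs_ge0 // ler_pM2l.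
rewrite (_ : n%:R * _ * _ = expR M * (cabs (z n - l) + 4 * M ^+ 2 * expR M * n%:R^-1)).
  rewrite ler_pM2l ?expR_gt0 // lerD2l.
  rewrite (_ : 8 = 4 * 2 :> R); last by rewrite -natrM.
  have -> : 4 * 2 * M ^+ 2 * expR M * harmonic n = 4 * M ^+ 2 * expR M * (2 * harmonic n) by ring.
  rewrite ler_wpM2l ?mulr_ge0 ?expR_ge0 ?exprn_ge0 //.
  rewrite /harmonic /= -[n%:R^-1]mul1r ler_pdivrMr // mulrAC ler_pdivlMr ?ltr0n //.
  by rewrite mul1r -natr1; have : 1 <= n%:R :> R by [rewrite ler1n]; lra.
by field; rewrite gt_eqF.
Unshelve. all: end_near. Qed.

End ComplexDerivative.

(** * Convergent power series at 0 on the right *)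

Section Germs.
Local Open Scope classical_set_scope.
Variable R : realType.
Local Notation C := (CC R).
Implicit Types (p q : {poly C}) (r x N M : R) (f g : R -> C).

Lemma ccauchy_cvg (u : nat -> C) :
  (forall e : R, 0 < e -> exists n0, forall m n, (n0 <= m)%N -> (n0 <= n)%N ->
     cabs (u m - u n) < e) -> exists l : C, u @ \oo --> l.
Proof.
move=> H.
have aux (v : nat -> R) : (forall m n, `|v m - v n| <= cabs (u m - u n)) -> cvgn v.
  move=> Hv; apply/cauchy_cvgP/cauchy_ballP => e e0.
  have [n0 Hn0] := H e e0.
  exists ([set v n | n in [set n | (n0 <= n)%N]], [set v n | n in [set n | (n0 <= n)%N]]) => /=.
    by split; exists n0 => // n /= n0n; exists n.
  move=> [a b] /= [[m mn0 <-] [n nn0 <-]]; rewrite /ball /=.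
  exact: le_lt_trans (Hv _ _) (Hn0 _ _ mn0 nn0).
have cre : cvgn (fun n => re (u n)).
  by apply: aux => m n; rewrite -reB cabs_re.
have cim : cvgn (fun n => im (u n)).
  by apply: aux => m n; rewrite -imB cabs_im.
exists (cpx (limn (fun n => re (u n))) (limn (fun n => im (u n)))).
exact: ccvg_reim.
Qed.

(** A weighted l^1 norm: it is submultiplicative and dominates the values on [0, r], so bounds on it
    survive products, powers and pointwise limits. *)
Definition pnorm r p : R := \sum_(i < size p) cabs p`_i * r ^+ i.

Lemma pnorm_widen r p n : (size p <= n)%N ->
  pnorm r p = \sum_(i < n) cabs p`_i * r ^+ i.
Proof.
move=> pn; rewrite /pnorm (big_ord_widen n (fun i => cabs p`_i * r ^+ i) pn).
rewrite big_mkcond /=; apply: eq_bigr => i _; case: ltnP => // h.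
by rewrite nth_default // cabs0 mul0r.
Qed.

Lemma pnorm_ge0 r p : 0 <= r -> 0 <= pnorm r p.
Proof.
by move=> r0; apply: sumr_ge0 => i _; rewrite mulr_ge0 ?cabs_ge0 ?exprn_ge0.
Qed.

Lemma pnormD r p q : 0 <= r -> pnorm r (p + q) <= pnorm r p + pnorm r q.
Proof.
move=> r0; set n := maxn (size p) (size q).
rewrite (@pnorm_widen r _ n); last by rewrite (leq_trans (size_polyD _ _)).
rewrite (@pnorm_widen r p n) ?leq_maxl // (@pnorm_widen r q n) ?leq_maxr //.
rewrite -big_split /=; apply: ler_sum => i _; rewrite coefD -mulrDl.
by rewrite ler_wpM2r ?exprn_ge0 ?cabsD.
Qed.

Lemma pnormC r c : pnorm r c%:P = cabs c.
Proof.
rewrite (@pnorm_widen r _ 1) ?size_polyC ?leq_b1 //.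
by rewrite big_ord1 coefC /= expr0 mulr1.
Qed.

Lemma pnorm0 r : pnorm r 0 = 0. Proof. by rewrite -polyC0 pnormC cabs0. Qed.
Lemma pnorm1 r : pnorm r 1 = 1. Proof. by rewrite -polyC1 pnormC cabs1. Qed.

Lemma pnorm_sum r I (s : seq I) (F : I -> {poly C}) : 0 <= r ->
  pnorm r (\sum_(i <- s) F i) <= \sum_(i <- s) pnorm r (F i).
Proof.
move=> r0; elim/big_rec2: _ => [|i y1 y2 _ H]; first by rewrite pnorm0.
by rewrite (le_trans (pnormD _ _ r0)) // lerD2l.
Qed.

Lemma pnormMX r p : 0 <= r -> pnorm r (p * 'X) <= r * pnorm r p.
Proof.
move=> r0; rewrite (@pnorm_widen r (p * 'X) (size p).+1); last first.
  by rewrite (leq_trans (size_polyMleq _ _)) // size_polyX addn2.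
rewrite big_ord_recl coefMX /= cabs0 mul0r add0r /pnorm mulr_sumr.
by apply: ler_sum => i _; rewrite coefMX /= exprS mulrCA.
Qed.

Lemma pnormZ r c p : 0 <= r -> pnorm r (c *: p) <= cabs c * pnorm r p.
Proof.
move=> r0; rewrite (@pnorm_widen r (c *: p) (size p)) ?size_scale_leq //.
by rewrite /pnorm mulr_sumr; apply: ler_sum => i _; rewrite coefZ cabsM mulrA.
Qed.

Lemma pnormM r p q : 0 <= r -> pnorm r (p * q) <= pnorm r p * pnorm r q.
Proof.
move=> r0; elim/poly_ind: p => [|p c IH]; first by rewrite mul0r pnorm0 mul0r.
have cE : pnorm r (p * 'X + c%:P) = pnorm r p * r + cabs c.
  have [->|p0] := eqVneq p 0; first by rewrite mul0r add0r pnormC pnorm0 mul0r add0r.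
  rewrite /pnorm size_MXaddC (negbTE p0) /= big_ord_recl /=.
  rewrite coefD coefMX coefC /= add0r expr0 mulr1 addrC; congr (_ + _).
  rewrite mulr_suml; apply: eq_bigr => i _.
  by rewrite coefD coefMX coefC /= addr0 exprSr mulrA.
rewrite cE !mulrDl (le_trans (pnormD _ _ r0)) // lerD //; last first.
  by rewrite mul_polyC pnormZ.
by rewrite mulrAC (le_trans (pnormMX _ r0)) // [pnorm r p * r]mulrC -mulrA ler_wpM2l.
Qed.

Lemma pnormX r p n : 0 <= r -> pnorm r (p ^+ n) <= pnorm r p ^+ n.
Proof.
move=> r0; elim: n => [|n IH]; first by rewrite !expr0 pnorm1.
by rewrite !exprS (le_trans (pnormM _ _ r0)) // ler_wpM2l ?pnorm_ge0.
Qed.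

Lemma pnorm_mono r r' p : 0 <= r' -> r' <= r -> pnorm r' p <= pnorm r p.
Proof.
move=> r0 r'r; apply: ler_sum => i _; rewrite ler_wpM2l ?cabs_ge0 //.
by rewrite lerXn2r ?nnegrE // (le_trans r0).
Qed.

Lemma cabs_horner r x p : 0 <= x <= r -> cabs p.[ofR x] <= pnorm r p.
Proof.
move=> /andP[x0 xr]; rewrite horner_coef (le_trans (cabs_sum _ _ _)) //.
apply: ler_sum => i _; rewrite cabsM cabsX cabs_ofR ler_wpM2l ?cabs_ge0 //.
by rewrite lerXn2r ?nnegrE // ?ger0_norm // (le_trans x0).
Qed.

Lemma poly_div1 p : p = drop_poly 1 p * 'X + (p`_0)%:P.
Proof.
apply/polyP => i; rewrite coefD coefMX coefC coef_drop_poly.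
by case: i => [|i] /=; rewrite ?add0r // addr0 addn1.
Qed.

Lemma pnorm_drop r p : 0 < r -> pnorm r (drop_poly 1 p) <= pnorm r p / r.
Proof.
move=> r0; rewrite ler_pdivlMr //.
rewrite (@pnorm_widen r p (size p).+1) // big_ord_recl.
rewrite (@pnorm_widen r _ (size p)); last by rewrite size_drop_poly leq_subr.
rewrite mulr_suml -[leLHS]add0r lerD ?mulr_ge0 ?cabs_ge0 ?expr0 //.
by apply: ler_sum => i _; rewrite coef_drop_poly addn1 /= exprSr mulrA.
Qed.

(* f is on (0, r] a pointwise limit of polynomials whose weighted coefficient
   norms are bounded by N; such f are the convergent power series. *)
Definition apx r N f : Prop := exists F : nat -> {poly C},
  (forall n, pnorm r (F n) <= N) /\
  forall x, 0 < x <= r -> (fun n => (F n).[ofR x]) @ \oo --> f x.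

Lemma apx_poly r p : apx r (pnorm r p) (fun x => p.[ofR x]).
Proof. by exists (fun=> p); split => // x _; exact: cvg_cst. Qed.

Lemma apx_ext r N f g : (forall x, 0 < x <= r -> f x = g x) ->
  apx r N f -> apx r N g.
Proof.
move=> fg [F [FN Ff]]; exists F; split; first exact: FN.
by move=> x xr; rewrite -(fg x xr); exact: Ff.
Qed.

Lemma apx_le r N r' N' f : 0 < r' -> r' <= r -> N <= N' -> apx r N f -> apx r' N' f.
Proof.
move=> r'0 r'r NN' [F [FN Ff]]; exists F; split => [n|x /andP[x0 xr]].
  by rewrite (le_trans _ NN') // (le_trans _ (FN n)) // pnorm_mono // ltW.
by apply: Ff; rewrite x0 (le_trans xr).
Qed.

Lemma apx_cst r c : apx r (cabs c) (fun=> c).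
Proof.
rewrite -(pnormC r); apply: apx_ext (apx_poly r c%:P) => x _.
by rewrite hornerC.
Qed.

Lemma apx_id r : 0 <= r -> apx r r (@ofR R).
Proof.
move=> r0; have E : pnorm r 'X = r.
  by rewrite /pnorm size_polyX !big_ord_recl big_ord0 !coefX /= cabs0 cabs1 mul0r mul1r expr1
    add0r addr0.
by rewrite -{2}E; apply: apx_ext (apx_poly _ _) => x _; rewrite hornerX.
Qed.

Lemma apxD r N M f g : 0 <= r -> apx r N f -> apx r M g ->
  apx r (N + M) (fun x => f x + g x).
Proof.
move=> r0 [F [FN Ff]] [G [GM Gg]]; exists (fun n => F n + G n); split => [n|x xr].
  by rewrite (le_trans (pnormD _ _ r0)) // lerD.
under eq_fun do rewrite hornerD.
by apply: cvgD; [exact: Ff | exact: Gg].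
Qed.

Lemma apxM r N M f g : 0 <= r -> apx r N f -> apx r M g ->
  apx r (N * M) (fun x => f x * g x).
Proof.
move=> r0 [F [FN Ff]] [G [GM Gg]]; exists (fun n => F n * G n); split => [n|x xr].
  by rewrite (le_trans (pnormM _ _ r0)) // ler_pM ?pnorm_ge0.
under eq_fun do rewrite hornerM.
by apply: cvgM; [exact: Ff | exact: Gg].
Qed.

Lemma apxX r N f n : 0 <= r -> apx r N f -> apx r (N ^+ n) (fun x => f x ^+ n).
Proof.
move=> r0 fN; elim: n => [|n IH].
  by rewrite expr0 -(cabs1 R); apply: apx_ext (apx_cst r 1) => x _; rewrite expr0.
by rewrite exprS; under eq_fun do rewrite exprS; exact: apxM.
Qed.

Lemma apx_exp r N f : 0 <= r -> apx r N f -> apx r (expR N) (fun x => cexp (f x)).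
Proof.
move=> r0 [F [FN Ff]].
exists (fun n => (1 + n%:R^-1%:P * F n) ^+ n); split => [n|x xr].
  rewrite (le_trans (pnormX _ _ r0)) //.
  apply: (@le_trans _ _ ((1 + N / n%:R) ^+ n)).
    rewrite lerXn2r ?nnegrE ?pnorm_ge0 //.
      by rewrite addr_ge0 ?divr_ge0 // (le_trans _ (FN 0%N)) ?pnorm_ge0.
    rewrite (le_trans (pnormD _ _ r0)) // pnorm1 lerD2l.
    rewrite (le_trans (pnormM _ _ r0)) // pnormC mulrC -ofR_nat cabsV cabs_ofR.
    by rewrite ger0_norm // ler_wpM2r ?invr_ge0.
  case: n => [|n]; first by rewrite expr0 -{1}expR0 ler_expR (le_trans _ (FN 0%N)) ?pnorm_ge0.
  apply: (@le_trans _ _ (expR (N / n.+1%:R) ^+ n.+1)).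
    rewrite lerXn2r ?nnegrE ?expR_ge0 ?expR_ge1Dx //.
    by rewrite addr_ge0 ?divr_ge0 // (le_trans _ (FN 0%N)) ?pnorm_ge0.
  by rewrite -expRM_natl mulrC divfK // pnatr_eq0.
under eq_fun do rewrite horner_exp hornerD hornerM !hornerC mulrC.
by apply: cvg_cexp_pow; exact: Ff.
Qed.

(** Partial sums of the geometric series; 2 is the bound of 1 / (1 - q) for q <= 1/2. *)
Lemma apx_geom r (q : R) f : 0 <= r -> 0 <= q <= 1 / 2 -> apx r q f ->
  apx r 2 (fun x => (1 - f x)^-1).
Proof.
move=> r0 /andP[q0 q2] [F [FN Ff]].
exists (fun n => \sum_(j < n) F n ^+ j); split => [n|x xr].
  rewrite (le_trans (pnorm_sum _ _ r0)) //.
  apply: (@le_trans _ _ (\sum_(j < n) q ^+ j)).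
    apply: ler_sum => i _; rewrite (le_trans (pnormX _ _ r0)) //.
    by rewrite lerXn2r ?nnegrE ?pnorm_ge0.
  have -> : \sum_(j < n) q ^+ j = (1 - q ^+ n) / (1 - q).
    have q1 : 1 - q != 0 by rewrite gt_eqF //; lra.
    by apply: (mulIf q1); rewrite divfK // mulrC -[1 - q ^+ n]opprB -[1 - q]opprB subrX1 mulNr.
  rewrite ler_pdivrMr; last by lra.
  by have := exprn_ge0 n q0; lra.
have zq n : cabs (F n).[ofR x] <= q.
  by rewrite (le_trans _ (FN n)) // cabs_horner // (andP xr).2 ltW // (andP xr).1.
have z1 n : 1 - (F n).[ofR x] != 0.
  rewrite -cabs_gt0 (lt_le_trans _ (cabs_lerB _ _)) // cabs1.
  by have := zq n; lra.
have fq : cabs (f x) <= q.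
  have H : (fun n => cabs (F n).[ofR x]) @ \oo --> cabs (f x).
    by apply: ccvg_cabs; exact: Ff.
  rewrite leNgt; apply/negP => fq.
  move/cvgrPdist_lt: H => /(_ (cabs (f x) - q)); rewrite subr_gt0 => /(_ fq).
  move=> [n0 _ /(_ n0 (leqnn _))] /=.
  by have := zq n0; have := ler_norm (cabs (f x) - cabs (F n0).[ofR x]); lra.
have f1 : 1 - f x != 0.
  by rewrite -cabs_gt0 (lt_le_trans _ (cabs_lerB _ _)) // cabs1; lra.
rewrite (_ : (fun n => _) = (fun n => (1 - (F n).[ofR x] ^+ n) * (1 - (F n).[ofR x])^-1)).
  rewrite -[X in _ --> X]mul1r; apply: cvgM; last first.
    by apply: cvgV => //; apply: cvgB; [exact: cvg_cst | exact: Ff].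
  rewrite -[X in _ --> X]subr0; apply: cvgB; first exact: cvg_cst.
  have Hq : (fun n => q ^+ n) @ \oo --> (0 : R).
    by apply: cvg_expr; rewrite ger0_norm //; lra.
  apply/ccvgP => e e0; move/cvgrPdist_lt: Hq => /(_ e e0); apply: filterS => n.
  rewrite !sub0r normrN cabsN cabsX ger0_norm ?exprn_ge0 //; apply: le_lt_trans.
  by rewrite lerXn2r ?nnegrE ?cabs_ge0.
apply/funext => n; rewrite horner_sum; apply: (mulIf (z1 n)); rewrite divfK //.
rewrite mulrC; under eq_bigr do rewrite horner_exp.
by rewrite -[1 - _ ^+ n]opprB -[1 - _.[_]]opprB subrX1 mulNr.
Qed.

Lemma apx_bound r N f x : 0 < x <= r -> apx r N f -> cabs (f x) <= N.
Proof.
move=> xr [F [FN Ff]]; have H : (fun n => cabs (F n).[ofR x]) @ \oo --> cabs (f x).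
  by apply: ccvg_cabs; exact: Ff.
rewrite leNgt; apply/negP => fN.
move/cvgrPdist_lt: H => /(_ (cabs (f x) - N)); rewrite subr_gt0 => /(_ fN).
move=> [n0 _ /(_ n0 (leqnn _))] /=.
have := FN n0; have := ler_norm (cabs (f x) - cabs (F n0).[ofR x]).
have : cabs (F n0).[ofR x] <= pnorm r (F n0).
  by apply: cabs_horner; rewrite (andP xr).2 ltW // (andP xr).1.
lra.
Qed.

(** The function f = 1 - sqrt(1 - y) is a fixed point of f -> (y + f^2) / 2. Started at 0, this
    iteration yields polynomials, keeps the weighted norm below 1/2 and contracts by 1/2 at every
    point. *)
Lemma apx_sqrt r Y (y : R -> R) : 0 <= r -> pnorm r Y <= 1 / 2 ->
  (forall x, 0 < x <= r -> Y.[ofR x] = ofR (y x)) ->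
  apx r (1 / 2) (fun x => ofR (1 - Num.sqrt (1 - y x))).
Proof.
move=> r0 YN Yy.
pose F := fix F n : {poly C} := if n is n'.+1 then (1 / 2)%:P * (Y + F n' ^+ 2) else 0.
have FS n : F n.+1 = (1 / 2)%:P * (Y + F n ^+ 2) by [].
have h2 : cabs (1 / 2 : C) = 1 / 2.
  by rewrite -(ofR_nat R 2) -ofR1 -ofRV -ofRM cabs_ofR ger0_norm // divr_ge0.
have FN n : pnorm r (F n) <= 1 / 2.
  elim: n => [|n IH]; first by rewrite pnorm0; lra.
  rewrite FS (le_trans (pnormM _ _ r0)) // pnormC h2.
  have := pnormD Y (F n ^+ 2) r0; have := pnormX (F n) 2 r0.
  have : pnorm r (F n) ^+ 2 <= (1 / 2) ^+ 2.
    by rewrite lerXn2r ?nnegrE ?pnorm_ge0 //; lra.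
  by rewrite !expr2; lra.
exists F; split => // x xr.
have xr' : 0 <= x <= r by rewrite (andP xr).2 ltW // (andP xr).1.
have yb : `|y x| <= 1 / 2.
  by rewrite -cabs_ofR -Yy // (le_trans _ YN) // cabs_horner.
set s := Num.sqrt (1 - y x).
have s0 : 0 <= s by exact: sqrtr_ge0.
have s2 : s ^+ 2 = 1 - y x.
  by rewrite sqr_sqrtr //; move: yb; rewrite ler_norml => /andP[]; lra.
have sb : `|1 - s| <= 1 / 2.
  have e : (1 - s) * (1 + s) = y x by rewrite -subr_sqr expr1n s2; ring.
  move: yb; rewrite -e normrM [(`|1 + s|)]ger0_norm; last by lra.
  by have := normr_ge0 (1 - s); nra.
have key n : cabs (ofR (1 - s) - (F n).[ofR x]) <= (1 / 2) ^+ n.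
  elim: n => [|n IH]; first by rewrite horner0 subr0 expr0 cabs_ofR; lra.
  rewrite FS hornerM hornerC hornerD horner_exp Yy //.
  set z := (F n).[ofR x] in IH *.
  have -> : ofR (1 - s) - 1 / 2 * (ofR (y x) + z ^+ 2) =
      1 / 2 * ((ofR (1 - s) - z) * (ofR (1 - s) + z)).
    have -> : ofR (y x) = ofR (1 - s) * (2 - ofR (1 - s)).
      by rewrite -(ofR_nat R 2) -ofRB -ofRM; congr ofR; rewrite -[RHS]opprK; ring: s2.
    by field.
  rewrite cabsM h2 cabsM exprS ler_wpM2l //.
  rewrite -[leRHS]mulr1 ler_pM ?cabs_ge0 //.
  rewrite (le_trans (cabsD _ _)) // cabs_ofR.
  by have := cabs_horner (F n) xr'; have := FN n; rewrite -/z; lra.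
apply/ccvgP => e e0.
have Hq : (fun n => (1 / 2 : R) ^+ n) @ \oo --> (0 : R).
  by apply: cvg_expr; rewrite ger0_norm //; lra.
move/cvgrPdist_lt: Hq => /(_ e e0); apply: filterS => n.
by rewrite sub0r normrN ger0_norm ?exprn_ge0 //; apply: le_lt_trans; exact: key.
Qed.

(** Dropping the constant coefficient costs a factor 1 / r in the norm but does not shrink the
    interval. The constant coefficients converge because at a small fixed x they differ by O(x) from
    the values of the polynomials, which converge. *)
Lemma apx_div r N f : 0 < r -> apx r N f -> exists a g,
  apx r (N / r) g /\ forall x, 0 < x <= r -> f x = a + ofR x * g x.
Proof.
move=> r0 [F [FN Ff]].
have FE n x : (F n).[ofR x] = (drop_poly 1 (F n)).[ofR x] * ofR x + (F n)`_0.
  by rewrite {1}[F n]poly_div1 hornerD hornerM hornerX hornerC.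
have dN n : pnorm r (drop_poly 1 (F n)) <= N / r.
  by rewrite (le_trans (pnorm_drop _ r0)) // ler_pM2r ?invr_gt0.
have N0 : 0 <= N / r by rewrite (le_trans _ (dN 0%N)) // pnorm_ge0 // ltW.
have [a aP] : exists l : C, (fun n => (F n)`_0) @ \oo --> l.
  apply: ccauchy_cvg => e e0.
  (* At this point the nonconstant part of every [F n] is at most e / 4. *)
  pose x := Num.min r (e / (4 * (N / r + 1))).
  have x0 : 0 < x by rewrite lt_min r0 divr_gt0 // mulr_gt0 //; lra.
  have xr : 0 < x <= r by rewrite x0 ge_min lexx.
  have xe : x * (N / r) <= e / 4.
    apply: (@le_trans _ _ (e / (4 * (N / r + 1)) * (N / r))).
      by rewrite ler_wpM2r // ge_min lexx orbT.
    rewrite mulrAC ler_pdivrMr; last by rewrite mulr_gt0 //; lra.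
    by nra.
  have dx n : cabs ((drop_poly 1 (F n)).[ofR x] * ofR x) <= e / 4.
    rewrite cabsM cabs_ofR ger0_norm ?(ltW x0) // mulrC (le_trans _ xe) // ler_pM2l //.
    by rewrite (le_trans _ (dN n)) // cabs_horner // (andP xr).2 ltW.
  have /ccvgP/(_ (e / 8)) [|n0 _ Hn0] := Ff x xr; first by rewrite divr_gt0.
  exists n0 => m n mn nn.
  have := Hn0 m mn; have := Hn0 n nn; rewrite /= !FE => H1 H2.
  have -> : (F m)`_0 - (F n)`_0 =
     (f x - ((drop_poly 1 (F n)).[ofR x] * ofR x + (F n)`_0))
     - (f x - ((drop_poly 1 (F m)).[ofR x] * ofR x + (F m)`_0))
     + ((drop_poly 1 (F n)).[ofR x] * ofR x - (drop_poly 1 (F m)).[ofR x] * ofR x).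
    by ring.
  rewrite (le_lt_trans (cabsD _ _)) //.
  have := cabsB (f x - ((drop_poly 1 (F n)).[ofR x] * ofR x + (F n)`_0))
     (f x - ((drop_poly 1 (F m)).[ofR x] * ofR x + (F m)`_0)).
  have := cabsB ((drop_poly 1 (F n)).[ofR x] * ofR x) ((drop_poly 1 (F m)).[ofR x] * ofR x).
  by have := dx n; have := dx m; lra.
exists a, (fun x => (f x - a) / ofR x); split; last first.
  by move=> x /andP[x0 _]; rewrite mulrC divfK ?ofR_eq0 ?gt_eqF //; ring.
exists (fun n => drop_poly 1 (F n)); split; first exact: dN.
move=> x xr.
have x0 : ofR x != 0 by rewrite ofR_eq0 gt_eqF // (andP xr).1.
rewrite (_ : (fun n => _) = (fun n => ((F n).[ofR x] - (F n)`_0) / ofR x)).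
  by apply: cvgM; [exact: (cvgB (Ff x xr) aP) | exact: cvg_cst].
by apply/funext => n; rewrite FE addrK mulfK.
Qed.

Definition germ f : Prop := exists r N, 0 < r /\ apx r N f.
Lemma germI r N f : 0 < r -> apx r N f -> germ f.
Proof. by move=> r0 fN; exists r, N. Qed.
Definition near0 (P : R -> Prop) : Prop :=
  exists2 r : R, 0 < r & forall x, 0 < x <= r -> P x.

Lemma near0_and P Q : near0 P -> near0 Q -> near0 (fun x => P x /\ Q x).
Proof.
move=> [r r0 rP] [s s0 sQ]; exists (Num.min r s); first by rewrite lt_min r0.
by move=> x /andP[x0]; rewrite le_min => /andP[xr xs]; split;
  [apply: rP | apply: sQ]; rewrite x0.
Qed.

Lemma near0_imp (P Q : R -> Prop) : (forall x, P x -> Q x) -> near0 P -> near0 Q.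
Proof. by move=> PQ [r r0 rP]; exists r => // x /rP /PQ. Qed.

Lemma near0_ex (P : R -> Prop) r : 0 < r -> near0 P -> exists2 x, 0 < x < r & P x.
Proof.
move=> r0 [s s0 sP]; exists (Num.min (r / 2) s).
  by rewrite lt_min divr_gt0 // s0 gt_min; apply/orP; left; lra.
by apply: sP; rewrite lt_min divr_gt0 // s0 ge_min lexx orbT.
Qed.

Lemma germ2 f g : germ f -> germ g -> exists r N M,
  [/\ 0 < r, apx r N f & apx r M g].
Proof.
move=> [r [N [r0 fN]]] [s [M [s0 gM]]]; exists (Num.min r s), N, M.
have m0 : 0 < Num.min r s by rewrite lt_min r0.
by split => //; [apply: apx_le fN | apply: apx_le gM]; rewrite // ge_min lexx ?orbT.
Qed.

Lemma germ_ext f g : near0 (fun x => f x = g x) -> germ f -> germ g.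
Proof.
move=> [s s0 fg] [r [N [r0 fN]]]; have m0 : 0 < Num.min r s by rewrite lt_min r0.
exists (Num.min r s), N; split => //; apply: (@apx_ext _ _ f) => [x /andP[x0]|].
  by rewrite le_min => /andP[_ xs]; apply: fg; rewrite x0.
by apply: apx_le fN; rewrite // ge_min lexx.
Qed.

Lemma germ_cst c : germ (fun=> c).
Proof. by exists 1, (cabs c); split => //; exact: apx_cst. Qed.
Lemma germ_id : germ (@ofR R).
Proof. by exists 1, 1; split => //; exact: apx_id. Qed.
Lemma germD f g : germ f -> germ g -> germ (fun x => f x + g x).
Proof.
move=> fg gg; have [r [N [M [r0 fN gM]]]] := germ2 fg gg.
exact: germI r0 (apxD (ltW r0) fN gM).
Qed.
Lemma germM f g : germ f -> germ g -> germ (fun x => f x * g x).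
Proof.
move=> fg gg; have [r [N [M [r0 fN gM]]]] := germ2 fg gg.
exact: germI r0 (apxM (ltW r0) fN gM).
Qed.
Lemma germN f : germ f -> germ (fun x => - f x).
Proof.
move=> fg; apply: germ_ext (germM (germ_cst (-1)) fg).
by exists 1 => // x _; rewrite mulN1r.
Qed.
Lemma germX f n : germ f -> germ (fun x => f x ^+ n).
Proof.
by move=> [r [N [r0 fN]]]; exact: germI r0 (apxX n (ltW r0) fN).
Qed.
Lemma germ_cexp f : germ f -> germ (fun x => cexp (f x)).
Proof.
by move=> [r [N [r0 fN]]]; exact: germI r0 (apx_exp (ltW r0) fN).
Qed.

Lemma germ_bound f : germ f -> exists2 N, 0 <= N & near0 (fun x => cabs (f x) <= N).
Proof.
move=> [r [N [r0 fN]]]; exists `|N| => //; exists r => // x xr.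
by rewrite (le_trans (apx_bound xr fN)) // ler_norm.
Qed.

Lemma germ_div f : germ f -> exists a g,
  germ g /\ near0 (fun x => f x = a + ofR x * g x).
Proof.
move=> [r [N [r0 fN]]]; have [a [g [gN fg]]] := apx_div r0 fN.
by exists a, g; split; [exists r, (N / r) | exists r].
Qed.

Lemma germ_lin f : germ f -> exists a K,
  0 <= K /\ near0 (fun x => cabs (f x - a) <= K * x).
Proof.
move=> /germ_div[a [g [gg fg]]]; have [N N0 gN] := germ_bound gg.
exists a, N; split => //; have := near0_and fg gN => -[r r0 H].
exists r => // x xr; have [-> gx] := H x xr.
rewrite addrC addrA addNr add0r cabsM cabs_ofR ger0_norm ?(ltW (andP xr).1) //.
by rewrite mulrC ler_pM2r // (andP xr).1.
Qed.

(** A nonzero constant term a is excluded since |a| <= (K + N) x for all small x. *)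
Lemma germ_div0 f K : germ f -> near0 (fun x => cabs (f x) <= K * x) ->
  exists2 g, germ g & near0 (fun x => f x = ofR x * g x).
Proof.
move=> gf fK; have [a [g [gg fg]]] := germ_div gf; have [N N0 gN] := germ_bound gg.
suff a0 : a = 0 by exists g => //; apply: near0_imp fg => x ->; rewrite a0 add0r.
apply/eqP; apply: contraT; rewrite -cabs_gt0 => a0.
have K0 : 0 < `|K| + N + 1 by have := normr_ge0 K; lra.
have [x /andP[x0 xr] [[fE fx] gx]] := near0_ex (divr_gt0 a0 K0)
  (near0_and (near0_and fg fK) gN).
move: xr; rewrite ltr_pdivlMr // ltNge => /negP[].
have -> : a = f x - ofR x * g x by rewrite fE addrK.
rewrite (le_trans (cabsB _ _)) // cabsM cabs_ofR ger0_norm ?(ltW x0) //.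
have := ler_norm K; nra.
Qed.

(** The interval is shrunk until x g / c has weighted norm at most 1/2, where the geometric series
    applies. *)
Lemma germ_inv c g : c != 0 -> germ g -> germ (fun x => (c + ofR x * g x)^-1).
Proof.
move=> c0 [r [N [r0 gN]]].
have cc : 0 < cabs c by rewrite cabs_gt0.
have N0 : 0 <= N by rewrite (le_trans (cabs_ge0 (g r))) // (apx_bound _ gN) // r0 lexx.
pose s := Num.min r (cabs c / (2 * (N + 1))).
have s0 : 0 < s by rewrite lt_min r0 divr_gt0 // mulr_gt0 //; lra.
have gs : apx s N g by apply: apx_le gN => //; rewrite ge_min lexx.
have := apxM (ltW s0) (apx_cst s (- c^-1)) (apxM (ltW s0) (apx_id (ltW s0)) gs).
move=> /(apx_geom (ltW s0)) H.
apply: (germI s0); apply: apx_ext (apxM (ltW s0) (apx_cst s c^-1) (H _)).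
  by move=> x xs; rewrite -invfM; congr (_^-1); field.
rewrite cabsN cabsV; apply/andP; split; first by rewrite !mulr_ge0 ?invr_ge0 ?(ltW cc) ?(ltW s0).
rewrite mulrC ler_pdivrMr // mulrC.
apply: (@le_trans _ _ (cabs c / (2 * (N + 1)) * N)).
  by rewrite mulrC ler_wpM2r // ge_min lexx orbT.
rewrite mulrAC ler_pdivrMr; last by rewrite mulr_gt0 //; lra.
by nra.
Qed.

(** Divide by x as long as the constant term vanishes. All quotients live on the same interval (0,
    r], with bounds N / r^k; if the division never stops, |f x| <= N (x / r)^k for all k and f
    vanishes on (0, r / 2]. *)
Lemma germ_order f : germ f -> near0 (fun x => f x = 0) \/
  exists k c g, [/\ c != 0, germ g &
    near0 (fun x => f x = ofR x ^+ k * (c + ofR x * g x))].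
Proof.
move=> [r [N [r0 fN]]].
have [[k [c [g [c0 gg H]]]]|H] := pselect (exists k c g, [/\ c != 0, germ g &
    near0 (fun x => f x = ofR x ^+ k * (c + ofR x * g x))]).
  by right; exists k, c, g.
left.
have P k : exists g, apx r (N / r ^+ k) g /\
    forall x, 0 < x <= r -> f x = ofR x ^+ k * g x.
  elim: k => [|k [g [gN fg]]].
    by exists f; rewrite expr0 divr1; split => // x _; rewrite mul1r.
  have [a [g1 [g1N gg1]]] := apx_div r0 gN.
  have [a0|a0] := eqVneq a 0; last first.
    case: H; exists k, a, g1; split => //; first by exists r, (N / r ^+ k / r).
    by exists r => // x xr; rewrite fg // gg1.
  exists g1; split => [|x xr]; first by rewrite exprSr invfM mulrA.
  by rewrite fg // gg1 // a0 add0r exprSr mulrA.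
exists (r / 2); first by rewrite divr_gt0.
move=> x /andP[x0 xr]; apply/eqP; rewrite -cabs_eq0; apply/eqP.
apply: le_anti; rewrite cabs_ge0 andbT.
have xr' : 0 < x <= r by rewrite x0 (le_trans xr) //; lra.
have bnd k : cabs (f x) <= N * (1 / 2) ^+ k.
  have [g [gN ->]] := P k; last by [].
  rewrite cabsM cabsX cabs_ofR ger0_norm ?(ltW x0) //.
  have gx := apx_bound xr' gN.
  have rk : 0 < r ^+ k by rewrite exprn_gt0.
  have N0 : 0 <= N by rewrite (le_trans (cabs_ge0 (f r))) // (apx_bound _ fN) // r0 lexx.
  apply: (@le_trans _ _ ((r / 2) ^+ k * (N / r ^+ k))) .
    rewrite ler_pM ?exprn_ge0 ?cabs_ge0 ?(ltW x0) //.
    by rewrite lerXn2r ?nnegrE ?divr_ge0 ?(ltW x0) ?(ltW r0).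
  rewrite exprMn div1r; set a := r ^+ k in rk *.
  by rewrite (_ : a * _ * (N / a) = N * 2^-1 ^+ k) //; field; rewrite gt_eqF.
have Hq : (fun n => N * (1 / 2 : R) ^+ n) @ \oo --> N * (0 : R).
  by apply: cvgM; [exact: cvg_cst | apply: cvg_expr; rewrite ger0_norm //; lra].
rewrite mulr0 in Hq.
rewrite leNgt; apply/negP => fx.
move/cvgrPdist_lt: Hq => /(_ _ fx)[n0 _ /(_ n0 (leqnn _))] /=.
rewrite sub0r normrN; have := ler_norm (N * (1 / 2) ^+ n0); have := bnd n0; lra.
Qed.

End Germs.

(** * The square roots and the linear system *)

Section VerticalWavenumber.
Local Open Scope classical_set_scope.
Variable R : realType.
Local Notation C := (CC R).
Implicit Types (k x lam b : R).

(* The principal branch of the square root on the real axis, without a case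
   distinction: Num.sqrt vanishes on negative arguments. *)
Definition rsqrt b : C := cpx (Num.sqrt b) (- Num.sqrt (- b)).

Lemma csqrt_ofR b : csqrt (ofR b) = rsqrt b.
Proof.
rewrite /csqrt /rsqrt cabs_ofR /carg cabs_ofR /= ltxx.
have [b0|b0|->] := ltgtP b 0; last first.
- by apply: cx_ext; rewrite normr0 sqrtr0 ofR0 mul0r /= ?oppr0 ?sqrtr0 ?oppr0.
- rewrite gtr0_norm // divff ?gt_eqF // acos1 oppr0 mul0r ofR0 mulr0 cexp0 mulr1.
  by apply: cx_ext => //=; rewrite [Num.sqrt (- b)]ler0_sqrtr ?oppr0 // oppr_le0 ltW.
- rewrite ltr0_norm // invrN mulrN divff ?lt_eqF // acosN1 mulNr.
  apply: cx_ext; rewrite ?reM ?imM /=.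
    rewrite [Num.sqrt b]ler0_sqrtr; last exact: ltW.
    by rewrite !(mul0r, mul1r, mulr0, add0r, subr0, addr0) cosN cos_pihalf !mulr0.
  rewrite !(mul0r, mul1r, mulr0, add0r, subr0, addr0, oppr0) sinN sin_pihalf expR0.
  by rewrite mul1r mulrN1.
Qed.

Lemma rsqrt_sqr b : rsqrt b ^+ 2 = ofR b.
Proof.
apply: cx_ext; rewrite expr2 ?reM ?imM /=; have [b0|b0] := leP 0 b.
- rewrite [Num.sqrt (- b)]ler0_sqrtr ?oppr_le0 //.
  by rewrite oppr0 mul0r subr0 -expr2 sqr_sqrtr.
- rewrite [Num.sqrt b]ler0_sqrtr ?ltW // mul0r sub0r mulrNN -expr2 sqr_sqrtr ?opprK //.
  by rewrite oppr_ge0 ltW.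
- by rewrite [Num.sqrt (- b)]ler0_sqrtr ?oppr_le0 // oppr0 mulr0 mul0r addr0.
- by rewrite [Num.sqrt b]ler0_sqrtr ?ltW // mulr0 mul0r addr0.
Qed.

Lemma rsqrt_re_ge0 b : 0 <= re (rsqrt b). Proof. exact: sqrtr_ge0. Qed.

Lemma rsqrt_ge0 b : 0 <= b -> rsqrt b = ofR (Num.sqrt b).
Proof. by move=> b0; rewrite /rsqrt [Num.sqrt (- b)]ler0_sqrtr ?oppr_le0 // oppr0. Qed.

Lemma rsqrt_eq0 b : (rsqrt b == 0) = (b == 0).
Proof. by have := expf_eq0 (rsqrt b) 2; rewrite rsqrt_sqr ofR_eq0 => ->. Qed.

Lemma rsqrtM x b : 0 <= x -> rsqrt (x ^+ 2 * b) = ofR x * rsqrt b.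
Proof.
move=> x0; apply: cx_ext; rewrite ?reZ ?imZ /= -?mulrN sqrtrM ?sqr_ge0 //;
by rewrite sqrtr_sqr ger0_norm // mulrN.
Qed.

Lemma sqrt_holder b c : `|Num.sqrt b - Num.sqrt c| <= Num.sqrt `|b - c|.
Proof.
wlog bc : b c / c <= b => [H|].
  have [/H//|/ltW /H] := leP c b; by rewrite distrC [(`|c - b|)]distrC.
have h1 : 0 <= Num.sqrt b - Num.sqrt c by rewrite subr_ge0 ler_wsqrtr.
rewrite (ger0_norm h1) [(`|b - c|)]ger0_norm ?subr_ge0 //.
rewrite lerBlDr.
have [c0|c0] := leP 0 c; last first.
  by rewrite [Num.sqrt c]ler0_sqrtr ?(ltW c0) // addr0 ler_wsqrtr //; lra.
rewrite -[leRHS]ger0_norm ?addr_ge0 ?sqrtr_ge0 // -sqrtr_sqr ler_wsqrtr //.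
rewrite sqrrD !sqr_sqrtr ?subr_ge0 //.
have := mulr_ge0 (sqrtr_ge0 (b - c)) (sqrtr_ge0 c); rewrite -mulr_natr; lra.
Qed.

Lemma rsqrt_holder b c : cabs (rsqrt b - rsqrt c) <= 2 * Num.sqrt `|b - c|.
Proof.
rewrite (le_trans (cabs_le _)) // reB imB /= mulr_natl mulr2n lerD ?sqrt_holder //.
rewrite -opprD normrN (le_trans (sqrt_holder _ _)) // -opprD normrN //.
Qed.

Definition hk k lam : C := rsqrt (lam ^+ 2 - k ^+ 2).

Lemma hrealE (md : medium R) lam t : hreal md lam t = hk (wavenum md t) lam.
Proof. by rewrite /hreal /hroot -!ofRX -ofRB csqrt_ofR. Qed.

Lemma hkN k lam : hk k (- lam) = hk k lam.
Proof. by rewrite /hk sqrrN. Qed.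

Lemma pnorm_small (Y : {poly C}) : Y`_0 = 0 ->
  exists2 r : R, 0 < r & pnorm r Y <= 1 / 2.
Proof.
move=> Y0; have YE : Y = drop_poly 1 Y * 'X by rewrite {1}[Y]poly_div1 Y0 polyC0 addr0.
set M := pnorm 1 (drop_poly 1 Y).
have M0 : 0 <= M by exact: pnorm_ge0.
have r0 : 0 < 1 / (2 * (M + 1)) by rewrite divr_gt0 // mulr_gt0 //; lra.
exists (1 / (2 * (M + 1))) => //.
rewrite YE (le_trans (pnormMX _ (ltW r0))) //.
apply: (@le_trans _ _ (1 / (2 * (M + 1)) * M)).
  rewrite ler_pM2l // pnorm_mono ?(ltW r0) // ler_pdivrMr; last by rewrite mulr_gt0 //; lra.
  by lra.
rewrite mulrAC ler_pdivrMr; last by rewrite mulr_gt0 //; lra.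
by lra.
Qed.

(** Near 0 the factor 1 - y is positive, so the sign of [b] alone fixes the branch and the root of
    the product splits. *)
Lemma germ_rsqrt (Y : {poly C}) (y : R -> R) b : b != 0 -> Y`_0 = 0 ->
  (forall x, Y.[ofR x] = ofR (y x)) -> germ (fun x => rsqrt (b * (1 - y x))).
Proof.
move=> b0 Y0 Yy; have [r r0 Yr] := pnorm_small Y0.
have g : germ (fun x => ofR (1 - Num.sqrt (1 - y x))).
  exact: germI r0 (apx_sqrt (ltW r0) Yr (fun x _ => Yy x)).
have g2 : germ (fun x => ofR (Num.sqrt (1 - y x))).
  apply: germ_ext (germD (germ_cst 1) (germN g)).
  by exists 1 => // x _; rewrite -ofRN -ofR1 -ofRD; congr ofR; ring.
apply: germ_ext (germM (germ_cst (rsqrt b)) g2).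
exists r => // x /andP[x0 xr].
have y1 : 0 <= 1 - y x.
  have : `|y x| <= 1 / 2.
    by rewrite -cabs_ofR -Yy (le_trans _ Yr) // cabs_horner // xr ltW.
  by rewrite ler_norml => /andP[]; lra.
by rewrite mulrC -rsqrtM ?sqrtr_ge0 // sqr_sqrtr // mulrC.
Qed.

Lemma germ_hk_at k nu (up : bool) : 0 < k ->
  germ (fun x => hk k (if up then nu + x ^+ 2 else nu - x ^+ 2)).
Proof.
move=> k0; pose s : R := if up then 1 else -1.
have s2 : s ^+ 2 = 1 by rewrite /s; case: (up); rewrite ?sqrrN expr1n.
have s0 : s != 0 by have := expf_eq0 s 2; rewrite s2 oner_eq0 => /esym/negbT.
have E x : (if up then nu + x ^+ 2 else nu - x ^+ 2) = nu + s * x ^+ 2.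
  by rewrite /s; case: (up); rewrite ?mul1r ?mulN1r.
apply: germ_ext (_ : germ (fun x => hk k (nu + s * x ^+ 2))).
  by exists 1 => // x _; rewrite E.
(* At a branch point nu = k or - k the radicand starts with 2 nu s x^2, whose root is a constant
   times x. This is why the local variable is the square root of the distance to nu. *)
have [bE|b0] := eqVneq (nu ^+ 2 - k ^+ 2) 0.
  have nu0 : nu != 0.
    by apply: contra_eq_neq bE => ->; rewrite expr0n sub0r oppr_eq0 expf_eq0 gt_eqF.
  have b1 : 2 * nu * s != 0 by rewrite !mulf_neq0 ?pnatr_eq0.
  have g := @germ_rsqrt ((ofR (- (2 * nu * s)^-1)) *: 'X^2) (fun x => - (2 * nu * s)^-1 * x ^+
    2) _ b1.
  apply: germ_ext (germM (germ_id R) (g _ _)).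
  - exists 1 => // x /andP[x0 _]; rewrite -rsqrtM ?(ltW x0) // /hk; congr rsqrt.
    have -> : (nu + s * x ^+ 2) ^+ 2 - k ^+ 2 =
      (nu ^+ 2 - k ^+ 2) + 2 * nu * s * x ^+ 2 + s ^+ 2 * x ^+ 4 by ring.
    by rewrite bE s2; set e := 2 * nu * s in b1 *; field; exact: b1.
  - by rewrite coefZ coefXn /= mulr0.
  - by move=> x; rewrite hornerZ hornerXn -ofRX -ofRM.
set b := nu ^+ 2 - k ^+ 2 in b0.
pose Y : {poly C} := (ofR (- b^-1)) *: (ofR (2 * nu * s) *: 'X^2 + 'X^4).
have g := @germ_rsqrt Y (fun x => - b^-1 * (2 * nu * s * x ^+ 2 + x ^+ 4)) _ b0.
apply: germ_ext (g _ _).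
- exists 1 => // x _; rewrite /hk; congr rsqrt.
  have -> : (nu + s * x ^+ 2) ^+ 2 - k ^+ 2 = b + (2 * nu * s * x ^+ 2 + s ^+ 2 * x ^+ 4).
    by rewrite /b; ring.
  by rewrite s2 mul1r mulrBr mulr1 mulNr mulrN opprK mulrA mulfV // mul1r.
- by rewrite /Y coefZ coefD coefZ !coefXn /= !mulr0 addr0 mulr0.
- move=> x; rewrite /Y hornerZ hornerD hornerZ !hornerXn -!ofRX -!ofRM -!ofRD -ofRM //.
Qed.

(* With lam = kap (u + 1/u) and x = 1/u. *)
Lemma germ_hk_inf k kap : 0 < kap ->
  germ (fun x => ofR x * hk k (kap * (x^-1 + x))).
Proof.
move=> kap0.
have b0 : kap ^+ 2 != 0 by rewrite expf_neq0 // gt_eqF.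
pose c := (k / kap) ^+ 2 - 2.
pose Y : {poly C} := ofR c *: 'X^2 - 'X^4.
apply: germ_ext (@germ_rsqrt Y (fun x => c * x ^+ 2 - x ^+ 4) _ b0 _ _).
- exists 1 => // x /andP[x0 _]; rewrite -rsqrtM ?(ltW x0) // /hk; congr rsqrt.
  by rewrite /c; field; rewrite !gt_eqF.
- by rewrite /Y coefB coefZ !coefXn /= mulr0 subr0.
- by move=> x; rewrite /Y hornerD hornerN hornerZ !hornerXn -!ofRX -ofRM -ofRB.
Qed.

End VerticalWavenumber.

Section LinearSystem.
Variables (R : realType) (md : medium R).
Local Notation C := (CC R).
Local Notation n := (nint md).
Implicit Types (h : nat -> C) (X : mark -> nat -> C).

(** Rows are numbered by condition and interface, columns by the unknowns Up 0, ..., n - 1 and Down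
    1, ..., n. This leaves out the two components incoming from infinity and makes the system
    square. *)
Definition eqn_idx (i : 'I_(n + n)) : bool * nat :=
  match fintype.split i with inl l => (true, val l) | inr l => (false, val l) end.

Definition sysmx h : 'M[C]_(n + n) := \matrix_(i, c)
  let: (j, l) := eqn_idx i in
  match fintype.split c with
  | inl m => (if val m == l then - cminus md h j l else 0)
      + (if val m == l.+1 then cminus md h j l.+1 * efac md h l.+1 else 0)
  | inr m => (if (val m).+1 == l then - (cplus md h j l * efac md h l) else 0)
      + (if val m == l then cplus md h j l.+1 else 0)
  end.

(** The right-hand side cleared of its factor 1 / (4 pi h_s), hence polynomial in the h_t. *)
Definition rhs0 star s h j l : C :=
  match star with
  | Up => if l == s then cplus md h j l else 0
  | Down => if l.+1 == s then - cminus md h j l.+1 else 0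
  end.

Definition rhsv star s h : 'cV[C]_(n + n) :=
  \col_i let: (j, l) := eqn_idx i in rhs0 star s h j l.

Definition solv X : 'cV[C]_(n + n) :=
  \col_i match fintype.split i with inl m => X Up (val m) | inr m => X Down (val m).+1 end.

Lemma rhsE star s h j l :
  rhs md h star s j l = (4 * ofR pi * h s)^-1 * rhs0 star s h j l.
Proof.
rewrite /rhs /rhs0; case: star; case: eqP => [<-|_]; rewrite ?mulr0 //.
  by rewrite mulrC.
by rewrite mulrN mulrC.
Qed.

(** The terms of the equations that have no column in the matrix are multiples of the two components
    that vanish. *)
Lemma sysmx_solv h X i : X Up n = 0 -> X Down 0%N = 0 ->
  (sysmx h *m solv X) i 0 = let: (j, l) := eqn_idx i in
     - cminus md h j l * X Up l - cplus md h j l * efac md h l * X Down l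
     + cminus md h j l.+1 * efac md h l.+1 * X Up l.+1 + cplus md h j l.+1 * X Down l.+1.
Proof.
move=> XU XD; rewrite mxE.
have ln : ((eqn_idx i).2 < n)%N by rewrite /eqn_idx; case: fintype.split => l /=.
rewrite big_split_ord /=.
under eq_bigr => m _ do rewrite !mxE (unsplitK (inl m)) /=.
under [X in _ + X]eq_bigr => m _ do rewrite !mxE (unsplitK (inr m)) /=.
case: (eqn_idx i) ln => j l /= ln.
have pick1 (F : nat -> C) (G : nat -> C) (p : nat) : (p < n)%N \/ G p = 0 ->
    \sum_(m < n) (if val m == p then F p else 0) * G (val m) = F p * G p.
  case: (ltnP p n) => [pn _|np].
    rewrite (bigD1 (Ordinal pn)) //= eqxx big1 ?addr0 // => m mp.
    case: eqP => [e|]; rewrite ?mul0r //.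
    by case/eqP: mp; apply: val_inj.
  case=> [|G0]; first by [].
  rewrite G0 mulr0 big1 // => m _; case: eqP => [e|]; rewrite ?mul0r //.
  by have := ltn_ord m; rewrite -[nat_of_ord m]/(val m) e => pn; move: np; rewrite leqNgt pn.
under eq_bigr do rewrite mulrDl.
under [X in _ + X]eq_bigr do rewrite mulrDl.
rewrite !big_split /=.
rewrite (pick1 (fun l => - cminus md h j l) (X Up)); last by left.
rewrite (pick1 (fun l => cminus md h j l * efac md h l) (X Up)); last first.
  case: (ltnP l.+1 n) => [|nl]; first by left.
  by right; rewrite (_ : l.+1 = n) //; apply/eqP; rewrite eqn_leq ln.
rewrite (pick1 (fun l => cplus md h j l.+1) (fun l => X Down l.+1)); last by left.
have -> : \sum_(m < n) (if m.+1 == l then - (cplus md h j l * efac md h l) else 0) * X Down m.+1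
    = - (cplus md h j l * efac md h l) * X Down l.
  case: l ln => [|l] ln.
    by rewrite XD [RHS]mulr0 big1 // => m _; rewrite mul0r.
  rewrite -(pick1 (fun l' => - (cplus md h j l.+1 * efac md h l.+1)) (fun l => X Down l.+1) l) //.
  by left; exact: ltnW.
by rewrite !addrA mulNr; ring.
Qed.

Lemma solves_sysmx h star s X : solves md h star s X <->
  [/\ X Up n = 0, X Down 0%N = 0 &
     sysmx h *m solv X = (4 * ofR pi * h s)^-1 *: rhsv star s h].
Proof.
split=> -[XU XD H]; split => //.
  apply/colP => i; rewrite sysmx_solv // mxE [rhsv _ _ _ _ _]mxE.
  have ln : ((eqn_idx i).2 < n)%N by rewrite /eqn_idx; case: fintype.split => l /=.
  by case: (eqn_idx i) ln => j l ln; rewrite H // rhsE.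
move=> j l ln.
pose i : 'I_(n + n) := if j then lshift n (Ordinal ln) else rshift n (Ordinal ln).
have ei : eqn_idx i = (j, l).
  by rewrite /eqn_idx /i; case: (j); rewrite (unsplitK (inl _)) || rewrite (unsplitK (inr _)).
have := sysmx_solv h i XU XD; rewrite ei => <-.
by rewrite H mxE mxE ei rhsE.
Qed.

Definition mark_idx (a : mark) (t : nat) (i : 'I_(n + n)) : Prop :=
  match a with
  | Up => exists2 m : 'I_n, val m = t & i = lshift n m
  | Down => exists2 m : 'I_n, (val m).+1 = t & i = rshift n m
  end.

Lemma mark_idx_ex a t : (t <= n)%N -> mark_ok md a t -> exists i, mark_idx a t i.
Proof.
case: a => /= tn ok.
  by exists (lshift n (Ordinal ok)), (Ordinal ok).
case: t tn ok => // t tn _.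
by exists (rshift n (Ordinal tn)), (Ordinal tn).
Qed.

Lemma solv_idx X a t i : mark_idx a t i -> solv X i 0 = X a t.
Proof.
by case: a => /= -[m <- ->]; rewrite mxE ?(unsplitK (inl m)) ?(unsplitK (inr m)).
Qed.

(** Uniqueness for one right-hand side is enough: a kernel vector could be added to the solution. *)
Lemma sysmx_det_neq0 h star s : uniquely_solvable md h star s -> \det (sysmx h) != 0.
Proof.
move=> [X [XS XU]]; apply/negP; rewrite -det_tr => /det0P[v v0 vA].
have Av : sysmx h *m v^T = 0 by apply: trmx_inj; rewrite trmx_mul trmxK vA trmx0.
(* The kernel vector as a family of components, with 0 for the two that come from infinity. *)
pose D (a : mark) (t : nat) : C := match a with
  | Up => if insub t is Some m then v 0 (lshift n m) else 0
  | Down => if t is t'.+1 then if insub t' is Some m then v 0 (rshift n m) else 0 else 0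
  end.
have DU : D Up n = 0 by rewrite /D insubF // ltnn.
have DD : D Down 0%N = 0 by [].
have sD : solv D = v^T.
  apply/colP => i; rewrite !mxE -[in RHS](splitK i).
  by case: (fintype.split i) => m; rewrite /D /= valK.
have [X1 X2 X3] := (solves_sysmx h star s X).1 XS.
have YS : solves md h star s (fun a t => X a t + D a t).
  apply/solves_sysmx; split; rewrite ?X1 ?X2 ?DU ?DD ?addr0 //.
  have -> : solv (fun a t => X a t + D a t) = solv X + solv D.
    by apply/colP => i; rewrite !mxE; case: fintype.split.
  by rewrite mulmxDr X3 sD Av addr0.
move/negP: v0; apply; apply/eqP/rowP => i; rewrite [RHS]mxE.
have <- : v^T i 0 = v 0 i by rewrite mxE.
rewrite -sD mxE.
have DX a t : (t <= n)%N -> D a t = 0.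
  by move=> tn; apply: (addrI (X a t)); rewrite addr0; exact: XU YS a t tn.
by case: fintype.split => m; apply: DX; [exact: ltnW (ltn_ord m) | exact: ltn_ord].
Qed.

Definition sysnum star s h (i : 'I_(n + n)) : C := (\adj (sysmx h) *m rhsv star s h) i 0.

(** Cramer's rule. Numerator and denominator are polynomials in the h_t and e_t, so every class of
    functions that is closed under ring operations and contains these contains both. *)
Lemma solutionE h star s a t i : uniquely_solvable md h star s -> mark_idx a t i ->
  solution md h star s a t = sysnum star s h i / (\det (sysmx h) * (4 * ofR pi * h s)).
Proof.
move=> us ai; have d0 := sysmx_det_neq0 us.
have XS : solves md h star s (solution md h star s).
  by rewrite /solution; case: xgetP => // nX; case: us => X [/nX].
have [X1 X2 X3] := (solves_sysmx h star s _).1 XS.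
rewrite -(solv_idx _ ai); apply: (mulfI d0).
have : \adj (sysmx h) *m (sysmx h *m solv (solution md h star s)) =
       \adj (sysmx h) *m ((4 * ofR pi * h s)^-1 *: rhsv star s h) by rewrite X3.
rewrite mulmxA mul_adj_mx mul_scalar_mx -scalemxAr => /matrixP /(_ i 0).
rewrite !mxE => ->; rewrite /sysnum mxE [RHS]mulrCA (invfM (\det _)) mulVKf //.
by rewrite mulrC.
Qed.

(* Closure properties shared by continuous functions, convergent power series
   and exponential sums with convergent power series as coefficients. *)
Section SubringOfFunctions.
Variable K : (R -> C) -> Prop.
Hypothesis K_cst : forall c, K (fun=> c).
Hypothesis KD : forall f g, K f -> K g -> K (fun x => f x + g x).
Hypothesis KM : forall f g, K f -> K g -> K (fun x => f x * g x).

Lemma K_N f : K f -> K (fun x => - f x).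
Proof.
move=> Kf; rewrite (_ : (fun x => - f x) = (fun x => -1 * f x)); first exact: KM.
by apply/funext => x; rewrite mulN1r.
Qed.

Lemma K_sum I (r : seq I) (P : pred I) (F : I -> R -> C) :
  (forall i, K (F i)) -> K (fun x => \sum_(i <- r | P i) F i x).
Proof.
move=> KF; elim: r => [|i r IH]; first by under eq_fun do rewrite big_nil.
by under eq_fun do rewrite big_cons; case: (P i) => //; exact: KD.
Qed.

Lemma K_prod I (r : seq I) (P : pred I) (F : I -> R -> C) :
  (forall i, K (F i)) -> K (fun x => \prod_(i <- r | P i) F i x).
Proof.
move=> KF; elim: r => [|i r IH]; first by under eq_fun do rewrite big_nil.
by under eq_fun do rewrite big_cons; case: (P i) => //; exact: KM.
Qed.

Lemma K_det m (A : R -> 'M[C]_m) : (forall i j, K (fun x => A x i j)) ->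
  K (fun x => \det (A x)).
Proof.
move=> KA; rewrite /determinant; apply: K_sum => s; apply: KM => //.
exact: K_prod.
Qed.

Lemma K_adj m (A : R -> 'M[C]_m) i j : (forall i j, K (fun x => A x i j)) ->
  K (fun x => (\adj (A x)) i j).
Proof.
move=> KA; under eq_fun do rewrite mxE /cofactor.
apply: KM => //; apply: K_det => i' j'; under eq_fun do rewrite !mxE.
exact: KA.
Qed.

Variable hh : R -> nat -> C.
Hypothesis K_h : forall t, (t <= n)%N -> K (hh ^~ t).
Hypothesis K_e : forall t, (0 < t < n)%N ->
  K (fun x => cexp (- (hh x t * ofR (iface md t.-1 - iface md t)))).

Lemma K_if (b : bool) f : K f -> K (fun x => if b then f x else 0).
Proof. by case: b. Qed.

Lemma K_cminus j t : (t <= n)%N -> K (fun x => cminus md (hh x) j t).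
Proof. by move=> tn; apply: KD => //; apply: K_N; apply: KM => //; exact: K_h. Qed.
Lemma K_cplus j t : (t <= n)%N -> K (fun x => cplus md (hh x) j t).
Proof. by move=> tn; apply: KD => //; apply: KM => //; exact: K_h. Qed.
Lemma K_efac t : K (fun x => efac md (hh x) t).
Proof.
rewrite /efac; have [tn|tn] := boolP (0 < t < n)%N; last exact: K_cst.
exact: K_e.
Qed.

Lemma K_sysmx i j : K (fun x => sysmx (hh x) i j).
Proof.
under eq_fun do rewrite mxE.
have ln : ((eqn_idx i).2 < n)%N by rewrite /eqn_idx; case: fintype.split => l /=.
case: (eqn_idx i) ln => b l /= ln; case: fintype.split => m; apply: KD; apply: K_if.
- by apply: K_N; apply: K_cminus; exact: ltnW.
- by apply: KM; [exact: K_cminus | exact: K_efac].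
- by apply: K_N; apply: KM; [apply: K_cplus; exact: ltnW | exact: K_efac].
- exact: K_cplus.
Qed.

Lemma K_sysdet : K (fun x => \det (sysmx (hh x))).
Proof. by apply: K_det => i j; exact: K_sysmx. Qed.

Lemma K_sysnum star s i : K (fun x => sysnum star s (hh x) i).
Proof.
under eq_fun do rewrite /sysnum mxE; apply: K_sum => j; apply: KM.
  by apply: K_adj => *; exact: K_sysmx.
under eq_fun do rewrite mxE.
have ln : ((eqn_idx j).2 < n)%N by rewrite /eqn_idx; case: fintype.split => l /=.
case: (eqn_idx j) ln => b l /= ln; rewrite /rhs0; case: star; apply: K_if.
- by apply: K_cplus; exact: ltnW.
- by apply: K_N; exact: K_cminus.
Qed.

End SubringOfFunctions.
End LinearSystem.

(** * Exponential sums *)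

Section ExponentialSums.
Variable R : realType.
Local Notation C := (CC R).
Implicit Types (x d B : R) (f g : R -> C) (L : seq (R * (R -> C))).

(* A term (d, a) stands for exp(- d / x) a(x). *)
Definition esum L x : C := \sum_(p <- L) ofR (expR (- p.1 / x)) * p.2 x.

Fixpoint all_germ L : Prop :=
  if L is p :: L' then germ p.2 /\ all_germ L' else True.

Fixpoint all_ge d L : Prop :=
  if L is p :: L' then d <= p.1 /\ all_ge d L' else True.

Definition expsum f : Prop :=
  exists L, all_germ L /\ near0 (fun x => f x = esum L x).

Lemma esum_nil x : esum [::] x = 0. Proof. by rewrite /esum big_nil. Qed.
Lemma esum_cons p L x :
  esum (p :: L) x = ofR (expR (- p.1 / x)) * p.2 x + esum L x.
Proof. by rewrite /esum big_cons. Qed.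

Lemma esum_cat L1 L2 x : esum (L1 ++ L2) x = esum L1 x + esum L2 x.
Proof. by rewrite /esum big_cat. Qed.

Lemma all_germ_cat L1 L2 : all_germ L1 -> all_germ L2 -> all_germ (L1 ++ L2).
Proof. by elim: L1 => //= p L1 IH [pg L1g] L2g; split => //; exact: IH. Qed.

Definition eterm_mul (p : R * (R -> C)) L :=
  [seq (p.1 + q.1, fun x => p.2 x * q.2 x) | q <- L].

Lemma esum_mul p L x : esum (eterm_mul p L) x = ofR (expR (- p.1 / x)) * p.2 x * esum L x.
Proof.
elim: L => [|q L IH]; first by rewrite /= !esum_nil mulr0.
rewrite /= !esum_cons /= IH mulrDr; congr (_ + _).
by rewrite opprD mulrDl expRD ofRM; ring.
Qed.

Lemma all_germ_mul p L : germ p.2 -> all_germ L -> all_germ (eterm_mul p L).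
Proof.
move=> pg; elim: L => [//|q L IH]; rewrite /= => -[qg Lg].
by split; [exact: (germM pg qg) | exact: (IH Lg)].
Qed.

Lemma all_ge_mul p L d : all_ge d L -> all_ge (p.1 + d) (eterm_mul p L).
Proof.
elim: L => //= q L IH [qd Ld]; split; first by rewrite lerD2l.
exact: IH.
Qed.

Lemma expsum_term d f : germ f -> expsum (fun x => ofR (expR (- d / x)) * f x).
Proof.
move=> fg; exists [:: (d, f)]; split => //; exists 1 => // x _.
by rewrite esum_cons esum_nil addr0.
Qed.

Lemma expsum_ext f g : near0 (fun x => f x = g x) -> expsum f -> expsum g.
Proof.
move=> fg [L [Lg fL]]; exists L; split => //.
by apply: near0_imp (near0_and fg fL) => x [<-].
Qed.

Lemma expsum_germ f : germ f -> expsum f.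
Proof.
move=> fg; apply: expsum_ext (expsum_term 0 fg).
by exists 1 => // x _; rewrite oppr0 mul0r expR0 mul1r.
Qed.

Lemma expsumD f g : expsum f -> expsum g -> expsum (fun x => f x + g x).
Proof.
move=> [L [Lg fL]] [M [Mg gM]]; exists (L ++ M); split; first exact: all_germ_cat.
by apply: near0_imp (near0_and fL gM) => x [-> ->]; rewrite esum_cat.
Qed.

Lemma expsumM f g : expsum f -> expsum g -> expsum (fun x => f x * g x).
Proof.
move=> [L [Lg fL]] [M [Mg gM]].
suff [K [Kg HK]] : exists K, all_germ K /\ forall x, esum K x = esum L x * esum M x.
  exists K; split => //; apply: near0_imp (near0_and fL gM) => x [-> ->].
  by rewrite HK.
elim: L Lg {fL} => [_|p L IH /= [pg /IH[K [Kg HK]]]].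
  by exists [::]; split => // x; rewrite esum_nil mul0r.
exists (eterm_mul p M ++ K); split; first exact/all_germ_cat/Kg/all_germ_mul.
by move=> x; rewrite esum_cat esum_mul HK esum_cons mulrDl.
Qed.

Lemma expsumX f n : expsum f -> expsum (fun x => f x ^+ n).
Proof.
move=> fe; elim: n => [|n IH].
  by apply: expsum_ext (expsum_germ (germ_cst 1)); exists 1.
by apply: expsum_ext (expsumM fe IH); exists 1 => // x _; rewrite exprS.
Qed.

Lemma expsum_sum n (F : nat -> R -> C) : (forall i, expsum (F i)) ->
  expsum (fun x => \sum_(i < n) F i x).
Proof.
move=> Fe; elim: n => [|n IH].
  by apply: expsum_ext (expsum_germ (germ_cst 0)); exists 1 => // x _; rewrite big_ord0.
by apply: expsum_ext (expsumD IH (Fe n)); exists 1 => // x _; rewrite big_ord_recr.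
Qed.

Lemma esum_bound d L : all_germ L -> all_ge d L ->
  exists2 K, 0 < K & near0 (fun x => cabs (esum L x) <= K * expR (- d / x)).
Proof.
elim: L => [_ _|p L IH /= [pg Lg] [pd Ld]].
  exists 1 => //; exists 1 => // x _.
  by rewrite esum_nil cabs0 mul1r expR_ge0.
have [K K0 HK] := IH Lg Ld; have [N N0 HN] := germ_bound pg.
exists (N + K); first by lra.
have [r r0 H] := near0_and HK HN; exists r => // x xr.
have [H1 H2] := H x xr; have x0 := (andP xr).1.
rewrite esum_cons (le_trans (cabsD _ _)) // mulrDl lerD // cabsM cabs_ofR.
rewrite ger0_norm ?expR_ge0 // mulrC ler_pM ?cabs_ge0 ?expR_ge0 //.
by rewrite ler_expR ler_pM2r ?invr_gt0 // lerN2.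
Qed.

Lemma all_ge_ex L : exists d, all_ge d L.
Proof.
elim: L => [|p L [d Ld]]; first by exists 0.
exists (Num.min p.1 d) => /=; rewrite ge_min lexx; split => //.
elim: L Ld => //= q L IH [qd Ld]; rewrite ge_min qd orbT; split => //.
exact: IH.
Qed.

Lemma all_ge_le d d' L : d' <= d -> all_ge d L -> all_ge d' L.
Proof.
move=> dd; elim: L => //= q L IH [qd Ld]; split; first exact: le_trans qd.
exact: IH.
Qed.

(** With c = (k + 1) / d, exp(- d / x) is the (k + 1)-st power of exp(- 1 / (c x)) <= c x; the spare
    factor x makes room for e. *)
Lemma exp_beats_pow d k (e : R) : 0 < d -> 0 < e ->
  near0 (fun x => expR (- d / x) <= e * x ^+ k).
Proof.
move=> d0 e0; pose c := k.+1%:R / d.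
have c0 : 0 < c by rewrite divr_gt0 // ltr0n.
have ck : 0 < c ^+ k.+1 by rewrite exprn_gt0.
exists (e / c ^+ k.+1); first by rewrite divr_gt0.
move=> x /andP[x0]; rewrite ler_pdivlMr // => xe.
apply: (@le_trans _ _ ((c * x) ^+ k.+1)); last first.
  by rewrite exprMn [x ^+ k.+1]exprS mulrA ler_wpM2r ?exprn_ge0 ?(ltW x0) // mulrC.
have -> : - d / x = k.+1%:R * (- (c * x)^-1).
  have kk0 : 0 < k.+1%:R :> R by rewrite ltr0n.
  by rewrite /c; set kk := k.+1%:R in kk0 *; field; rewrite !gt_eqF.
have cx : 0 < c * x by rewrite mulr_gt0.
rewrite expRM_natl lerXn2r ?nnegrE ?expR_ge0 ?(ltW cx) //.
rewrite expRN invf_ple ?posrE ?expR_gt0 //.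
by rewrite (le_trans _ (expR_ge1Dx _)) // lerDr.
Qed.

Definition ordg f : Prop := exists k c g, [/\ c != 0, germ g &
    near0 (fun x => f x = ofR x ^+ k * (c + ofR x * g x))].

(** Exponents increase strictly and no coefficient vanishes near 0, so that the first term dominates
    all others. *)
Fixpoint normal d L : Prop :=
  if L is p :: L' then [/\ d < p.1, germ p.2, ordg p.2 & normal p.1 L'] else True.

Lemma normal_le d d' L : d' <= d -> normal d L -> normal d' L.
Proof. by case: L => //= p L dd [H ? ? ?]; split => //; exact: le_lt_trans H. Qed.

Lemma normal_germ d L : normal d L -> all_germ L.
Proof. by elim: L d => //= p L IH d [_ pg _ /IH]. Qed.

Lemma normal_ge d L : normal d L -> all_ge d L.
Proof.
elim: L d => //= p L IH d [dp _ _ /IH Lp]; split; first exact: ltW.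
by apply: all_ge_le Lp; exact: ltW.
Qed.

(** Coefficients of equal exponents may cancel, and then the merged term has to disappear: this
    needs the dichotomy of [germ_order]. *)
Lemma normal_insert d e a L : d < e -> germ a -> normal d L -> exists L',
  normal d L' /\ near0 (fun x => esum L' x = ofR (expR (- e / x)) * a x + esum L x).
Proof.
move=> + ag; elim: L d => [|[e1 a1] L IH] d de /=.
  move=> _; have [a0|ao] := germ_order ag.
    exists [::]; split => //; apply: near0_imp a0 => x ->.
    by rewrite mulr0 add0r.
  exists [:: (e, a)]; split => //; exists 1 => // x _.
  by rewrite esum_cons.
move=> [de1 a1g a1o Ln]; have [ee1|e1e|e1E] := ltgtP e e1.
- have [a0|ao] := germ_order ag.
    exists ((e1, a1) :: L); split => //; apply: near0_imp a0 => x ->.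
    by rewrite mulr0 add0r.
  exists [:: (e, a), (e1, a1) & L]; split.
    split=> /=; [exact: de | exact: ag | exact: ao |].
    by split=> /=; [exact: ee1 | exact: a1g | exact: a1o | exact: Ln].
  by exists 1 => // x _; rewrite esum_cons.
- have [L' [L'n H]] := IH e1 e1e Ln; exists ((e1, a1) :: L'); split => //.
  by apply: near0_imp H => x; rewrite !esum_cons => ->; rewrite addrCA.
- subst e1; have bg := germD ag a1g; have [b0|bo] := germ_order bg.
    exists L; split; first by apply: normal_le Ln; exact: ltW.
    apply: near0_imp b0 => x; rewrite esum_cons /= addrA -mulrDr => ->.
    by rewrite mulr0 add0r.
  exists ((e, fun x => a x + a1 x) :: L); split => //; exists 1 => // x _.
  by rewrite !esum_cons /= mulrDr addrA.
Qed.

Lemma expsum_normal f : expsum f ->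
  exists d L, normal d L /\ near0 (fun x => f x = esum L x).
Proof.
move=> [L [Lg fL]].
suff [d [L' [Ln H]]] : exists d L', normal d L' /\ near0 (fun x => esum L' x = esum L x).
  by exists d, L'; split => //; apply: near0_imp (near0_and fL H) => x [-> ->].
elim: L Lg {fL} => [_|[e a] L IH /= [ag /IH[d [L' [Ln H]]]]].
  by exists 0, [::]; split => //; exists 1.
have de : Num.min d (e - 1) < e by rewrite gt_min; apply/orP; right; lra.
have dd : Num.min d (e - 1) <= d by rewrite ge_min lexx.
have [L2 [L2n H2]] := normal_insert de ag (normal_le dd Ln).
exists (Num.min d (e - 1)), L2; split => //.
by apply: near0_imp (near0_and H H2) => x [Hx ->]; rewrite Hx esum_cons.
Qed.

Lemma normal_gap e L : normal e L -> exists2 d, e < d & all_ge d L.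
Proof.
case: L => [_|p L /= [ep _ _ Ln]]; first by exists (e + 1); rewrite ?ltrDl.
by exists p.1 => //; split => //; exact: normal_ge Ln.
Qed.

(** The first term is at least (|c| / 2) x^k exp(- e / x). The others have exponents beyond a gap
    and add up to at most half of this. *)
Lemma normal_lower d e a L : normal d ((e, a) :: L) -> exists k,
  exists2 K, 0 < K & near0 (fun x => K * x ^+ k * expR (- e / x) <= cabs (esum ((e, a) :: L) x)).
Proof.
move=> /= [_ ag [k [c [g [c0 gg aE]]]] Ln].
have [d1 ed1 Ld1] := normal_gap Ln.
have [K K0 HK] := esum_bound (normal_germ Ln) Ld1.
have [N N0 HN] := germ_bound gg.
have cc : 0 < cabs c by rewrite cabs_gt0.
have d10 : 0 < d1 - e by lra.
have e1 : 0 < cabs c / (4 * K) by rewrite divr_gt0 // mulr_gt0.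
exists k, (cabs c / 4); first by lra.
have [r r0 H] := near0_and (near0_and aE HK) (near0_and HN (exp_beats_pow k d10 e1)).
have s0 : 0 < Num.min r (cabs c / (2 * (N + 1))).
  by rewrite lt_min r0 divr_gt0 // mulr_gt0 //; lra.
exists (Num.min r (cabs c / (2 * (N + 1)))) => // x /andP[x0].
rewrite le_min => /andP[xr xc].
have [[aEx HKx] [HNx Hex]] := H x (introT andP (conj x0 xr)).
have E0 : 0 < expR (- e / x) by exact: expR_gt0.
have xk : 0 < x ^+ k by rewrite exprn_gt0.
have t1 : cabs (ofR (expR (- e / x)) * a x) >= expR (- e / x) * (x ^+ k * (cabs c / 2)).
  rewrite cabsM cabs_ofR gtr0_norm // ler_pM2l // aEx cabsM cabsX cabs_ofR gtr0_norm //.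
  rewrite ler_pM2l // -[c in leRHS]opprK -[leRHS]cabsN opprD opprK.
  rewrite (le_trans _ (cabs_lerB _ _)) // cabsM cabs_ofR gtr0_norm // cabsN.
  have : x * (N + 1) <= cabs c / 2.
    by move: xc; rewrite ler_pdivlMr; last (rewrite mulr_gt0 //; lra); lra.
  by have := cabs_ge0 (g x); nra.
have t2 : cabs (esum L x) <= expR (- e / x) * (x ^+ k * (cabs c / 4)).
  rewrite (le_trans HKx) // (_ : - d1 / x = - e / x + - (d1 - e) / x); last first.
    by rewrite -mulrDl; congr (_ / _); ring.
  rewrite expRD mulrCA ler_pM2l //.
  apply: (@le_trans _ _ (K * (cabs c / (4 * K) * x ^+ k))); first by rewrite ler_pM2l.
  rewrite (_ : K * _ = x ^+ k * (cabs c / 4)) //.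
  by set y := x ^+ k; field; rewrite gt_eqF.
rewrite esum_cons /= -[esum L x]opprK (le_trans _ (cabs_lerB _ _)) // cabsN.
by move: t1 t2; set u := expR _; set y := x ^+ k; lra.
Qed.

(* The quotient of two exponential sums is expanded by a finite geometric
   series, up to an error O(exp(- B / x)) with B arbitrary; the growth
   hypothesis excludes negative exponents from the result. *)
Lemma expsum_quotient (num den : R -> C) n1 n2 B : 0 <= B ->
  expsum (fun x => ofR x ^+ n1 * den x) -> expsum (fun x => ofR x ^+ n2 * num x) ->
  near0 (fun x => den x != 0) ->
  (forall e : R, 0 < e -> exists K : R, near0 (fun x =>
     cabs (num x / den x) <= K * expR (e / x))) ->
  exists n L K, [/\ all_germ L, all_ge 0 L & near0 (fun x =>
     cabs (ofR x ^+ n * (num x / den x) - esum L x) <= K * expR (- B / x))].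
Proof.
move=> B0 /expsum_normal[d [LD [LDn DE]]] [LN [LNg NE]] den0 growth.
have [LD0 | [p [L0 LDE]]] : LD = [::] \/ exists p L0, LD = p :: L0.
  by case: (LD) => [|p L0]; [left|right; exists p, L0].
  have [x /andP[x0 _] [H1 H2]] := near0_ex ltr01 (near0_and DE den0).
  case/negP: H2; move/eqP: H1; rewrite LD0 esum_nil mulf_eq0 expf_eq0 ofR_eq0.
  by rewrite gt_eqF // andbF.
case: p LDE => D0 a0 LDE; subst LD.
move: (LDn) => /= [_ a0g [k [c [g [c0 gg a0E]]]] L0n].
have invg := germ_inv c0 gg.
pose iv x := (c + ofR x * g x)^-1.
have [d1 Dd1 L0d] := normal_gap L0n.
pose LT := eterm_mul (- D0, iv) L0.
have LTg : all_germ LT by apply: all_germ_mul => //; exact: normal_germ L0n.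
have LTd : all_ge (d1 - D0) LT by rewrite addrC; exact: all_ge_mul.
have [KT KT0 HT] := esum_bound LTg LTd.
pose dl := d1 - D0; have dl0 : 0 < dl by rewrite /dl subr_gt0.
have [A LNA] := all_ge_ex LN.
have [KN KN0 HN] := esum_bound LNg LNA.
have [N N0 Hiv] := germ_bound invg.
(* Number of terms of the geometric expansion: exp(- m dl / x) has to provide the required exp(- B /
   x) and to compensate for exp(D0 / x), from the division by the leading term, and exp(- A / x),
   from the numerator. *)
have [m Hm] : exists m : nat, B + D0 - A <= m%:R * dl.
  have Hm := archi_boundP (normr_ge0 ((B + D0 - A) / dl)).
  exists (Num.bound `|(B + D0 - A) / dl|); rewrite -ler_pdivrMr //.
  by rewrite (le_trans (ler_norm _)) // ltW.
have [rg rg0 Hg] : near0 (fun x => c + ofR x * g x != 0).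
  have [M M0 [r r0 HM]] := germ_bound gg.
  have cc : 0 < cabs c by rewrite cabs_gt0.
  have s0 : 0 < Num.min r (cabs c / (2 * (M + 1))).
    by rewrite lt_min r0 divr_gt0 // mulr_gt0 //; lra.
  exists (Num.min r (cabs c / (2 * (M + 1)))) => // x /andP[x0].
  rewrite le_min => /andP[xr xc].
  have gM := HM x (introT andP (conj x0 xr)).
  rewrite -cabs_gt0 -[ofR x * _]opprK (lt_le_trans _ (cabs_lerB _ _)) //.
  rewrite cabsN cabsM cabs_ofR gtr0_norm //.
  have : x * (M + 1) <= cabs c / 2.
    by move: xc; rewrite ler_pdivlMr; last (rewrite mulr_gt0 //; lra); lra.
  by have := cabs_ge0 (g x); nra.
have h2 : 0 < 1 / (2 * KT) by rewrite divr_gt0 // mulr_gt0.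
pose T x := esum LT x.
(* Up to a power of x, the denominator is its leading exponential times (c + x g) (x^k + T), and
   x^(k m) - (- T)^m = (x^k + T) P. Multiplying by x^(k m) beforehand avoids negative powers of x;
   one more x^k in [n] bounds x^k / (x^k + T) by 2 in the remainder. *)
pose P x : C := \sum_(j < m) (ofR x ^+ k) ^+ (m.-1 - j) * (- T x) ^+ j.
pose main x := ofR x ^+ (n1 + k) * esum LN x * (ofR (expR (D0 / x)) * iv x) * P x.
have mainE : expsum main.
  apply: expsumM; first apply: expsumM; first apply: expsumM.
  - by apply: expsum_germ; apply: germX; exact: germ_id.
  - by exists LN; split => //; exists 1.
  - by have := expsum_term (- D0) invg; rewrite opprK.
  - pose F (j : nat) x := (ofR x ^+ k) ^+ (m.-1 - j) * (- T x) ^+ j.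
    suff H j : expsum (F j) by exact: (expsum_sum m H).
    apply: expsumM; first by apply: expsum_germ; do 2 apply: germX; exact: germ_id.
    apply: expsumX.
    have Te : expsum T by exists LT; split => //; exists 1.
    apply: expsum_ext (expsumM (expsum_germ (germ_cst (-1))) Te).
    by exists 1 => // x _; rewrite mulN1r.
pose n := (n2 + k * m + k)%N.
pose K1 := KN * N * KT ^+ m * 2.
have K1_ge0 : 0 <= K1 by rewrite /K1 !mulr_ge0 ?exprn_ge0 // ltW.
have key : near0 (fun x => cabs (ofR x ^+ n * (num x / den x) - main x) <= K1 * expR (- B / x)).
  have [r r0 H] := near0_and (near0_and (near0_and DE NE) (near0_and den0 a0E))
    (near0_and (near0_and HT HN) (near0_and Hiv (exp_beats_pow k dl0 h2))).
  have s0 : 0 < Num.min (Num.min r rg) 1 by rewrite !lt_min r0 rg0 /=.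
  exists (Num.min (Num.min r rg) 1) => // x /andP[x0].
  rewrite !le_min => /andP[/andP[xr xrg] x1].
  have [[[DEx NEx] [denx a0x]] [[HTx HNx] [Hivx Hex]]] := H x (introT andP (conj x0 xr)).
  have gx := Hg x (introT andP (conj x0 xrg)).
  have xC : ofR x != 0 by rewrite ofR_eq0 gt_eqF.
  have E0 : ofR (expR (- D0 / x)) != 0 by rewrite ofR_eq0 gt_eqF ?expR_gt0.
  have EE : ofR (expR (D0 / x)) = (ofR (expR (- D0 / x)))^-1.
    by rewrite mulNr expRN ofRV invrK.
  have TE : esum L0 x = ofR (expR (- D0 / x)) * (c + ofR x * g x) * T x.
    rewrite /T /LT esum_mul /= opprK EE /iv; set E := ofR (expR _) in E0 *.
    by field; rewrite E0 gx.
  have denE : ofR x ^+ n1 * den x = ofR (expR (- D0 / x)) * (c + ofR x * g x) * (ofR x ^+ k + T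
    x).
    by rewrite DEx esum_cons /= a0x TE; ring.
  have xk0 : 0 < x ^+ k by rewrite exprn_gt0.
  have TX : cabs (T x) <= x ^+ k / 2.
    rewrite (le_trans HTx) //; apply: (@le_trans _ _ (KT * (1 / (2 * KT) * x ^+ k))).
      by rewrite ler_pM2l.
    rewrite (_ : KT * _ = x ^+ k / 2) //.
    by set y := x ^+ k; field; rewrite gt_eqF.
  have XT : x ^+ k / 2 <= cabs (ofR x ^+ k + T x).
    rewrite -[T x]opprK (le_trans _ (cabs_lerB _ _)) // cabsN cabsX cabs_ofR gtr0_norm //; lra.
  have XT0 : ofR x ^+ k + T x != 0 by rewrite -cabs_gt0 (lt_le_trans _ XT) // divr_gt0.
  have geo : (ofR x ^+ k) ^+ m - (- T x) ^+ m = (ofR x ^+ k + T x) * P x.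
    by rewrite subrXX opprK.
  have remE : ofR x ^+ n * (num x / den x) - main x =
     ofR x ^+ n1 * esum LN x * ofR (expR (D0 / x)) * iv x * (- T x) ^+ m
      * (ofR x ^+ k / (ofR x ^+ k + T x)).
    have PE : P x = ((ofR x ^+ k) ^+ m - (- T x) ^+ m) / (ofR x ^+ k + T x).
      by rewrite geo mulrC mulKf.
    have dE : den x = ofR (expR (- D0 / x)) * (c + ofR x * g x) * (ofR x ^+ k + T x) / ofR x ^+
      n1.
      by rewrite -denE mulrC mulKf // expf_neq0.
    have nE : num x = esum LN x / ofR x ^+ n2 by rewrite -NEx mulrC mulKf // expf_neq0.
    rewrite dE nE /main PE EE /iv /n !exprD exprM.
    have x1n : ofR x ^+ n1 != 0 by rewrite expf_neq0.
    have x2n : ofR x ^+ n2 != 0 by rewrite expf_neq0.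
    set X1 := ofR x ^+ n1 in x1n *; set X2 := ofR x ^+ n2 in x2n *.
    set X := ofR x ^+ k in XT0 *; set XM := X ^+ m; set TM := (- T x) ^+ m.
    set E := ofR (expR _) in E0 *; set G := c + _ in gx *.
    by field; rewrite x1n x2n E0 gx XT0.
  rewrite remE !cabsM cabs_ofR (gtr0_norm (expR_gt0 _)).
  have b1 : cabs (ofR x ^+ n1) <= 1.
    by rewrite cabsX cabs_ofR gtr0_norm // exprn_ile1 // ltW.
  have b2 : cabs ((- T x) ^+ m) <= KT ^+ m * expR (- (m%:R * dl) / x).
    rewrite cabsX cabsN mulNr -mulrA -mulrN expRM_natl -mulNr -exprMn.
    by rewrite lerXn2r ?nnegrE ?cabs_ge0 ?mulr_ge0 ?expR_ge0 // ltW.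
  have b3 : cabs (ofR x ^+ k) * cabs ((ofR x ^+ k + T x)^-1) <= 2.
    rewrite cabsV cabsX cabs_ofR gtr0_norm // ler_pdivrMr; last by rewrite cabs_gt0.
    by move: XT; lra.
  apply: (@le_trans _ _ (1 * (KN * expR (- A / x)) * expR (D0 / x) * N *
      (KT ^+ m * expR (- (m%:R * dl) / x)) * 2)).
    by do 5 (apply: ler_pM => //; rewrite ?mulr_ge0 ?cabs_ge0 ?expR_ge0 //).
  rewrite /K1 (_ : _ * 2 = KN * N * KT ^+ m * 2 * expR (- A / x + D0 / x + - (m%:R * dl) / x));
    last first.
    by rewrite !expRD; ring.
  rewrite ler_wpM2l // ler_expR -!mulrDl ler_pM2r ?invr_gt0 //; lra.
have [d2 [LM [LMn ME]]] := expsum_normal mainE.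
exists n, LM, K1; split; first exact: normal_germ LMn; last first.
  by apply: near0_imp (near0_and key ME) => x [+ <-].
case: LM LMn ME => [//|[e a] LM] LMn ME.
(* In normal form the first exponent decides. Were it negative, the expansion would be at least of
   size x^j exp(2 h / x) with h = - e / 2, against the growth bound O(exp(h / x)). *)
suff e0 : 0 <= e.
  split => //; case: LMn => _ _ _ /normal_ge; exact: all_ge_le.
rewrite leNgt; apply/negP => e0.
have [j [K2 K20 low]] := normal_lower LMn.
pose h := - e / 2; have h0 : 0 < h by rewrite /h; lra.
have [Kg HKg] := growth h h0.
pose K3 := `|Kg| + K1 + 1.
have K30 : 0 < K3 by rewrite /K3; have := normr_ge0 Kg; lra.
have e3 : 0 < K2 / (2 * K3) by rewrite divr_gt0 // mulr_gt0.
have [x /andP[x0 x1] [[keyx MEx] [[lowx growx] bx]]] := near0_ex ltr01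
  (near0_and (near0_and key ME) (near0_and (near0_and low HKg) (exp_beats_pow j h0 e3))).
have xj : 0 < x ^+ j by rewrite exprn_gt0.
have u1 : cabs (main x) <= K3 * expR (h / x).
  have -> : main x = ofR x ^+ n * (num x / den x) - (ofR x ^+ n * (num x / den x) - main x) by
    ring.
  rewrite (le_trans (cabsB _ _)) // cabsM.
  have b1 : cabs (ofR x ^+ n) <= 1.
    by rewrite cabsX cabs_ofR gtr0_norm // exprn_ile1 // ltW.
  have b2 : cabs (num x / den x) <= `|Kg| * expR (h / x).
    by rewrite (le_trans growx) // ler_pM2r ?expR_gt0 // ler_norm.
  have b3 : K1 * expR (- B / x) <= K1 * expR (h / x).
    by rewrite ler_wpM2l // ler_expR ler_pM2r ?invr_gt0 //; lra.
  have b4 : cabs (ofR x ^+ n) * cabs (num x / den x) <= 1 * (`|Kg| * expR (h / x)).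
    by rewrite ler_pM ?cabs_ge0.
  by rewrite /K3; have := expR_gt0 (h / x); move: b3 b4 keyx; lra.
move: lowx; rewrite -MEx => lowx.
have : K2 * x ^+ j * expR (- e / x) <= K3 * expR (h / x) by exact: le_trans u1.
have -> : - e / x = h / x + h / x by rewrite -mulrDl /h; congr (_ / _); field.
rewrite expRD mulrA ler_pM2r ?expR_gt0 //; apply/negP; rewrite -ltNge.
have e3x : 0 < K2 / (2 * K3) * x ^+ j by rewrite mulr_gt0.
move: bx; rewrite mulNr expRN invf_ple ?posrE ?expR_gt0 // => bx.
have : (K2 / (2 * K3) * x ^+ j)^-1 * (K2 * x ^+ j) <= expR (h / x) * (K2 * x ^+ j).
  by rewrite ler_wpM2r // mulr_ge0 // ltW.
have -> : (K2 / (2 * K3) * x ^+ j)^-1 * (K2 * x ^+ j) = 2 * K3.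
  by set y := x ^+ j in xj *; field; rewrite !gt_eqF.
rewrite [expR _ * _]mulrC => H2; apply: lt_le_trans H2; lra.
Qed.

End ExponentialSums.

(** * Real singularities of sigma *)

Section SigmaAnalysis.
Local Open Scope classical_set_scope.
Variable R : realType.
Local Notation C := (CC R).

Lemma finite_bounded (F : set R) : finite_set F -> exists2 M, 0 < M & forall x, F x -> `|x| < M.
Proof.
move=> /finite_seqP[s ->]; elim: s => [|y s [M M0 HM]].
  by exists 1 => // x; rewrite set_nil.
exists (M + `|y|) => [|x /=]; first by rewrite ltr_wpDr.
rewrite inE => /orP[/eqP ->|xs]; first by rewrite ltrDr.
by rewrite ltr_wpDr // HM.
Qed.

Lemma finite_isolated (F : set R) nu : finite_set F ->
  exists2 d, 0 < d & forall x, F x -> x != nu -> d <= `|x - nu|.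
Proof.
move=> /finite_seqP[s ->]; elim: s => [|y s [d d0 Hd]].
  by exists 1 => // x; rewrite set_nil.
have [->|ynu] := eqVneq y nu.
  exists d => // x /=; rewrite inE => /orP[/eqP ->|xs xnu]; first by rewrite eqxx.
  exact: Hd.
have y0 : 0 < `|y - nu| by rewrite normr_gt0 subr_eq0.
exists (Num.min d `|y - nu|) => [|x /=]; first by rewrite lt_min d0.
rewrite inE ge_min => /orP[/eqP -> _|xs xnu]; first by rewrite lexx orbT.
by rewrite Hd.
Qed.

(** For a quotient of power series mere convergence improves to the rate O(x): the limit excludes a
    negative order, and the quotient is then itself a power series. The factor x^2 stands for
    |lambda - nu|. *)
Lemma germ_quotient_lim (num den : R -> C) (l : C) :
  germ num -> germ den -> near0 (fun x => den x != 0) ->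
  (forall e, 0 < e -> near0 (fun x => cabs (ofR x ^+ 2 * (num x / den x) - l) < e)) ->
  exists2 K, 0 <= K & near0 (fun x => cabs (ofR x ^+ 2 * (num x / den x) - l) <= K * x).
Proof.
move=> ng dg den0 lim.
have uniq (a : C) K : 0 <= K ->
    near0 (fun x => cabs (ofR x ^+ 2 * (num x / den x) - a) <= K * x) ->
    exists2 K, 0 <= K & near0 (fun x => cabs (ofR x ^+ 2 * (num x / den x) - l) <= K * x).
  move=> K0 HK; suff -> : l = a by exists K.
  apply/eqP; rewrite -subr_eq0 -cabs_eq0 eq_le cabs_ge0 andbT leNgt; apply/negP => al.
  have e0 : 0 < cabs (l - a) / 2 by rewrite divr_gt0.
  have d0 : 0 < cabs (l - a) / (2 * (K + 1)) by rewrite divr_gt0 // mulr_gt0 //; lra.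
  have [x /andP[x0 xd] [H1 H2]] := near0_ex d0 (near0_and (lim _ e0) HK).
  have := cabsB (ofR x ^+ 2 * (num x / den x) - a) (ofR x ^+ 2 * (num x / den x) - l).
  rewrite (_ : _ - a - (_ - l) = l - a); last by ring.
  have : x * (K + 1) < cabs (l - a) / 2.
    by move: xd; rewrite ltr_pdivlMr; last (rewrite mulr_gt0 //; lra); lra.
  by nra.
have [d0|[k [c [g [c0 gg dE]]]]] := germ_order dg.
  by have [x _ [d0x /negP]] := near0_ex ltr01 (near0_and d0 den0); rewrite d0x eqxx.
have invg := germ_inv c0 gg.
have [n0|[j [c' [g' [c'0 gg' nE]]]]] := germ_order ng.
  apply: (uniq 0 0) => //; apply: near0_imp n0 => x ->.
  by rewrite !mul0r mulr0 subrr cabs0.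
have g'' : germ (fun x => c' + ofR x * g' x).
  exact: (germD (germ_cst c') (germM (germ_id R) gg')).
have E : near0 (fun x => (0 < x) /\ ofR x ^+ k * (ofR x ^+ 2 * (num x / den x)) =
    ofR x ^+ (2 + j) * ((c' + ofR x * g' x) * (c + ofR x * g x)^-1)).
  have [r r0 H] := near0_and (near0_and dE den0) nE; exists r => // x xr.
  have [[dx dx0] nx] := H x xr; split; first exact: (andP xr).1.
  move: dx0; rewrite nx dx mulf_eq0 negb_or => /andP[xk0 G0].
  rewrite exprD; set X := ofR x ^+ k in xk0 *; set Y := ofR x ^+ j; set G := c + _ in G0 *.
  by field; rewrite xk0 G0.
have [kj|jk] := leqP k (2 + j).
  have [a [K [K0 HK]]] := germ_lin (germM (germX (2 + j - k) (germ_id R)) (germM g'' invg)).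
  apply: (uniq a K) => //; apply: near0_imp (near0_and E HK) => x [[x0 Ex]].
  suff -> : ofR x ^+ 2 * (num x / den x) =
    ofR x ^+ (2 + j - k) * ((c' + ofR x * g' x) * (c + ofR x * g x)^-1) by [].
  have xk0 : ofR x ^+ k != 0 by rewrite expf_neq0 // ofR_eq0 gt_eqF.
  by apply: (mulfI xk0); rewrite Ex [RHS]mulrA -exprD subnKC.
(* A denominator of order k > 2 + j would make c' + x g' of size O(x), although c' is not 0. *)
exfalso.
have [N N0 HN] := germ_bound invg.
have [a [K [K0 HK]]] := germ_lin (germ_inv c'0 gg').
have [M M0 HM] := germ_bound (germ_inv c'0 gg').
have [gM gM0 HgM] := germ_bound gg.
pose D := cabs c + gM + 1.
have D0 : 0 < D by rewrite /D; have := cabs_ge0 c; lra.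
have c'pos : 0 < cabs c' by rewrite cabs_gt0.
pose Q := D * (cabs l + 1) * 2 / cabs c' + 1.
have Q0 : 0 < Q.
  have : 0 <= D * (cabs l + 1) * 2 / cabs c'.
    by rewrite !mulr_ge0 ?invr_ge0 ?(ltW c'pos) ?(ltW D0) // addr_ge0 // cabs_ge0.
  by rewrite /Q; lra.
have [gM' gM'0 HgM'] := germ_bound gg'.
have s0 : 0 < Num.min (Num.min 1 Q^-1) (cabs c' / (2 * (gM' + 1))).
  by rewrite !lt_min ltr01 invr_gt0 Q0 divr_gt0 // mulr_gt0 //; lra.
have [x /andP[x0]] := near0_ex s0 (near0_and (near0_and E (lim _ ltr01))
    (near0_and (near0_and HgM HgM') (near0_and dE den0))).
rewrite !lt_min => /andP[/andP[x1 xQ] xc] [[[_ Ex] lx] [[gx g'x] [dx dx0]]].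
have G0 : c + ofR x * g x != 0 by move: dx0; rewrite dx mulf_eq0 negb_or => /andP[].
have xC : ofR x != 0 by rewrite ofR_eq0 gt_eqF.
pose f := ofR x ^+ 2 * (num x / den x).
have fE : c' + ofR x * g' x = ofR x ^+ (k - (2 + j)) * f * (c + ofR x * g x).
  apply: (mulfI (expf_neq0 (2 + j) xC)).
  have Ex' : ofR x ^+ k * f = ofR x ^+ (2 + j) * ((c' + ofR x * g' x) / (c + ofR x * g x)) := Ex.
  rewrite -[X in _ = _ * X]mulrA [RHS]mulrA -exprD subnKC ?(ltnW jk) //.
  by rewrite mulrA Ex' -!mulrA mulVf // mulr1.
have fl : cabs f <= cabs l + 1.
  have := cabsD (f - l) l; rewrite subrK => H; apply: le_trans H _.
  by rewrite addrC lerD2l ltW.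
clearbody f.
have up : cabs (c' + ofR x * g' x) <= x * ((cabs l + 1) * D).
  rewrite fE !cabsM cabsX cabs_ofR gtr0_norm // -mulrA ler_pM ?exprn_ge0 ?mulr_ge0 ?cabs_ge0
    ?(ltW x0) //.
    have -> : (k - (2 + j) = (k - (2 + j)).-1.+1)%N by rewrite prednK // subn_gt0.
    by rewrite exprS ler_piMr ?(ltW x0) // exprn_ile1 // ltW.
  rewrite ler_pM ?cabs_ge0 // (le_trans (cabsD _ _)) // cabsM cabs_ofR gtr0_norm //.
  by have := cabs_ge0 (g x); rewrite /D; nra.
have lo : cabs c' / 2 <= cabs (c' + ofR x * g' x).
  rewrite -[ofR x * _]opprK (le_trans _ (cabs_lerB _ _)) // cabsN cabsM cabs_ofR gtr0_norm //.
  have : x * (gM' + 1) <= cabs c' / 2.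
    by move: xc; rewrite ltr_pdivlMr; last (rewrite mulr_gt0 //; lra); lra.
  by have := cabs_ge0 (g' x); nra.
have : x * Q < 1.
  by move: xQ; rewrite -[Q^-1]mul1r ltr_pdivlMr.
rewrite /Q mulrDr mulr1 => xQ1.
have : x * (D * (cabs l + 1) * 2 / cabs c') < 1 by lra.
rewrite mulrA ltr_pdivrMr // mul1r => H; move: lo up; nra.
Qed.

Definition ccont (f : R -> C) : Prop :=
  continuous (fun x => re (f x)) /\ continuous (fun x => im (f x)).

Lemma ccont_cst c : ccont (fun=> c).
Proof. by split=> x; exact: cvg_cst. Qed.

Lemma ccontD f g : ccont f -> ccont g -> ccont (fun x => f x + g x).
Proof.
move=> [f1 f2] [g1 g2]; split=> x.
- rewrite (_ : (fun x => _) = (fun x => re (f x) + re (g x))); last by apply/funext => y;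
  rewrite reD.
  exact: (cvgD (f1 x) (g1 x)).
- rewrite (_ : (fun x => _) = (fun x => im (f x) + im (g x))); last by apply/funext => y;
  rewrite imD.
  exact: (cvgD (f2 x) (g2 x)).
Qed.

Lemma ccontM f g : ccont f -> ccont g -> ccont (fun x => f x * g x).
Proof.
move=> [f1 f2] [g1 g2]; split=> x.
- rewrite (_ : (fun x => _) = (fun x => re (f x) * re (g x) - im (f x) * im (g x))); last first.
    by apply/funext => y; rewrite reM.
  exact: (cvgB (cvgM (f1 x) (g1 x)) (cvgM (f2 x) (g2 x))).
- rewrite (_ : (fun x => _) = (fun x => re (f x) * im (g x) + im (f x) * re (g x))); last first.
    by apply/funext => y; rewrite imM.
  exact: (cvgD (cvgM (f1 x) (g2 x)) (cvgM (f2 x) (g1 x))).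
Qed.

Lemma ccont_cexp f : ccont f -> ccont (fun x => cexp (f x)).
Proof.
move=> [f1 f2]; split=> x /=.
- apply: (@cvgM _ _ _ _ (fun x => expR (re (f x))) (fun x => cos (im (f x)))).
    by apply: continuous_comp; [exact: f1 | exact: continuous_expR].
  by apply: continuous_comp; [exact: f2 | exact: continuous_cos].
- apply: (@cvgM _ _ _ _ (fun x => expR (re (f x))) (fun x => sin (im (f x)))).
    by apply: continuous_comp; [exact: f1 | exact: continuous_expR].
  by apply: continuous_comp; [exact: f2 | exact: continuous_sin].
Qed.

Lemma ccont_ofR (f : R -> R) : continuous f -> ccont (fun x => ofR (f x)).
Proof. by move=> fc; split=> x //=; exact: cvg_cst. Qed.

Lemma ccont_hk k : ccont (hk k).
Proof.
have c2 : continuous (fun x : R => x ^+ 2 - k ^+ 2).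
  by move=> x; apply: cvgB; [exact: exprn_continuous | exact: cvg_cst].
split=> x /=.
- by apply: continuous_comp; [exact: c2 | exact: sqrt_continuous].
- apply: cvgN; apply: continuous_comp; last exact: sqrt_continuous.
  by apply: cvgN; exact: c2.
Qed.

Lemma ccont_bound f nu : ccont f -> exists d M, [/\ 0 < d, 0 <= M &
  forall x, `|x - nu| < d -> cabs (f x) <= M].
Proof.
move=> [f1 f2].
have /cvgrPdist_lt/(_ 1 ltr01)/nbhs_ballP[d1 d10 H1] := f1 nu.
have /cvgrPdist_lt/(_ 1 ltr01)/nbhs_ballP[d2 d20 H2] := f2 nu.
exists (Num.min d1 d2), (`|re (f nu)| + `|im (f nu)| + 2); split.
- by rewrite lt_min d10.
- by rewrite !addr_ge0.
move=> x; rewrite lt_min => /andP[xd1 xd2].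
have := H1 x; rewrite /ball /= distrC => /(_ xd1) h1.
have := H2 x; rewrite /ball /= distrC => /(_ xd2) h2.
rewrite (le_trans (cabs_le _)) //.
have := ler_normB (re (f nu)) (re (f nu) - re (f x)).
have := ler_normB (im (f nu)) (im (f nu) - im (f x)).
rewrite !subKr; lra.
Qed.

Lemma ccont_lower f nu : ccont f -> f nu != 0 -> exists d m, [/\ 0 < d, 0 < m &
  forall x, `|x - nu| < d -> m <= cabs (f x)].
Proof.
move=> [f1 f2] fnu.
have fc : f x @[x --> nu] --> f nu by apply: ccvg_reim; [exact: f1 | exact: f2].
have a0 : 0 < cabs (f nu) / 2 by rewrite divr_gt0 // cabs_gt0.
have /ccvgP/(_ _ a0)/nbhs_ballP[d d0 H] := fc.
exists d, (cabs (f nu) / 2); split => // x xd.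
have := H x; rewrite /ball /= distrC => /(_ xd) h.
by have := cabs_lerB (f nu) (f nu - f x); rewrite subKr; lra.
Qed.

Variables (md : medium R) (s : nat) (star : mark) (t : nat) (a : mark).
Hypotheses (wp : well_posed md s) (sn : (s <= nint md)%N) (tn : (t <= nint md)%N).
Hypotheses (star_ok : mark_ok md star s) (a_ok : mark_ok md a t).
Local Notation sg := (sigma md s star t a).
Local Notation k_ := (wavenum md).

(** Off this finite set Cramer's rule applies; the points where lam^2 = k_s^2 are added because of
    the division by h_s. *)
Definition sing : set R := [set lam | ~ uniquely_solvable md (hreal md lam) star s]
  `|` [set lam | lam ^+ 2 = k_ s ^+ 2].

Lemma ks_gt0 l : (l <= nint md)%N -> 0 < k_ l. Proof. exact: wavenum_gt0. Qed.

Lemma sing_finite : finite_set sing.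
Proof.
rewrite finite_setU; split; first exact: wp.1.
apply: (@sub_finite_set _ _ [set k_ s; - k_ s]); last exact: finite_set2.
by move=> x /= /eqP; rewrite eqf_sqr => /orP[/eqP|/eqP]; [left|right].
Qed.

(** Numerator and denominator are functions of the h_t alone, so the closure property can be used
    with continuous functions of lambda, with power series at a real point, and with exponential
    sums at infinity. *)
Lemma sigma_frac : exists num den : (nat -> C) -> C,
  [/\ forall lam, ~ sing lam ->
        sg lam = num (hreal md lam) / den (hreal md lam) /\ den (hreal md lam) != 0 &
   forall (K : (R -> C) -> Prop), (forall c, K (fun=> c)) ->
     (forall f g, K f -> K g -> K (fun x => f x + g x)) ->
     (forall f g, K f -> K g -> K (fun x => f x * g x)) ->
     forall hh : R -> nat -> C, (forall t, (t <= nint md)%N -> K (hh ^~ t)) ->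
     (forall t, (0 < t < nint md)%N ->
       K (fun x => cexp (- (hh x t * ofR (iface md t.-1 - iface md t))))) ->
     K (fun x => num (hh x)) /\ K (fun x => den (hh x))].
Proof.
have [i ai] := mark_idx_ex tn a_ok.
exists (fun h => sysnum star s h i), (fun h => \det (sysmx md h) * (4 * ofR pi * h s)).
split=> [lam nsing|K Kc KD KM hh Kh Ke].
  have us : uniquely_solvable md (hreal md lam) star s.
    by apply: contrapT => H; apply: nsing; left.
  split; first by rewrite /sigma (solutionE us ai).
  rewrite mulf_neq0 ?(sysmx_det_neq0 us) // mulf_neq0 //.
    by rewrite mulf_neq0 ?pnatr_eq0 // ofR_eq0 gt_eqF ?pi_gt0.
  rewrite hrealE rsqrt_eq0 subr_eq0; apply/eqP => H; apply: nsing; by right.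
split; first exact: K_sysnum.
apply: (KM); first exact: K_sysdet.
by apply: (KM); [exact: Kc | exact: Kh].
Qed.

Lemma sigma_even lam : sg (- lam) = sg lam.
Proof.
rewrite /sigma; congr (solution md _ star s a t).
by apply/funext => l; rewrite !hrealE hkN.
Qed.

Lemma sigma_cont_frac : exists num den : R -> C, [/\ ccont num, ccont den &
  forall lam, ~ sing lam -> sg lam = num lam / den lam /\ den lam != 0].
Proof.
have [num [den [E HK]]] := sigma_frac.
have [] := HK ccont ccont_cst ccontD ccontM (hreal md).
- by move=> l _; under eq_fun do rewrite hrealE; exact: ccont_hk.
- move=> l _; apply: ccont_cexp.
  under eq_fun do rewrite hrealE -mulN1r.
  apply: ccontM; first exact: ccont_cst.
  by apply: ccontM; [exact: ccont_hk | exact: ccont_cst].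
by move=> cn cd; exists (fun l => num (hreal md l)), (fun l => den (hreal md l)).
Qed.

Lemma sigma_loc_bounded nu : ~ sing nu -> exists d M, [/\ 0 < d, 0 <= M &
  forall x, `|x - nu| < d -> ~ sing x -> cabs (sg x) <= M].
Proof.
move=> nnu; have [num [den [cn cd E]]] := sigma_cont_frac.
have [d1 [M [d10 M0 H1]]] := ccont_bound nu cn.
have [d2 [m [d20 m0 H2]]] := ccont_lower cd (E nu nnu).2.
exists (Num.min d1 d2), (M / m); split; first by rewrite lt_min d10.
  by rewrite divr_ge0 // ltW.
move=> x; rewrite lt_min => /andP[xd1 xd2] nx; have [-> dx] := E x nx.
rewrite cabsM cabsV ler_pM ?invr_ge0 ?cabs_ge0 ?H1 //.
by rewrite lef_pV2 ?posrE ?cabs_gt0 ?H2.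
Qed.

Lemma residueP nu e : 0 < e -> exists2 d, 0 < d & forall x, 0 < `|x - nu| < d ->
  cabs (ofR (x - nu) * sg x - residue sg nu) < e.
Proof.
move=> e0; have [po _ _ _] := wp.2 star t a star_ok tn a_ok.
have /ccvgP/(_ e e0) : ofR (x - nu) * sg x @[x --> nu^'] --> residue sg nu by exact: (po nu).
move=> /nbhs_ballP[d d0 H]; exists d => // x /andP[x0 xd].
rewrite cabs_distC; apply: H; first by rewrite /ball /= distrC.
by apply/eqP => xnu; move: x0; rewrite xnu subrr normr0 ltxx.
Qed.

(** On each side of nu, with lambda = nu + x^2 or nu - x^2, sigma is a quotient of power series in
    x, and (lambda - nu) sigma converges by well-posedness. The rate O(x) of [germ_quotient_lim] is
    a square root of |lambda - nu|. *)
Lemma sigma_loc nu : exists d K, [/\ 0 < d, 0 <= K & forall x, 0 < `|x - nu| < d ->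
  cabs (sg x - residue sg nu / ofR (x - nu)) <= K / Num.sqrt `|x - nu|].
Proof.
have [num [den [E HK]]] := sigma_frac.
pose pt (up : bool) (x : R) := if up then nu + x ^+ 2 else nu - x ^+ 2.
have side (up : bool) : exists d K, [/\ 0 < d, 0 <= K & forall x, 0 < x < d ->
    cabs (ofR (pt up x - nu) * sg (pt up x) - residue sg nu) <= K * x].
  pose y := pt up.
  have yE x : ofR (y x - nu) = (if up then 1 else -1) * ofR x ^+ 2.
    rewrite -ofRX /y /pt; case: (up); rewrite ?mul1r ?mulN1r -?ofRN; congr ofR; ring.
  have ny x : `|y x - nu| = x ^+ 2.
    rewrite /y /pt; case: (up); rewrite addrC addKr ?normrN ger0_norm ?sqr_ge0 //.
  have [gn gd] := HK (@germ R) (@germ_cst R) (@germD R) (@germM R) (fun x => hreal md (y x))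
    (fun l ln => eq_ind_r _ (germ_hk_at nu up (ks_gt0 ln)) (funext (fun x => hrealE md (y x) l)))
    (fun l ln => eq_ind_r _ (germ_cexp (germN (germM (germ_hk_at nu up (ks_gt0 (ltnW (andP
      ln).2)))
       (germ_cst (ofR (iface md l.-1 - iface md l)))))) (funext (fun x =>
        congr1 (fun h => cexp (- (h * ofR (iface md l.-1 - iface md l)))) (hrealE md (y x) l)))).
  have [d d0 Hd] := finite_isolated nu sing_finite.
  have ysing : near0 (fun x => ~ sing (y x)).
    exists (Num.min 1 (d / 2)); first by rewrite lt_min ltr01 divr_gt0.
    move=> x /andP[x0]; rewrite le_min => /andP[x1 xd] ys.
    have := Hd _ ys; rewrite -subr_eq0 -normr_eq0 ny expf_eq0 /= gt_eqF // => /(_ isT).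
    by apply/negP; rewrite -ltNge expr2; nra.
  have dn0 : near0 (fun x => den (hreal md (y x)) != 0).
    by apply: near0_imp ysing => x /E[].
  pose l := (if up then 1 else -1) * residue sg nu.
  have lim e : 0 < e -> near0 (fun x => cabs (ofR x ^+ 2 * (num (hreal md (y x)) / den (hreal md
    (y x))) - l) < e).
    move=> e0; have [d2 d20 Hd2] := residueP nu e0.
    have m0 : 0 < Num.min 1 (d2 / 2) by rewrite lt_min ltr01 divr_gt0.
    have [r r0 Hr] := ysing.
    exists (Num.min r (Num.min 1 (d2 / 2))); first by rewrite lt_min r0.
    move=> x /andP[x0]; rewrite !le_min => /and3P[xr x1 xd].
    have [<- _] := E _ (Hr x (introT andP (conj x0 xr))).
    have : 0 < `|y x - nu| < d2 by rewrite ny exprn_gt0 //= expr2; nra.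
    move=> /Hd2; rewrite yE; apply: le_lt_trans.
    rewrite /l; case: (up); rewrite ?mul1r // !mulN1r mulNr -[X in _ <= cabs X]opprK cabsN opprD
      !opprK //.
  have [K K0 [r r0 HKr]] := germ_quotient_lim gn gd dn0 lim.
  have [r2 r20 Hr2] := ysing.
  exists (Num.min r r2), K; split; rewrite ?lt_min ?r0 // => x /andP[x0].
  rewrite lt_min => /andP[/ltW xr /ltW xr2].
  rewrite -/y yE.
  have := HKr x (introT andP (conj x0 xr)).
  have [<- _] := E _ (Hr2 x (introT andP (conj x0 xr2))).
  apply: le_trans; rewrite /l; case: (up); rewrite ?mul1r // !mulN1r mulNr.
  by rewrite -[X in cabs X <= _]opprK cabsN opprD !opprK.
have [d1 [K1 [d10 K10 H1]]] := side true.
have [d2 [K2 [d20 K20 H2]]] := side false.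
have dd : 0 < Num.min d1 d2 by rewrite lt_min d10.
exists (Num.min d1 d2 ^+ 2), (K1 + K2); split; rewrite ?exprn_gt0 ?addr_ge0 //.
move=> x /andP[x0 xd].
pose xi := Num.sqrt `|x - nu|.
have xi0 : 0 < xi by rewrite sqrtr_gt0.
have xi2 : xi ^+ 2 = `|x - nu| by rewrite sqr_sqrtr.
have xid : xi < Num.min d1 d2.
  by rewrite -(@ltr_pXn2r _ 2) ?nnegrE ?(ltW xi0) ?(ltW dd) // xi2.
have xnu : ofR (x - nu) != 0 by rewrite ofR_eq0 -normr_eq0 gt_eqF.
suff H : cabs (ofR (x - nu) * sg x - residue sg nu) <= (K1 + K2) * xi.
  rewrite -/xi (_ : sg x - _ = (ofR (x - nu) * sg x - residue sg nu) / ofR (x - nu)); last first.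
    by rewrite mulrBl mulrAC mulfV // mul1r.
  rewrite cabsM cabsV cabs_ofR -xi2 ler_pdivrMr ?exprn_gt0 //.
  by rewrite expr2 mulrA divfK ?gt_eqF.
move: xid; rewrite lt_min => /andP[xi1 xi2'].
have [xn|xn|xn] := ltgtP x nu; last by move: xnu; rewrite xn subrr ofR0 eqxx.
- have := H2 xi; rewrite xi0 xi2' => /(_ isT); rewrite /pt /= xi2 ltr0_norm ?subr_lt0 //.
  rewrite (_ : nu - - (x - nu) = x); last by ring.
  by move=> H; apply: le_trans H _; rewrite ler_pM2r // lerDr.
- have := H1 xi; rewrite xi0 xi1 => /(_ isT); rewrite /pt /= xi2 gtr0_norm ?subr_gt0 //.
  rewrite (_ : nu + (x - nu) = x); last by ring.
  by move=> H; apply: le_trans H _; rewrite ler_pM2r // lerDl.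
Qed.

Lemma residue_nsing nu : ~ sing nu -> residue sg nu = 0.
Proof.
move=> nnu; have [d [M [d0 M0 HM]]] := sigma_loc_bounded nnu.
have [d2 d20 Hd2] := finite_isolated nu sing_finite.
apply/eqP; rewrite -cabs_eq0 eq_le cabs_ge0 andbT leNgt; apply/negP => r0.
have r2 : 0 < cabs (residue sg nu) / 2 by rewrite divr_gt0.
have [d3 d30 Hd3] := residueP nu r2.
pose e := Num.min (Num.min d d2) (Num.min d3 (cabs (residue sg nu) / (2 * (M + 1)))) / 2.
have m0 : 0 < Num.min (Num.min d d2) (Num.min d3 (cabs (residue sg nu) / (2 * (M + 1)))).
  by rewrite !lt_min d0 d20 d30 divr_gt0 // mulr_gt0 //; lra.
have e0 : 0 < e by rewrite divr_gt0.
have em : e < Num.min (Num.min d d2) (Num.min d3 (cabs (residue sg nu) / (2 * (M + 1)))).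
  by rewrite /e; lra.
move: em; rewrite !lt_min => /andP[/andP[ed ed2] /andP[ed3 eM]].
have ne : `|(nu + e) - nu| = e by rewrite addrC addKr gtr0_norm.
have ns : ~ sing (nu + e).
  move=> /Hd2; rewrite ne => H; have : d2 <= e by apply: H; rewrite -subr_eq0 addrC addKr gt_eqF.
  by rewrite leNgt ed2.
have := HM (nu + e); rewrite ne => /(_ ed ns) h1.
have := Hd3 (nu + e); rewrite ne e0 ed3 => /(_ isT) h2.
have := cabsB (ofR (nu + e - nu) * sg (nu + e)) (ofR (nu + e - nu) * sg (nu + e) - residue sg nu).
rewrite subKr cabsM cabs_ofR ne.
have : e * (M + 1) < cabs (residue sg nu) / 2.
  by move: eM; rewrite ltr_pdivlMr; last (rewrite mulr_gt0 //; lra); lra.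
by nra.
Qed.

Lemma poles_sing : real_poles sg `<=` sing.
Proof. by move=> nu /eqP nu0; apply: contrapT => /residue_nsing. Qed.

Lemma poles_finite : finite_set (real_poles sg).
Proof. exact: sub_finite_set poles_sing sing_finite. Qed.

(** Off the finite set [sing], sigma is a quotient of continuous functions; a finite set does not
    affect measurability. *)
Lemma sigma_measurable : measurable_fun setT (fun x => re (sg x)) /\
  measurable_fun setT (fun x => im (sg x)).
Proof.
have [num [den [cn cd E]]] := sigma_cont_frac.
have mF (F : set R) : finite_set F -> measurable F.
  by move=> fF; apply: countable_measurable => [x|];
    [exact: measurable_set1 | exact: finite_set_countable].
have msing := mF _ sing_finite.
have mod_fin (f g : R -> R) : measurable_fun setT g -> (forall x, ~ sing x -> f x = g x) ->
    measurable_fun setT f.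
  move=> mg fg _ B mB; rewrite setTI.
  have -> : f @^-1` B = (g @^-1` B `&` ~` sing) `|` (f @^-1` B `&` sing).
    apply/seteqP; split=> x /=.
      by move=> fB; have [sx|sx] := pselect (sing x); [right|left]; rewrite -?fg.
    by move=> [[gB /fg ->]|[]].
  apply: measurableU.
    apply: measurableI; last exact: measurableC.
    by rewrite -[X in measurable X]setTI; exact: mg.
  by apply: mF; apply: sub_finite_set sing_finite; exact: subIsetr.
have mre f : ccont f -> measurable_fun setT (fun x => re (f x)).
  by move=> [c _]; exact: continuous_measurable_fun.
have mim f : ccont f -> measurable_fun setT (fun x => im (f x)).
  by move=> [_ c]; exact: continuous_measurable_fun.
pose n2 x := re (den x) ^+ 2 + im (den x) ^+ 2.
have mn2V : measurable_fun setT (fun x => (n2 x)^-1).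
  rewrite (_ : (fun x => _) = (fun x => n2 x `^ (-1))); last first.
    by apply/funext => x; rewrite powR_inv1 // addr_ge0 ?sqr_ge0.
  apply: (measurableT_comp (measurable_powR (-1))).
  by apply: measurable_funD; apply: measurable_funX; [exact: mre | exact: mim].
have divE x : ~ sing x -> sg x = cpx
   ((re (num x) * re (den x) + im (num x) * im (den x)) * (n2 x)^-1)
   ((im (num x) * re (den x) - re (num x) * im (den x)) * (n2 x)^-1).
  move=> /E[-> _]; rewrite /n2; case: (num x) => p q; case: (den x) => u v.
  by apply: cx_ext => /=; ring.
split.
- apply: (mod_fin _ (fun x => (re (num x) * re (den x) + im (num x) * im (den x)) * (n2 x)^-1)).
    apply: measurable_funM => //; apply: measurable_funD; apply: measurable_funM;
    by [exact: mre | exact: mim].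
  by move=> x /divE ->.
- apply: (mod_fin _ (fun x => (im (num x) * re (den x) - re (num x) * im (den x)) * (n2 x)^-1)).
    apply: measurable_funM => //; apply: measurable_funB; apply: measurable_funM;
    by [exact: mre | exact: mim].
  by move=> x /divE ->.
Qed.

End SigmaAnalysis.

(** * Integrals across real poles *)

Section Integration.
Local Open Scope classical_set_scope.
Variable R : realType.
Local Notation C := (CC R).
Local Notation mu := (@lebesgue_measure R).
Local Notation MR := (measurableTypeR R).
Implicit Types (D : set MR) (f g : R -> R).

Definition mf f : Prop := measurable_fun [set: MR] (f : MR -> R).
Definition itg D f : Prop := mu.-integrable D (EFin \o f).

Lemma mfS D f : mf f -> measurable_fun D f.
Proof. by move=> h; apply: measurable_funTS. Qed.

Lemma itg_le D f g : measurable D -> mf f -> itg D g ->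
  (forall x, D x -> `|f x| <= g x) -> itg D f.
Proof.
move=> mD mff ig fg; apply: le_integrable ig => //.
  by apply/measurable_EFinP; exact: mfS.
by move=> x Dx; rewrite /= lee_fin (le_trans (fg x Dx)) // ler_norm.
Qed.

Lemma itgS D E f : measurable D -> measurable E -> D `<=` E -> itg E f -> itg D f.
Proof. by move=> mD mE DE; exact: integrableS. Qed.

Lemma itgD D f g : measurable D -> itg D f -> itg D g -> itg D (fun x => f x + g x).
Proof.
move=> mD fi gi; rewrite /itg.
rewrite (_ : EFin \o _ = (EFin \o f) \+ (EFin \o g))%E; last by apply/funext.
exact: integrableD.
Qed.

Lemma itgZ D f c : measurable D -> itg D f -> itg D (fun x => c * f x).
Proof.
move=> mD fi; rewrite /itg.
rewrite (_ : EFin \o _ = (fun x => c%:E * (EFin \o f) x)%E); last by apply/funext.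
exact: integrableZl.
Qed.

Lemma itgU A B f : measurable A -> measurable B -> mf f -> itg A f -> itg B f ->
  itg (A `|` B) f.
Proof.
move=> mA mB mff fA fB.
have mAB : measurable (B `\` A) by exact: measurableD.
have fBA : itg (B `\` A) f by apply: itgS fB => //; exact: subDsetl.
apply/integrableP; split; first by apply/measurable_EFinP; exact: mfS.
rewrite -(setDUK (@subsetUl _ A B)) setDUl setDv set0U.
rewrite ge0_integral_setU //; last first.
- by rewrite disj_set2E setDE setICA setICr setI0.
- apply: measurableT_comp => //; apply/measurable_EFinP; exact: mfS.
by apply: lte_add_pinfty; [case/integrableP: fA | case/integrableP: fBA].
Qed.

Lemma finite_null (F : set MR) : finite_set F -> measurable F /\ mu F = 0%E.
Proof.
move=> fF; have cF : countable F by exact: finite_set_countable.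
split; first by apply: countable_measurable => [x|] //; exact: measurable_set1.
exact: countable_lebesgue_measure0.
Qed.

Lemma itg_le_ae D F f g : measurable D -> finite_set F -> mf f -> itg D g ->
  (forall x, D x -> ~ F x -> `|f x| <= g x) ->
  itg D f /\ `|\int[mu]_(x in D) f x| <= \int[mu]_(x in D) g x.
Proof.
move=> mD /finite_null[mF F0] mff ig fg.
have mDF : measurable (D `\` F) by exact: measurableD.
have igF : itg (D `\` F) g by apply: itgS ig => //; exact: subDsetl.
have ifF : itg (D `\` F) f by apply: itg_le igF _ => // x [Dx nF]; exact: fg.
have fi : itg D f.
  have mfD' : measurable_fun D (EFin \o f) by apply/measurable_EFinP; exact: mfS.
  by have [_ H] := @negligible_integrable _ MR R mu D F (EFin \o f) mF mD mfD' F0; exact: H.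
split=> //.
rewrite /Rintegral (negligible_integral mF mD fi F0) (negligible_integral mF mD ig F0).
rewrite -/(Rintegral mu (D `\` F) f) -/(Rintegral mu (D `\` F) g).
rewrite (le_trans (le_normr_Rintegral mDF ifF)) // le_Rintegral //.
  by apply: itg_le igF _ => // [|x [Dx nF]]; [exact: measurableT_comp | rewrite normr_id fg].
by move=> x [Dx nF]; exact: fg.
Qed.

Lemma mfD f g : mf f -> mf g -> mf (fun x => f x + g x).
Proof. exact: measurable_funD. Qed.
Lemma mfM f g : mf f -> mf g -> mf (fun x => f x * g x).
Proof. exact: measurable_funM. Qed.
Lemma mfN f : mf f -> mf (fun x => - f x).
Proof. by move=> h; apply: measurableT_comp. Qed.

Lemma mf_reflect (a : R) : mf (fun x => a - x).
Proof. by apply: measurable_funB => //; exact: measurable_cst. Qed.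

(** The preimage of ]p, q] is an interval of the same length, and this characterizes the measure. *)
Lemma lebesgue_reflect (a : R) (A : set MR) : measurable A ->
  mu A = mu ((fun x : R => a - x) @^-1` A).
Proof.
move=> mA.
have mr : measurable_fun [set: MR] (fun x : MR => (a - x : MR)) := mf_reflect a.
have H := @lebesgue_measure_unique R (measure_function_pushforward__canonical__measure_function_Measure mu mr).
apply: H => //= X [[p q] /= pq <-]; rewrite /pushforward.
have -> : (fun x : R => a - x) @^-1` `]p, q] = `[a - q, a - p[%classic.
  by apply/seteqP; split=> x /=; rewrite !in_itv /= => /andP[]; lra.
rewrite !lebesgue_measure_itv /= !lte_fin ltrD2l ltrN2.
by case: ifP => // _; rewrite -!EFinD; congr (_%:E); ring.
Qed.

Lemma integral_reflect (a : R) D f : measurable D -> mf f ->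
  itg ((fun x => a - x) @^-1` D) (fun x => f (a - x)) ->
  itg D f /\ \int[mu]_(x in D) f x = \int[mu]_(x in (fun x => a - x) @^-1` D) f (a - x).
Proof.
move=> mD mff fi.
have mr : measurable_fun [set: MR] (fun x : MR => (a - x : MR)) := mf_reflect a.
have mfE : measurable_fun [set: MR] (EFin \o (f : MR -> R)) by apply/measurable_EFinP.
have E (h : MR -> \bar R) : (\int[pushforward mu (fun x : MR => ((a - x)%R : MR))]_(x in D) h x
  = \int[mu]_(x in D) h x)%E.
  apply: (@eq_measure_integral _ MR R D mu
    (measure_function_pushforward__canonical__measure_function_Measure mu mr) h) => A mA _.
  by rewrite [RHS](lebesgue_reflect a mA).
have pi := integrable_pushforward mr mfE fi mD.
have fD : itg D f.
  have /integrableP[m1 m2] := pi; apply/integrableP; split => //.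
  by rewrite -E.
split=> //; rewrite /Rintegral -E.
by rewrite (integral_pushforward mr mfE fi mD).
Qed.

Lemma mfV f : mf f -> mf (fun x => (f x)^-1).
Proof.
move=> h; rewrite (_ : (fun x => _) = (fun x => f x * (f x ^+ 2) `^ (-1))).
  apply: mfM => //; apply: (measurableT_comp (measurable_powR (-1))).
  exact: measurable_funX.
apply/funext => x; rewrite powR_inv1 ?sqr_ge0 //.
have [->|f0] := eqVneq (f x) 0; first by rewrite invr0 mul0r.
by field.
Qed.

Lemma mf_cont f : continuous f -> mf f.
Proof. exact: continuous_measurable_fun. Qed.

Lemma cvg_int_itv f a : mf f -> itg `[a, +oo[ f ->
  (fun n => \int[mu]_(x in `[a, a + n%:R]) f x) @ \oo --> \int[mu]_(x in `[a, +oo[) f x.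
Proof.
move=> mff fi.
have E n : \int[mu]_(x in `[a, a + n%:R]) f x = \int[mu]_(x in `[a, +oo[) (f \_ `[a, a + n%:R]) x.
  rewrite -Rintegral_mkcondr; congr (Rintegral mu _ _).
  apply/seteqP; split=> x /=; rewrite !in_itv /= ?andbT; last by case=> _ /andP[-> ->].
  by move=> /andP[-> ->].
under eq_fun do rewrite E.
rewrite /Rintegral; apply: fine_cvg; rewrite fineK; last exact: integrable_fin_num fi.
apply: (@dominated_cvg _ MR R mu _ _ _ (fun x => (f x)%:E) (EFin \o (fun x => `|f x|))) => //.
- move=> n; apply/measurable_EFinP; apply: mfS; apply/(measurable_restrictT _ _).1 => //.
  exact: mfS.
- move=> x; rewrite /= in_itv /= andbT => ax; apply: cvg_EFin; first exact: nearW.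
  apply: cvg_near_cst.
  have h := archi_boundP (normr_ge0 (x - a)).
  exists (Num.bound `|x - a|) => // n /= nb; apply/esym;
    rewrite /= patchE mem_set //= in_itv /= ax /=.
  by rewrite -lerBlDl (le_trans (ler_norm _)) // (le_trans (ltW h)) // ler_nat.
- apply: le_integrable fi => //; last by move=> x _ /=; rewrite normr_id.
  by apply/measurable_EFinP; apply: mfS; exact: measurableT_comp.
- by move=> n x _ /=; rewrite lee_fin patchE; case: ifP; rewrite ?normr0.
Qed.

Lemma within_cont (A : set R) f : (forall x, A x -> {for x, continuous f}) ->
  {within A, continuous f}.
Proof. by move=> h; apply: continuous_in_subspaceT => x /set_mem; exact: h. Qed.

Lemma ftc_itv f F a b : a < b -> (forall x, a <= x <= b -> {for x, continuous f}) ->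
  (forall x, a <= x <= b -> is_derive x 1 F (f x)) ->
  itg `[a, b] f /\ \int[mu]_(x in `[a, b]) f x = F b - F a.
Proof.
move=> ab cf dF; have wf : {within `[a, b], continuous f}.
  by apply: within_cont => x /=; rewrite in_itv; exact: cf.
have cF x : a <= x <= b -> {for x, continuous F}.
  by move=> /dF[dx _]; apply: differentiable_continuous; rewrite -derivable1_diffP.
split; first by apply: continuous_compact_integrable => //; exact: segment_compact.
rewrite /Rintegral (@continuous_FTC2 R f F) //.
  split.
  - by move=> x; rewrite in_itv => /= /andP[h1 h2]; case: (dF x) => //; rewrite !ltW.
  - by apply: cvg_at_right_filter; apply: cF; rewrite lexx ltW.
  - by apply: cvg_at_left_filter; apply: cF; rewrite lexx andbT ltW.
move=> x; rewrite in_itv => /= /andP[h1 h2]; rewrite derive1E.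
by case: (dF x) => //; rewrite !ltW.
Qed.

Lemma ftc_y f F a : mf f -> itg `[a, +oo[ f ->
  (forall x, a <= x -> {for x, continuous f}) ->
  (forall x, a <= x -> is_derive x 1 F (f x)) -> F x @[x --> +oo] --> (0 : R) ->
  \int[mu]_(x in `[a, +oo[) f x = - F a.
Proof.
move=> mff fi cf dF F0.
have H := cvg_int_itv mff fi; apply: (cvg_unique _ H) => //.
have FN : (fun n : nat => F (a + n%:R)) @ \oo --> (0 : R).
  apply: (cvg_comp _ _ _ F0); apply/cvgryPge => A.
  have h := archi_boundP (normr_ge0 (A - a)).
  exists (Num.bound `|A - a|) => // n /= nb.
  by rewrite -lerBlDl (le_trans (ler_norm _)) // (le_trans (ltW h)) // ler_nat.
rewrite /= -[- F a]add0r; apply: cvg_trans (cvgB FN (cvg_cst (F a))).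
apply: near_eq_cvg; exists 1%N => // n /= n1.
have [] := @ftc_itv f F a (a + n%:R) => //.
- by rewrite ltrDl ltr0n.
- by move=> x /andP[ax _]; exact: cf.
- by move=> x /andP[ax _]; exact: dF.
Qed.

(** The integrable majorant of sigma minus its polar part, as provided by [sigma_loc]. *)
Definition isq (m x : R) : R := (Num.sqrt `|x - m|)^-1.

Lemma mf_isq m : mf (isq m).
Proof.
apply: mfV; apply: mf_cont => x; apply: continuous_comp; last exact: sqrt_continuous.
apply: continuous_comp; last exact: norm_continuous.
by apply: cvgB; [exact: cvg_id | exact: cvg_cst].
Qed.

Lemma isq_ge0 m x : 0 <= isq m x.
Proof. by rewrite invr_ge0 sqrtr_ge0. Qed.

(** Monotone convergence along [m + 1 / (n + 1), m + L], where 2 sqrt(x - m) is a primitive; L > 1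
    keeps these intervals nondegenerate. *)
Lemma itg_isq_right m L : 1 < L -> itg `]m, m + L] (isq m).
Proof.
move=> L1; pose E (n : nat) : set MR := `[m + n.+1%:R^-1, m + L]%classic.
have n1 (n : nat) : n.+1%:R^-1 <= 1 :> R by rewrite invf_le1 ?ltr0n // ler1n.
have np (n : nat) : 0 < n.+1%:R^-1 :> R by rewrite invr_gt0 ltr0n.
have EU : \bigcup_n E n = `]m, m + L].
  apply/seteqP; split=> x.
    move=> [n _]; rewrite /E /= !in_itv /= => /andP[h h2]; rewrite h2 andbT.
    by rewrite (lt_le_trans _ h) // ltrDl.
  rewrite /= in_itv /= => /andP[mx xL].
  have xm : 0 < x - m by rewrite subr_gt0.
  have xmV : 0 <= (x - m)^-1 by rewrite invr_ge0 ltW.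
  have h := archi_boundP xmV.
  exists (Num.bound (x - m)^-1) => //; rewrite /E /= in_itv /= xL andbT.
  rewrite -lerBrDl invf_ple ?posrE ?ltr0n // (le_trans (ltW h)) // ler_nat //.
have mE n : measurable (E n) by exact: measurable_itv.
have bnd n : (\int[mu]_(x in E n) (isq m x)%:E <= (2 * Num.sqrt L)%:E)%E.
  have ab : m + n.+1%:R^-1 < m + L by rewrite ltrD2l (le_lt_trans (n1 n)).
  have pos x : m + n.+1%:R^-1 <= x -> 0 < x - m.
    by move=> h; rewrite subr_gt0 (lt_le_trans _ h) // ltrDl.
  have [|x|i1 i2] := @ftc_itv (isq m) (fun x => 2 * Num.sqrt (x - m)) _ _ ab.
  - move=> x /andP[/pos xm _].
    have c1 : {for x, continuous (fun y : R => Num.sqrt `|y - m|)}.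
      apply: continuous_comp; last exact: sqrt_continuous.
      apply: continuous_comp; last exact: norm_continuous.
      by apply: cvgB; [exact: cvg_id | exact: cvg_cst].
    by apply: cvgV => //; rewrite gt_eqF // sqrtr_gt0 gtr0_norm.
  - move=> /andP[/pos xm _].
    have d1 : is_derive x 1 (fun y : R => y - m) 1.
      rewrite -[X in is_derive _ _ _ X]subr0.
      exact: (is_deriveB (is_derive_id x 1) (is_derive_cst m x 1)).
    have d2 := @is_derive1_comp R Num.sqrt (fun y => y - m) x _ 1 (is_derive1_sqrt xm) d1.
    have d3 := is_deriveZ 2 d2.
    apply: is_derive_eq d3 _; rewrite /isq gtr0_norm // /GRing.scale /= mulr1 invfM mulrA.
    by rewrite mulfV ?mul1r.
  rewrite -[X in (X <= _)%E](fineK (integrable_fin_num _ i1)) // lee_fin.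
  rewrite -/(Rintegral mu (E n) (isq m)) i2.
  rewrite [m + L]addrC addrK; have := sqrtr_ge0 (m + n.+1%:R^-1 - m); lra.
have nE : {homo E : a b / (a <= b)%N >-> (a <= b)%O}.
  move=> a b ab; rewrite subsetEset => x; rewrite /E /= !in_itv /= => /andP[h ->].
  by rewrite andbT (le_trans _ h) // lerD2l lef_pV2 ?posrE ?ltr0n // ler_nat ltnS.
have mfE n : measurable_fun (E n) (EFin \o isq m).
  by apply/measurable_EFinP; apply: mfS; exact: mf_isq.
have geE n x : E n x -> (0 <= (EFin \o isq m) x)%E by move=> _; rewrite lee_fin isq_ge0.
have cvE := @ge0_nondecreasing_set_cvg_integral _ MR R E (EFin \o isq m) mu nE mE mfE geE.
apply/integrableP; split; first by apply/measurable_EFinP; apply: mfS; exact: mf_isq.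
have -> : (\int[mu]_(x in `]m, (m + L)%R]) `|(EFin \o isq m) x| =
           \int[mu]_(x in \bigcup_n E n) (EFin \o isq m) x)%E.
  by rewrite EU; apply: eq_integral => x _ /=; rewrite ger0_norm // isq_ge0.
apply: (@le_lt_trans _ _ (2 * Num.sqrt L)%:E); last exact: ltry.
rewrite -(cvg_lim _ cvE) //; apply: lime_le; first exact: cvgP cvE.
by apply: nearW => n; exact: bnd.
Qed.

Lemma itg_isq m a b : itg `[a, b] (isq m).
Proof.
pose L := `|a - m| + `|b - m| + 2.
have L1 : 1 < L by rewrite /L; have := normr_ge0 (a - m); have := normr_ge0 (b - m); lra.
have ir := itg_isq_right m L1.
have mI (i : interval R) : measurable [set` i] by exact: measurable_itv.
have il : itg `[m - L, m[ (isq m).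
  suff h : itg ((fun x : R => m + m - x) @^-1` `[m - L, m[%classic) (fun x => isq m (m + m - x)).
    exact: (@integral_reflect (m + m) `[m - L, m[%classic (isq m) (mI _) (mf_isq m) h).1.
  rewrite (_ : _ @^-1` _ = `]m, m + L]); last first.
    by apply/seteqP; split=> x /=; rewrite !in_itv /= => /andP[]; lra.
  rewrite (_ : (fun x => _) = isq m) //; apply/funext => x.
  by rewrite /isq distrC; congr (Num.sqrt `|_|)^-1; ring.
have i0 : itg [set m] (isq m).
  apply/integrableP; split; first by apply/measurable_EFinP; apply: mfS; exact: mf_isq.
  by rewrite integral_set1.
have mm : mf (isq m) := mf_isq m.
have m1 : measurable ([set m] : set MR) by exact: measurable_set1.
have mU1 : measurable (`[m - L, m[%classic `|` [set m] : set MR) by exact: measurableU.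
have mU2 : measurable ((`[m - L, m[%classic `|` [set m]) `|` `]m, m + L]%classic : set MR).
  exact: measurableU.
apply: (itgS (mI _) mU2 _ (itgU mU1 (mI _) mm (itgU (mI _) m1 mm il i0) ir)).
move=> x; rewrite /= in_itv /= => /andP[ax xb].
have h1 := ler_normB (a - m) 0; have := ler_norm (b - m); have := ler_norm (- (a - m)).
rewrite normrN => h2 h3.
have [xm|xm|xm] := ltgtP x m.
- left; left => /=; rewrite in_itv /= xm andbT /L; have := normr_ge0 (b - m); lra.
- right; rewrite /= in_itv /= xm /= /L; have := normr_ge0 (a - m); lra.
- by left; right.
Qed.

End Integration.

Section ComplexIntegral.
Local Open Scope classical_set_scope.
Variable R : realType.
Local Notation C := (CC R).
Local Notation mu := (@lebesgue_measure R).
Local Notation MR := (measurableTypeR R).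
Implicit Types (D : set MR) (f g : R -> C) (c : C).

Definition cmf f : Prop := mf (fun x => re (f x)) /\ mf (fun x => im (f x)).
Definition citg D f : Prop := itg D (fun x => re (f x)) /\ itg D (fun x => im (f x)).

Lemma cmf_cst c : cmf (fun=> c).
Proof. by split; exact: measurable_cst. Qed.

Lemma cmf_ofR (h : R -> R) : mf h -> cmf (fun x => ofR (h x)).
Proof. by move=> mh; split => //=; exact: measurable_cst. Qed.

Lemma cmfD f g : cmf f -> cmf g -> cmf (fun x => f x + g x).
Proof.
move=> [f1 f2] [g1 g2]; split.
- by rewrite (_ : (fun x => _) = (fun x => re (f x) + re (g x)));
  [exact: mfD | apply/funext => x; rewrite reD].
- by rewrite (_ : (fun x => _) = (fun x => im (f x) + im (g x)));
  [exact: mfD | apply/funext => x; rewrite imD].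
Qed.

Lemma cmfN f : cmf f -> cmf (fun x => - f x).
Proof.
move=> [f1 f2]; split.
- by rewrite (_ : (fun x => _) = (fun x => - re (f x))); [exact: mfN | apply/funext => x;
  rewrite reN].
- by rewrite (_ : (fun x => _) = (fun x => - im (f x))); [exact: mfN | apply/funext => x;
  rewrite imN].
Qed.

Lemma cmfM f g : cmf f -> cmf g -> cmf (fun x => f x * g x).
Proof.
move=> [f1 f2] [g1 g2]; split.
- rewrite (_ : (fun x => _) = (fun x => re (f x) * re (g x) + - (im (f x) * im (g x)))).
    by apply: mfD; [exact: mfM | apply: mfN; exact: mfM].
  by apply/funext => x; rewrite reM.
- rewrite (_ : (fun x => _) = (fun x => re (f x) * im (g x) + im (f x) * re (g x))).
    by apply: mfD; exact: mfM.
  by apply/funext => x; rewrite imM.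
Qed.

Lemma cmf_cont f : ccont f -> cmf f.
Proof. by move=> [f1 f2]; split; exact: mf_cont. Qed.

(** The finite set [F] absorbs the points at which nothing is known about sigma; the factor 2 comes
    from the separate treatment of the two parts. *)
Lemma citg_le D (F : set MR) f (h : R -> R) : measurable D -> finite_set F -> cmf f -> itg D h ->
  (forall x, D x -> ~ F x -> cabs (f x) <= h x) ->
  citg D f /\ cabs (cint D f) <= 2 * \int[mu]_(x in D) h x.
Proof.
move=> mD fF [f1 f2] hi fh.
have [i1 b1] := itg_le_ae mD fF f1 hi (fun x Dx nF => le_trans (cabs_re _) (fh x Dx nF)).
have [i2 b2] := itg_le_ae mD fF f2 hi (fun x Dx nF => le_trans (cabs_im _) (fh x Dx nF)).
by split=> //; rewrite (le_trans (cabs_le _)) // mulr_natl mulr2n lerD.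
Qed.

Lemma citgD D f g : measurable D -> citg D f -> citg D g -> citg D (fun x => f x + g x).
Proof.
move=> mD [f1 f2] [g1 g2]; split.
- by rewrite (_ : (fun x => _) = (fun x => re (f x) + re (g x)));
  [exact: itgD | apply/funext => x; rewrite reD].
- by rewrite (_ : (fun x => _) = (fun x => im (f x) + im (g x)));
  [exact: itgD | apply/funext => x; rewrite imD].
Qed.

Lemma citgZ D c f : measurable D -> citg D f -> citg D (fun x => c * f x).
Proof.
move=> mD [f1 f2]; split.
- rewrite (_ : (fun x => _) = (fun x => re c * re (f x) + (- im c) * im (f x))).
    by apply: itgD => //; exact: itgZ.
  by apply/funext => x; rewrite reM mulNr.
- rewrite (_ : (fun x => _) = (fun x => re c * im (f x) + im c * re (f x))).
    by apply: itgD => //; exact: itgZ.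
  by apply/funext => x; rewrite imM.
Qed.

Lemma cintD D f g : measurable D -> citg D f -> citg D g ->
  cint D (fun x => f x + g x) = cint D f + cint D g.
Proof.
move=> mD [f1 f2] [g1 g2]; apply: cx_ext; rewrite ?reD ?imD /=.
- by under eq_Rintegral do rewrite reD; rewrite RintegralD.
- by under eq_Rintegral do rewrite imD; rewrite RintegralD.
Qed.

Lemma cintZ D c f : measurable D -> citg D f ->
  cint D (fun x => c * f x) = c * cint D f.
Proof.
move=> mD [f1 f2]; apply: cx_ext; rewrite ?reM ?imM /=.
- under eq_Rintegral do rewrite reM -mulNr.
  by rewrite RintegralD ?RintegralZl ?mulNr //; exact: itgZ.
- under eq_Rintegral do rewrite imM.
  by rewrite RintegralD ?RintegralZl //; exact: itgZ.
Qed.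

Lemma eq_cint D f g : (forall x, D x -> f x = g x) -> cint D f = cint D g.
Proof.
by move=> fg; congr cpx; apply: eq_Rintegral => x /set_mem Dx; rewrite fg.
Qed.

Lemma citgU A B f : measurable A -> measurable B -> cmf f -> citg A f -> citg B f ->
  citg (A `|` B) f.
Proof. by move=> mA mB [m1 m2] [f1 f2] [g1 g2]; split; exact: itgU. Qed.

Lemma cintU A B f : measurable A -> measurable B -> cmf f -> citg A f -> citg B f ->
  A `&` B = set0 -> cint (A `|` B) f = cint A f + cint B f.
Proof.
move=> mA mB mff fA fB AB; have [i1 i2] := citgU mA mB mff fA fB.
have dAB : [disjoint A & B] by rewrite disj_set2E AB.
by apply: cx_ext; rewrite ?reD ?imD /= Rintegral_setU.
Qed.

Lemma cint_reflect (a : R) D f : measurable D -> cmf f ->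
  citg ((fun x => a - x) @^-1` D) (fun x => f (a - x)) ->
  citg D f /\ cint D f = cint ((fun x => a - x) @^-1` D) (fun x => f (a - x)).
Proof.
move=> mD [m1 m2] [i1 i2].
have [j1 e1] := integral_reflect mD m1 i1; have [j2 e2] := integral_reflect mD m2 i2.
by split=> //; rewrite /cint e1 e2.
Qed.

Lemma itg_cst (a b k : R) : itg `[a, b] (fun=> k).
Proof.
apply: continuous_compact_integrable; first exact: segment_compact.
by apply: within_cont => x _; exact: cvg_cst.
Qed.

Lemma itv_setE (a b : R) : [set x | a <= x <= b] = `[a, b]%classic.
Proof. by apply/seteqP; split=> x /=; rewrite in_itv. Qed.

Lemma mf_sub (nu : R) : mf (fun x => x - nu).
Proof. by apply: measurable_funB => //; exact: measurable_cst. Qed.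

Lemma cmf_pole c (nu : R) : cmf (fun x => c / ofR (x - nu)).
Proof.
apply: cmfM; first exact: cmf_cst.
under eq_fun do rewrite -ofRV.
by apply: cmf_ofR; apply: mfV; exact: mf_sub.
Qed.

Lemma m_ge (h : R -> R) (k : R) : mf h -> measurable ([set x | k <= h x] : set MR).
Proof.
move=> mh; rewrite (_ : [set x | k <= h x] = setT `&` h @^-1` `[k, +oo[%classic).
  by apply: mh => //; exact: measurable_itv.
by apply/seteqP; split=> x /=; rewrite in_itv /= andbT // => -[].
Qed.

Lemma m_gt (h : R -> R) (k : R) : mf h -> measurable ([set x | k < h x] : set MR).
Proof.
move=> mh; rewrite (_ : [set x | k < h x] = setT `&` h @^-1` `]k, +oo[%classic).
  by apply: mh => //; exact: measurable_itv.
by apply/seteqP; split=> x /=; rewrite in_itv /= andbT // => -[].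
Qed.

Lemma mf_dist (nu : R) : mf (fun x => `|x - nu|).
Proof. by apply: measurableT_comp => //; exact: mf_sub. Qed.

Lemma mf_dist_itv (nu r eta : R) :
  measurable ([set x | nu - r <= x <= nu + r /\ eta <= `|x - nu|] : set MR).
Proof.
rewrite (_ : [set x | _] = `[nu - r, nu + r]%classic `&` [set x | eta <= `|x - nu|]).
  by apply: measurableI; [exact: measurable_itv | apply: m_ge; exact: mf_dist].
by apply/seteqP; split=> x /=; rewrite in_itv.
Qed.

(** The integrand is odd about nu and the truncated domain is symmetric, so the integrals vanish
    already before the limit. *)
Lemma pv_pole c (nu r : R) : pv (nu - r) (nu + r) nu (fun x => c / ofR (x - nu)) = 0.
Proof.
apply: cvg_lim => //.
have H eta : 0 < eta -> cint [set x | nu - r <= x <= nu + r /\ eta <= `|x - nu|]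
    (fun x => c / ofR (x - nu)) = 0.
  move=> e0; set D := [set x | _]; have mD : measurable (D : set MR) by exact: mf_dist_itv.
  have rD : (fun x => (nu + nu) - x) @^-1` D = D.
    have rx (x : R) : nu + nu - x - nu = - (x - nu) by ring.
    rewrite predeqE => x; rewrite /D /preimage /= rx normrN.
    by split=> -[/andP[h1 h2] h3]; split=> //; apply/andP; split; lra.
  have Di : D `<=` `[nu - r, nu + r]%classic by move=> x [h _]; rewrite /= in_itv.
  have [x [_ h] _|iD _] := citg_le mD (finite_set0 _) (cmf_pole c nu)
    (itgS mD (measurable_itv _) Di (itg_cst _ _ (cabs c / eta))).
    rewrite cabsM cabsV cabs_ofR ler_wpM2l ?cabs_ge0 // lef_pV2 ?posrE //.
    exact: lt_le_trans h.
  have E x : c / ofR (nu + nu - x - nu) = -1 * (c / ofR (x - nu)).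
    by rewrite (_ : nu + nu - x - nu = - (x - nu)); [rewrite ofRN invrN mulrN mulN1r | ring].
  have [|_] := @cint_reflect (nu + nu) D _ mD (cmf_pole c nu).
    by rewrite rD; under eq_fun do rewrite E; exact: citgZ.
  rewrite rD; under [RHS]eq_cint do rewrite E.
  rewrite (@cintZ D (-1) _ mD iD) mulN1r => /eqP; rewrite -addr_eq0 -mulr2n mulrn_eq0 /= => /eqP
    //.
apply: (@cvg_trans _ ((fun=> (0 : C)) @ (0 : R)^'+)); last exact: cvg_cst.
apply: near_eq_cvg; near=> eta.
by rewrite H //; near: eta; exact: nbhs_right_gt.
Unshelve. all: by end_near. Qed.

End ComplexIntegral.

Section FiniteFunctional.
Local Open Scope classical_set_scope.
Variable R : realType.
Local Notation C := (CC R).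
Local Notation mu := (@lebesgue_measure R).
Local Notation MR := (measurableTypeR R).

Definition isq_bounded (m : R) (f : R -> C) : Prop :=
  exists d K, [/\ 0 < d, 0 <= K & forall x, 0 < `|x - m| < d -> cabs (f x) <= K * isq m x].

Lemma isq_boundedD m f g : isq_bounded m f -> isq_bounded m g ->
  isq_bounded m (fun x => f x + g x).
Proof.
move=> [d [K [d0 K0 H]]] [d' [K' [d0' K0' H']]]; exists (Num.min d d'), (K + K').
split; [by rewrite lt_min d0 | exact: addr_ge0 |] => x; rewrite lt_min => /and3P[x0 x1 x2].
by rewrite (le_trans (cabsD _ _)) // mulrDl lerD ?H ?H' ?x0.
Qed.

Lemma isq_bounded_pole m nu c : m != nu -> isq_bounded m (fun x => c / ofR (x - nu)).
Proof.
move=> mn; have p0 : 0 < `|m - nu| by rewrite normr_gt0 subr_eq0.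
exists (Num.min 1 (`|m - nu| / 2)), (cabs c / (`|m - nu| / 2)); split.
- by rewrite lt_min ltr01 divr_gt0.
- by rewrite divr_ge0 ?cabs_ge0 // divr_ge0.
move=> x; rewrite lt_min => /and3P[x0 x1 x2].
have s1 : 1 <= isq m x.
  by rewrite /isq invf_ge1 ?sqrtr_gt0 // -[leRHS]sqrtr1 ler_wsqrtr // ltW.
have h : `|m - nu| / 2 <= `|x - nu|.
  have := ler_normD (m - x) (x - nu); rewrite addrA subrK (distrC m x); lra.
rewrite cabsM cabsV cabs_ofR -[leLHS]mulr1 ler_pM ?divr_ge0 ?cabs_ge0 //.
by rewrite ler_wpM2l ?cabs_ge0 // lef_pV2 ?posrE ?divr_gt0 //; apply: lt_le_trans h;
  rewrite divr_gt0.
Qed.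

Lemma itg_sum (a b : R) (I : Type) (l : seq I) (h : I -> R -> R) :
  (forall i, itg `[a, b] (h i)) -> itg `[a, b] (fun x => \sum_(i <- l) h i x).
Proof.
move=> hi; elim: l => [|i l IH].
  rewrite (_ : (fun x => _) = fun=> 0); [exact: itg_cst | by apply/funext => x; rewrite big_nil].
rewrite (_ : (fun x => _) = fun x => h i x + \sum_(j <- l) h j x).
  by apply: itgD; [exact: measurable_itv | exact: hi | exact: IH].
by apply/funext => x; rewrite big_cons.
Qed.

(** By compactness finitely many neighbourhoods suffice. [W] is the sum of their majorants and [F]
    the set of their centers, where the local bounds say nothing. *)
Lemma isq_bounded_cover f (a b : R) : (forall m, isq_bounded m f) ->
  exists (F : set R) (W : R -> R), [/\ finite_set F, itg `[a, b] W, forall x, 0 <= W x &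
    forall x, a <= x <= b -> ~ F x -> cabs (f x) <= W x].
Proof.
move=> H.
have /choice[d Hd] : forall m, exists d, exists K, [/\ 0 < d, 0 <= K &
  forall x, 0 < `|x - m| < d -> cabs (f x) <= K * isq m x] by exact: H.
have {Hd}/choice[K HK] := Hd.
have := @segment_compact R a b; rewrite compact_cover.
move=> /(_ R setT (fun m => ball m (d m))) [].
- by move=> m _; apply: ball_open; have [] := HK m.
- by move=> x _; exists x => //; apply: ballxx; have [] := HK x.
move=> D _ cD; exists [set` D], (fun x => \sum_(m <- finmap.enum_fset D) K m * isq m x); split.
- exact: finite_fset.
- by apply: itg_sum => m; apply: itgZ; [exact: measurable_itv | exact: itg_isq].
- by move=> x; apply: sumr_ge0 => m _; rewrite mulr_ge0 ?isq_ge0 //; have [] := HK m.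
move=> x xab nx; have [|m mD xm] := cD x; first by rewrite /= in_itv.
rewrite (big_rem m) //= -[leLHS]addr0 lerD //.
  have [_ _] := HK m; apply; rewrite distrC xm andbT normr_gt0 subr_eq0.
  by apply: contra_not_neq nx => <-.
by apply: sumr_ge0 => m' _; rewrite mulr_ge0 ?isq_ge0 //; have [] := HK m'.
Qed.

(** The radius is picked by [xget], so one witness is enough: a quarter of the least distance
    between two points, capped by 1. *)
Lemma sep_radiusP (S : set R) : finite_set S -> 0 < sep_radius S /\
  forall nu mu, S nu -> S mu -> nu != mu -> 2 * sep_radius S < `|nu - mu|.
Proof.
move=> fS; apply: (@xgetPex _ 1 [set r | 0 < r /\
    forall nu mu, S nu -> S mu -> nu != mu -> 2 * r < `|nu - mu|]).
have /finite_fsetP[X ->] := fS; pose l := finmap.enum_fset X.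
have [e e0 He] : exists2 e : R, 0 < e & forall x y, x \in l -> y \in l -> x != y -> e < `|x - y|.
  exists (\big[Num.min/1]_(p <- [seq (x, y) | x <- l, y <- l] | p.1 != p.2) `|p.1 - p.2| / 2).
    rewrite divr_gt0 //; elim/big_ind: _ => // [x y x0 y0|p pp]; first by rewrite lt_min x0.
    by rewrite normr_gt0 subr_eq0.
  move=> x y xl yl xy; have xy0 : 0 < `|x - y| by rewrite normr_gt0 subr_eq0.
  apply: (@le_lt_trans _ _ (`|x - y| / 2)); last by lra.
  rewrite ler_pM2r ?invr_gt0 //.
  have : (x, y) \in [seq (x, y) | x <- l, y <- l] by apply/allpairsP; exists (x, y).
  elim: [seq _ | _ <- _, _ <- _] => // p s IH; rewrite in_cons big_cons => /orP[/eqP <-|ps] /=.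
    by rewrite xy ge_min lexx.
  by case: ifP => _; rewrite ?ge_min IH ?orbT.
exists (e / 2); split; first by rewrite divr_gt0.
by move=> nu mu hn hm nm; rewrite mulrC divfK //; exact: He.
Qed.

End FiniteFunctional.

Lemma Rintegral_subset (R : realType) (D E : set (measurableTypeR R)) (f : R -> R) :
  measurable D -> measurable E -> (D `<=` E)%classic -> itg E f -> (forall x, 0 <= f x) ->
  \int[@lebesgue_measure R]_(x in D) f x <= \int[@lebesgue_measure R]_(x in E) f x.
Proof.
move=> mD mE DE fi f0.
have mED : measurable (E `\` D)%classic by exact: measurableD.
have EU : (E = D `|` (E `\` D))%classic by rewrite setDUK.
rewrite [in leRHS]EU Rintegral_setU //.
- by rewrite lerDl; apply: Rintegral_ge0 => x _.
- by rewrite -EU.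
- by rewrite disj_set2E setDIK.
Qed.

(** * The integral across real poles as a functional on Hoelder continuous integrands *)

Section RealIntegral.
Local Open Scope classical_set_scope.
Variable R : realType.
Local Notation C := (CC R).
Local Notation mu := (@lebesgue_measure R).
Local Notation MR := (measurableTypeR R).
Variables (sg : R -> C) (side : R -> bool) (La : R).
Local Notation S := (real_poles sg).
Local Notation l := (finmap.enum_fset (fset_set S)).
Local Notation r := (sep_radius S).
Local Notation res := (residue sg).
Hypotheses (msg : cmf sg) (fS : finite_set S).
Hypothesis loc : forall m, isq_bounded m (fun x => sg x - res m / ofR (x - m)).
Hypothesis La0 : 0 < La.
Hypothesis hLa : forall nu, S nu -> `|nu| + r < La.

Lemma polesP nu : (nu \in l) = (nu \in S).
Proof. by rewrite -[LHS]/(nu \in fset_set S) in_fset_set. Qed.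

Lemma poles_uniq : uniq l.
Proof. exact: finmap.fset_uniq. Qed.

Lemma isq_bounded_ext m (f g : R -> C) : (forall x, f x = g x) -> isq_bounded m f ->
  isq_bounded m g.
Proof. by move=> /funext ->. Qed.

Lemma isq_bounded_sum m (s : seq R) (f : R -> R -> C) : (forall nu, nu \in s ->
  isq_bounded m (f nu)) ->
  isq_bounded m (fun x => \sum_(nu <- s) f nu x).
Proof.
elim: s => [_|nu s IH H].
  exists 1, 0; split=> // x _; rewrite big_nil mul0r cabs0 //.
apply: (@isq_bounded_ext _ (fun x => f nu x + \sum_(nu <- s) f nu x)).
  by move=> x; rewrite big_cons.
apply: isq_boundedD; first by apply: H; rewrite mem_head.
by apply: IH => nu' ns; apply: H; rewrite in_cons ns orbT.
Qed.

(** All polar parts are subtracted at once, so that a single function has integrable singularities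
    everywhere; near [m] the polar parts of the other poles are bounded. *)
Lemma regular_part m : isq_bounded m (fun x => sg x - \sum_(nu <- l) res nu / ofR (x - nu)).
Proof.
have E (s : seq R) : m \notin s ->
    isq_bounded m (fun x => - \sum_(nu <- s) res nu / ofR (x - nu)).
  move=> ms; apply: (@isq_bounded_ext _ (fun x => \sum_(nu <- s) (- res nu) / ofR (x - nu))).
    by move=> x; rewrite -sumrN; apply: eq_bigr => nu _; rewrite mulNr.
  by apply: isq_bounded_sum => nu ns; apply: isq_bounded_pole; apply: contraNneq ms => ->.
have [ml|ml] := boolP (m \in l).
  apply: (@isq_bounded_ext _ (fun x => (sg x - res m / ofR (x - m)) +
      - \sum_(nu <- rem m l) res nu / ofR (x - nu))).
    by move=> x; rewrite [in RHS](big_rem m) //= opprD addrA.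
  apply: isq_boundedD; first exact: loc.
  by apply: E; rewrite mem_rem_uniqF // poles_uniq.
have r0 : res m = 0.
  by apply: contraNeq ml => r0; rewrite polesP; apply/mem_set.
have := loc m; under eq_fun do rewrite r0 mul0r subr0.
by move=> h; apply: isq_boundedD => //; exact: E.
Qed.

(** One majorant serves for both kinds of integrand in [real_int]: outside the intervals around the
    poles all polar parts are bounded, and within the interval of one pole those of the others are,
    by the choice of the separation radius. *)
Lemma real_int_weight : exists (F : set R) (W : R -> R),
  [/\ finite_set F, itg `[-La, La] W, forall x, 0 <= W x,
    forall x, -La <= x <= La -> ~ F x -> (forall nu, S nu -> r < `|x - nu|) ->
      cabs (sg x) <= W x &
    forall x nu, S nu -> nu - r <= x <= nu + r -> ~ F x ->
      cabs (sg x - res nu / ofR (x - nu)) <= W x].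
Proof.
have [r0 rS] := sep_radiusP fS.
have [F [W [fF iW W0 HW]]] := isq_bounded_cover (-La) La regular_part.
pose k := \sum_(nu <- l) cabs (res nu) / r.
have tp x (s : seq R) : (forall nu, nu \in s -> r < `|x - nu|) ->
    cabs (\sum_(nu <- s) res nu / ofR (x - nu)) <= \sum_(nu <- s) cabs (res nu) / r.
  move=> h; rewrite (le_trans (cabs_sum _ _ _)) // big_seq [leRHS]big_seq.
  apply: ler_sum => nu ns.
  rewrite cabsM cabsV cabs_ofR ler_wpM2l ?cabs_ge0 // lef_pV2 ?posrE ?(ltW (h _ ns)) //.
  exact: lt_trans (h _ ns).
have k0 (s : seq R) : 0 <= \sum_(nu <- s) cabs (res nu) / r.
  by apply: sumr_ge0 => nu _; rewrite divr_ge0 ?cabs_ge0 ?(ltW r0).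
exists F, (fun x => W x + k); split=> //.
- by apply: itgD; [exact: measurable_itv | exact: iW | exact: itg_cst].
- by move=> x; rewrite addr_ge0 // k0.
- move=> x xL nF h; rewrite -(subrK (\sum_(nu <- l) res nu / ofR (x - nu)) (sg x)).
  rewrite (le_trans (cabsD _ _)) // lerD ?HW // tp // => nu; rewrite polesP => /set_mem; exact: h.
move=> x nu nS nux nF; have nl : nu \in l by rewrite polesP; apply/mem_set.
have -> : sg x - res nu / ofR (x - nu) = (sg x - \sum_(nu <- l) res nu / ofR (x - nu)) +
    \sum_(nu <- rem nu l) res nu / ofR (x - nu).
  by rewrite [in RHS](big_rem nu) //= opprD addrA subrK.
rewrite (le_trans (cabsD _ _)) // lerD ?HW //.
  have := hLa nS; have := ler_norm nu; have := ler_norm (- nu); rewrite normrN.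
  by move: nux => /andP[? ?] ? ? ?; apply/andP; split; lra.
apply: (@le_trans _ _ (\sum_(nu <- rem nu l) cabs (res nu) / r)); last first.
  by rewrite /k [in leRHS](big_rem nu) //= lerDr divr_ge0 ?cabs_ge0 ?(ltW r0).
apply: tp => nu' n'; have nn' : nu != nu'.
  by apply: contraTneq n' => <-; rewrite mem_rem_uniqF // poles_uniq.
have n'S : S nu' by apply/set_mem; rewrite -polesP; exact: mem_rem n'.
have := rS _ _ nS n'S nn'; have := ler_normD (nu - x) (x - nu').
rewrite addrA subrK; have : `|nu - x| <= r by rewrite ler_norml; move: nux => /andP[? ?];
  apply/andP; split; lra.
lra.
Qed.

(** [A] measures the size of the test function on [-La, La] only, with a Hoelder condition at the
    poles. The tails are merely integrable here, because their size has to be estimated with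
    oscillation. *)
Definition adm (A : R) (g : R -> C) : Prop :=
  [/\ cmf g, forall x, -La <= x <= La -> cabs (g x) <= A,
    forall x nu, -La <= x <= La -> S nu -> cabs (g x - g nu) <= A * Num.sqrt `|x - nu|,
    citg `]-oo, -La] (fun x => g x * sg x) & citg `[La, +oo[ (fun x => g x * sg x)].

Lemma admD A B f g : adm A f -> adm B g -> adm (A + B) (fun x => f x + g x).
Proof.
move=> [f1 f2 f3 f4 f5] [g1 g2 g3 g4 g5].
have E : (fun x => (f x + g x) * sg x) = (fun x => f x * sg x + g x * sg x).
  by apply/funext => x; rewrite mulrDl.
split; first exact: (cmfD f1 g1).
- by move=> x xL; rewrite (le_trans (cabsD _ _)) // lerD ?f2 ?g2.
- move=> x nu xL nS; rewrite opprD addrACA (le_trans (cabsD _ _)) // mulrDl.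
  by rewrite lerD ?f3 ?g3.
- by rewrite E; apply: citgD => //; exact: measurable_itv.
- by rewrite E; apply: citgD => //; exact: measurable_itv.
Qed.

Lemma admZ A c f : adm A f -> adm (cabs c * A) (fun x => c * f x).
Proof.
move=> [f1 f2 f3 f4 f5].
have E : (fun x => c * f x * sg x) = (fun x => c * (f x * sg x)).
  by apply/funext => x; rewrite mulrA.
split; first exact: (cmfM (cmf_cst c) f1).
- by move=> x xL; rewrite cabsM ler_wpM2l ?cabs_ge0 ?f2.
- by move=> x nu xL nS; rewrite -mulrBr cabsM -mulrA ler_wpM2l ?cabs_ge0 ?f3.
- by rewrite E; apply: citgZ => //; exact: measurable_itv.
- by rewrite E; apply: citgZ => //; exact: measurable_itv.
Qed.

Definition away : set MR := [set x | forall nu, S nu -> r < `|x - nu|].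

Lemma measurable_away : measurable away.
Proof.
rewrite (_ : away = \bigcap_(nu in S) [set x | r < `|x - nu|]).
  by apply: fin_bigcap_measurable => // nu _; apply: m_gt; exact: mf_dist.
by apply/seteqP; split.
Qed.

Lemma adm_pieces : exists K : R, 0 <= K /\ forall A g, 0 <= A -> adm A g ->
  [/\ citg (away `&` `]-La, La[) (fun x => g x * sg x),
      cabs (cint (away `&` `]-La, La[) (fun x => g x * sg x)) <= K * A &
      forall nu, S nu ->
        citg `[nu - r, nu + r] (fun x => g x * sg x - g nu * res nu / ofR (x - nu)) /\
        cabs (cint `[nu - r, nu + r] (fun x => g x * sg x - g nu * res nu / ofR (x - nu))) <= K
          * A].
Proof.
have [F [W [fF iW W0 H1 H2]]] := real_int_weight.
have mI (i : interval R) : measurable ([set` i] : set MR) by exact: measurable_itv.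
pose c := \sum_(nu <- l) cabs (res nu).
have cnu nu : S nu -> cabs (res nu) <= c.
  move=> nS; have nl : nu \in l by rewrite polesP; apply/mem_set.
  by rewrite /c (big_rem nu) //= lerDl sumr_ge0 // => ? _; exact: cabs_ge0.
have c0 : 0 <= c by apply: sumr_ge0 => ? _; exact: cabs_ge0.
pose V nu x := W x + c * isq nu x.
have V0 nu x : 0 <= V nu x by rewrite addr_ge0 // mulr_ge0 ?isq_ge0.
have iV nu : itg `[-La, La] (V nu).
  by apply: itgD => //; apply: itgZ => //; exact: itg_isq.
pose I nu := \int[mu]_(x in `[-La, La]) V nu x.
have I0 nu : 0 <= I nu by apply: Rintegral_ge0.
have sub nu D A : measurable D -> 0 <= A -> D `<=` `[-La, La] ->
  \int[mu]_(x in D) (A * V nu x) <= A * I nu.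
  move=> mD A0 DL; rewrite RintegralZl //; last exact: (itgS mD (mI _) DL (iV nu)).
  by rewrite ler_wpM2l //; apply: Rintegral_subset.
exists (2 * (I 0 + \sum_(nu <- l) I nu)).
have Inu nu : S nu -> I nu <= I 0 + \sum_(nu <- l) I nu.
  move=> nS; have nl : nu \in l by rewrite polesP; apply/mem_set.
  by rewrite (big_rem nu) //= addrCA lerDl addr_ge0 // sumr_ge0.
have S0 : 0 <= \sum_(nu <- l) I nu by apply: sumr_ge0.
split; first by rewrite mulr_ge0 // addr_ge0.
move=> A g A0 [g1 g2 g3 g4 g5].
have mgs : cmf (fun x => g x * sg x) by exact: cmfM.
have mD : measurable (away `&` `]-La, La[) by apply: measurableI => //; exact: measurable_away.
have DL : away `&` `]-La, La[ `<=` `[-La, La] by move=> x [_]; exact: subset_itv_oo_cc.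
have [x [xa xL] nF|i1 b1] := citg_le mD fF mgs (itgZ A mD (itgS mD (mI _) DL (iV 0))).
  have xL' : -La <= x <= La by move: xL; rewrite /= in_itv /= => /andP[/ltW -> /ltW ->].
  rewrite cabsM ler_pM ?cabs_ge0 ?g2 //.
  by rewrite (le_trans (H1 _ _ _ _)) // /V lerDl mulr_ge0 ?isq_ge0.
split=> //.
  apply: (le_trans b1); rewrite -[leRHS]mulrA ler_pM2l //.
  by apply: (le_trans (sub 0 _ A mD A0 DL)); rewrite mulrC ler_wpM2r // lerDl.
move=> nu nS; have mE : measurable (`[nu - r, nu + r] : set MR) by [].
have EL : `[nu - r, nu + r] `<=` `[-La, La].
  move=> x /=; rewrite !in_itv /=; have := hLa nS; have := ler_norm nu; have := ler_norm (- nu);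
    rewrite normrN.
  by move=> ? ? ? /andP[? ?]; apply/andP; split; lra.
have nuL : -La <= nu <= La.
  by move: (EL nu); rewrite /= !in_itv /=; apply; have [? _] := sep_radiusP fS; apply/andP;
    split; lra.
have mf2 : cmf (fun x => g x * sg x - g nu * res nu / ofR (x - nu)).
  by apply: cmfD => //; apply: cmfN; exact: cmf_pole.
have fF' : finite_set (F `|` [set nu]) by rewrite finite_setU; split=> //; exact: finite_set1.
have [x xE nF|i2 b2] := citg_le mE fF' mf2 (itgZ A mE (itgS mE (mI _) EL (iV nu))).
  have xL : -La <= x <= La by move: (EL x xE); rewrite /= in_itv.
  have xnu : 0 < `|x - nu|.
    by rewrite normr_gt0 subr_eq0; apply: contra_not_neq nF => ->; right.
  (* The first summand is covered by [W]; in the second the Hoelder bound on g turns 1 / |x - nu|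
     into |x - nu|^(-1/2). *)
  rewrite (_ : _ - _ = g x * (sg x - res nu / ofR (x - nu)) + (g x - g nu) * (res nu / ofR (x -
    nu))); last by ring.
  rewrite (le_trans (cabsD _ _)) // /V [leRHS]mulrDr lerD // cabsM.
    rewrite ler_pM ?cabs_ge0 ?g2 // H2 //; by move=> ?; apply: nF; left.
  rewrite cabsM cabsV cabs_ofR (le_trans (ler_wpM2r _ (g3 _ _ xL nS))) ?mulr_ge0 ?invr_ge0
    ?cabs_ge0 //.
  rewrite -mulrA ler_wpM2l // mulrCA ler_pM ?cabs_ge0 ?cnu //.
  rewrite /isq -[X in _ / X](sqr_sqrtr (normr_ge0 (x - nu))) expr2 invfM mulrA mulfV ?mul1r //.
  by rewrite gt_eqF // sqrtr_gt0.
split=> //; apply: (le_trans b2); rewrite -[leRHS]mulrA ler_pM2l //.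
by apply: (le_trans (sub nu _ A mE A0 EL)); rewrite mulrC ler_wpM2r // Inu.
Qed.

(** The contribution of [-La, La] to [real_int]. The principal values are missing because they
    vanish on intervals centered at the pole. *)
Definition central (g : R -> C) : C :=
  cint (away `&` `]-La, La[) (fun x => g x * sg x) +
  \sum_(nu <- l) (cint `[nu - r, nu + r] (fun x => g x * sg x - g nu * res nu / ofR (x - nu)) +
    (if side nu then 1 else -1) * (Ci R * ofR pi * (g nu * res nu))).

Lemma real_intE A g : 0 <= A -> adm A g -> real_int side sg g =
  cint `]-oo, -La] (fun x => g x * sg x) + cint `[La, +oo[ (fun x => g x * sg x) + central g.
Proof.
move=> A0 ag; have [K [_ /(_ A g A0 ag)[i1 _ _]]] := adm_pieces.
have [g1 _ _ i2 i3] := ag; have mgs : cmf (fun x => g x * sg x) by exact: cmfM.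
have mI (i : interval R) : measurable ([set` i] : set MR) by exact: measurable_itv.
have mD : measurable (away `&` `]-La, La[) by apply: measurableI => //; exact: measurable_away.
have [r0 _] := sep_radiusP fS.
have aw x : La <= `|x| -> away x.
  move=> Lx nu nS; have := hLa nS; have := ler_normD (x - nu) nu; rewrite subrK; lra.
have E : away = `]-oo, -La] `|` (`[La, +oo[ `|` (away `&` `]-La, La[)).
  apply/seteqP; split=> x /=; rewrite !in_itv /= ?andbT.
    by move=> ax; have [|h1] := leP x (-La); [left | right; have [|h2] := leP La x;
      [left | right]].
  move=> [h|[h|[]//]]; apply: aw; first by rewrite ler_normr lerNr h orbT.
  by rewrite ler_normr h.
rewrite /real_int -/away E.
rewrite cintU //; last 3 first.
- by apply: measurableU.
- exact: citgU.
- apply/seteqP; split=> x //=; rewrite !in_itv /= andbT => -[h1 [h2|[_ /andP[h2 _]]]].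
    by have : La <= -La := le_trans h2 h1; have := La0; lra.
  by have := lt_le_trans h2 h1; rewrite ltxx.
rewrite cintU //; last first.
  by apply/seteqP; split=> x //=; rewrite !in_itv /= andbT => -[h1 [_ /andP[_ h2]]]; lra.
rewrite /central fsbig_finite //= !addrA; congr (_ + _).
apply: eq_bigr => nu _; rewrite /int_across pv_pole addr0 itv_setE //.
Qed.

Lemma central_bound : exists K : R, 0 <= K /\ forall A g, 0 <= A -> adm A g ->
  cabs (central g) <= K * A.
Proof.
have [K [K0 H]] := adm_pieces.
exists (K + \sum_(nu <- l) (K + pi * cabs (res nu))).
have t0 nu : 0 <= K + pi * cabs (res nu) by rewrite addr_ge0 // mulr_ge0 ?pi_ge0 ?cabs_ge0.
split; first by rewrite addr_ge0 // sumr_ge0.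
move=> A g A0 ag; have [_ b1 b2] := H A g A0 ag.
rewrite (le_trans (cabsD _ _)) // mulrDl lerD // (le_trans (cabs_sum _ _ _)) // mulr_suml.
rewrite big_seq [leRHS]big_seq; apply: ler_sum => nu; rewrite polesP => /set_mem nS.
rewrite (le_trans (cabsD _ _)) // mulrDl lerD ?(b2 nu nS).2 // cabsM.
have -> : cabs (if side nu then 1 else -1 : C) = 1 by case: (side nu); rewrite ?cabsN cabs1.
rewrite mul1r !cabsM cabs_Ci mul1r cabs_ofR ger0_norm ?pi_ge0 // -mulrA ler_wpM2l ?pi_ge0 //
  mulrC ler_wpM2l ?cabs_ge0 //.
have [_ h _ _ _] := ag; apply: h.
by have [r0 _] := sep_radiusP fS; have := hLa nS; have := ler_norm nu; have := ler_norm (- nu);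
  rewrite normrN => ? ? ?; apply/andP; split; lra.
Qed.

Lemma real_intD A B f g : 0 <= A -> 0 <= B -> adm A f -> adm B g ->
  real_int side sg (fun x => f x + g x) = real_int side sg f + real_int side sg g.
Proof.
move=> A0 B0 af ag; rewrite (real_intE A0 af) (real_intE B0 ag) (real_intE (addr_ge0 A0 B0)
  (admD af ag)).
have [K [_ H]] := adm_pieces.
have [f1 _ f2] := H A f A0 af; have [g1 _ g2] := H B g B0 ag.
have [_ _ _ f3 f4] := af; have [_ _ _ g3 g4] := ag.
have mI (i : interval R) : measurable ([set` i] : set MR) by exact: measurable_itv.
have mD : measurable (away `&` `]-La, La[) by apply: measurableI => //; exact: measurable_away.
have E D : measurable D -> citg D (fun x => f x * sg x) -> citg D (fun x => g x * sg x) ->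
    cint D (fun x => (f x + g x) * sg x) = cint D (fun x => f x * sg x) + cint D (fun x => g x *
      sg x).
  by move=> mD' i1 i2; rewrite -cintD //; apply: eq_cint => x _; rewrite mulrDl.
have -> : central (fun x => f x + g x) = central f + central g.
  rewrite /central E // addrACA -big_split /=; congr (_ + _).
  rewrite big_seq [RHS]big_seq; apply: eq_bigr => nu; rewrite polesP => /set_mem nS.
  have [i1 _] := f2 nu nS; have [i2 _] := g2 nu nS.
  rewrite addrACA -cintD //; congr (_ + _); last by rewrite !mulrDl !mulrDr.
  by apply: eq_cint => x _; rewrite !mulrDl opprD addrACA.
by rewrite !E //; ring.
Qed.

Lemma real_intZ A c f : 0 <= A -> adm A f ->
  real_int side sg (fun x => c * f x) = c * real_int side sg f.
Proof.
move=> A0 af; rewrite (real_intE A0 af) (real_intE (mulr_ge0 (cabs_ge0 c) A0) (admZ c af)).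
have [K [_ H]] := adm_pieces.
have [f1 _ f2] := H A f A0 af.
have [_ _ _ f3 f4] := af.
have mI (i : interval R) : measurable ([set` i] : set MR) by exact: measurable_itv.
have mD : measurable (away `&` `]-La, La[) by apply: measurableI => //; exact: measurable_away.
have E D : measurable D -> citg D (fun x => f x * sg x) ->
    cint D (fun x => (c * f x) * sg x) = c * cint D (fun x => f x * sg x).
  by move=> mD' i1; rewrite -cintZ //; apply: eq_cint => x _; rewrite mulrA.
have -> : central (fun x => c * f x) = c * central f.
  rewrite /central E // mulrDr mulr_sumr; congr (_ + _).
  rewrite big_seq [RHS]big_seq; apply: eq_bigr => nu; rewrite polesP => /set_mem nS.
  have [i1 _] := f2 nu nS.
  rewrite mulrDr -cintZ //; congr (_ + _); last by ring.
  by apply: eq_cint => x _; ring.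
by rewrite !E // !mulrDr.
Qed.
End RealIntegral.

(** * Integrals near infinity *)

Section TailIntegral.
Local Open Scope classical_set_scope.
Variable R : realType.
Local Notation C := (CC R).
Local Notation mu := (@lebesgue_measure R).
Local Notation MR := (measurableTypeR R).

Lemma itg_le_dom (D : set MR) (f g : R -> R) : measurable D -> measurable_fun D (f : MR -> R) ->
  itg D g ->
  (forall x, D x -> `|f x| <= g x) -> itg D f /\ `|\int[mu]_(x in D) f x| <= \int[mu]_(x in D) g
    x.
Proof.
move=> mD mff ig fg.
have fi : itg D f.
  apply: le_integrable ig => //; first exact/measurable_EFinP.
  by move=> x Dx; rewrite /= lee_fin (le_trans (fg x Dx)) // ler_norm.
split=> //; apply: (le_trans (le_normr_Rintegral mD fi)).
apply: le_Rintegral => //.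
exact: integrable_norm fi.
Qed.

Lemma itg_measurable (D : set MR) (f : R -> R) : measurable D -> itg D f ->
  measurable_fun D (f : MR -> R).
Proof. by move=> mD /measurable_int /measurable_EFinP. Qed.

Lemma citg_le_dom (D : set MR) (f : R -> C) (h : R -> R) : measurable D ->
  measurable_fun D ((fun x => re (f x)) : MR -> R) ->
    measurable_fun D ((fun x => im (f x)) : MR -> R) ->
  itg D h -> (forall x, D x -> cabs (f x) <= h x) ->
  citg D f /\ cabs (cint D f) <= 2 * \int[mu]_(x in D) h x.
Proof.
move=> mD f1 f2 hi fh.
have [i1 b1] := itg_le_dom mD f1 hi (fun x Dx => le_trans (cabs_re _) (fh x Dx)).
have [i2 b2] := itg_le_dom mD f2 hi (fun x Dx => le_trans (cabs_im _) (fh x Dx)).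
by split=> //; rewrite (le_trans (cabs_le _)) // mulr_natl mulr2n lerD.
Qed.

Lemma itg_ge0_y (f F : R -> R) (a l : R) : mf f -> (forall x, a <= x -> 0 <= f x) ->
  (forall x, a <= x -> {for x, continuous f}) ->
  (forall x, a <= x -> is_derive x 1 F (f x)) -> F x @[x --> +oo] --> l ->
  itg `[a, +oo[ f /\ \int[mu]_(x in `[a, +oo[) f x = l - F a.
Proof.
move=> mff f0 cf dF Fl.
have cF x : a <= x -> {for x, continuous F}.
  move=> ax; apply: differentiable_continuous; apply/derivable1_diffP.
  by have [] := dF x ax.
have E : (\int[mu]_(x in `[a, +oo[) (f x)%:E = l%:E - (F a)%:E)%E.
  apply: ge0_continuous_FTC2y => //.
  - by apply: within_cont => x /=; rewrite in_itv /= andbT; exact: cf.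
  - by move=> x /ltW ax; have [] := dF x ax.
  - by apply: cvg_at_right_filter; exact: cF.
  - move=> x; rewrite in_itv /= andbT => /ltW ax.
    by rewrite derive1E; have [_ ->] := dF x ax.
split; last by rewrite /Rintegral E.
apply/integrableP; split; first by apply/measurable_EFinP; exact: mfS.
suff -> : (\int[mu]_(x in `[a, +oo[) `|(EFin \o f) x| =
  \int[mu]_(x in `[a, +oo[) (f x)%:E)%E by rewrite E ltry.
by apply: eq_integral => x /set_mem /=; rewrite in_itv /= andbT => ax; rewrite ger0_norm // f0.
Qed.

Lemma cftc_y (f F : R -> C) a : ccont f \/ cmf f -> citg `[a, +oo[ f ->
  (forall x, a <= x -> {for x, continuous (fun x => re (f x))} /\ {for x,
    continuous (fun x => im (f x))}) ->
  (forall x, a <= x -> cderiv F x (f x)) -> cabs (F x) @[x --> +oo] --> (0 : R) ->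
  cint `[a, +oo[ f = - F a.
Proof.
move=> mff [i1 i2] cf dF F0.
have [m1 m2] : cmf f by case: mff => // /cmf_cont.
have z0 (g : R -> R) : (forall x, `|g x| <= cabs (F x)) -> g x @[x --> +oo] --> (0 : R).
  move=> gF; apply/norm_cvg0P; apply: (@squeeze_cvgr _ _ _ _ (fun=> 0) (fun x => cabs (F x))) =>
    //; last exact: cvg_cst.
  by near=> x; rewrite normr_ge0 gF.
apply: cx_ext; rewrite ?reN ?imN /=.
- apply: (@ftc_y _ _ (fun x => re (F x))) => //.
  + by move=> x /cf[].
  + by move=> x /dF[].
  + by apply: z0 => x; exact: cabs_re.
- apply: (@ftc_y _ _ (fun x => im (F x))) => //.
  + by move=> x /cf[].
  + by move=> x /dF[].
  + by apply: z0 => x; exact: cabs_im.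
Unshelve. all: by end_near. Qed.

Lemma pow_le_fact_exp n (x : R) : 0 <= x -> x ^+ n <= n`!%:R * expR x.
Proof.
move=> x0; case: n => [|n]; first by rewrite expr0 fact0 mul1r -expR0 ler_expR.
have := expR_ge1Dxn n x0 => h.
have {}h : x ^+ n.+1 / n.+1`!%:R <= expR x by apply: le_trans h; rewrite lerDr.
by rewrite mulrC -ler_pdivrMr ?ltr0n ?fact_gt0.
Qed.

Lemma pow_le_exp (c : R) n : 0 < c -> exists2 A : R, 0 <= A & forall u, 0 <= u ->
  u ^+ n <= A * expR (c * u).
Proof.
move=> c0; exists (n`!%:R / c ^+ n); first by rewrite divr_ge0 ?exprn_ge0 ?ler0n // ltW.
move=> u u0; have := pow_le_fact_exp n (mulr_ge0 (ltW c0) u0).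
by rewrite exprMn mulrC -ler_pdivlMr ?exprn_gt0 // mulrAC.
Qed.

(** Dominated convergence used to carry a bound [B] on the integrals to the limit; [B] may be much
    better than what the majorant [h] gives. *)
Lemma citg_dct (D : set MR) (G : nat -> R -> C) (g : R -> C) (h : R ->
  R) (B : R) : measurable D ->
  (forall n, citg D (G n)) -> (forall x, D x -> (fun n => G n x) @ \oo --> g x) ->
  itg D h -> (forall n x, D x -> cabs (G n x) <= h x) ->
  (forall n, cabs (cint D (G n)) <= B) ->
  citg D g /\ cabs (cint D g) <= B.
Proof.
move=> mD Gi Gg hi Gh GB.
have H (p : C -> R) : (forall z, `|p z| <= cabs z) ->
    (forall n, itg D (fun x => p (G n x))) ->
    (forall x, D x -> (fun n => p (G n x)) @ \oo --> p (g x)) ->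
    itg D (fun x => p (g x)) /\
    (fun n => \int[mu]_(x in D) p (G n x)) @ \oo --> \int[mu]_(x in D) p (g x).
  move=> pz pi pg.
  have [] := @dominated_convergence _ _ _ mu D mD (fun n => EFin \o (fun x => p (G n x)))
     (EFin \o (fun x => p (g x))) (EFin \o h).
  - by move=> n; have /measurable_int := pi n.
  - apply/measurable_EFinP; apply: (measurable_fun_cvg (h := fun n x => p (G n x))) => //.
    by move=> n; exact: itg_measurable.
  - apply: aeW => x Dx; apply: cvg_EFin; first by near=> n.
    exact: pg.
  - exact: hi.
  - by apply: aeW => x n Dx; rewrite /= lee_fin (le_trans (pz _)) ?Gh.
  move=> i1 _ c1; split=> //.
  apply: fine_cvg; rewrite fineK; first exact: c1.
  exact: integrable_fin_num.
have [i1 c1] := H (@re R) (@cabs_re R) (fun n => (Gi n).1) (fun x Dx => ccvg_re (Gg x Dx)).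
have [i2 c2] := H (@im R) (@cabs_im R) (fun n => (Gi n).2) (fun x Dx => ccvg_im (Gg x Dx)).
split=> //; have c : (fun n => cint D (G n)) @ \oo --> cint D g by exact: ccvg_reim.
have cc : (fun n => cabs (cint D (G n))) @ \oo --> cabs (cint D g) by apply: ccvg_cabs.
rewrite -(cvg_lim _ cc) //.
apply: limr_le; first by apply/cvg_ex; exists (cabs (cint D g)).
by near=> n; exact: GB.
Unshelve. all: by end_near. Qed.

Lemma citg0 (D : set MR) : measurable D -> citg D (fun=> 0).
Proof. by move=> mD; split; exact: integrable0. Qed.

Lemma citg_sum (I : Type) (s : seq I) (D : set MR) (F : I -> R -> C) : measurable D ->
  (forall i, citg D (F i)) -> citg D (fun x => \sum_(i <- s) F i x) /\
  cint D (fun x => \sum_(i <- s) F i x) = \sum_(i <- s) cint D (F i).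
Proof.
move=> mD Fi; elim: s => [|i s [IH1 IH2]].
  rewrite (_ : (fun x => _) = fun=> 0); last by apply/funext => x; rewrite big_nil.
  split; first exact: citg0.
  by rewrite big_nil /cint /= /Rintegral integral0.
rewrite (_ : (fun x => _) = fun x => F i x + \sum_(j <- s) F j x); last by apply/funext => x;
  rewrite big_cons.
by split; [exact: citgD | rewrite cintD // big_cons IH2].
Qed.

Variables (u du : R -> R) (La : R).
Hypotheses (mu_ : mf u) (mdu : mf du).
Hypothesis du_u : forall x, La <= x -> is_derive x 1 u (du x).
Hypothesis cdu : forall x, La <= x -> {for x, continuous du}.
Hypothesis du0 : forall x, La <= x -> 0 <= du x.
Hypothesis u_ge : forall x, La <= x -> u La <= u x.
Hypothesis u1 : 1 <= u La.
Hypothesis uy : u x @[x --> +oo] --> +oo.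
Local Notation U := (u La).
Local Notation D := (`[La, +oo[%classic : set MR).

Let mD : measurable D. Proof. exact: measurable_itv. Qed.
Let u_ge1 x : La <= x -> 1 <= u x. Proof. by move=> /u_ge; exact: le_trans. Qed.
Let DE x : D x = (La <= x). Proof. by rewrite /= in_itv /= andbT. Qed.

Definition wave (z : C) (x : R) : C := cexp (- (ofR (u x) * z)).

Lemma cabs_wave z x : cabs (wave z x) = expR (- (u x * re z)).
Proof. by rewrite cabs_cexp reN reM /= mul0r subr0. Qed.

Lemma mfC_wave z : cmf (wave z).
Proof.
have m1 : mf (fun x => - (u x * re z)) by apply: mfN; apply: mfM => //; exact: measurable_cst.
have m2 : mf (fun x => - (u x * im z)) by apply: mfN; apply: mfM => //; exact: measurable_cst.
have E x : wave z x = cpx (expR (- (u x * re z)) * cos (- (u x * im z))) (expR (- (u x * re z))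
  * sin (- (u x * im z))).
  by rewrite /wave /cexp reN imN reM imM /= !mul0r subr0 addr0.
split.
- rewrite (_ : (fun x => _) = fun x => expR (- (u x * re z)) * cos (- (u x * im z)));
  last by apply/funext => x; rewrite E.
  by apply: mfM; apply: measurableT_comp => //; apply: continuous_measurable_fun;
    exact: continuous_cos.
- rewrite (_ : (fun x => _) = fun x => expR (- (u x * re z)) * sin (- (u x * im z)));
  last by apply/funext => x; rewrite E.
  by apply: mfM; apply: measurableT_comp => //; apply: continuous_measurable_fun;
    exact: continuous_sin.
Qed.

Lemma wave_deriv z x : La <= x -> cderiv (wave z) x (- (ofR (du x) * z) * wave z x).
Proof.
move=> xL; apply: cderiv_eq (cderiv_cexp (cderivN (cderivM (cderiv_ofR (du_u xL)) (cderiv_cst z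
  x)))) _.
by rewrite mulr0 addr0.
Qed.

Lemma ler_du x y z : La <= x -> y <= z -> y * du x <= z * du x.
Proof. by move=> xL yz; rewrite ler_wpM2r // du0. Qed.

Lemma u_cont x : La <= x -> {for x, continuous u}.
Proof.
by move=> xL; apply: differentiable_continuous; apply/derivable1_diffP; have [] := du_u xL.
Qed.

(** Substitution v = u x by the fundamental theorem, with primitive G composed with u. *)
Lemma itg_comp (g G : R -> R) l : mf (fun x => g (u x)) ->
  (forall v : R, 1 <= v -> 0 <= g v) -> (forall v : R, 1 <= v -> {for v, continuous g}) ->
  (forall v : R, 1 <= v -> is_derive v 1 G (g v)) -> G v @[v --> +oo] --> l ->
  itg D (fun x => g (u x) * du x) /\ \int[mu]_(x in D) (g (u x) * du x) = l - G U.
Proof.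
move=> mg g0 cg dG Gl; apply: (@itg_ge0_y (fun x => g (u x) * du x) (fun x => G (u x))).
- exact: mfM.
- by move=> x xL; rewrite mulr_ge0 ?du0 // g0 ?u_ge1.
- move=> x xL; apply: cvgM; last exact: cdu.
  by apply: continuous_comp; [exact: u_cont | exact: cg (u_ge1 xL)].
- by move=> x xL; apply: is_derive1_comp; [exact: dG (u_ge1 xL) | exact: du_u].
exact: cvg_comp uy Gl.
Qed.

Lemma expN_cvg0 c : 0 < c -> expR (- c * v) @[v --> +oo] --> (0 : R).
Proof.
move=> c0; apply/cvgrPdist_le => e e0; exists `|(1 / e) / c|; split; first exact: num_real.
move=> v hv; rewrite sub0r normrN ger0_norm ?expR_ge0 //.
have cv : 1 / e < c * v.
  by rewrite -ltr_pdivrMl // mulrC; exact: le_lt_trans (ler_norm _) hv.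
rewrite mulNr expRN -[leRHS]invrK lef_pV2 ?posrE ?expR_gt0 ?invr_gt0 //.
have := expR_ge1Dx (c * v); rewrite div1r in cv; lra.
Qed.

Lemma itg_exp c : 0 < c -> itg D (fun x => expR (- (c * u x)) * du x).
Proof.
move=> c0.
have dE (v : R) : is_derive v 1 (fun v : R => - c^-1 * expR (- c * v)) (expR (- c * v)).
  have d1 : is_derive v 1 (fun v : R => - c * v) (- c).
    by have := is_deriveZ (- c) (is_derive_id v 1); rewrite /GRing.scale /= mulr1.
  have d2 := is_derive1_comp (is_derive_expR (- c * v)) d1.
  have := is_deriveZ (- c^-1) d2.
  by rewrite /GRing.scale /= mulrCA mulrNN mulVf ?mulr1 // gt_eqF.
rewrite (_ : (fun x => _) = (fun x => expR (- c * u x) * du x)); last by apply/funext => x;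
  rewrite mulNr.
apply: (@itg_comp (fun v => expR (- c * v)) (fun v => - c^-1 * expR (- c * v)) 0 _ _ _ (fun v _
  => dE v) _).1.
- by apply: measurableT_comp => //; apply: mfM => //; exact: measurable_cst.
- by move=> v _; exact: expR_ge0.
- move=> v _; apply: continuous_comp; last exact: continuous_expR.
  by apply: cvgM; [exact: cvg_cst | exact: cvg_id].
rewrite -[X in _ --> X](mulr0 (- c^-1)); apply: cvgM; first exact: cvg_cst.
exact: expN_cvg0.
Qed.

Lemma cont_derive (f : R -> R) (x d : R) : is_derive x 1 f d -> {for x, continuous f}.
Proof. by move=> [h _]; apply: differentiable_continuous; apply/derivable1_diffP. Qed.

Lemma is_derive_invX n (v : R) : 1 <= v ->
  is_derive v 1 (fun v : R => v^-1 ^+ n) (- (n%:R * v^-1 ^+ n.+1)).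
Proof.
move=> v1; have v0 : v != 0 by rewrite gt_eqF // (lt_le_trans ltr01).
have d1 := is_deriveX n (@is_deriveV R id v 1 1 v0 (is_derive_id v 1)).
rewrite (_ : (fun v : R => _) = (GRing.inv : R -> R) ^+ n); last by apply/funext => w;
  rewrite exprfctE.
apply: is_derive_eq d1 _; case: n => [|n]; rewrite /GRing.scale /= ?mul0r ?oppr0 // mulr1.
by rewrite -exprVn mulrN -mulrA -exprD addn2.
Qed.

Lemma inv_cvg0 q : (v : R)^-1 ^+ q.+1 @[v --> +oo] --> (0 : R).
Proof.
apply/cvgrPdist_le => e e0; exists (Num.max 1 e^-1); split; first exact: num_real.
move=> v; rewrite gt_max => /andP[v1 ve]; have v0 := lt_trans ltr01 v1.
have vi0 : 0 <= v^-1 by rewrite invr_ge0 ltW.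
rewrite sub0r normrN ger0_norm ?exprn_ge0 // exprS -[e]mulr1 ler_pM ?exprn_ge0 //.
  by rewrite -[e]invrK lef_pV2 ?posrE ?invr_gt0 // ltW.
by rewrite exprn_ile1 // invf_le1 // ltW.
Qed.

Lemma itg_inv q : itg D (fun x => (u x)^-1 ^+ q.+2 * du x) /\
  \int[mu]_(x in D) ((u x)^-1 ^+ q.+2 * du x) = U^-1 ^+ q.+1 / q.+1%:R.
Proof.
have q0 : q.+1%:R != 0 :> R by rewrite pnatr_eq0.
have dE (v : R) : 1 <= v -> is_derive v 1 (fun v : R => - q.+1%:R^-1 * v^-1 ^+ q.+1) (v^-1 ^+
  q.+2).
  move=> v1; apply: is_derive_eq (is_deriveZ (- q.+1%:R^-1) (is_derive_invX q.+1 v1)) _.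
  by rewrite /GRing.scale /= mulrNN mulrA mulVf ?mul1r.
have [||||i1 E] := @itg_comp (fun v : R => v^-1 ^+ q.+2) (fun v : R => - q.+1%:R^-1 * v^-1 ^+
  q.+1) 0 _ _ _ dE.
- by apply: measurable_funX; exact: mfV.
- by move=> v v1; rewrite exprn_ge0 // invr_ge0 (le_trans ler01).
- by move=> v v1; exact: cont_derive (is_derive_invX q.+2 v1).
- rewrite -[X in _ --> X](mulr0 (- q.+1%:R^-1)); apply: cvgM; first exact: cvg_cst.
  exact: inv_cvg0.
by split => //; rewrite E mulNr sub0r opprK mulrC.
Qed.

(** Growth slower than any exponential makes exp(- u z) g(u) integrable however small re z > 0
    is. *)
Definition subexp (g : R -> R) : Prop := forall c, 0 < c ->
  exists2 A : R, 0 <= A & forall v, 1 <= v -> `|g v| <= A * expR (c * v).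

Lemma subexp_X n : subexp (fun v => v ^+ n).
Proof.
move=> c c0; have [A A0 HA] := pow_le_exp n c0; exists A => // v v1.
by rewrite ger0_norm ?HA ?exprn_ge0 // (le_trans ler01).
Qed.

Lemma subexp_V n : subexp (fun v => v^-1 ^+ n).
Proof.
move=> c c0; exists 1 => // v v1; have v0 : 0 < v by apply: lt_le_trans v1.
rewrite ger0_norm ?exprn_ge0 ?invr_ge0 ?(ltW v0) // mul1r.
apply: (@le_trans _ _ 1); first by rewrite exprn_ile1 ?invr_ge0 ?(ltW v0) // invf_le1.
by rewrite -expR0 ler_expR mulr_ge0 // ltW.
Qed.

Lemma itg_subexp g : mf (fun x => g (u x)) -> subexp g ->
  forall c, 0 < c -> itg D (fun x => expR (- (c * u x)) * (`|g (u x)| * du x)).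
Proof.
move=> mg gr c c0; have c2 : 0 < c / 2 by rewrite divr_gt0.
have [A A0 HA] := gr _ c2.
have key (x : R) : La <= x -> expR (- (c * u x)) * `|g (u x)| <= A * expR (- (c / 2 * u x)).
  move=> xL; have := HA _ (u_ge1 xL); rewrite -(ler_pM2l (expR_gt0 (- (c * u x)))) => h.
  apply: (le_trans h); rewrite mulrCA -expRD ler_wpM2l // ler_expR; lra.
apply: (itg_le mD _ (itgZ A mD (itg_exp c2))).
  apply: mfM; first by apply: measurableT_comp => //; apply: mfN; apply: mfM => //;
    exact: measurable_cst.
  by apply: mfM => //; apply: measurableT_comp.
move=> x; rewrite DE => xL; rewrite ger0_norm ?mulr_ge0 ?expR_ge0 ?du0 // !mulrA ler_du //.
exact: key.
Qed.

(** The Laplace transform of g on [U, +oo[ at z, pulled back along u. *)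
Definition tint (z : C) (g : R -> R) : C := cint D (fun x => wave z x * ofR (g (u x) * du x)).

Lemma citg_tint z g : 0 < re z -> mf (fun x => g (u x)) -> subexp g ->
  citg D (fun x => wave z x * ofR (g (u x) * du x)) /\
  cabs (tint z g) <= 2 * \int[mu]_(x in D) (expR (- (re z * u x)) * (`|g (u x)| * du x)).
Proof.
move=> z0 mg gs; apply: (citg_le mD (finite_set0 _)) (itg_subexp mg gs z0) _.
  by apply: cmfM; [exact: mfC_wave | apply: cmf_ofR; exact: mfM].
move=> x Dx _; move: Dx; rewrite DE => xL.
by rewrite cabsM cabs_wave cabs_ofR normrM (ger0_norm (du0 xL)) (mulrC (u x)).
Qed.

Definition ccat (x : R) (f : R -> C) : Prop :=
  {for x, continuous (fun x => re (f x))} /\ {for x, continuous (fun x => im (f x))}.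

Lemma ccatM x f g : ccat x f -> ccat x g -> ccat x (fun x => f x * g x).
Proof.
move=> [f1 f2] [g1 g2]; split.
- rewrite (_ : (fun x => _) = fun x => re (f x) * re (g x) - im (f x) * im (g x));
  last by apply/funext => y; rewrite reM.
  by apply: cvgB; apply: cvgM.
- rewrite (_ : (fun x => _) = fun x => re (f x) * im (g x) + im (f x) * re (g x));
  last by apply/funext => y; rewrite imM.
  by apply: cvgD; apply: cvgM.
Qed.

Lemma ccatD x f g : ccat x f -> ccat x g -> ccat x (fun x => f x + g x).
Proof.
move=> [f1 f2] [g1 g2]; split.
- rewrite (_ : (fun x => _) = fun x => re (f x) + re (g x)); last by apply/funext => y;
  rewrite reD.
  exact: cvgD.
- rewrite (_ : (fun x => _) = fun x => im (f x) + im (g x)); last by apply/funext => y;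
  rewrite imD.
  exact: cvgD.
Qed.

Lemma ccat_ofR x (f : R -> R) : {for x, continuous f} -> ccat x (fun x => ofR (f x)).
Proof. by move=> fc; split=> //=; exact: cvg_cst. Qed.

Lemma ccat_cderiv x f d : cderiv f x d -> ccat x f.
Proof. by move=> [d1 d2]; split; [exact: cont_derive d1 | exact: cont_derive d2]. Qed.

(** Integration by parts in u: the only step that gains a factor 1 / |z| instead of 1 / re z. *)
Lemma tint_parts z g g' : 0 < re z -> mf (fun x => g (u x)) -> mf (fun x => g' (u x)) ->
  subexp g -> subexp g' -> (forall v : R, 1 <= v -> is_derive v 1 g (g' v)) ->
  (forall v : R, 1 <= v -> {for v, continuous g'}) ->
  z * tint z g = wave z La * ofR (g U) + tint z g'.
Proof.
move=> z0 mg mg' gs gs' dg cg'.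
have [i1 _] := citg_tint z0 mg gs; have [i2 _] := citg_tint z0 mg' gs'.
pose f x := - z * (wave z x * ofR (g (u x) * du x)) + wave z x * ofR (g' (u x) * du x).
have fi : citg D f by apply: citgD => //; exact: citgZ.
have mff : cmf f.
  apply: cmfD; first apply: cmfM; first exact: cmf_cst.
    by apply: cmfM; [exact: mfC_wave | apply: cmf_ofR; exact: mfM].
  by apply: cmfM; [exact: mfC_wave | apply: cmf_ofR; exact: mfM].
have dF x : La <= x -> cderiv (fun x => wave z x * ofR (g (u x))) x (f x).
  move=> xL; have dgu := is_derive1_comp (dg _ (u_ge1 xL)) (du_u xL).
  apply: cderiv_eq (cderivM (wave_deriv z xL) (cderiv_ofR dgu)) _.
  by rewrite /f !ofRM; ring.
suff H : cint D f = - (wave z La * ofR (g U)).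
  move: H; rewrite /f cintD //; last exact: citgZ.
  rewrite cintZ // -/(tint z g) -/(tint z g') mulNr => /eqP.
  by rewrite addrC eq_sym -subr_eq eq_sym opprK => /eqP ->; rewrite addrC; ring.
apply: (cftc_y _ fi _ dF); first by right.
- move=> x xL; have cw : ccat x (wave z) := ccat_cderiv (wave_deriv z xL).
  have cg (h : R -> R) : (forall v : R, 1 <= v -> {for v, continuous h}) ->
      ccat x (fun x => wave z x * ofR (h (u x) * du x)).
    move=> hc; apply: ccatM => //; apply: ccat_ofR; apply: cvgM; last exact: cdu.
    by apply: continuous_comp; [exact: u_cont | exact: hc (u_ge1 xL)].
  apply: ccatD; last exact: cg.
  apply: ccatM; first by split=> //=; exact: cvg_cst.
  by apply: cg => v v1; exact: cont_derive (dg v v1).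
have c2 : 0 < re z / 2 by rewrite divr_gt0.
have [A A0 HA] := gs _ c2.
apply: (@squeeze_cvgr _ _ _ _ (fun=> 0) (fun x => A * expR (- (re z / 2) * u x))).
- near=> x; rewrite cabs_ge0 /=.
  have xL : La <= x by near: x; apply: nbhs_pinfty_ge; exact: num_real.
  have := HA _ (u_ge1 xL); rewrite -(ler_pM2l (expR_gt0 (- (re z * u x)))) => h.
  rewrite cabsM cabs_wave cabs_ofR (mulrC (u x)); apply: (le_trans h).
  rewrite mulrCA -expRD ler_wpM2l // ler_expR; lra.
- exact: cvg_cst.
- rewrite -[X in _ --> X](mulr0 A); apply: cvgM; first exact: cvg_cst.
  exact: cvg_comp uy (expN_cvg0 c2).
Unshelve. all: by end_near. Qed.

Lemma wave_La z : 0 < re z -> cabs (wave z La) <= 1.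
Proof.
by move=> z0; rewrite cabs_wave -expR0 ler_expR oppr_le0 mulr_ge0 ?(ltW z0) // (le_trans ler01).
Qed.

Lemma mfZ (c : R) f : mf f -> mf (fun x => c * f x).
Proof. by move=> mff; apply: mfM => //; exact: measurable_cst. Qed.

Lemma mf_uX n : mf (fun x => u x ^+ n).
Proof. exact: measurable_funX. Qed.

Lemma mf_uV n : mf (fun x => (u x)^-1 ^+ n).
Proof. by apply: measurable_funX; exact: mfV. Qed.

Lemma is_derive_X n (v : R) : is_derive v 1 (fun v : R => v ^+ n) (n%:R * v ^+ n.-1).
Proof.
have := is_deriveX n (is_derive_id v (1 : R)).
rewrite (_ : (fun v : R => _) = (id : R -> R) ^+ n); last by apply/funext => w; rewrite exprfctE.
by rewrite /GRing.scale /= mulr1.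
Qed.

Lemma tint_ext z g h : (forall v, 1 <= v -> g v = h v) -> tint z g = tint z h.
Proof. by move=> gh; apply: eq_cint => x; rewrite DE => xL; rewrite gh // u_ge1. Qed.

Lemma tintZ z c g : 0 < re z -> mf (fun x => g (u x)) -> subexp g ->
  tint z (fun v => c * g v) = ofR c * tint z g.
Proof.
move=> z0 mg gs; have [i _] := citg_tint z0 mg gs.
by rewrite /tint -cintZ //; apply: eq_cint => x _; rewrite !ofRM; ring.
Qed.

Lemma subexpZ c g : subexp g -> subexp (fun v => c * g v).
Proof.
move=> gs e e0; have [A A0 H] := gs e e0; exists (`|c| * A); first by rewrite mulr_ge0.
by move=> v v1; rewrite normrM -mulrA ler_wpM2l ?H.
Qed.

Lemma cabs_re_gt0 (z : C) : 0 < re z -> 0 < cabs z.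
Proof. by move=> z0; apply: lt_le_trans z0 _; exact: le_trans (ler_norm _) (cabs_re z). Qed.

(** Repeated integration by parts. The boundary terms satisfy (U |z|)^n <= 2^-n n! exp(2 U |z|), and
    these geometric contributions add up to the factor 2 - 2^-n. *)
Lemma tint_pow z n : 0 < re z ->
  cabs (tint z (fun v => v ^+ n)) * cabs z ^+ n.+1 <= n`!%:R * ((2 - 2^-1 ^+ n) * expR (2 * (U *
    cabs z))).
Proof.
move=> z0; have cz := cabs_re_gt0 z0; have U0 : 0 < U by apply: lt_le_trans u1.
have dg m (v : R) : 1 <= v -> is_derive v 1 (fun v : R => v ^+ m) (m%:R * v ^+ m.-1).
  by move=> _; exact: is_derive_X.
have cg m (v : R) : 1 <= v -> {for v, continuous (fun v : R => m%:R * v ^+ m.-1)}.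
  by move=> _; apply: cvgM; [exact: cvg_cst | exact: cont_derive (is_derive_X _ _)].
have P m := tint_parts z0 (mf_uX m) (mfZ m%:R (mf_uX m.-1))
   (@subexp_X m) (@subexpZ m%:R _ (subexp_X m.-1)) (dg m) (cg m).
have Uz0 : 0 <= U * cabs z by rewrite mulr_ge0 ?cabs_ge0 ?(ltW U0).
elim: n => [|n IH].
  rewrite expr1 mulrC -cabsM P tintZ //; [|exact: mf_uX|exact: subexp_X].
  rewrite mul0r addr0 !expr0 fact0 !mul1r mulr1 (le_trans (wave_La z0)) // (_ : 2 - 1 = 1);
    last by ring.
  by rewrite mul1r -expR0 ler_expR mulr_ge0.
rewrite (exprS _ n.+1) mulrA (mulrC _ (cabs z)) -cabsM P tintZ //;
  [|exact: mf_uX|exact: subexp_X].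
apply: (@le_trans _ _ (U ^+ n.+1 * cabs z ^+ n.+1 + n.+1%:R * (cabs (tint z (fun v => v ^+ n)) *
  cabs z ^+ n.+1))).
  rewrite mulrA -mulrDl ler_wpM2r ?exprn_ge0 ?cabs_ge0 // (le_trans (cabsD _ _)) // lerD //.
    rewrite cabsM cabs_ofR ger0_norm ?exprn_ge0 ?(ltW U0) // -[leRHS]mul1r ler_wpM2r ?exprn_ge0
      ?(ltW U0) //.
    exact: wave_La.
  by rewrite cabsM cabs_ofR normr_nat.
have h := pow_le_fact_exp n.+1 (mulr_ge0 (ler0n R 2) Uz0).
rewrite -exprMn; apply: (@le_trans _ _ (2^-1 ^+ n.+1 * (n.+1`!%:R * expR (2 * (U * cabs z))) +
   n.+1%:R * (n`!%:R * ((2 - 2^-1 ^+ n) * expR (2 * (U * cabs z)))))).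
  apply: lerD; last by rewrite ler_wpM2l.
  have -> : (U * cabs z) ^+ n.+1 = 2^-1 ^+ n.+1 * (2 * (U * cabs z)) ^+ n.+1.
    by rewrite -exprMn mulKf // pnatr_eq0.
  by rewrite ler_wpM2l // exprn_ge0 // invr_ge0.
rewrite factS natrM exprS le_eqVlt; apply/orP; left; apply/eqP; by field.
Qed.

(** One integration by parts; in the remaining integral absolute values are harmless, since u^(-q-2)
    integrates to U^(-q-1) / (q + 1), which cancels the factor q + 1. *)
Lemma tint_inv z q : 0 < re z -> cabs (tint z (fun v => v^-1 ^+ q.+1)) * cabs z <= 3 * U^-1 ^+
  q.+1.
Proof.
move=> z0; have cz := cabs_re_gt0 z0; have U0 : 0 < U by apply: lt_le_trans u1.
have dg (v : R) : 1 <= v -> is_derive v 1 (fun v : R => v^-1 ^+ q.+1) (- q.+1%:R * v^-1 ^+ q.+2).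
  by move=> v1; rewrite mulNr; exact: is_derive_invX.
have cg (v : R) : 1 <= v -> {for v, continuous (fun v : R => - q.+1%:R * v^-1 ^+ q.+2)}.
  by move=> v1; apply: cvgM; [exact: cvg_cst | exact: cont_derive (is_derive_invX q.+2 v1)].
have P := tint_parts z0 (mf_uV q.+1) (mfZ (- q.+1%:R) (mf_uV q.+2))
   (@subexp_V q.+1) (@subexpZ (- q.+1%:R) _ (@subexp_V q.+2)) dg cg.
rewrite mulrC -cabsM P tintZ //; [|exact: mf_uV|exact: subexp_V].
have Ui : 0 <= U^-1 ^+ q.+1 by rewrite exprn_ge0 // invr_ge0 ltW.
rewrite (_ : 3 = 1 + 2) // mulrDl (le_trans (cabsD _ _)) // lerD //.
  by rewrite cabsM cabs_ofR ger0_norm // ler_wpM2r // wave_La.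
rewrite cabsM cabs_ofR normrN normr_nat.
have [_ h] := citg_tint z0 (mf_uV q.+2) (@subexp_V q.+2).
have [i2 I2] := itg_inv q.
have {}h := le_trans h (_ : _ <= 2 * (U^-1 ^+ q.+1 / q.+1%:R)).
rewrite (le_trans (ler_wpM2l _ (h _))) //; last first.
  by rewrite mulrCA ler_wpM2l // mulrCA mulfV ?mulr1 // pnatr_eq0.
have key (x : R) : La <= x -> expR (- (re z * u x)) * (`|(u x)^-1 ^+ q.+2| * du x) <= (u x)^-1
  ^+ q.+2 * du x.
  move=> xL; have u0 : 0 <= (u x)^-1 ^+ q.+2.
    by rewrite exprn_ge0 // invr_ge0 (le_trans ler01) // u_ge1.
  rewrite (ger0_norm u0) -[leRHS]mul1r ler_wpM2r ?(mulr_ge0 u0 (du0 xL)) //.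
  by rewrite -expR0 ler_expR oppr_le0 mulr_ge0 ?(ltW z0) // (le_trans ler01) // u_ge1.
rewrite ler_pM2l // -I2; apply: le_Rintegral => //.
  exact: (itg_subexp (mf_uV q.+2) (@subexp_V q.+2) z0).
by move=> x; rewrite DE; exact: key.
Qed.

(** The bound depends on k through U^-k alone. Therefore the bounds of the terms of a power series
    in 1 / u add up to its weighted norm at any radius r >= 1 / U. *)
Lemma tint_mono z m k : 0 < re z -> cabs (tint z (fun v => v ^+ m * v^-1 ^+ k)) <=
  3 * (m`!%:R * expR (3 * (U * cabs z)) / cabs z ^+ m.+1) * U^-1 ^+ k.
Proof.
move=> z0; have cz := cabs_re_gt0 z0; have U0 : 0 < U by apply: lt_le_trans u1.
have Uz0 : 0 <= U * cabs z by rewrite mulr_ge0 ?cabs_ge0 ?(ltW U0).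
have Uk (i : nat) : 0 < U ^+ i by rewrite exprn_gt0.
have zk (i : nat) : 0 < cabs z ^+ i by rewrite exprn_gt0.
set a := U * cabs z in Uz0 *; set t := cabs (tint _ _).
rewrite exprVn ler_pdivlMr // mulrA ler_pdivlMr //.
have e1 (c d : R) : c <= d -> expR (c * a) <= expR (d * a) by move=> cd;
  rewrite ler_expR ler_wpM2r.
have [km|mk] := leqP k m.
  have E : t = cabs (tint z (fun v => v ^+ (m - k)%N)).
    congr cabs; apply: tint_ext => v v1; have v0 : v != 0 by rewrite gt_eqF // (lt_le_trans
      ltr01).
    by rewrite -[in LHS](subnK km) exprD exprVn mulfK // expf_neq0.
  have h := tint_pow (m - k) z0; rewrite -E -/a in h.
  have -> : t * U ^+ k * cabs z ^+ m.+1 = t * cabs z ^+ (m - k).+1 * a ^+ k.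
    by rewrite -[in LHS](subnK km) -addSn exprD exprMn; ring.
  apply: le_trans (ler_pM _ (exprn_ge0 k Uz0) h (pow_le_fact_exp k Uz0)) _.
    by rewrite mulr_ge0 ?cabs_ge0 // ltW.
  have hb : ((m - k)`! * k`!)%:R <= m`!%:R :> R.
    rewrite ler_nat -(bin_fact km) mulnC [leqRHS]mulnC leq_pmulr // bin_gt0 //.
  have -> : 3 * (m`!%:R * expR (3 * a)) = m`!%:R * (3 * (expR (2 * a) * expR a)) by rewrite
    -expRD (_ : 2 * a + a = 3 * a); ring.
  have -> : (m - k)`!%:R * ((2 - 2^-1 ^+ (m - k)) * expR (2 * a)) * (k`!%:R * expR a)
     = ((m - k)`! * k`!)%:R * ((2 - 2^-1 ^+ (m - k)) * (expR (2 * a) * expR a)) by rewrite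
       natrM; ring.
  have p2 : 0 <= 2^-1 ^+ (m - k) :> R by rewrite exprn_ge0 // invr_ge0.
  have q2 : 2^-1 ^+ (m - k) <= 1 :> R by rewrite exprn_ile1 ?invr_ge0 // invf_le1 // ler1n.
  apply: ler_pM => //; first by rewrite !mulr_ge0 ?expR_ge0 //; lra.
  by rewrite ler_wpM2r ?mulr_ge0 ?expR_ge0 //; lra.
have [q kE] : exists q, k = (m + q.+1)%N by exists (k - m).-1;
  rewrite prednK ?subnKC ?subn_gt0 // ltnW.
have E : t = cabs (tint z (fun v => v^-1 ^+ q.+1)).
  congr cabs; apply: tint_ext => v v1; have v0 : v != 0 by rewrite gt_eqF // (lt_le_trans ltr01).
  by rewrite kE exprD mulrA -exprMn mulfV // expr1n mul1r.
have h := tint_inv q z0; rewrite -E in h.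
have -> : t * U ^+ k * cabs z ^+ m.+1 = (t * cabs z) * (U ^+ q.+1 * a ^+ m).
  by rewrite [in LHS]kE exprD /a exprMn (exprS (cabs z) m); ring.
apply: le_trans (ler_wpM2r _ h) _; first by rewrite mulr_ge0 ?exprn_ge0 ?(ltW U0).
have -> : 3 * U^-1 ^+ q.+1 * (U ^+ q.+1 * a ^+ m) = 3 * a ^+ m.
  by rewrite -mulrA exprVn mulKf // expf_neq0 // gt_eqF.
rewrite ler_pM2l //; apply: le_trans (pow_le_fact_exp m Uz0) _.
by rewrite ler_wpM2l // -[leLHS]mul1r -/a -[X in expR X]mul1r mul1r e1 //; lra.
Qed.

Lemma subexpM g h : subexp g -> subexp h -> subexp (fun v => g v * h v).
Proof.
move=> gs hs c c0; have c2 : 0 < c / 2 by rewrite divr_gt0.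
have [A A0 HA] := gs _ c2; have [B B0 HB] := hs _ c2.
exists (A * B); first exact: mulr_ge0.
move=> v v1; rewrite normrM; apply: le_trans (ler_pM _ _ (HA v v1) (HB v v1)) _ => //.
by rewrite mulrACA -expRD ler_wpM2l ?mulr_ge0 // ler_expR; lra.
Qed.

Lemma tail_poly z r p m : 0 < re z -> U^-1 <= r ->
  citg D (fun x => wave z x * ofR (u x ^+ m * du x) * p.[ofR (u x)^-1]) /\
  cabs (cint D (fun x => wave z x * ofR (u x ^+ m * du x) * p.[ofR (u x)^-1])) <=
  3 * (m`!%:R * expR (3 * (U * cabs z)) / cabs z ^+ m.+1) * pnorm r p.
Proof.
move=> z0 Ur; set B := 3 * _.
have Ui : 0 <= U^-1 by rewrite invr_ge0 (le_trans ler01).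
have B0 : 0 <= B by rewrite mulr_ge0 // divr_ge0 ?exprn_ge0 ?cabs_ge0 // mulr_ge0 ?expR_ge0.
pose F (k : 'I_(size p)) x := p`_k * (wave z x * ofR ((u x ^+ m * (u x)^-1 ^+ k) * du x)).
have mg k : mf (fun x => u x ^+ m * (u x)^-1 ^+ k) := mfM (mf_uX m) (mf_uV k).
have sg k : subexp (fun v => v ^+ m * v^-1 ^+ k) := subexpM (@subexp_X m) (@subexp_V k).
have Fi k : citg D (F k) by apply: citgZ => //; have [] := citg_tint z0 (mg k) (sg k).
have E : (fun x => wave z x * ofR (u x ^+ m * du x) * p.[ofR (u x)^-1]) =
  fun x => \sum_(k <- index_enum 'I_(size p)) F k x.
  apply/funext => x; rewrite horner_coef mulr_sumr; apply: eq_bigr => k _.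
  by rewrite /F !ofRM !ofRX; ring.
rewrite E; have [i1 ->] := citg_sum (index_enum 'I_(size p)) mD Fi; split=> //.
rewrite (le_trans (cabs_sum _ _ _)) // /pnorm mulr_sumr; apply: ler_sum => k _.
rewrite cintZ //; last by have [] := citg_tint z0 (mg k) (sg k).
rewrite cabsM mulrCA ler_wpM2l ?cabs_ge0 //; apply: le_trans (tint_mono m k z0) _.
by rewrite ler_wpM2l // lerXn2r ?nnegrE // (le_trans Ui).
Qed.

Lemma tail_apx z r N f m : 0 < re z -> U^-1 <= r -> apx r N f ->
  citg D (fun x => wave z x * ofR (u x ^+ m * du x) * f (u x)^-1) /\
  cabs (cint D (fun x => wave z x * ofR (u x ^+ m * du x) * f (u x)^-1)) <=
  3 * (m`!%:R * expR (3 * (U * cabs z)) / cabs z ^+ m.+1) * N.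
Proof.
move=> z0 Ur [F [FN Ff]]; set B := 3 * _.
have B0 : 0 <= B by rewrite mulr_ge0 // divr_ge0 ?exprn_ge0 ?cabs_ge0 // mulr_ge0 ?expR_ge0.
have ur x : La <= x -> 0 < (u x)^-1 <= r.
  move=> xL; have u0 : 0 < u x by apply: lt_le_trans (u_ge1 xL).
  rewrite invr_gt0 u0 (le_trans _ Ur) // lef_pV2 ?posrE ?u_ge //.
  exact: lt_le_trans u1.
have H n := @tail_poly z r (F n) m z0 Ur.
apply: (citg_dct mD (fun n => (H n).1) _ (itgZ N mD (itg_subexp (mf_uX m) (@subexp_X m) z0))).
- move=> x; rewrite DE => xL; apply: cvgM; first exact: cvg_cst.
  exact: Ff (ur x xL).
- have key n (x : R) : La <= x -> cabs (wave z x * ofR (u x ^+ m * du x) * (F n).[ofR (u x)^-1])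
  <= N * (expR (- (re z * u x)) * (`|u x ^+ m| * du x)).
    move=> xL; rewrite mulrC cabsM ler_pM ?cabs_ge0 //.
      rewrite (le_trans (cabs_horner _ (_ : 0 <= (u x)^-1 <= r))) //.
      by have /andP[/ltW -> ->] := ur x xL.
    by rewrite cabsM cabs_wave cabs_ofR normrM (ger0_norm (du0 xL)) (mulrC (u x)).
  by move=> n x; rewrite DE; exact: key.
- by move=> n; rewrite (le_trans (H n).2) // ler_wpM2l.
Qed.

End TailIntegral.

Section AtInfinity.
Local Open Scope classical_set_scope.
Variable R : realType.
Local Notation C := (CC R).

(** The leading term kap u of h_k at infinity is the same for all wave numbers k; the rest is a
    power series in 1 / u, whose exponential can be absorbed into coefficients. *)
Lemma hk_inf (k kap : R) : 0 < kap -> exists2 g : R -> C, germ g &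
  near0 (fun x => ofR x * hk k (kap * (x^-1 + x)) = ofR kap + ofR x * g x).
Proof.
move=> kap0; pose K := 2 * Num.sqrt (3 * kap ^+ 2 + k ^+ 2).
have [] := @germ_div0 _ (fun x => ofR x * hk k (kap * (x^-1 + x)) - ofR kap) K.
- by apply: germD; [exact: germ_hk_inf | exact: germN (germ_cst (ofR kap))].
- exists 1 => // x /andP[x0 x1].
  have -> : ofR kap = rsqrt (kap ^+ 2) by rewrite rsqrt_ge0 ?sqr_ge0 // sqrtr_sqr ger0_norm //
    ltW.
  rewrite /hk -rsqrtM ?(ltW x0) //; apply: le_trans (rsqrt_holder _ _) _;
    rewrite /K -[leRHS]mulrA ler_pM2l //.
  have -> : Num.sqrt (3 * kap ^+ 2 + k ^+ 2) * x = Num.sqrt ((3 * kap ^+ 2 + k ^+ 2) * x ^+ 2).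
    rewrite sqrtrM; first by rewrite sqrtr_sqr ger0_norm // ltW.
    by apply: addr_ge0; [apply: mulr_ge0 => //; exact: sqr_ge0 | exact: sqr_ge0].
  apply: ler_wsqrtr.
  have -> : x ^+ 2 * ((kap * (x^-1 + x)) ^+ 2 - k ^+ 2) - kap ^+ 2 =
    (kap ^+ 2 * (2 + x ^+ 2) - k ^+ 2) * x ^+ 2.
    by field; rewrite gt_eqF.
  rewrite normrM (ger0_norm (sqr_ge0 x)) ler_wpM2r ?sqr_ge0 // (le_trans (ler_normB _ _)) //.
  rewrite normrM !(ger0_norm (sqr_ge0 _)) lerD2r mulrC ler_wpM2r ?sqr_ge0 //.
  rewrite ger0_norm ?addr_ge0 ?sqr_ge0 // -lerBrDl (_ : 3 - 2 = 1); last by ring.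
  by rewrite exprn_ile1 // ltW.
move=> g gg E; exists g => //; apply: near0_imp E => x Ex.
by rewrite -[LHS](subrK (ofR kap)) Ex addrC.
Qed.

Lemma near0_gt (kap M : R) : 0 < kap -> near0 (fun x => M < kap * (x^-1 + x)).
Proof.
move=> kap0; have d0 : 0 < kap / (`|M| + 1) by rewrite divr_gt0 // ltr_wpDl.
exists (kap / (`|M| + 1)) => // x /andP[x0 xd].
rewrite mulrDr (@lt_le_trans _ _ (kap / x)) ?lerDl ?mulr_ge0 ?(ltW x0) ?(ltW kap0) //.
have : `|M| + 1 <= kap / x.
  by rewrite ler_pdivlMr // -ler_pdivlMl ?ltr_wpDl // mulrC.
have := ler_norm M; lra.
Qed.

Variables (md : medium R) (s : nat) (star : mark) (t : nat) (a : mark) (b : nat).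
Hypotheses (wp : well_posed md s) (sn : (s <= nint md)%N) (tn : (t <= nint md)%N).
Hypotheses (star_ok : mark_ok md star s) (a_ok : mark_ok md a t) (bn : (b <= nint md)%N).
Local Notation sg := (sigma md s star t a).
Local Notation kap := (wavenum md b / 2).

(* With lam = kap (1/x + x): up to a factor x^n and an exponentially small error,
   sg is a finite sum of terms exp(- d / x) a(x), d >= 0, a a power series. *)
Definition inf_expansion (sg : R -> C) (kap : R) : Prop := forall B, 0 <= B -> exists n L K,
  [/\ all_germ L, all_ge 0 L & near0 (fun x =>
   cabs (ofR x ^+ n * sg (kap * (x^-1 + x)) - esum L x) <= K * expR (- B / x))].

Lemma sigma_inf : inf_expansion sg kap.
Proof.
move=> B B0; have kap0 : 0 < kap by rewrite divr_gt0 // ks_gt0.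
pose y x := kap * (x^-1 + x).
have [num [den [E HK]]] := sigma_frac star sn tn a_ok.
(* The h_t have a pole at x = 0, so the class must allow for a factor x^n. *)
pose KK (f : R -> C) := exists n, expsum (fun x => ofR x ^+ n * f x).
have KKc c : KK (fun=> c).
  by exists 0%N; apply: expsum_ext (expsum_germ (germ_cst c)); exists 1 => // x _;
    rewrite expr0 mul1r.
have KKup (f : R -> C) n m : expsum (fun x => ofR x ^+ n * f x) ->
  expsum (fun x => ofR x ^+ (m + n) * f x).
  move=> h; apply: expsum_ext (expsumM (expsum_germ (germX m (germ_id R))) h).
  by exists 1 => // x _; rewrite mulrA exprD.
have KKD f g : KK f -> KK g -> KK (fun x => f x + g x).
  move=> [n fn] [m gm]; exists (m + n)%N.
  apply: expsum_ext (expsumD (KKup _ _ m fn) (KKup _ _ n gm)).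
  by exists 1 => // x _; rewrite (addnC n m) mulrDr.
have KKM f g : KK f -> KK g -> KK (fun x => f x * g x).
  move=> [n fn] [m gm]; exists (n + m)%N; apply: expsum_ext (expsumM fn gm).
  by exists 1 => // x _; rewrite exprD; ring.
have [] := HK KK KKc KKD KKM (fun x => hreal md (y x)).
- move=> l _; exists 1%N; apply: expsum_germ; apply: germ_ext (germ_hk_inf (wavenum md l) kap0).
  by exists 1 => // x _; rewrite hrealE.
- move=> l _; set th := iface _ _ - _; exists 0%N.
  have [g gg Eg] := hk_inf (wavenum md l) kap0.
  apply: expsum_ext (expsum_term (kap * th) (germ_cexp (germN (germM gg (germ_cst (ofR th)))))).
  have [r r0 H] := Eg; exists r => // x xr; have /andP[x0 _] := xr.
  rewrite expr0 mul1r hrealE -cexp_ofR -cexpD; congr cexp.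
  have -> : hk (wavenum md l) (y x) = ofR (kap / x) + g x.
    apply: (@mulfI _ (ofR x)); first by rewrite ofR_eq0 gt_eqF.
    by rewrite H // mulrDr -ofRM mulrCA mulfV ?mulr1 // gt_eqF.
  have -> : - (kap * th) / x = - (kap / x * th) by ring.
  rewrite ofRN ofRM; ring.
move=> [n2 num2] [n1 den1].
have [M M0 HM] := finite_bounded (sing_finite wp star_ok).
have nsing : near0 (fun x => ~ sing md s star (y x)).
  by apply: near0_imp (near0_gt M kap0) => x hx /HM; rewrite ltNge => /negP; apply;
    rewrite (le_trans (ltW hx)) // ler_norm.
have [] := expsum_quotient B0 den1 num2.
- by apply: near0_imp nsing => x /E[].
- move=> e e0.
  have [_ _ _ gr] := wp.2 star t a star_ok tn a_ok.
  (* For x <= 1 one has lambda <= 2 kap / x, hence this exponent in the growth hypothesis. *)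
  have e'0 : 0 < e / (2 * kap) by rewrite divr_gt0 // mulr_gt0.
  have [K [N [_ HN]]] := gr _ e'0; exists `|K|.
  apply: near0_imp (near0_and (near0_and nsing (near0_gt N kap0)) (_ : near0 (fun x => 0 < x <=
    1))); last by exists 1.
  move=> x [[ns Nx] /andP[x0 x1]]; have [<- _] := E _ ns.
  apply: le_trans (HN _ Nx) _; apply: (@le_trans _ _ (`|K| * expR (e / (2 * kap) * y x))).
    by rewrite ler_wpM2r ?expR_ge0 // ler_norm.
  rewrite ler_wpM2l // ler_expR /y.
  have kb0 : wavenum md b != 0 by rewrite gt_eqF // ks_gt0.
  have -> : e / (2 * kap) * (kap * (x^-1 + x)) = e * ((x^-1 + x) / 2) by field;
    rewrite ?kb0 ?gt_eqF.
  rewrite ler_pM2l // ler_pdivrMr // mulr_natr mulr2n lerD2l.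
  by rewrite (le_trans x1) // invf_ge1.
move=> n [L [K [Lg L0 H]]]; exists n, L, K; split=> //.
by apply: near0_imp (near0_and nsing H) => x [/E[-> _]].
Qed.

End AtInfinity.

(** * Tail estimates uniform in the positions *)

Section TailBound.
Local Open Scope classical_set_scope.
Variable R : realType.
Local Notation C := (CC R).
Local Notation mu := (@lebesgue_measure R).
Local Notation MR := (measurableTypeR R).
Variables (k1 k2 k : R).
Hypothesis k0 : 0 < k.
Local Notation kap := (k / 2).

Definition kern (be be' X lam : R) : C :=
  cexp (- (hk k1 lam * ofR be) - hk k2 lam * ofR be' + Ci R * ofR (lam * X)).

(** The variable u = 1 / w of the overview for the wave number k, on lam > k; [duu] is its
    derivative there. *)
Definition uu (lam : R) : R := (lam + Num.sqrt (lam ^+ 2 - k ^+ 2)) / k.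
Definition duu (lam : R) : R := uu lam / Num.sqrt (lam ^+ 2 - k ^+ 2).

Lemma kap_gt0 : 0 < kap. Proof. by rewrite divr_gt0. Qed.

Lemma sqr_gap_gt0 lam : k < lam -> 0 < lam ^+ 2 - k ^+ 2.
Proof. by move=> kl; rewrite subr_gt0 ltrXn2r ?nnegrE ?(ltW k0) // ltW // (lt_trans k0). Qed.

Lemma uu_cont : continuous uu.
Proof.
move=> x; apply: cvgM; last exact: cvg_cst.
apply: cvgD; first exact: cvg_id.
apply: (continuous_comp (f := fun x : R => x ^+ 2 - k ^+ 2)); last exact: sqrt_continuous.
by apply: cvgB; [exact: exprn_continuous | exact: cvg_cst].
Qed.

Lemma is_derive_uu lam : k < lam -> is_derive lam 1 uu (duu lam).
Proof.
move=> kl; have g0 := sqr_gap_gt0 kl.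
have s0 : Num.sqrt (lam ^+ 2 - k ^+ 2) != 0 by rewrite gt_eqF // sqrtr_gt0.
have d1 : is_derive lam 1 (fun x : R => x ^+ 2 - k ^+ 2) (2 * lam).
  have := is_deriveB (is_derive_X 2 lam) (is_derive_cst (k ^+ 2) lam (1 : R)).
  by rewrite subr0 expr1.
have d2 := @is_derive1_comp R Num.sqrt (fun x : R => x ^+ 2 - k ^+ 2) lam _ _ (is_derive1_sqrt
  g0) d1.
have d3 := is_deriveZ k^-1 (is_deriveD (is_derive_id lam (1 : R)) d2).
rewrite (_ : uu = k^-1 \*: ((id : R -> R) + (Num.sqrt \o (fun x : R => x ^+ 2 - k ^+ 2)))).
  apply: is_derive_eq d3 _.
  rewrite /duu /uu /GRing.scale /=; field; rewrite s0 gt_eqF //.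
by apply/funext => x; rewrite /uu /= mulrC.
Qed.

Lemma duu_cont lam : k < lam -> {for lam, continuous duu}.
Proof.
move=> kl; apply: cvgM; first exact: uu_cont.
apply: cvgV; first by rewrite gt_eqF // sqrtr_gt0 sqr_gap_gt0.
apply: (continuous_comp (f := fun x : R => x ^+ 2 - k ^+ 2)); last exact: sqrt_continuous.
by apply: cvgB; [exact: exprn_continuous | exact: cvg_cst].
Qed.

Lemma mf_uu : mf uu. Proof. exact: mf_cont uu_cont. Qed.

Lemma mf_duu : mf duu.
Proof.
apply: mfM; first exact: mf_uu.
apply: mfV; apply: mf_cont => x; apply: (continuous_comp (f := fun x : R => x ^+ 2 - k ^+ 2));
  last exact: sqrt_continuous.
by apply: cvgB; [exact: exprn_continuous | exact: cvg_cst].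
Qed.

Lemma uu_gt0 lam : k < lam -> 0 < uu lam.
Proof. by move=> kl; rewrite divr_gt0 // ltr_wpDr ?sqrtr_ge0 // (lt_trans k0). Qed.

Lemma duu_ge0 lam : k < lam -> 0 <= duu lam.
Proof. by move=> kl; rewrite divr_ge0 ?sqrtr_ge0 // ltW // uu_gt0. Qed.

Lemma uu_mono lam lam' : 0 <= lam -> lam <= lam' -> uu lam <= uu lam'.
Proof.
move=> l0 ll; rewrite ler_pM2r ?invr_gt0 // lerD // ler_wsqrtr // lerD2r.
by rewrite lerXn2r ?nnegrE // (le_trans l0).
Qed.

Lemma uu_ge lam : lam / k <= uu lam.
Proof. by rewrite ler_pM2r ?invr_gt0 // lerDl sqrtr_ge0. Qed.

Lemma uu_ge1 lam : k < lam -> 1 <= uu lam.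
Proof. by move=> kl; apply: le_trans (uu_ge lam); rewrite ler_pdivlMr // mul1r ltW. Qed.

Lemma uu_y : uu x @[x --> +oo] --> +oo.
Proof.
apply/cvgryPge => A; exists (A * k); split; first exact: num_real.
move=> x Ax; apply: le_trans (uu_ge x); rewrite ler_pdivlMr // ltW //.
Qed.

Lemma uuV lam : k < lam -> (uu lam)^-1 = (lam - Num.sqrt (lam ^+ 2 - k ^+ 2)) / k.
Proof.
move=> kl; have g0 := sqr_gap_gt0 kl; set S := Num.sqrt _.
have hS : S ^+ 2 = lam ^+ 2 - k ^+ 2 by rewrite sqr_sqrtr // ltW.
have p : lam + S != 0 by rewrite gt_eqF // ltr_wpDr ?sqrtr_ge0 // (lt_trans k0).
have k0' : k != 0 by rewrite gt_eqF.
apply/eqP; rewrite /uu invf_div -/S eqr_div ?p ?k0' //; apply/eqP.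
have -> : (lam - S) * (lam + S) = lam ^+ 2 - S ^+ 2 by ring.
by rewrite hS; ring.
Qed.

Lemma uu_joukowski lam : k < lam -> kap * ((uu lam)^-1 ^-1 + (uu lam)^-1) = lam.
Proof. by move=> kl; rewrite invrK uuV // /uu; field; rewrite gt_eqF. Qed.

Lemma uu_diff lam : k < lam -> kap * (uu lam - (uu lam)^-1) = Num.sqrt (lam ^+ 2 - k ^+ 2).
Proof. by move=> kl; rewrite uuV // /uu; field; rewrite gt_eqF. Qed.

Lemma duuE lam : k < lam -> duu lam * (kap * (1 - (uu lam)^-1 ^+ 2)) = 1.
Proof.
move=> kl; have u0 : uu lam != 0 by rewrite gt_eqF // uu_gt0.
have s0 : Num.sqrt (lam ^+ 2 - k ^+ 2) != 0 by rewrite gt_eqF // sqrtr_gt0 sqr_gap_gt0.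
rewrite /duu mulrAC -(uu_diff kl) in s0 *.
have -> : uu lam * (kap * (1 - (uu lam)^-1 ^+ 2)) = kap * (uu lam - (uu lam)^-1) by field.
by rewrite mulfV.
Qed.

Lemma duu_ge lam : k < lam -> 1 <= kap * duu lam.
Proof.
move=> kl; have u0 := uu_gt0 kl; apply: (@le_trans _ _ (duu lam * (kap * (1 - (uu lam)^-1 ^+
  2)))); first by rewrite duuE.
rewrite mulrCA ler_wpM2l ?(ltW kap_gt0) //.
by rewrite -[leRHS]mulr1 ler_wpM2l ?duu_ge0 // gerDl oppr_le0 exprn_ge0 // invr_ge0 ltW.
Qed.

(* As lam -> +oo, kern be be' X lam decays like exp(- lam z) with z = zz be be' X. *)
Definition zz (be be' X : R) : C := cpx (be + be') (- X).

(* The factorial gain over the power of zz comes from integrating u^j exp(- c u z). *)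
Definition tailb (Bd : R) (n0 : nat) (f : R -> C) : Prop :=
  exists La0, forall La, La0 <= La -> forall zm, 0 < zm -> exists2 A : R, 0 <= A &
  forall be be' X (j l : nat), 0 <= be <= Bd -> 0 <= be' <= Bd -> `|X| <= Bd -> 0 < be + be' ->
    zm <= cabs (zz be be' X) ->
    let F lam := kern be be' X lam * ofR (uu lam ^+ j * (uu lam)^-1 ^+ l) * f lam in
    citg `[La, +oo[ F /\
    cabs (cint `[La, +oo[ F) <= A * ((j + n0)`!%:R / (kap * cabs (zz be be' X)) ^+ j).

Lemma tailb_ext Bd n0 f g M : (forall lam, M <= lam -> f lam = g lam) -> tailb Bd n0 f ->
  tailb Bd n0 g.
Proof.
move=> fg [La0 H]; exists (Num.max La0 M) => La; rewrite ge_max => /andP[h1 h2] zm zm0.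
have [A A0 HA] := H La h1 zm zm0; exists A => // be be' X j l b1 b2 b3 b4 b5.
have [i1 i2] := HA be be' X j l b1 b2 b3 b4 b5.
have E x : `[La, +oo[%classic x -> kern be be' X x * ofR (uu x ^+ j * (uu x)^-1 ^+ l) * f x =
    kern be be' X x * ofR (uu x ^+ j * (uu x)^-1 ^+ l) * g x.
  by rewrite /= in_itv /= andbT => xL; rewrite fg // (le_trans h2).
split; last by rewrite -(eq_cint E).
have [[e1 e2] [m1 m2]] := (i1, i1).
by split; [apply: eq_integrable e1 | apply: eq_integrable e2] => // x /set_mem /E /= ->.
Qed.

Lemma tailbD Bd n0 f g : tailb Bd n0 f -> tailb Bd n0 g -> tailb Bd n0 (fun x => f x + g x).
Proof.
move=> [L1 H1] [L2 H2]; exists (Num.max L1 L2) => La; rewrite ge_max => /andP[h1 h2] zm zm0.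
have [A A0 HA] := H1 La h1 zm zm0; have [B B0 HB] := H2 La h2 zm zm0.
exists (A + B) => [|be be' X j l b1 b2 b3 b4 b5]; first exact: addr_ge0.
have [i1 i2] := HA be be' X j l b1 b2 b3 b4 b5.
have [j1 j2] := HB be be' X j l b1 b2 b3 b4 b5.
have mD : measurable (`[La, +oo[ : set MR) by exact: measurable_itv.
rewrite (_ : (fun lam => _) = fun lam => kern be be' X lam * ofR (uu lam ^+ j * (uu lam)^-1 ^+
  l) * f lam +
   kern be be' X lam * ofR (uu lam ^+ j * (uu lam)^-1 ^+ l) * g lam); last by apply/funext => x;
     rewrite mulrDr.
split; first exact: citgD.
by rewrite cintD // (le_trans (cabsD _ _)) // mulrDl lerD.
Qed.

Lemma apx_min r r' N (f : R -> C) : 0 < r' -> r' <= r -> apx r N f -> apx r' N f.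
Proof. by move=> r0 rr; exact: apx_le. Qed.

Lemma apx_ge0 r N (f : R -> C) : 0 < r -> apx r N f -> 0 <= N.
Proof. by move=> r0 fN; apply: le_trans (cabs_ge0 (f r)) (apx_bound _ fN); rewrite r0 lexx. Qed.

Lemma cabs_shift (z : C) (d : R) : 0 <= re z -> 0 <= d -> cabs z <= cabs (z + ofR d).
Proof.
move=> z0 d0; rewrite /cabs ler_wsqrtr // reD imD /= addr0 lerD2r lerXn2r ?nnegrE ?addr_ge0 //.
by rewrite lerDl.
Qed.

Lemma zz_le Bd be be' X : 0 <= be <= Bd -> 0 <= be' <= Bd -> `|X| <= Bd ->
  cabs (zz be be' X) <= 3 * Bd.
Proof.
move=> /andP[? ?] /andP[? ?] ?; rewrite (le_trans (cabs_le _)) //= normrN ger0_norm; first lra.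
by apply: addr_ge0.
Qed.

(** By [hk_inf] the kernel is exp(- kap u zz) times a power series in 1 / u whose norm is bounded in
    terms of [Bd] only. The factor exp(- d u) joins the exponent, and w = kap zz + d has modulus at
    least kap |zz| because re zz and d are nonnegative. *)
Lemma tailb_term Bd n0 d (f : R -> C) : germ f -> 0 <= d -> 0 <= Bd ->
  tailb Bd n0 (fun lam => ofR (uu lam) ^+ n0 * (ofR (expR (- d * uu lam)) * f (uu lam)^-1)).
Proof.
move=> gf d0 Bd0.
(* The factor kap (1 - x^2) is dlam / du; it turns the integral over lam into one over u. *)
have gh : germ (fun x => ofR kap * (1 + - (ofR x * ofR x)) * f x).
  apply: (germM (germM (germ_cst (ofR kap)) (germD (germ_cst 1) (germN (germM (germ_id R)
    (germ_id R))))) gf).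
have [g1 [r1 [N1 [r10 a1]]] [s1 s10 E1]] := hk_inf k1 kap_gt0.
have [g2 [r2 [N2 [r20 a2]]] [s2 s20 E2]] := hk_inf k2 kap_gt0.
have [r3 [N3 [r30 a3]]] := gh.
pose r := Num.min (Num.min (Num.min r1 s1) (Num.min r2 s2)) (Num.min r3 1).
have r0 : 0 < r by rewrite !lt_min r10 s10 r20 s20 r30 ltr01.
have [[rr1 rs1 rr2 rs2 rr3] r_1] : [/\ r <= r1, r <= s1, r <= r2, r <= s2 & r <= r3] /\ r <= 1.
  by rewrite /r !ge_min !lexx ?orbT.
exists (Num.max (k + 1) (k / r)) => La; rewrite ge_max => /andP[La1 La2] zm zm0.
have kLa : k < La by apply: lt_le_trans La1; rewrite ltrDl.
have U1 := uu_ge1 kLa; set U := uu La in U1.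
have Ur : U^-1 <= r.
  rewrite -[r]invrK lef_pV2 ?posrE ?invr_gt0 //; last exact: lt_le_trans U1.
  by apply: le_trans (uu_ge La); rewrite ler_pdivlMr // mulrC.
have N10 := apx_ge0 r10 a1; have N20 := apx_ge0 r20 a2; have N30 := apx_ge0 r30 a3.
pose N := N3 * expR (N1 * Bd + N2 * Bd + kap * Bd).
have N0 : 0 <= N by rewrite mulr_ge0 ?expR_ge0.
have kz0 : 0 < kap * zm by rewrite mulr_gt0 ?kap_gt0.
exists (3 * (expR (3 * (U * (kap * (3 * Bd) + d))) / (kap * zm) ^+ n0.+1) * N).
  by rewrite mulr_ge0 // mulr_ge0 // divr_ge0 ?expR_ge0 ?exprn_ge0 // ltW.
move=> be be' X j l hbe hbe' hX hb hz F.
have /andP[be0 beB] := hbe; have /andP[be'0 be'B] := hbe'.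
pose w : C := ofR kap * zz be be' X + ofR d.
have rw : re w = kap * (be + be') + d by rewrite reD reM /= mul0r subr0.
have w0 : 0 < re w by rewrite rw ltr_wpDr // mulr_gt0 ?kap_gt0.
pose G (x : R) := cexp ((-1) * (g1 x * ofR be + g2 x * ofR be') + ofR (kap * X) * Ci R * ofR x).
have aG : apx r (expR (N1 * Bd + N2 * Bd + kap * Bd)) G.
  have r0' := ltW r0.
  apply: apx_exp => //.
  apply: (apx_le r0 (lexx r) _ (apxD r0' (apxM r0' (apx_cst r (-1)) (apxD r0'
     (apxM r0' (apx_min r0 rr1 a1) (apx_cst r (ofR be))) (apxM r0' (apx_min r0 rr2 a2) (apx_cst
       r (ofR be')))))
     (apxM r0' (apx_cst r (ofR (kap * X) * Ci R)) (apx_id r0')))).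
  rewrite cabsN cabs1 mul1r cabsM cabs_Ci mulr1 !cabs_ofR normrM (ger0_norm be0) (ger0_norm
    be'0) (ger0_norm (ltW kap_gt0)).
  rewrite lerD // ?lerD // ?ler_wpM2l //.
  have kp := ltW kap_gt0; rewrite -[leRHS]mulr1; apply: ler_pM => //; first exact: mulr_ge0.
  exact: ler_wpM2l.
have aH : apx r N (fun x => (ofR kap * (1 + - (ofR x * ofR x)) * f x) * G x * ofR x ^+ l).
  have r0' := ltW r0.
  apply: (apx_le r0 (lexx r) _ (apxM r0' (apxM r0' (apx_min r0 rr3 a3) aG) (apxX l r0' (apx_id
    r0')))).
  by rewrite -[leRHS]mulr1 ler_wpM2l // exprn_ile1.
have [] := tail_apx mf_uu mf_duu (fun x xL => is_derive_uu (lt_le_trans kLa xL)) (fun x xL =>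
  duu_cont (lt_le_trans kLa xL))
  (fun x xL => duu_ge0 (lt_le_trans kLa xL)) (fun x xL => uu_mono (ltW (lt_trans k0 kLa)) xL) U1
    uu_y (j + n0) w0 Ur aH.
pose F' x := wave uu w x * ofR (uu x ^+ (j + n0) * duu x) *
  (ofR kap * (1 + - (ofR (uu x)^-1 * ofR (uu x)^-1)) * f (uu x)^-1 * G (uu x)^-1 * ofR (uu x)^-1
    ^+ l).
rewrite -/F' => iF bF.
have FE x : La <= x -> F x = F' x.
  move=> xL; have kx := lt_le_trans kLa xL; have u0 := uu_gt0 kx; set v := (uu x)^-1.
  have v0 : 0 < v by rewrite invr_gt0.
  have vr : v <= r.
    by apply: le_trans Ur; rewrite lef_pV2 ?posrE // ?uu_mono // ?(ltW (lt_trans k0 kLa)) //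
      (lt_le_trans ltr01).
  have vx : kap * (v^-1 + v) = x := uu_joukowski kx.
  have hkE kk (g : R -> C) sr : (forall y, 0 < y <= sr ->
    ofR y * hk kk (kap * (y^-1 + y)) = ofR kap + ofR y * g y) ->
      r <= sr -> hk kk x = ofR (kap * uu x) + g v.
    move=> E rs; apply: (@mulfI _ (ofR v)); first by rewrite ofR_eq0 gt_eqF.
    rewrite -[in LHS]vx E ?v0 ?(le_trans vr) // mulrDr -ofRM; congr (ofR _ + _).
    by rewrite mulrCA /v mulVf ?mulr1 // gt_eqF.
  have KE : kern be be' X x * ofR (expR (- d * uu x)) = wave uu w x * G v.
    rewrite /kern /wave /G -cexp_ofR -!cexpD; congr cexp.
    rewrite (hkE _ _ _ E1 rs1) (hkE _ _ _ E2 rs2) -{3}vx /v invrK.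
    have -> : w = ofR kap * (ofR (be + be') - Ci R * ofR X) + ofR d.
      by apply: cx_ext; rewrite /w /zz ?reD ?imD ?reM ?imM /= ?reB ?imB ?reM ?imM /=; ring.
    by move: (uu x) (uu x)^-1 kap (g1 _) (g2 _) => u' v' K' G1 G2; rewrite !(ofRM, ofRN, ofRD);
      ring.
  have DE : ofR (duu x) * (ofR kap * (1 + - (ofR v * ofR v))) = 1.
    by rewrite -ofRM -ofR1 -ofRN -ofRD -!ofRM -expr2 duuE.
  have -> : F' x = (wave uu w x * G v) * (ofR (uu x ^+ (j + n0)) *
      (ofR (duu x) * (ofR kap * (1 + - (ofR v * ofR v)))) * (f v * ofR v ^+ l)).
    rewrite /F' -/v (ofRM (uu x ^+ (j + n0)) (duu x)).
    move: (wave _ _ _) (ofR (uu x ^+ _)) (ofR (duu x)) (ofR kap) => e1 e2 e3 e4; ring.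
  rewrite DE mulr1 -KE /F -/v exprD (ofRM (uu x ^+ j) (v ^+ l)) (ofRM (uu x ^+ j) (uu x ^+ n0))
    !ofRX.
  move: (kern _ _ _ _) (ofR (uu x)) => e1 e2; ring.
have FF x : `[La, +oo[%classic x -> F' x = F x by rewrite /= in_itv /= andbT => /FE.
split.
  by split; [apply: eq_integrable iF.1 | apply: eq_integrable iF.2] => // x /set_mem /FF /= ->.
rewrite -(eq_cint FF); apply: le_trans bF _.
have zB := zz_le hbe hbe' hX; set z := zz be be' X in hz zB *.
have cz : 0 < cabs z by apply: lt_le_trans hz.
have kz : 0 < kap * cabs z by rewrite mulr_gt0 ?kap_gt0.
have wz : kap * cabs z <= cabs w.
  rewrite -[kap]ger0_norm ?(ltW kap_gt0) // -cabs_ofR -cabsM; apply: cabs_shift => //.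
  by rewrite reM /= mul0r subr0 mulr_ge0 ?(ltW kap_gt0) // addr_ge0.
have wle : cabs w <= kap * (3 * Bd) + d.
  rewrite (le_trans (cabsD _ _)) // cabsM !cabs_ofR !ger0_norm ?(ltW kap_gt0) // lerD //
    ler_wpM2l ?(ltW kap_gt0) //.
have cw : 0 < cabs w by apply: lt_le_trans wz.
have U0 : 0 <= U by rewrite (le_trans ler01).
have -> : 3 * (expR (3 * (U * (kap * (3 * Bd) + d))) / (kap * zm) ^+ n0.+1) * N * ((j + n0)`!%:R
  / (kap * cabs z) ^+ j)
  = 3 * ((j + n0)`!%:R * expR (3 * (U * (kap * (3 * Bd) + d))) * ((kap * zm) ^+ n0.+1 * (kap *
    cabs z) ^+ j)^-1) * N.
  by rewrite invfM; ring.
rewrite ler_wpM2r // ler_wpM2l // ler_pM //; last 2 first.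
- by rewrite ler_wpM2l // ler_expR ler_wpM2l // ler_wpM2l.
- rewrite lef_pV2 ?posrE ?exprn_gt0 ?mulr_gt0 ?exprn_gt0 //.
  rewrite -addnS addnC exprD ler_pM ?exprn_ge0 ?(ltW kz0) ?(ltW kz) // lerXn2r ?nnegrE ?(ltW
    kz0) ?(ltW kz) ?(ltW cw) //.
  by apply: le_trans wz; rewrite ler_wpM2l ?(ltW kap_gt0).
by rewrite invr_ge0 exprn_ge0 // ltW.
Qed.

Lemma kern_le1 be be' X lam : 0 <= be -> 0 <= be' -> cabs (kern be be' X lam) <= 1.
Proof.
move=> b0 b0'; rewrite cabs_cexp -expR0 ler_expR !(reD, reN, reM) /= !mulr0 !mul0r !subr0 addr0.
have h1 := rsqrt_re_ge0 (lam ^+ 2 - k1 ^+ 2); have h2 := rsqrt_re_ge0 (lam ^+ 2 - k2 ^+ 2).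
by rewrite -opprD oppr_le0 addr_ge0 ?mulr_ge0.
Qed.

Lemma cmf_kern be be' X : cmf (kern be be' X).
Proof.
apply: cmf_cont; apply: ccont_cexp; apply: ccontD; first apply: ccontD.
- rewrite (_ : (fun x => _) = fun x => (- ofR be) * hk k1 x); last by apply/funext => x;
  rewrite mulrC mulNr.
  by apply: ccontM; [exact: ccont_cst | exact: ccont_hk].
- rewrite (_ : (fun x => _) = fun x => (- ofR be') * hk k2 x); last by apply/funext => x;
  rewrite mulrC mulNr.
  by apply: ccontM; [exact: ccont_cst | exact: ccont_hk].
apply: ccontM; first exact: ccont_cst.
by apply: ccont_ofR => x; apply: cvgM; [exact: cvg_id | exact: cvg_cst].
Qed.

(** An error of order exp(- B u) is harmless once B / 2 >= kap |zz|: half of the exponential yields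
    u^(j + n0) <= (j + n0)! (2 / B)^(j + n0) exp(B u / 2), and (2 / B)^j <= (kap |zz|)^-j. As |zz|
    <= 3 Bd, such a B can be fixed in advance. *)
Lemma tailb_approx Bd n0 (f T : R -> C) K B M : cmf f -> tailb Bd n0 T -> 0 <= Bd ->
  2 * (kap * (3 * Bd) + 1) <= B -> 0 <= K ->
  (forall lam, M <= lam -> cabs (f lam - T lam) <= K * (uu lam ^+ n0 * expR (- (B * uu lam)))) ->
  tailb Bd n0 f.
Proof.
move=> mff [L1 H1] Bd0 hB K0 hT; exists (Num.max L1 (Num.max M (k + 1))) => La.
rewrite !ge_max => /and3P[h1 h2 h3] zm zm0; have [A A0 HA] := H1 La h1 zm zm0.
have kLa : k < La by apply: lt_le_trans h3; rewrite ltrDl.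
have mD : measurable (`[La, +oo[ : set MR) by exact: measurable_itv.
have kp := kap_gt0.
have B1 : 1 <= B / 2 by rewrite ler_pdivlMr // mul1r (le_trans _ hB) // mulrDr mulr1 lerDr
  !mulr_ge0 // ltW.
have Bp : 0 < B / 2 by apply: lt_le_trans B1.
have ie := itg_exp mf_uu mf_duu (fun x xL => is_derive_uu (lt_le_trans kLa xL)) (fun x xL =>
  duu_cont (lt_le_trans kLa xL))
  (fun x xL => duu_ge0 (lt_le_trans kLa xL)) (fun x xL => uu_mono (ltW (lt_trans k0 kLa)) xL)
    (uu_ge1 kLa) uu_y Bp.
pose I := \int[mu]_(x in `[La, +oo[) (expR (- (B / 2 * uu x)) * duu x).
have I0 : 0 <= I.
  apply: Rintegral_ge0 => x; rewrite /= in_itv /= andbT => xL.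
  by rewrite mulr_ge0 ?expR_ge0 ?duu_ge0 // (lt_le_trans kLa).
exists (A + 2 * (K * kap * I)) => [|be be' X j l b1 b2 b3 b4 b5 F].
  by rewrite addr_ge0 ?mulr_ge0 // ltW.
have [i1 i2] := HA be be' X j l b1 b2 b3 b4 b5; move: i1 i2.
set FT := (fun lam => _ * T lam) => i1 i2.
have mF : cmf F.
  apply: cmfM => //; apply: cmfM; first exact: cmf_kern.
  apply: cmf_ofR; apply: mfM; first by apply: measurable_funX; exact: mf_uu.
  by apply: measurable_funX; apply: mfV; exact: mf_uu.
pose m := (j + n0)%N.
pose c := K * kap * (m`!%:R * (B / 2)^-1 ^+ m).
have key (x : R) : La <= x -> cabs (F x + (-1) * FT x) <= c * (expR (- (B / 2 * uu x)) * duu x).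
  move=> xL; have kx := lt_le_trans kLa xL; have u1 := uu_ge1 kx;
    have u0 : 0 <= uu x by rewrite (le_trans ler01).
  have -> : F x + (-1) * FT x = kern be be' X x * ofR (uu x ^+ j * (uu x)^-1 ^+ l) * (f x - T x).
    by rewrite /F /FT; ring.
  have ui : 0 <= (uu x)^-1 ^+ l <= 1.
    by rewrite exprn_ge0 ?invr_ge0 //= exprn_ile1 ?invr_ge0 // invf_le1 // (lt_le_trans ltr01).
  have /andP[ui0 ui1] := ui.
  have e1 : cabs (kern be be' X x * ofR (uu x ^+ j * (uu x)^-1 ^+ l)) <= uu x ^+ j.
    have p0 : 0 <= uu x ^+ j * (uu x)^-1 ^+ l by rewrite mulr_ge0 // exprn_ge0.
    rewrite cabsM cabs_ofR (ger0_norm p0); apply: (@le_trans _ _ (1 * (uu x ^+ j * 1)));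
      last by rewrite mul1r mulr1.
    apply: ler_pM; [exact: cabs_ge0 | exact: p0 | | by rewrite ler_wpM2l // exprn_ge0].
    by apply: kern_le1; [case/andP: b1 | case/andP: b2].
  rewrite cabsM; apply: le_trans (ler_pM (cabs_ge0 _) (cabs_ge0 _) e1 (hT x (le_trans h2 xL))) _.
  have -> : uu x ^+ j * (K * (uu x ^+ n0 * expR (- (B * uu x)))) =
    K * (uu x ^+ m * expR (- (B * uu x))).
    by rewrite /m exprD; ring.
  have -> : c * (expR (- (B / 2 * uu x)) * duu x) =
      K * ((m`!%:R * (B / 2)^-1 ^+ m * expR (- (B / 2 * uu x))) * (kap * duu x)) by rewrite /c;
        ring.
  rewrite ler_wpM2l //.
  have pw := pow_le_fact_exp m (mulr_ge0 (ltW Bp) u0).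
  have {}pw : uu x ^+ m <= m`!%:R * (B / 2)^-1 ^+ m * expR (B / 2 * uu x).
    by rewrite exprVn mulrAC ler_pdivlMr ?exprn_gt0 // mulrC -exprMn.
  apply: le_trans (ler_wpM2r (expR_ge0 _) pw) _.
  rewrite -[X in X <= _]mulrA -expRD (_ : B / 2 * uu x - B * uu x = - (B / 2 * uu x));
    last by field.
  by rewrite -[leLHS]mulr1 ler_wpM2l ?duu_ge // !mulr_ge0 ?expR_ge0 ?exprn_ge0 // invr_ge0 ltW.
have ir : citg `[La, +oo[ (fun x => F x + (-1) * FT x) /\
    cabs (cint `[La, +oo[ (fun x => F x + (-1) * FT x)) <= 2 * (c * I).
  have iT : citg `[La, +oo[ (fun x => (-1) * FT x) by exact: citgZ.
  have [] := @citg_le_dom _ `[La, +oo[ (fun x => F x + (-1) * FT x) (fun x => c * (expR (- (B /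
    2 * uu x)) * duu x)) mD.
  - rewrite (_ : (fun x => _) = fun x => re (F x) + re ((-1) * FT x));
    last by apply/funext => x; rewrite reD.
    apply: measurable_funD; first by apply: measurable_funTS; exact: mF.1.
    exact: itg_measurable iT.1.
  - rewrite (_ : (fun x => _) = fun x => im (F x) + im ((-1) * FT x));
    last by apply/funext => x; rewrite imD.
    apply: measurable_funD; first by apply: measurable_funTS; exact: mF.2.
    exact: itg_measurable iT.2.
  - exact: itgZ.
  - by move=> x; rewrite /= in_itv /= andbT; exact: key.
  by move=> i3; rewrite RintegralZl.
have [j1 j2] := ir.
have FE : F = fun x => FT x + (F x + (-1) * FT x) by apply/funext => x;
  rewrite mulN1r addrC subrK.
rewrite FE; split; first exact: citgD.
rewrite cintD // (le_trans (cabsD _ _)) // mulrDl lerD // (le_trans j2) //.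
have zB := zz_le b1 b2 b3; set z := zz be be' X in b5 zB *.
have cz : 0 < cabs z by apply: lt_le_trans b5.
have -> : 2 * (c * I) = (2 * (K * kap * I)) * (m`!%:R * (B / 2)^-1 ^+ m) by rewrite /c; ring.
have cKI : 0 <= 2 * (K * kap * I) by rewrite !mulr_ge0 // ltW.
apply: (ler_wpM2l cKI); rewrite ler_wpM2l //.
have Bi : 0 <= (B / 2)^-1 <= 1 by rewrite invr_ge0 (ltW Bp) invf_le1.
have /andP[Bi0 Bi1] := Bi.
apply: (@le_trans _ _ ((B / 2)^-1 ^+ j)).
  by rewrite /m exprD -[leRHS]mulr1 ler_wpM2l ?exprn_ge0 // exprn_ile1.
have kz : 0 < kap * cabs z by exact: mulr_gt0.
rewrite -exprVn; apply: lerXn2r; rewrite ?nnegrE // ?invr_ge0 ?(ltW kz) // lef_pV2 ?posrE //.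
by rewrite ler_pdivlMr // mulrC (le_trans _ hB) // ler_wpM2l // (le_trans (ler_wpM2l (ltW kp)
  zB)) // lerDl ler01.
Qed.

Lemma tailb_esum Bd n0 L : all_germ L -> all_ge 0 L -> 0 <= Bd ->
  tailb Bd n0 (fun lam => ofR (uu lam) ^+ n0 * esum L (uu lam)^-1).
Proof.
move=> + + Bd0; elim: L => [_ _|[d f] L IH /= [fg Lg] [d0 L0]].
  apply: (@tailb_ext _ _ _ _ 0 _ (tailb_term n0 (germ_cst 0) (lexx 0) Bd0)) => lam _.
  by rewrite esum_nil !mulr0.
apply: (@tailb_ext _ _ _ _ 0 _ (tailbD (tailb_term n0 fg d0 Bd0) (IH Lg L0))) => lam _.
by rewrite esum_cons /= mulrDr invrK.
Qed.

(** [Q] will be the factor (i / w_t)^m, in either direction; its growth like a power of u at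
    infinity is taken into [n0]. *)
Lemma tail_bound Bd (sg Q : R -> C) (qn : nat) : 0 <= Bd -> cmf sg -> cmf Q ->
  inf_expansion sg kap -> germ (fun x => ofR x ^+ qn * Q (kap * (x^-1 + x))) ->
  exists n0, tailb Bd n0 (fun lam => Q lam * sg lam).
Proof.
move=> Bd0 msg mQ hsg gQ.
have B0 : 0 <= 2 * (kap * (3 * Bd) + 1) by rewrite mulr_ge0 // addr_ge0 // !mulr_ge0 // ltW //
  kap_gt0.
have [n [L [K [Lg L0 HL]]]] := hsg _ B0.
have [NQ NQ0 bQ] := germ_bound gQ.
pose q x := ofR x ^+ qn * Q (kap * (x^-1 + x)).
exists (qn + n)%N.
have [r r0 H] := near0_and HL bQ.
have LQg : all_germ (eterm_mul (0, q) L) := all_germ_mul (p := (0, q)) gQ Lg.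
have LQ0 : all_ge 0 (eterm_mul (0, q) L) by have := all_ge_mul (0, q) L0; rewrite /= addr0.
apply: (tailb_approx (K := NQ * `|K|) (M := Num.max (k + 1) (k / r)) (cmfM mQ msg) (tailb_esum
  (qn + n) LQg LQ0 Bd0) Bd0 (lexx _)).
  by rewrite mulr_ge0.
move=> lam; rewrite ge_max => /andP[l1 l2]; have kl : k < lam by apply: lt_le_trans l1;
  rewrite ltrDl.
have u0 := uu_gt0 kl; set v := (uu lam)^-1.
have v0 : 0 < v by rewrite invr_gt0.
have vr : v <= r.
  rewrite -[r]invrK lef_pV2 ?posrE ?invr_gt0 //.
  by apply: le_trans (uu_ge lam); rewrite ler_pdivlMr // mulrC.
have vx : kap * (v^-1 + v) = lam := uu_joukowski kl.
have [] := H v; first by rewrite v0.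
rewrite vx => e1 e2.
have uv : ofR (uu lam) * ofR v = 1 by rewrite -ofRM mulfV // gt_eqF.
have -> : Q lam * sg lam - ofR (uu lam) ^+ (qn + n) * esum (eterm_mul (0, q) L) v =
   ofR (uu lam) ^+ (qn + n) * ((ofR v ^+ qn * Q lam) * (ofR v ^+ n * sg lam - esum L v)).
  have un m : ofR (uu lam) ^+ m * ofR v ^+ m = 1 by rewrite -exprMn uv expr1n.
  rewrite esum_mul /= oppr0 mul0r expR0 mul1r /q vx.
  have E : ofR (uu lam) ^+ (qn + n) * (ofR v ^+ qn * Q lam * (ofR v ^+ n * sg lam)) =
    Q lam * sg lam.
    transitivity ((ofR (uu lam) ^+ qn * ofR v ^+ qn) * (ofR (uu lam) ^+ n * ofR v ^+ n) * (Q lam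
      * sg lam)).
      by rewrite exprD; move: (ofR (uu lam)) => e3; ring.
    by rewrite !un !mul1r.
  by rewrite mulrBr mulrBr E.
have -> : NQ * `|K| * (uu lam ^+ (qn + n) * expR (- (2 * (kap * (3 * Bd) + 1) * uu lam))) =
  uu lam ^+ (qn + n) * (NQ * (`|K| * expR (- (2 * (kap * (3 * Bd) + 1) * uu lam)))) by ring.
rewrite cabsM cabsX cabs_ofR (ger0_norm (ltW u0)) ler_wpM2l ?exprn_ge0 ?(ltW u0) //.
rewrite cabsM; apply: ler_pM; rewrite ?cabs_ge0 //; apply: le_trans e1 _.
by rewrite /v mulNr invrK ler_wpM2r ?expR_ge0 // ler_norm.
Qed.
End TailBound.

(** * Bessel functions and the truncated expansion *)

Section Bessel.
Local Open Scope classical_set_scope.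
Variable R : realType.
Implicit Types (x y : R) (n : nat).

Definition bcoef n (j : nat) : R := (-1) ^+ j / (j`! * (j + n)`!)%:R.
(** J_n(x) = (x / 2)^n bser n ((x / 2)^2). In this variable the derivative of [bser n] is - bser (n
    + 1), and the recurrence of J_n is an identity between coefficients. *)
Definition bser n y : R := limn (pseries (bcoef n) y).

Lemma factR_gt0 n : 0 < n`!%:R :> R. Proof. by rewrite ltr0n fact_gt0. Qed.
Lemma factR_neq0 n : n`!%:R != 0 :> R. Proof. by rewrite gt_eqF ?factR_gt0. Qed.

Lemma bcoef_bound n j y : `|bcoef n j * y ^+ j| <= n`!%:R^-1 * exp_coeff `|y| j.
Proof.
rewrite /bcoef /exp_coeff /= !normrM normfV normrX normrN1 expr1n mul1r normrX normr_nat natrM.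
rewrite mulrCA [leLHS]mulrC ler_wpM2l ?exprn_ge0 // invfM mulrC ler_wpM2r ?invr_ge0 //.
rewrite lef_pV2 ?posrE ?factR_gt0 // ler_nat; elim: j => // j IH.
by rewrite addSn factS (leq_trans IH) // leq_pmull.
Qed.

Lemma is_cvg_bser_norm n y : cvgn [normed series (fun j => bcoef n j * y ^+ j)].
Proof.
apply: (@series_le_cvg _ _ (fun j => n`!%:R^-1 * exp_coeff `|y| j)).
- by move=> j; exact: normr_ge0.
- by move=> j; rewrite mulr_ge0 ?invr_ge0 // exp_coeff_ge0.
- by move=> j; exact: bcoef_bound.
- exact: is_cvg_seriesZ (is_cvg_series_exp_coeff _).
Qed.

Lemma is_cvg_bser n y : cvgn (pseries (bcoef n) y).
Proof. by apply: normed_cvg; exact: is_cvg_bser_norm. Qed.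

Lemma bser_bound n y : `|bser n y| <= n`!%:R^-1 * expR `|y|.
Proof.
apply: le_trans (lim_series_norm (@is_cvg_bser_norm n y)) _.
have -> : n`!%:R^-1 * expR `|y| = limn (series (fun j => n`!%:R^-1 * exp_coeff `|y| j)).
  by rewrite lim_seriesZ //; exact: is_cvg_series_exp_coeff.
apply: lim_series_le => [||j]; last exact: bcoef_bound.
- exact: is_cvg_bser_norm.
- exact: is_cvg_seriesZ (is_cvg_series_exp_coeff _).
Qed.

Lemma bcoef_diffs n : pseries_diffs (bcoef n) = fun j => - bcoef n.+1 j.
Proof.
apply/funext => j; rewrite /pseries_diffs /bcoef exprS addnS addSn (factS j).
rewrite (natrM _ (j.+1 * j`!) (j + n).+1`!) (natrM _ j.+1 j`!) (natrM _ j`! (j + n).+1`!).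
have j0 : j.+1%:R != 0 :> R by rewrite pnatr_eq0.
move: (factR_neq0 j) (factR_neq0 (j + n).+1); move: j0.
by move: (j.+1%:R) (j`!%:R) ((j + n).+1`!%:R) => a b c a0 b0 c0; field; rewrite a0 b0 c0.
Qed.

Lemma pseriesN (c : R ^nat) y : pseries (fun j => - c j) y = - pseries c y.
Proof.
by apply/funext => N; rewrite /pseries /series /= fctE -sumrN; apply: eq_bigr => j _;
  rewrite mulNr.
Qed.

Lemma is_derive_bser n y : is_derive y 1 (bser n) (- bser n.+1 y).
Proof.
have E c : pseries_diffs (fun j => - c j) = fun j : nat => - pseries_diffs c j :> R.
  by apply/funext => j; rewrite /pseries_diffs mulrN.
have -> : - bser n.+1 y = limn (pseries (pseries_diffs (bcoef n)) y).
  by rewrite bcoef_diffs pseriesN limN //; exact: is_cvg_bser.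
apply: (@pseries_snd_diffs _ _ (`|y| + 1)).
- exact: is_cvg_bser.
- by rewrite bcoef_diffs pseriesN; apply: is_cvgN; exact: is_cvg_bser.
- rewrite bcoef_diffs E bcoef_diffs.
  rewrite (_ : (fun j => _) = bcoef n.+2); first exact: is_cvg_bser.
  by apply/funext => j; rewrite opprK.
- by rewrite [ltRHS]ger0_norm ?addr_ge0 // ltrDl.
Qed.

Lemma bser_rec n y : bser n y = n.+1%:R * bser n.+1 y - y * bser n.+2 y.
Proof.
have H (N : nat) : pseries (bcoef n) y N.+1 = n.+1%:R * pseries (bcoef n.+1) y N.+1 - y *
  pseries (bcoef n.+2) y N.
  rewrite /pseries /series /= !big_nat_recl // mulrDr !mulr_sumr -addrA -sumrB; congr (_ + _).
    rewrite /bcoef !expr0 !mulr1 !add0n !fact0 !mul1n factS natrM.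
    by field; rewrite factR_neq0 /= addrC natr1 pnatr_eq0.
  apply: eq_bigr => j _; rewrite /bcoef !addnS !addSn !factS !natrM !exprS.
  have nz m : m.+1%:R != 0 :> R by rewrite pnatr_eq0.
  have e : (j + n).+2%:R = j.+1%:R + n.+1%:R :> R by rewrite -natrD addSn addnS.
  move: (nz (j + n).+1) (nz j) (nz (j + n)%N) (factR_neq0 j) (factR_neq0 (j + n)); rewrite e.
  move: (j.+1%:R) (n.+1%:R) ((j + n).+1%:R) (j`!%:R) ((j + n)`!%:R) => a b c d f ab0 a0 c0 d0 f0.
  by field; rewrite a0 ab0 c0 d0 f0.
have c0 : pseries (bcoef n) y @ \oo --> bser n y := is_cvg_bser (n := n) (y := y).
have c1 : pseries (bcoef n.+1) y @ \oo --> bser n.+1 y := is_cvg_bser (n := n.+1) (y := y).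
have c2 : pseries (bcoef n.+2) y @ \oo --> bser n.+2 y := is_cvg_bser (n := n.+2) (y := y).
have d0 : (fun N => pseries (bcoef n) y N.+1) @ \oo --> bser n y by rewrite cvg_shiftS.
have d1 : (fun N => pseries (bcoef n.+1) y N.+1) @ \oo --> bser n.+1 y by rewrite cvg_shiftS.
apply: (cvg_unique _ d0) => //.
rewrite (_ : (fun N => _) = fun N => n.+1%:R * pseries (bcoef n.+1) y N.+1 - y * pseries (bcoef
  n.+2) y N); last first.
  by apply/funext => N; rewrite H.
by apply: cvgB; apply: cvgM => //; exact: cvg_cst.
Qed.

Lemma bessel_natE n x : bessel_nat n x = (x / 2) ^+ n * bser n ((x / 2) ^+ 2).
Proof.
rewrite /bessel_nat; apply: cvg_lim => //.
have c : pseries (bcoef n) ((x / 2) ^+ 2) @ \oo --> bser n ((x / 2) ^+ 2) := is_cvg_bser (n :=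
  n) (y := (x / 2) ^+ 2).
rewrite (_ : series _ = fun N => (x / 2) ^+ n * pseries (bcoef n) ((x / 2) ^+ 2) N).
  by apply: cvgM => //; exact: cvg_cst.
apply/funext => N; rewrite /pseries /series /= mulr_sumr; apply: eq_bigr => j _.
by rewrite /bcoef exprD exprM; ring.
Qed.

Lemma bessel_nat_bound n x : `|bessel_nat n x| <= (`|x| / 2) ^+ n / n`!%:R * expR ((x / 2) ^+ 2).
Proof.
rewrite bessel_natE normrM normrX normrM normfV (ger0_norm (ler0n R 2)) -mulrA.
rewrite ler_wpM2l ?exprn_ge0 ?divr_ge0 //.
by have := bser_bound n ((x / 2) ^+ 2); rewrite (ger0_norm (sqr_ge0 (x / 2))).
Qed.

Lemma is_derive_bser_sqr n x : is_derive x 1 (fun x => bser n ((x / 2) ^+ 2)) (- bser n.+1 ((x /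
  2) ^+ 2) * (x / 2)).
Proof.
have d1 : is_derive x 1 (fun x : R => (x / 2) ^+ 2) (x / 2).
  have d2 := is_deriveZ (2^-1 ^+ 2) (is_derive_X 2 x).
  rewrite (_ : (fun x : R => (x / 2) ^+ 2) = 2^-1 ^+ 2 \*: ((fun v : R => v ^+ 2) : R -> R));
    last first.
    by apply/funext => v; rewrite /GRing.scale /= exprMn mulrC.
  by apply: is_derive_eq d2 _; rewrite /GRing.scale /= expr1; field.
exact: is_derive1_comp (is_derive_bser n _) d1.
Qed.

Lemma is_derive_bessel_nat n x : is_derive x 1 (bessel_nat n)
  (n%:R / 2 * (x / 2) ^+ n.-1 * bser n ((x / 2) ^+ 2) - (x / 2) ^+ n.+1 * bser n.+1 ((x / 2) ^+
    2)).
Proof.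
have d1 : is_derive x 1 (fun x : R => (x / 2) ^+ n) (n%:R / 2 * (x / 2) ^+ n.-1).
  have d0 : is_derive x 1 (fun x : R => x / 2) 2^-1.
    have := is_deriveZ (2^-1) (is_derive_id x (1 : R)); rewrite /GRing.scale /= mulr1.
    by rewrite (_ : 2^-1 \*: id = fun x : R => x / 2) //; apply/funext => v;
      rewrite /GRing.scale /= mulrC.
  apply: is_derive_eq (@is_derive1_comp R (fun v => v ^+ n) (fun v => v / 2) x _ _ (is_derive_X
    n (x / 2)) d0) _.
  by rewrite /= mulrAC.
rewrite (_ : bessel_nat n = (fun x : R => (x / 2) ^+ n) * (fun x => bser n ((x / 2) ^+ 2)));
  last first.
  by apply/funext => v; rewrite bessel_natE.
apply: is_derive_eq (is_deriveM d1 (is_derive_bser_sqr n x)) _.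
by rewrite /GRing.scale /= (exprS (x / 2) n); move: (bser n _) (bser n.+1 _) => b1 b2; ring.
Qed.

Lemma bessel_natN n x : besselJ (- n%:Z) x = (-1) ^+ n * bessel_nat n x.
Proof. by case: n => [|n]; rewrite ?oppr0 ?expr0 ?mul1r. Qed.

Lemma is_derive_besselJ (p : int) x :
  is_derive x 1 (besselJ p) ((besselJ (p - 1) x - besselJ (p + 1) x) / 2).
Proof.
have S n : n.+1%:R / 2 * (x / 2) ^+ n * bser n.+1 ((x / 2) ^+ 2) - (x / 2) ^+ n.+2 * bser n.+2
  ((x / 2) ^+ 2)
    = (bessel_nat n x - bessel_nat n.+2 x) / 2.
  rewrite !bessel_natE (bser_rec n).
  by move: (bser n.+1 _) (bser n.+2 _) => b1 b2; rewrite !exprS; field.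
case: p => [[|n]|n].
- apply: is_derive_eq (is_derive_bessel_nat 0 x) _.
  have -> : besselJ (0%N%:Z - 1) x = - bessel_nat 1 x by rewrite sub0r (bessel_natN 1) expr1
    mulN1r.
  have -> : besselJ (0%N%:Z + 1) x = bessel_nat 1 x by rewrite add0r.
  by rewrite !mul0r sub0r bessel_natE expr1; move: (bser 1 _) => b1; field.
- rewrite (_ : n.+1%:Z - 1 = n%:Z); last by rewrite -addn1 PoszD addrK.
  rewrite (_ : n.+1%:Z + 1 = n.+2%:Z); last by rewrite -PoszD addn1.
  by apply: is_derive_eq (is_derive_bessel_nat n.+1 x) _; rewrite S.
rewrite NegzE (_ : - n.+1%:Z - 1 = - n.+2%:Z); last by rewrite -opprD -PoszD addn1.
rewrite (_ : - n.+1%:Z + 1 = - n%:Z); last by rewrite -addn1 PoszD opprD addrNK.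
rewrite (_ : besselJ (- n.+1%:Z) = (-1) ^+ n.+1 \*: bessel_nat n.+1); last by apply/funext => v;
  rewrite bessel_natN.
apply: is_derive_eq (is_deriveZ ((-1) ^+ n.+1) (is_derive_bessel_nat n.+1 x)) _.
by rewrite /GRing.scale /= S !bessel_natN !exprS; field.
Qed.

Lemma besselJ_bound (p : int) x : `|besselJ p x| <= (`|x| / 2) ^+ `|p|%N / `|p|%N`!%:R * expR
  ((x / 2) ^+ 2).
Proof.
case: p => n; first exact: bessel_nat_bound.
by rewrite NegzE bessel_natN normrM normrX normrN1 expr1n mul1r abszN; exact: bessel_nat_bound.
Qed.

Lemma besselJ0 (p : int) : besselJ p 0 = (p == 0)%:R :> R.
Proof.
have b n : bessel_nat n 0 = (n == 0%N)%:R :> R.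
  rewrite bessel_natE mul0r !expr0n /=; case: n => [|n]; last by rewrite mul0r.
  rewrite mul1r /bser; apply: cvg_lim => //; apply: cvg_near_cst.
  exists 1%N => // N /= N1; case: N N1 => // N _.
  rewrite /pseries /series /= big_nat_recl // big1 ?addr0; last by move=> j _;
    rewrite expr0n /= mulr0.
  by rewrite /bcoef !expr0 addn0 fact0 mul1r muln1 invr1 mulr1.
by case: p => [n|n]; rewrite /= ?b // mulr0.
Qed.

End Bessel.

Section Remainder.
Local Open Scope classical_set_scope.
Variable R : realType.
Local Notation C := (CC R).
Local Notation mu := (@lebesgue_measure R).
Local Notation MR := (measurableTypeR R).

Lemma zsum1 (F : int -> C) : zsum 1 F = F 0.
Proof. by rewrite /zsum big_geq // addr0. Qed.

Lemma zsumS P (F : int -> C) : zsum P.+2 F = zsum P.+1 F + (F P.+1%:Z + F (- P.+1%:Z)).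
Proof. by rewrite /zsum big_nat_recr //= addrA. Qed.

Lemma zsum_ext P (F G : int -> C) : (forall p, F p = G p) -> zsum P F = zsum P G.
Proof. by move=> FG; congr zsum; apply/funext. Qed.

Lemma zsumMl P c (F : int -> C) : zsum P (fun p => c * F p) = c * zsum P F.
Proof. by rewrite /zsum mulrDr mulr_sumr; congr (_ + _); apply: eq_bigr => i _;
  rewrite mulrDr. Qed.

Lemma zsumD P (F G : int -> C) : zsum P (fun p => F p + G p) = zsum P F + zsum P G.
Proof. by rewrite /zsum addrACA -big_split /=; congr (_ + _); apply: eq_bigr => i _;
  rewrite addrACA. Qed.

Lemma zsum_telescope P (f : int -> C) : zsum P.+1 (fun p => f p - f (p + 1)) =
  f (- P%:Z) - f (P.+1%:Z).
Proof.
elim: P => [|P IH]; first by rewrite zsum1 oppr0 add0r.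
rewrite zsumS IH (_ : - P.+1%:Z + 1 = - P%:Z); last by rewrite -addn1 PoszD opprD addrNK.
rewrite (_ : P.+1%:Z + 1 = P.+2%:Z); last by rewrite -PoszD addn1.
by ring.
Qed.

Lemma cderiv_zsum P (F : int -> R -> C) (d : int -> C) x : (forall p, cderiv (F p) x (d p)) ->
  cderiv (fun t => zsum P (fun p => F p t)) x (zsum P d).
Proof.
move=> Fd; apply: (cderivD (Fd 0)); apply: cderiv_sum => i.
exact: cderivD.
Qed.

Lemma zsum_delta P (m : int) : (`|m| < P)%N -> zsum P (fun p => (p == m)%:R : C) = 1.
Proof.
case: P => // P; elim: P m => [|P IH] m.
  by rewrite ltnS leqn0 absz_eq0 zsum1 => /eqP ->.
rewrite ltnS leq_eqVlt => /orP[/eqP mP|mP].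
  have z0 : zsum P.+1 (fun p => (p == m)%:R : C) = 0.
    rewrite /zsum; have -> : (0 == m) = false by apply/negbTE; rewrite eq_sym -absz_eq0 mP.
    rewrite add0r big_nat big1 // => i /andP[i1 iP].
    have ne p : `|p|%N = i -> (p == m) = false.
      by move=> pi; apply/eqP => pm; move: iP; rewrite -pi pm mP ltnn.
    by rewrite !ne ?abszN ?addr0.
  rewrite zsumS z0 add0r; have [mm|mm] : m = P.+1%:Z \/ m = - P.+1%:Z.
    by case: (m) mP => n /= <-; [left | right; rewrite NegzE].
  - by rewrite mm eqxx (_ : (_ == _) = false) ?addr0.
  - by rewrite mm eqxx (_ : (_ == _) = false) ?add0r.
have n1 : (P.+1%:Z == m) = false by apply/eqP => h; move: mP; rewrite -h ltnn.
have n2 : (- P.+1%:Z == m) = false by apply/eqP => h; move: mP; rewrite -h abszN ltnn.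
by rewrite zsumS (IH _ mP) n1 n2 !addr0.
Qed.

(* The generating function of the J_p is exp((c / 2) (Z - 1 / Z)); by the
   recurrence of J_p' the sum over p telescopes. *)
Lemma cderiv_remainder (Z : C) (c : R) (m : int) (P : nat) (s : R) : Z != 0 ->
  let S := ofR (c / 2) * (Z - Z^-1) in
  let A := - P.+1%:Z - m in let B := P.+1%:Z - m in
  let J p := ofR (besselJ p (c * s)) in
  cderiv (fun s => cexp (ofR (1 - s) * S) * zsum P.+1 (fun p => ofR (besselJ (p - m) (c * s)) *
    Z ^ (p - m))) s
    (cexp (ofR (1 - s) * S) * (ofR (c / 2) *
      (J A * Z ^ (A + 1) + J (A + 1) * Z ^ A - J (B - 1) * Z ^ B - J B * Z ^ (B - 1)))).
Proof.
move=> Z0 S A B J.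
have d1 : cderiv (fun s => ofR (1 - s) * S) s (- S).
  have d0 : is_derive s 1 (fun s : R => 1 - s) (- 1).
    have := is_deriveB (is_derive_cst (1 : R) s (1 : R)) (is_derive_id s (1 : R));
      rewrite sub0r //.
  apply: cderiv_eq (cderivM (cderiv_ofR d0) (cderiv_cst S s)) _.
  by rewrite mulr0 addr0 ofRN ofR1 mulN1r.
have dJ p : cderiv (fun s => ofR (besselJ p (c * s))) s (ofR (c / 2) * (J (p - 1) - J (p + 1))).
  have d0 : is_derive s 1 (fun s : R => c * s) c.
    by have := is_deriveZ c (is_derive_id s (1 : R)); rewrite /GRing.scale /= mulr1.
  apply: cderiv_eq (cderiv_ofR (@is_derive1_comp R (besselJ p) (fun s => c * s) s _ _
    (is_derive_besselJ p (c * s)) d0)) _.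
  by rewrite /J -ofRB -ofRM; congr ofR; field.
have dT := @cderiv_zsum P.+1 (fun p s => ofR (besselJ (p - m) (c * s)) * Z ^ (p - m)) _ s
  (fun p => cderivM (dJ (p - m)) (cderiv_cst (Z ^ (p - m)) s)).
apply: cderiv_eq (cderivM (cderiv_cexp d1) dT) _.
set E := cexp _; set T := zsum _ _; set T' := zsum _ _.
have -> : - S * E * T + E * T' = E * (T' - S * T) by ring.
congr (E * _).
have Zs q : Z ^ (q + 1) = Z ^ q * Z by rewrite expfzDr // expr1z.
have Zp q : Z ^ (q - 1) = Z ^ q / Z by rewrite expfzDr // exprN1.
pose f p := J (p - m - 1) * Z ^ (p - m) + J (p - m) * Z ^ (p - m - 1).
have -> : T' - S * T = ofR (c / 2) * zsum P.+1 (fun p => f p - f (p + 1)).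
  rewrite -mulNr /T /T' -!zsumMl -zsumD; apply: zsum_ext => p.
  rewrite /f /S -/(J _) (_ : p + 1 - m - 1 = p - m); last by ring.
  rewrite (_ : p + 1 - m = p - m + 1); last by ring.
  rewrite Zs Zp; set z := Z ^ _; set a := J (_ - 1); set b := J (_ + 1); set e := J _.
  by move: z a b e => z a b e; field.
rewrite (zsum_telescope P f); congr (_ * _).
rewrite /f (_ : - P%:Z - m - 1 = A); last by rewrite /A -addn1 PoszD; ring.
rewrite (_ : - P%:Z - m = A + 1); last by rewrite /A -addn1 PoszD; ring.
by rewrite -/B opprD addrA.
Qed.

(** At argument 0 only J_0 survives, that is p = m, which belongs to the truncated sum because |m| <
    P. So at s = 0 the interpolation is the exact kernel. *)
Lemma remainder_at0 (Z : C) (c : R) (m : int) (P : nat) : (`|m| < P)%N ->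
  zsum P (fun p => ofR (besselJ (p - m) (c * 0)) * Z ^ (p - m)) = 1.
Proof.
move=> mP; rewrite -(zsum_delta mP); apply: zsum_ext => p.
rewrite mulr0 besselJ0 subr_eq0; have [->|_] := eqVneq p m; last by rewrite mul0r.
by rewrite subrr expr0z mulr1.
Qed.

(** Differentiation under the integral sign takes place on an open interval around [0, 1], whence
    [d], and uses the majorant [G]. The bound itself comes from [M], that is from the integral of
    the derivative with its oscillation. *)
Lemma integral_mvt (D : set MR) (f df : R -> R -> C) (G : R -> R) (d M : R) : measurable D ->
  0 < d ->
  (forall s, - d < s < 1 + d -> citg D (f s)) ->
  (forall s x, - d < s < 1 + d -> D x -> cderiv (f ^~ x) s (df s x)) ->
  (forall x, 0 <= G x) -> itg D G ->
  (forall s x, - d < s < 1 + d -> D x -> cabs (df s x) <= G x) ->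
  (forall s, 0 <= s <= 1 -> cabs (cint D (df s)) <= M) ->
  cabs (cint D (f 0) - cint D (f 1)) <= 2 * M.
Proof.
move=> mD d0 fi fd G0 Gi dG dM.
have H (p : C -> R) : (forall z, `|p z| <= cabs z) ->
    (forall s : R, - d < s < 1 + d -> itg D (fun x => p (f s x))) ->
    (forall (s x : R), - d < s < 1 + d -> D x ->
      is_derive s 1 (fun s => p (f s x)) (p (df s x))) ->
    forall s : R, 0 <= s <= 1 -> is_derive s 1 (fun s => \int[mu]_(x in D) p (f s x))
      (\int[mu]_(x in D) p (df s x)).
  move=> pz pi pd s /andP[s0 s1].
  have Is : `](- d), (1 + d)[%classic s by rewrite /= in_itv /=; apply/andP; split; lra.
  have I2 t : `](- d), (1 + d)[%classic t -> - d < t < 1 + d by rewrite /= in_itv.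
  have d1E t x : - d < t < 1 + d -> D x -> partial1of2 (fun s x => p (f s x)) t x = p (df t x).
    by move=> ht Dx; rewrite partial1of2E; have [_ ->] := pd t x ht Dx.
  have h1 := fun t It => pi t (I2 t It).
  have h2 (t x : R) : `](- d), (1 + d)[%classic t -> D x -> derivable (fun s => p (f s x)) t 1.
    by move=> It Dx; have [] := pd t x (I2 t It) Dx.
  have h3 (t x : R) : `](- d), (1 + d)[%classic t -> D x ->
    `|partial1of2 (fun s x => p (f s x)) t x| <= G x.
    by move=> It Dx; rewrite d1E ?I2 // (le_trans (pz _)) // dG // I2.
  split; first exact: (derivable_under_integral mD Is h1 h2 G0 Gi h3).
  rewrite -derive1E (differentiation_under_integral mD Is h1 h2 G0 Gi h3).
  by apply: eq_Rintegral => x /set_mem Dx; rewrite d1E // I2.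
have Hr := H (@re R) (@cabs_re R) (fun s hs => (fi s hs).1) (fun s x hs Dx => (fd s x hs Dx).1).
have Hi := H (@im R) (@cabs_im R) (fun s hs => (fi s hs).2) (fun s x hs Dx => (fd s x hs Dx).2).
rewrite cabs_distC -[2 * M]mulr1 -[X in _ * X]subr0.
apply: (@cmvt_bound _ (fun s => cint D (f s)) (fun s => cint D (df s))) => // s hs.
by split; [exact: Hr | exact: Hi].
Qed.

End Remainder.

(** * Estimates of the remainder *)

Section Estimates.
Variable R : realType.
Local Notation C := (CC R).

Lemma fact_ratio n m : ((n + m)`! <= n`! * (n + m) ^ m)%N.
Proof.
elim: m => [|m IH]; first by rewrite addn0 expn0 muln1.
rewrite addnS factS expnS mulnCA leq_mul // (leq_trans IH) // leq_mul //.
by have [->|m0] := posnP m; rewrite // leq_exp2r.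
Qed.

(** (ka r w)^(n+1) is (r / D)^(n+1) times (ka D w)^(n+1) <= (n+1)! exp(ka M w), and the factorial of
    the Bessel function cancels this one up to a factor n + 1. The two cases are the pairs of Bessel
    index and power of w in the telescoped terms. *)
Lemma central_estimate (ka r D M w : R) n nu a : 0 < ka -> 0 <= r <= D -> 0 < D <= M -> 1 <= w ->
  (nu = n.+1 /\ a = n) \/ (nu = n /\ a = n.+1) ->
  ka * r * ((ka * r) ^+ nu / nu`!%:R) * w ^+ a <= (1 + ka * M) * expR (ka * M * w) * n.+1%:R *
    (r / D) ^+ n.+1.
Proof.
move=> k0 /andP[r0 rD] /andP[D0 DM] w1.
have w0 : 0 <= w by rewrite (le_trans ler01).
have M0 : 0 < M by apply: lt_le_trans DM.
have kr0 : 0 <= ka * r by rewrite mulr_ge0 // ltW.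
have kM0 : 0 <= ka * M by rewrite mulr_ge0 // ltW.
have y0 : 0 <= r / D by rewrite divr_ge0 // ltW.
have rE : r = r / D * D by rewrite divfK // gt_eqF.
have n1 : 1 <= n.+1%:R :> R by rewrite ler1n.
have E : (ka * r) ^+ n.+1 * w ^+ n.+1 <= (r / D) ^+ n.+1 * (n.+1`!%:R * expR (ka * M * w)).
  rewrite -exprMn (_ : ka * r * w = r / D * (ka * D * w)); last by rewrite {1}rE; ring.
  rewrite exprMn ler_wpM2l ?exprn_ge0 //.
  apply: le_trans (pow_le_fact_exp _ (mulr_ge0 kM0 w0)).
  by rewrite lerXn2r ?nnegrE ?mulr_ge0 ?(ltW k0) ?(ltW D0) ?(ltW M0) // ler_wpM2r // ler_pM2l.
have f0 := fact_gt0; have F m : 0 < m`!%:R :> R by rewrite ltr0n fact_gt0.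
have X0 : 0 <= expR (ka * M * w) * (r / D) ^+ n.+1 by rewrite mulr_ge0 ?expR_ge0 ?exprn_ge0.
case=> -[-> ->].
- apply: (@le_trans _ _ (ka * M * (expR (ka * M * w) * (r / D) ^+ n.+1))); last first.
    rewrite (_ : (1 + ka * M) * _ * _ * _ = ((1 + ka * M) * n.+1%:R) * (expR (ka * M * w) * (r /
      D) ^+ n.+1)); last by ring.
    rewrite ler_wpM2r // -[leLHS]mulr1 ler_pM // lerDr //.
  rewrite -mulrA ler_pM //; first by rewrite mulr_ge0 ?divr_ge0 ?exprn_ge0.
    by rewrite ler_pM2l // (le_trans rD).
  rewrite mulrAC ler_pdivrMr // (_ : expR _ * _ * _ =
    (r / D) ^+ n.+1 * (n.+1`!%:R * expR (ka * M * w))); last by ring.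
  apply: le_trans E; rewrite ler_wpM2l ?exprn_ge0 // ler_weXn2l //.
- have -> : ka * r * ((ka * r) ^+ n / n`!%:R) * w ^+ n.+1 =
  ((ka * r) ^+ n.+1 * w ^+ n.+1) / n`!%:R.
    by rewrite (exprS (ka * r)); ring.
  rewrite ler_pdivrMr //; apply: le_trans E _.
  rewrite factS natrM (_ : _ * (_ * _ * _) = 1 * (n.+1%:R * n`!%:R * (expR (ka * M * w) * (r /
    D) ^+ n.+1))); last by ring.
  rewrite (_ : (1 + ka * M) * _ * _ * _ * _ = (1 + ka * M) * (n.+1%:R * n`!%:R * (expR (ka * M *
    w) * (r / D) ^+ n.+1))); last by ring.
  apply: ler_wpM2r; last by rewrite lerDl.
  by rewrite mulr_ge0 // mulr_ge0.
Qed.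

(** The key inequality is s r / z <= r / D, which follows from s D <= D - (1 - s) r <= z for r <= D.
    The factorials nu! and (a + n0)! cancel up to a polynomial in n. *)
Lemma tail_estimate (ka r D M zm z s : R) n nu a n0 : 0 < ka -> 0 <= r <= D -> 0 < D <= M ->
  0 < zm <= z ->
  0 <= s <= 1 -> D - (1 - s) * r <= z ->
  (nu = n.+1 /\ a = n) \/ (nu = n /\ a = n.+1) ->
  ka * r * ((ka * r * s) ^+ nu / nu`!%:R) * ((a + n0)`!%:R / (ka * z) ^+ a) <=
  ((ka * M) ^+ 2 + M / zm) * (n.+1 + n0)%:R ^+ n0.+1 * (r / D) ^+ n.+1.
Proof.
move=> k0 /andP[r0 rD] /andP[D0 DM] /andP[zm0 zz] /andP[s0 s1] hz.
have z0 : 0 < z by apply: lt_le_trans zz.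
have k0' := ltW k0; have z0' := ltW z0.
have M0 : 0 < M by apply: lt_le_trans DM.
have kz : 0 < ka * z by rewrite mulr_gt0.
have y0 : 0 <= r / D by rewrite divr_ge0 // ltW.
have yD : r / D * D = r by rewrite divfK // gt_eqF.
have F m : 0 < m`!%:R :> R by rewrite ltr0n fact_gt0.
have sz : ka * r * s / (ka * z) <= r / D.
  rewrite ler_pdivrMr // (_ : r / D * (ka * z) = r * (ka * z) / D); last by ring.
  rewrite ler_pdivlMr //.
  have -> : r * (ka * z) = ka * (r * z) by ring.
  have -> : ka * r * s * D = ka * (r * (s * D)) by ring.
  rewrite ler_pM2l // ler_wpM2l // (le_trans _ hz) //.
  have : (1 - s) * r <= (1 - s) * D by rewrite ler_wpM2l // subr_ge0.
  lra.
have szn : (ka * r * s) ^+ n / (ka * z) ^+ n <= (r / D) ^+ n.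
  rewrite -expr_div_n lerXn2r ?nnegrE // divr_ge0 ?mulr_ge0 // ltW //.
have sz0 : 0 <= (ka * r * s) ^+ n / (ka * z) ^+ n.
  by rewrite divr_ge0 // exprn_ge0 // ?mulr_ge0 // ltW.
have N1 : 1 <= (n.+1 + n0)%:R :> R by rewrite ler1n addSn.
have fr : (n.+1 + n0)`!%:R <= n.+1`!%:R * (n.+1 + n0)%:R ^+ n0 :> R.
  by rewrite -natrX -natrM ler_nat fact_ratio.
have p0 m : 0 <= (n.+1 + n0)%:R ^+ m :> R by rewrite exprn_ge0.
have yn : 0 <= (r / D) ^+ n by rewrite exprn_ge0.
have MM : r <= r / D * M by rewrite -{1}yD ler_wpM2l.
case=> -[-> ->].
- apply: (@le_trans _ _ ((ka * M) ^+ 2 * (n.+1 + n0)%:R ^+ n0.+1 * (r / D) ^+ n.+1)); last first.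
    by rewrite ler_wpM2r ?exprn_ge0 // ler_wpM2r // lerDl divr_ge0 // ltW.
  have -> : ka * r * ((ka * r * s) ^+ n.+1 / n.+1`!%:R) * ((n + n0)`!%:R / (ka * z) ^+ n) =
     (ka ^+ 2 * (r * r) * s) * ((n + n0)`!%:R / n.+1`!%:R) * ((ka * r * s) ^+ n / (ka * z) ^+ n).
    by rewrite exprS; field; rewrite !expf_neq0 ?gt_eqF.
  have -> : (ka * M) ^+ 2 * (n.+1 + n0)%:R ^+ n0.+1 * (r / D) ^+ n.+1 =
     (ka ^+ 2 * (M * (r / D * M))) * (n.+1 + n0)%:R ^+ n0.+1 * (r / D) ^+ n by rewrite (exprS (r
       / D)); move: (_%:R ^+ _) => e; ring.
  have a1 : 0 <= ka ^+ 2 * (r * r) * s by rewrite !mulr_ge0 ?sqr_ge0.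
  have a2 : 0 <= (n + n0)`!%:R / n.+1`!%:R :> R by rewrite divr_ge0.
  apply: ler_pM => //; first exact: mulr_ge0.
  apply: ler_pM => //.
    rewrite -[leLHS]mulrA; apply: ler_wpM2l; first exact: sqr_ge0.
    rewrite -[leRHS]mulr1; apply: ler_pM => //; first exact: mulr_ge0.
    by apply: ler_pM => //; apply: le_trans rD DM.
  have h1 : (n + n0)`!%:R <= (n.+1 + n0)`!%:R :> R by rewrite ler_nat addSn factS leq_pmull.
  rewrite ler_pdivrMr //; apply: le_trans h1 _; apply: le_trans fr _.
  by rewrite mulrC ler_wpM2r // exprS ler_peMl.
- apply: (@le_trans _ _ (M / zm * (n.+1 + n0)%:R ^+ n0.+1 * (r / D) ^+ n.+1)); last first.
    by rewrite ler_wpM2r ?exprn_ge0 // ler_wpM2r // lerDr sqr_ge0.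
  have -> : ka * r * ((ka * r * s) ^+ n / n`!%:R) * ((n.+1 + n0)`!%:R / (ka * z) ^+ n.+1) =
     (r / z) * ((n.+1 + n0)`!%:R / n`!%:R) * ((ka * r * s) ^+ n / (ka * z) ^+ n).
    by rewrite (exprS (ka * z)); field; rewrite !expf_neq0 ?gt_eqF.
  have -> : M / zm * (n.+1 + n0)%:R ^+ n0.+1 * (r / D) ^+ n.+1 =
     (r / D * M / zm) * (n.+1 + n0)%:R ^+ n0.+1 * (r / D) ^+ n by rewrite (exprS (r / D)); ring.
  have a1 : 0 <= r / z by rewrite divr_ge0 // ltW.
  have a2 : 0 <= (n.+1 + n0)`!%:R / n`!%:R :> R by rewrite divr_ge0.
  apply: ler_pM => //; first exact: mulr_ge0.
  apply: ler_pM => //.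
    by apply: ler_pM => //; [rewrite invr_ge0 ltW | rewrite lef_pV2 ?posrE].
  rewrite ler_pdivrMr // (le_trans fr) // factS natrM exprS.
  have -> : n.+1%:R * n`!%:R * (n.+1 + n0)%:R ^+ n0 =
    n.+1%:R * ((n.+1 + n0)%:R ^+ n0 * n`!%:R) :> R by ring.
  rewrite -[leRHS]mulrA ler_wpM2r ?mulr_ge0 // ler_nat leq_addr //.
Qed.

End Estimates.

(** * Hoelder classes on a bounded segment *)

Section Hoelder.
Variable R : realType.
Local Notation C := (CC R).
Variable La : R.
Hypothesis La0 : 0 < La.
Implicit Types (f g : R -> C) (A B : R).

(* The exponent is 1/2 because of the square roots sqrt(lam^2 - k_l^2); it makes
   the finite part at a pole controllable. *)
Definition ho A f : Prop := (forall x, -La <= x <= La -> cabs (f x) <= A) /\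
  (forall x y, -La <= x <= La -> -La <= y <= La -> cabs (f x - f y) <= A * Num.sqrt `|x - y|).

Lemma in0 : -La <= 0 <= La.
Proof. by rewrite oppr_le0 ltW. Qed.

Lemma ho_ge0 A f : ho A f -> 0 <= A.
Proof. by move=> [h _]; apply: le_trans (cabs_ge0 _) (h 0 in0). Qed.

Lemma ho_le A B f : A <= B -> ho A f -> ho B f.
Proof.
move=> AB [h1 h2]; split=> [x xL|x y xL yL]; first exact: le_trans (h1 x xL) AB.
by apply: le_trans (h2 x y xL yL) _; rewrite ler_wpM2r ?sqrtr_ge0.
Qed.

Lemma ho_ext A f g : (forall x, f x = g x) -> ho A f -> ho A g.
Proof. by move=> /funext ->. Qed.

Lemma ho_cst c : ho (cabs c) (fun=> c).
Proof. by split=> // x y _ _; rewrite subrr cabs0 mulr_ge0 ?cabs_ge0 ?sqrtr_ge0. Qed.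

Lemma hoD A B f g : ho A f -> ho B g -> ho (A + B) (fun x => f x + g x).
Proof.
move=> [f1 f2] [g1 g2]; split=> [x xL|x y xL yL].
  by rewrite (le_trans (cabsD _ _)) // lerD ?f1 ?g1.
by rewrite opprD addrACA (le_trans (cabsD _ _)) // mulrDl lerD ?f2 ?g2.
Qed.

Lemma hoZ c A f : ho A f -> ho (cabs c * A) (fun x => c * f x).
Proof.
move=> [f1 f2]; split=> [x xL|x y xL yL]; first by rewrite cabsM ler_wpM2l ?cabs_ge0 ?f1.
by rewrite -mulrBr cabsM -mulrA ler_wpM2l ?cabs_ge0 ?f2.
Qed.

Lemma hoM A B f g : ho A f -> ho B g -> ho (2 * A * B) (fun x => f x * g x).
Proof.
move=> hf hg; have A0 := ho_ge0 hf; have B0 := ho_ge0 hg.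
move: hf hg => [f1 f2] [g1 g2]; split=> [x xL|x y xL yL].
  apply: (@le_trans _ _ (A * B)); first by rewrite cabsM ler_pM ?cabs_ge0 ?f1 ?g1.
  by rewrite ler_wpM2r // ler_peMl // ler1n.
have -> : f x * g x - f y * g y = f x * (g x - g y) + g y * (f x - f y) by ring.
rewrite (le_trans (cabsD _ _)) // !cabsM.
have -> : 2 * A * B * Num.sqrt `|x - y| = A * (B * Num.sqrt `|x - y|) + B * (A * Num.sqrt `|x -
  y|) by ring.
by rewrite lerD // ler_pM ?cabs_ge0 ?f1 ?g1 ?f2 ?g2.
Qed.

Lemma hoX A f n : ho A f -> ho ((2 * A) ^+ n) (fun x => f x ^+ n).
Proof.
move=> hf; elim: n => [|n IH].
  by rewrite expr0 -(cabs1 R); apply: (ho_ext _ (ho_cst 1)) => x; rewrite expr0.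
by rewrite exprS; apply: (ho_ext _ (hoM hf IH)) => x; rewrite exprS.
Qed.

Lemma ho_hk k : exists A, ho A (hk k).
Proof.
exists (2 * Num.sqrt (2 * La) + 2 * Num.sqrt (La ^+ 2 + k ^+ 2)).
have sq x : -La <= x <= La -> x ^+ 2 <= La ^+ 2.
  by move=> xL; rewrite -[x ^+ 2]real_normK ?num_real // lerXn2r ?nnegrE ?(ltW La0) // ler_norml.
split=> [x xL|x y xL yL].
  have -> : hk k x = rsqrt (x ^+ 2 - k ^+ 2) - rsqrt 0.
    by have -> : rsqrt (0 : R) = 0 by [apply/eqP; rewrite rsqrt_eq0]; rewrite subr0.
  rewrite (le_trans (rsqrt_holder _ _)) // subr0 ler_wpDl ?mulr_ge0 ?sqrtr_ge0 // ler_wpM2l //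
    ler_wsqrtr //.
  by rewrite (le_trans (ler_normB _ _)) // !ger0_norm ?sqr_ge0 // lerD2r sq.
apply: le_trans (rsqrt_holder _ _) _.
have -> : x ^+ 2 - k ^+ 2 - (y ^+ 2 - k ^+ 2) = x ^+ 2 - y ^+ 2 by ring.
rewrite [leRHS]mulrDl ler_wpDr ?mulr_ge0 ?sqrtr_ge0 //.
rewrite -mulrA ler_wpM2l // -sqrtrM ?mulr_ge0 ?(ltW La0) // ler_wsqrtr //.
rewrite subr_sqr normrM mulrC ler_wpM2r // ler_norml.
by move: xL yL => /andP[? ?] /andP[? ?]; apply/andP; split; lra.
Qed.

Lemma ho_id : exists A, ho A (@ofR R).
Proof.
exists (La + Num.sqrt (2 * La)); split=> [x xL|x y xL yL].
  by rewrite cabs_ofR ler_wpDr ?sqrtr_ge0 // ler_norml.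
rewrite -ofRB cabs_ofR mulrDl ler_wpDl ?mulr_ge0 ?sqrtr_ge0 ?(ltW La0) //.
rewrite -sqrtrM ?mulr_ge0 ?(ltW La0) // -[leLHS]ger0_norm // -sqrtr_sqr ler_wsqrtr // expr2
  ler_wpM2r // ler_norml.
by move: xL yL => /andP[? ?] /andP[? ?]; apply/andP; split; lra.
Qed.

(** For nonnegative depths the exponent has nonpositive real part, where the exponential is
    Lipschitz with constant 2; so the kernel inherits the Hoelder condition from the h_k. *)
Lemma ho_kern k1 k2 Bd : 0 <= Bd -> exists A, forall be be' X, 0 <= be <= Bd ->
  0 <= be' <= Bd -> `|X| <= Bd ->
  ho A (kern k1 k2 be be' X).
Proof.
move=> Bd0; have [A1 h1] := ho_hk k1; have [A2 h2] := ho_hk k2; have [A3 h3] := ho_id.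
have A10 := ho_ge0 h1; have A20 := ho_ge0 h2; have A30 := ho_ge0 h3.
exists (1 + 2 * (Bd * A1 + Bd * A2 + Bd * A3)) => be be' X /andP[b0 bB] /andP[b0' bB'] XB.
have A0 : 0 <= 2 * (Bd * A1 + Bd * A2 + Bd * A3) by rewrite !mulr_ge0 // !addr_ge0 // mulr_ge0.
split=> [x xL|x y xL yL]; first by rewrite (le_trans (kern_le1 k1 k2 X x b0 b0')) // lerDl.
have rx z : re (- (hk k1 z * ofR be) - hk k2 z * ofR be' + Ci R * ofR (z * X)) <= 0.
  have := kern_le1 k1 k2 X z b0 b0'; rewrite /kern cabs_cexp -expR0 ler_expR //.
rewrite /kern (le_trans (cexp_lipschitz (rx x) (rx y))) // expR0 mulr1 [leRHS]mulrDl ler_wpDl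
  ?sqrtr_ge0 ?mul1r //.
rewrite -[leRHS]mulrA ler_wpM2l // [leRHS]mulrDl [X in _ <= X + _]mulrDl.
have -> : - (hk k1 x * ofR be) - hk k2 x * ofR be' + Ci R * ofR (x * X) -
  (- (hk k1 y * ofR be) - hk k2 y * ofR be' + Ci R * ofR (y * X)) =
  (- ofR be) * (hk k1 x - hk k1 y) + (- ofR be') * (hk k2 x - hk k2 y) + (Ci R * ofR X) * (ofR x
    - ofR y).
  by rewrite !ofRM; ring.
rewrite (le_trans (cabsD _ _)) // lerD //.
  rewrite (le_trans (cabsD _ _)) // lerD // cabsM cabsN cabs_ofR ger0_norm // -mulrA ler_pM
    ?cabs_ge0 //.
    by have [_ h] := h1; exact: h.
  by have [_ h] := h2; exact: h.
rewrite cabsM cabsM cabs_Ci mul1r cabs_ofR -mulrA ler_pM ?cabs_ge0 //.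
by have [_ h] := h3; exact: h.
Qed.

End Hoelder.

(** * Powers of w *)

Section WaveFactor.
Variable R : realType.
Local Notation C := (CC R).
Variable k : R.
Hypothesis k0 : 0 < k.

Definition sgnb (e : bool) : R := if e then 1 else -1.

(* W true = i / w and W false = - i w, where w = (lambda - h) / k. *)
Definition W (e : bool) (lam : R) : C := Ci R * (ofR (sgnb e * lam) + hk k lam) / ofR k.

Lemma CiCi : Ci R * Ci R = -1.
Proof. by apply: cx_ext; rewrite ?reM ?imM ?reN ?imN /=; ring. Qed.

Lemma sgnbN e : sgnb (~~ e) = - sgnb e.
Proof. by case: e => /=; rewrite ?opprK. Qed.

Lemma hk_sqr lam : hk k lam ^+ 2 = ofR (lam ^+ 2 - k ^+ 2).
Proof. by rewrite rsqrt_sqr. Qed.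

Lemma W_mul e lam : W e lam * W (~~ e) lam = 1.
Proof.
have kC : ofR k != 0 by rewrite ofR_eq0 gt_eqF.
have s2 : sgnb e ^+ 2 = 1 by case: e; rewrite /= ?sqrrN expr1n.
have -> : W e lam * W (~~ e) lam = - ((hk k lam ^+ 2 - ofR (sgnb e * lam) ^+ 2) / ofR k ^+ 2).
  rewrite /W sgnbN mulNr ofRN; move: (hk k lam) (ofR (sgnb e * lam)) => h l.
  rewrite (_ : _ / _ * _ = (Ci R * Ci R) * ((h ^+ 2 - l ^+ 2) / ofR k ^+ 2)); last by field.
  by rewrite CiCi mulN1r.
rewrite hk_sqr -ofRX exprMn s2 mul1r -ofRB -ofRX -mulNr -ofRN.
rewrite (_ : - (lam ^+ 2 - k ^+ 2 - lam ^+ 2) = k ^+ 2); last by ring.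
by rewrite mulfV // ofR_eq0 expf_neq0 // gt_eqF.
Qed.

Lemma W_neq0 e lam : W e lam != 0.
Proof. by apply/eqP => h; have := W_mul e lam; rewrite h mul0r => /eqP;
  rewrite eq_sym oner_eq0. Qed.

Lemma W_inv e lam : (W e lam)^-1 = W (~~ e) lam.
Proof. by apply: (mulfI (W_neq0 e lam)); rewrite mulfV ?W_neq0 // W_mul. Qed.

Lemma WN e lam : W e (- lam) = W (~~ e) lam.
Proof. by rewrite /W hkN sgnbN mulrN mulNr. Qed.

Lemma WX e lam (q : int) : W e lam ^ q = W (if q is Posz _ then e else ~~ e) lam ^+ `|q|%N.
Proof. by case: q => n //; rewrite NegzE -exprz_inv W_inv. Qed.

Lemma W_uu e lam : k < lam -> exists om : C, [/\ cabs om = 1, om = ofR (sgnb e) * Ci R &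
  W e lam = om * ofR (if e then uu k lam else (uu k lam)^-1)].
Proof.
move=> kl; exists (ofR (sgnb e) * Ci R); split=> //.
  by rewrite cabsM cabs_Ci cabs_ofR mulr1; case: e; rewrite /= ?normrN normr1.
have hE : hk k lam = ofR (Num.sqrt (lam ^+ 2 - k ^+ 2)) by rewrite /hk rsqrt_ge0 // ltW //
  sqr_gap_gt0.
rewrite /W hE; case: e => /=.
  by rewrite mul1r mul1r /uu -ofRD ofRM ofRV mulrA.
by rewrite uuV // !(ofRM, ofRN, ofRD, ofRV, ofR1); ring.
Qed.

(** The exponents of u and of 1 / u are kept apart as natural numbers because [tailb] charges only
    for the growing power. *)
Definition wexp (e : bool) (q : int) : nat * nat :=
  match q with Posz n => if e then (n, 0%N) else (0%N, n)
  | Negz n => if e then (0%N, n.+1) else (n.+1, 0%N) end.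

Lemma W_tail e q : exists2 om : C, cabs om = 1 & forall lam, k < lam ->
  W e lam ^ q = om * ofR (uu k lam ^+ (wexp e q).1 * (uu k lam)^-1 ^+ (wexp e q).2).
Proof.
pose f := if q is Posz _ then e else ~~ e.
exists ((ofR (sgnb f) * Ci R) ^+ `|q|%N).
  by rewrite cabsX cabsM cabs_Ci cabs_ofR mulr1 /sgnb; case: (f); rewrite ?normrN normr1 expr1n.
move=> lam kl; rewrite WX -/f; have [_ [_ -> ->]] := W_uu f kl.
rewrite exprMn; congr (_ * _); rewrite -ofRX; congr ofR.
by rewrite /f; case: q {f} => n; case: e => /=; rewrite ?expr0 ?mulr1 ?mul1r.
Qed.

Lemma wexp_abs e q : (wexp e q = (`|q|%N, 0%N)) \/ (wexp e q = (0%N, `|q|%N)).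
Proof. by case: q => n; case: e => /=; [left|right|right|left]. Qed.

Lemma ccontX (f : R -> C) n : ccont f -> ccont (fun x => f x ^+ n).
Proof.
move=> fc; elim: n => [|n IH]; first exact: ccont_cst.
rewrite (_ : (fun x => _) = fun x => f x * f x ^+ n); first exact: ccontM.
by apply/funext => x; rewrite exprS.
Qed.

Lemma ccont_W e : ccont (W e).
Proof.
rewrite (_ : W e = fun x => (Ci R / ofR k) * (ofR (sgnb e * x) + hk k x)); last first.
  by apply/funext => x; rewrite /W; ring.
apply: ccontM; first exact: ccont_cst.
apply: ccontD; last exact: ccont_hk.
by apply: ccont_ofR => x; apply: cvgM; [exact: cvg_cst | exact: cvg_id].
Qed.

Lemma ccont_WX e (q : int) : ccont (fun lam => W e lam ^ q).
Proof. by under eq_fun do rewrite WX; apply: ccontX; exact: ccont_W. Qed.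

Lemma germ_W kap e (q : int) : 0 < kap ->
  germ (fun x => ofR x ^+ `|q|%N * W e (kap * (x^-1 + x)) ^ q).
Proof.
move=> kap0; pose f := if q is Posz _ then e else ~~ e.
have g : germ (fun x => (Ci R / ofR k) * (ofR (sgnb f * kap) * (1 + ofR x * ofR x) + ofR x * hk
  k (kap * (x^-1 + x)))).
  apply: (germM (germ_cst (Ci R / ofR k)) (germD (germM (germ_cst (ofR (sgnb f * kap)))
    (germD (germ_cst 1) (germM (germ_id R) (germ_id R)))) (germ_hk_inf k kap0))).
apply: germ_ext (germX `|q|%N g); exists 1 => // x /andP[x0 _].
rewrite WX -/f -exprMn; congr (_ ^+ _).
have x1 : ofR x * ofR (x^-1 + x) = 1 + ofR x * ofR x by rewrite -ofRM mulrDr mulfV ?ofRD ?ofRM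
  // gt_eqF.
rewrite /W !ofRM -x1; ring.
Qed.

(** Geometric growth in |q| is harmless: in [central_estimate] it meets a factorial. *)
Lemma ho_W La : 0 < La -> exists2 w : R, 1 <= w & forall e (q : int),
  ho La (w ^+ `|q|%N) (fun lam => W e lam ^ q).
Proof.
move=> La0; have [A1 h1] := ho_hk La0 k; have [A2 h2] := ho_id La0.
have A10 := ho_ge0 La0 h1; have A20 := ho_ge0 La0 h2.
pose A := cabs (Ci R / ofR k) * (A2 + A1); have A0 : 0 <= A by rewrite mulr_ge0 ?cabs_ge0 //
  addr_ge0.
have hW e : ho La A (W e).
  apply: (@ho_ext _ _ _ (fun x => (Ci R / ofR k) * (ofR (sgnb e) * ofR x + hk k x))).
    by move=> x; rewrite /W ofRM; ring.
  apply: hoZ; apply: hoD => //; apply: (ho_le _ (hoZ (ofR (sgnb e)) h2)).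
  by rewrite cabs_ofR; case: (e); rewrite /= ?normrN normr1 mul1r.
exists (1 + 2 * A) => [|e q]; first by rewrite lerDl mulr_ge0.
apply: (ho_ext (fun x => esym (WX e x q))).
apply: (ho_le _ (hoX La0 `|q|%N (hW _))).
have A2' : 0 <= 2 * A by rewrite mulr_ge0.
by apply: lerXn2r; rewrite ?nnegrE ?addr_ge0 // lerDr.
Qed.

End WaveFactor.

(* A target of kernel parameters (be, be', X) reached from the point displaced
   by the polar vector (rho, phi). *)
Record move (R : realType) := Move { mb : R; mb' : R; mX : R; mr : R; mphi : R }.

(** * The path from a displaced point to its center *)

Section Move.
Local Open Scope classical_set_scope.
Variable R : realType.
Local Notation C := (CC R).
Local Notation mu := (@lebesgue_measure R).
Local Notation MR := (measurableTypeR R).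
Implicit Types (e d : bool) (g : move R) (s lam : R) (m mq nu q : int).
Variables k k2 kq : R.
Hypotheses (k0 : 0 < k) (kq0 : 0 < kq).
Local Notation kap := (k / 2).

(* The boolean e is true for expansions about target centers (LE, L2L), with
   Z = (i / w_t) exp(i phi), and false for those about source centers (ME, M2L),
   with Z = - i w_s exp(i phi). As s goes from 0 to 1, the displaced point moves
   to the center. The factor (i / w_t)^m of M2L and L2L is extra_factor. *)
Definition depth_at g s := mb g + (1 - s) * (mr g * sin (mphi g)).
Definition offset_at e g s := mX g + (1 - s) * (sgnb R e * (mr g * cos (mphi g))).
Definition center_dist g := cabs (zz (mb g) (mb' g) (mX g)).
Definition dist_at e g s := cabs (zz (depth_at g s) (mb' g) (offset_at e g s)).
(** The effect of lam -> - lam, which also negates [e] and [d] (see [expansionN]): as sigma is even,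
    a tail at -oo becomes a tail at +oo of the same form. *)
Definition reflect g := Move (mb g) (mb' g) (- mX g) (mr g) (mphi g).
Definition phase_wave e g lam : C := W k e lam * cexp (Ci R * ofR (mphi g)).
Definition extra_factor d mq lam : C := W kq d lam ^ mq.
Definition kern_at e g s lam : C := kern k k2 (depth_at g s) (mb' g) (offset_at e g s) lam.
Definition bessel_coef g nu s : R := k * mr g / 2 * besselJ nu (k * mr g * s).
Definition deriv_term e d mq g nu q s lam : C :=
  kern_at e g s lam * (ofR (bessel_coef g nu s) * phase_wave e g lam ^ q) * extra_factor d mq lam.
Definition expansion e d mq m P g s lam : C :=
  kern_at e g s lam * zsum P (fun p => ofR (besselJ (p - m) (k * mr g * s)) * phase_wave e g lam
    ^ (p - m)) * extra_factor d mq lam.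
Definition expansion_deriv e d mq m P g s lam : C :=
  let A := - P%:Z - m in let B := P%:Z - m in
  deriv_term e d mq g A (A + 1) s lam + deriv_term e d mq g (A + 1) A s lam
  - deriv_term e d mq g (B - 1) B s lam - deriv_term e d mq g B (B - 1) s lam.

Lemma cexp_phase (phi : R) : cexp (Ci R * ofR phi) = ofR (cos phi) + Ci R * ofR (sin phi).
Proof.
apply: cx_ext; rewrite /cexp !(reD, imD, reM, imM) /= !(mul0r, mulr0, mul1r, subr0, add0r,
  addr0, sub0r, oppr0) expR0 mul1r //.
Qed.

Lemma cabs_phase (phi : R) : cabs (cexp (Ci R * ofR phi)) = 1.
Proof. by rewrite cabs_cexp reM /= !(mul0r, mulr0) subrr expR0. Qed.

Lemma phase_wave_neq0 e g lam : phase_wave e g lam != 0.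
Proof. by rewrite mulf_neq0 ?W_neq0 // cexp_neq0. Qed.

(** Since i^2 = -1, (k / 2) (Z - 1 / Z) is i lam cos(phi), up to the sign given by [e], minus h
    sin(phi). Times r, this is the change of the exponent under a displacement by (r cos phi, r sin
    phi). *)
Lemma kern_at_move e g s lam : kern_at e g s lam = kern k k2 (mb g) (mb' g) (mX g) lam *
  cexp (ofR (1 - s) * (ofR (k * mr g / 2) * (phase_wave e g lam - (phase_wave e g lam)^-1))).
Proof.
rewrite /kern_at /kern -cexpD; congr cexp.
have kC : ofR k != 0 by rewrite ofR_eq0 gt_eqF.
have -> : (phase_wave e g lam)^-1 = W k (~~ e) lam * (ofR (cos (mphi g)) - Ci R * ofR (sin (mphi
  g))).
  rewrite /phase_wave invfM W_inv // -cexpN; congr (_ * _).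
  by rewrite -mulrN -ofRN cexp_phase cosN sinN ofRN mulrN.
have E : ofR (k * mr g / 2) = ofR k * ofR (mr g) / 2 :> C.
  by rewrite !ofRM ofRV ofR_nat.
rewrite /phase_wave cexp_phase E /W sgnbN /depth_at /offset_at; clear E.
rewrite (ofRD (mb g)) (mulrDr lam (mX g)) (ofRD (lam * mX g)) !ofRM !ofRN;
  set cs := ofR (cos _); set sn := ofR (sin _).
have H (K r L h sb : C) : K != 0 -> (K * r / 2) * (Ci R * (sb * L + h) / K * (cs + Ci R * sn) -
   Ci R * (- sb * L + h) / K * (cs - Ci R * sn)) =
   r * (Ci R * (sb * L) * cs + (Ci R * Ci R) * h * sn) by move=> K0; field.
rewrite !H // CiCi.
move: (ofR lam) (ofR (mr g)) (ofR (1 - s)) (ofR (sgnb R e)) (hk k lam) (hk k2 lam) (ofR (mb g))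
  (ofR (mb' g)) (ofR (mX g)) (cs) (sn) => ? ? ? ? ? ? ? ? ? ? ?.
by ring.
Qed.

Lemma phase_wave_zexp e g lam q : phase_wave e g lam ^ q =
  W k e lam ^ q * cexp (Ci R * ofR (mphi g)) ^ q.
Proof. by rewrite /phase_wave expfzMl. Qed.

Lemma cabs_zexp1 (z : C) q : cabs z = 1 -> cabs (z ^ q) = 1.
Proof.
by move=> z1; case: q => n; rewrite ?NegzE -?exprz_inv cabsX ?cabsV z1 ?invr1 expr1n.
Qed.

Lemma cderiv_expansion e d mq m P g s lam :
  cderiv (fun s => expansion e d mq m P.+1 g s lam) s (expansion_deriv e d mq m P.+1 g s lam).
Proof.
have H := cderiv_remainder (k * mr g) m P s (phase_wave_neq0 e g lam).
set S := ofR _ * _ in H.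
pose K := kern k k2 (mb g) (mb' g) (mX g) lam * extra_factor d mq lam.
have E : (fun s => expansion e d mq m P.+1 g s lam) = fun s => K * (cexp (ofR (1 - s) * S) *
    zsum P.+1 (fun p => ofR (besselJ (p - m) (k * mr g * s)) * phase_wave e g lam ^ (p - m))).
  by apply/funext => t; rewrite /expansion kern_at_move /K; ring.
rewrite E; apply: cderiv_eq (cderivZ K H) _.
rewrite /expansion_deriv /deriv_term !kern_at_move /K /bessel_coef /=.
have EM x : ofR (k * mr g / 2 * x) = ofR (k * mr g / 2) * ofR x by rewrite ofRM.
rewrite !EM.
rewrite -/S.
move: (kern _ _ _ _ _ _) (extra_factor _ _ _) (cexp _) (ofR (k * mr g / 2)) => ? ? ? ?.
by ring.
Qed.

Lemma expansion_0 e d mq m P g lam : (`|m| < P)%N ->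
  expansion e d mq m P g 0 lam = kern_at e g 0 lam * extra_factor d mq lam.
Proof. by move=> mP; rewrite /expansion remainder_at0 // mulr1. Qed.

Lemma kernN b b' X lam : kern k k2 b b' X (- lam) = kern k k2 b b' (- X) lam.
Proof. by rewrite /kern !hkN mulNr mulrN. Qed.

Lemma kern_atN e g s lam : kern_at e g s (- lam) = kern_at (~~ e) (reflect g) s lam.
Proof. rewrite /kern_at kernN (_ : offset_at (~~ e) (reflect g) s = - offset_at e g s) //.
by rewrite /offset_at sgnbN /=; ring. Qed.

Lemma expansionN e d mq m P g s lam : expansion e d mq m P g s (- lam) =
  expansion (~~ e) (~~ d) mq m P (reflect g) s lam.
Proof.
rewrite /expansion kern_atN; have -> : extra_factor d mq (- lam) =
  extra_factor (~~ d) mq lam by rewrite /extra_factor WN.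
have -> : phase_wave e g (- lam) = phase_wave (~~ e) (reflect g) lam by rewrite /phase_wave WN.
by [].
Qed.

(** Positive depths and bounds by [Bd] are required at both ends of the path and extend to it by
    convexity. The distance at the center, not the depths, is bounded away from 0 by [rm]. *)
Definition geo e (Bd rm M c0 : R) g : Prop :=
  [/\ 0 < mb g <= Bd, 0 < mb' g <= Bd, `|mX g| <= Bd,
    0 < depth_at g 0 <= Bd & `|offset_at e g 0| <= Bd] /\
  [/\ 0 <= mr g, c0 * mr g < center_dist g & rm <= center_dist g <= M].

Lemma geo_reflect e Bd rm M c0 g : geo e Bd rm M c0 g -> geo (~~ e) Bd rm M c0 (reflect g).
Proof.
move=> [[h1 h2 h3 h4 h5] [h6 h7 h8]].
have D : center_dist (reflect g) = center_dist g by rewrite /center_dist /zz /cabs /= opprK sqrrN.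
split; split; rewrite ?D //=; first by rewrite normrN.
by rewrite /offset_at /= sgnbN (_ : - _ + _ = - offset_at e g 0) ?normrN // /offset_at; ring.
Qed.

Section Geometry.
Variables (e : bool) (Bd rm M c0 : R) (g : move R).
Hypotheses (c01 : 1 < c0) (rm0 : 0 < rm) (hg : geo e Bd rm M c0 g).

Lemma center_dist_gt0 : 0 < center_dist g.
Proof. by have [_ [_ _ /andP[h _]]] := hg; apply: lt_le_trans h. Qed.

Lemma mr_ge0 : 0 <= mr g. Proof. by have [_ []] := hg. Qed.

Lemma mr_le : mr g <= center_dist g.
Proof.
have [_ [h0 h1 _]] := hg; apply: le_trans (ltW h1).
by rewrite ler_peMl // ltW.
Qed.

Lemma center_dist_le : center_dist g <= M. Proof. by have [_ [_ _ /andP[]]] := hg. Qed.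

(** Lower bound for the distance along the path: D - (1 - s) r >= D - r >= D (1 - 1 / c0), positive
    because c0 > 1. *)
Definition zmin := rm * (1 - c0^-1).

Lemma zmin_gt0 : 0 < zmin.
Proof. by rewrite mulr_gt0 // subr_gt0 invf_lt1 // (lt_trans ltr01). Qed.

(** Triangle inequality: at s the complexified distance differs from that at the center by a number
    of modulus (1 - s) r. *)
Lemma dist_at_ge s : 0 <= s <= 1 -> center_dist g - (1 - s) * mr g <= dist_at e g s.
Proof.
move=> /andP[s0 s1].
have E : zz (mb g) (mb' g) (mX g) = zz (depth_at g s) (mb' g) (offset_at e g s) -
    ofR ((1 - s) * mr g) * cpx (sin (mphi g)) (- (sgnb R e * cos (mphi g))).
  by apply: cx_ext; rewrite /zz /depth_at /offset_at ?(reB, imB, reM, imM) /=; ring.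
have n1 : cabs (cpx (sin (mphi g)) (- (sgnb R e * cos (mphi g)))) = 1.
  rewrite /cabs /= sqrrN exprMn (_ : sgnb R e ^+ 2 = 1) ?mul1r.
    by rewrite addrC cos2Dsin2 sqrtr1.
  by case: (e) => /=; rewrite ?sqrrN expr1n.
rewrite lerBlDr /center_dist E (le_trans (cabsD _ _)) // cabsN lerD2l cabsM n1 mulr1 cabs_ofR.
by rewrite ger0_norm // mulr_ge0 ?mr_ge0 // subr_ge0.
Qed.

Lemma zmin_le s : 0 <= s <= 1 -> zmin <= dist_at e g s.
Proof.
move=> hs; apply: le_trans (dist_at_ge hs); have /andP[s0 s1] := hs.
have [_ [h0 h1 /andP[h2 _]]] := hg; have c00 : 0 < c0 by apply: lt_trans c01.
have h3 : mr g <= center_dist g / c0 by rewrite ler_pdivlMr // mulrC ltW.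
have h4 : (1 - s) * mr g <= mr g by rewrite ler_piMl // lerBlDr lerDl.
apply: (@le_trans _ _ (center_dist g * (1 - c0^-1))).
  by rewrite ler_wpM2r // subr_ge0 invf_le1 // ltW.
by rewrite mulrBr mulr1 lerB // (le_trans h4).
Qed.

Lemma convex_between (x y s : R) : 0 <= s <= 1 -> x <= Bd -> y <= Bd ->
  y + (1 - s) * (x - y) <= Bd.
Proof.
move=> /andP[s0 s1] xB yB.
have -> : y + (1 - s) * (x - y) = s * y + (1 - s) * x by ring.
have h1 : s * y <= s * Bd by rewrite ler_wpM2l.
have h2 : (1 - s) * x <= (1 - s) * Bd by rewrite ler_wpM2l // subr_ge0.
lra.
Qed.

Lemma depth_atE s : depth_at g s = mb g + (1 - s) * (depth_at g 0 - mb g).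
Proof. by rewrite /depth_at; ring. Qed.
Lemma offset_atE s : offset_at e g s = mX g + (1 - s) * (offset_at e g 0 - mX g).
Proof. by rewrite /offset_at; ring. Qed.

Lemma geo_at s : 0 <= s <= 1 -> [/\ 0 <= depth_at g s <= Bd, 0 <= mb' g <= Bd,
  `|offset_at e g s| <= Bd & 0 < depth_at g s + mb' g].
Proof.
move=> hs; have /andP[s0 s1] := hs.
have [[/andP[h1 h1'] /andP[h2 h2'] h3 /andP[h4 h4'] h5] _] := hg.
have b0 : 0 <= depth_at g s.
  rewrite depth_atE (_ : _ + _ = s * mb g + (1 - s) * depth_at g 0); last by ring.
  by rewrite addr_ge0 // mulr_ge0 // ?subr_ge0 // ltW.
move: h3 h5; rewrite !ler_norml => /andP[h3 h3'] /andP[h5 h5'].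
split.
- by rewrite b0 depth_atE convex_between.
- by rewrite h2' ltW.
- apply/andP; split; last by rewrite offset_atE convex_between.
  have := convex_between hs (_ : - offset_at e g 0 <= Bd) (_ : - mX g <= Bd).
  rewrite [X in _ -> is_true (_ <= X)]offset_atE; lra.
- by rewrite ltr_wpDl.
Qed.

End Geometry.
End Move.

Section Terms.
Local Open Scope classical_set_scope.
Variable R : realType.
Local Notation C := (CC R).
Local Notation mu := (@lebesgue_measure R).
Local Notation MR := (measurableTypeR R).
Implicit Types (e d : bool) (g : move R) (s lam : R) (m mq nu q : int) (n : nat).
Variables k k2 kq : R.
Hypotheses (k0 : 0 < k) (kq0 : 0 < kq).
Local Notation deriv_term := (deriv_term k k2 kq).
Local Notation expansion := (expansion k k2 kq).
Local Notation extra_factor := (extra_factor kq).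
Local Notation kern_at := (kern_at k k2).
Local Notation dist_at := (@dist_at R).

(* The indices of J_nu and of Z^q in the terms of expansion_deriv: these have
   absolute values n and n + 1, in one order or the other. *)
Definition pair n nu q : Prop :=
  (`|nu|%N = n.+1 /\ `|q|%N = n) \/ (`|nu|%N = n /\ `|q|%N = n.+1).

Lemma bessel_coef_le g nu s : 0 <= mr g -> 0 <= s -> `|bessel_coef k g nu s| <=
  k / 2 * mr g * ((k / 2 * mr g * s) ^+ `|nu|%N / `|nu|%N`!%:R) * expR ((k / 2 * mr g * s) ^+ 2).
Proof.
move=> r0 s0; have h : k * mr g * s / 2 = k / 2 * mr g * s by ring.
have k0' := ltW k0.
have h2 : 0 <= k / 2 * mr g by rewrite mulr_ge0 // divr_ge0.
rewrite /bessel_coef normrM (_ : k * mr g / 2 = k / 2 * mr g); last by ring.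
rewrite (ger0_norm h2) -[leRHS]mulrA ler_wpM2l //.
apply: le_trans (besselJ_bound _ _) _.
by rewrite h (ger0_norm (mulr_ge0 (mulr_ge0 k0' r0) s0)) h.
Qed.

Lemma bessel_coef_le1 g nu s M : 0 <= mr g <= M -> 0 <= s <= 1 -> `|bessel_coef k g nu s| <=
  k / 2 * mr g * ((k / 2 * mr g * s) ^+ `|nu|%N / `|nu|%N`!%:R) * expR ((k / 2 * M) ^+ 2).
Proof.
move=> /andP[r0 rM] /andP[s0 s1]; apply: le_trans (bessel_coef_le nu r0 s0) _.
have h2 : 0 <= k / 2 * mr g by rewrite mulr_ge0 // divr_ge0 // ltW.
have h3 : 0 <= k / 2 * mr g * s by rewrite mulr_ge0.
apply: ler_wpM2l.
  by rewrite mulr_ge0 // divr_ge0 ?exprn_ge0 // ler0n.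
rewrite ler_expR lerXn2r ?nnegrE //; first by rewrite mulr_ge0 // ?divr_ge0 ?(ltW k0) //
  (le_trans r0).
apply: (@le_trans _ _ (k / 2 * mr g)); first by rewrite ler_piMr.
by rewrite ler_wpM2l // divr_ge0 // ltW.
Qed.

(** A crude bound on a range larger than [0, 1], for the majorant in the differentiation under the
    integral. *)
Lemma bessel_coef_bounded g nu B : 0 <= B -> exists2 c : R, 0 <= c & forall s, `|s| <= B ->
  `|bessel_coef k g nu s| <= c.
Proof.
move=> B0.
exists (`|k * mr g / 2| * ((`|k * mr g| * B / 2) ^+ `|nu|%N / `|nu|%N`!%:R * expR ((`|k * mr g|
  * B / 2) ^+ 2))).
  by rewrite !mulr_ge0 ?expR_ge0 // ?exprn_ge0 ?mulr_ge0 // ?invr_ge0 ?ler0n.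
move=> s sB; rewrite /bessel_coef normrM ler_wpM2l //.
apply: le_trans (besselJ_bound _ _) _.
have h : `|k * mr g * s| <= `|k * mr g| * B by rewrite normrM ler_wpM2l.
have {}B0 : 0 <= `|k * mr g| * B by rewrite mulr_ge0.
apply: ler_pM; rewrite ?expR_ge0 // ?divr_ge0 ?exprn_ge0 ?divr_ge0 ?ler0n //.
  rewrite ler_wpM2r ?invr_ge0 ?ler0n // lerXn2r ?nnegrE ?divr_ge0 //.
  by rewrite ler_wpM2r ?invr_ge0 ?ler0n.
rewrite ler_expR -[(k * mr g * s / 2) ^+ 2]real_normK ?num_real //.
rewrite lerXn2r ?nnegrE ?divr_ge0 // normrM (ger0_norm (_ : 0 <= 2^-1 :> R)) ?invr_ge0 //.
by rewrite ler_wpM2r ?invr_ge0.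
Qed.

Lemma deriv_termE e d mq g nu q s lam : deriv_term e d mq g nu q s lam =
  kern k k2 (depth_at g s) (mb' g) (offset_at e g s) lam *
  (ofR (bessel_coef k g nu s) * cexp (Ci R * ofR (mphi g)) ^ q * W k e lam ^ q) * W kq d lam ^ mq.
Proof.
rewrite /deriv_term /kern_at /extra_factor phase_wave_zexp.
by move: (kern _ _ _ _ _ _) (ofR _) (W k e lam ^ q) (cexp _ ^ q) (W kq d lam ^ mq) => a b c f h;
  ring.
Qed.

Lemma deriv_term_central (La Bd rm M c0 : R) mq : 0 < La -> 0 <= Bd -> 1 < c0 -> 0 < rm ->
  exists2 A : R, 0 <= A & forall e d g n nu q s, geo e Bd rm M c0 g -> 0 <= s <= 1 ->
    pair n nu q ->
    ho La (A * n.+1%:R * (mr g / center_dist g) ^+ n.+1) (deriv_term e d mq g nu q s).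
Proof.
move=> La0 Bd0 c01 rm0.
have [A0 H0] := ho_kern La0 k k2 Bd0.
have [w w1 Hw] := ho_W k0 La0; have [w' w'1 Hw'] := ho_W kq0 La0.
have w'0 : 0 <= w' ^+ `|mq|%N by rewrite exprn_ge0 // (le_trans ler01).
have A00 : 0 <= A0.
  by apply: (ho_ge0 La0 (H0 0 0 0 _ _ _)); rewrite ?lexx ?normr0.
pose EB := expR ((k / 2 * M) ^+ 2).
have cE : 0 <= 4 * A0 * w' ^+ `|mq|%N * EB by rewrite !mulr_ge0 ?expR_ge0.
exists (4 * A0 * w' ^+ `|mq|%N * EB * ((1 + k / 2 * `|M|) * expR (k / 2 * M * w))).
  by rewrite !mulr_ge0 ?expR_ge0 // addr_ge0 // mulr_ge0 // divr_ge0 // ltW.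
move=> e d g n nu q s hg hs hp.
have r0 := mr_ge0 hg; have rD := mr_le c01 hg; have D0 := center_dist_gt0 rm0 hg;
  have DM := center_dist_le hg.
have M0 : 0 < M by apply: lt_le_trans DM.
have kM0 : 0 <= k / 2 * mr g by rewrite mulr_ge0 // divr_ge0 // ltW.
have [b1 b2 b3 b4] := geo_at hg hs.
have Hk := H0 _ _ _ b1 b2 b3.
have hz := hoZ (ofR (bessel_coef k g nu s) * cexp (Ci R * ofR (mphi g)) ^ q) (Hw e q).
have hm := hoM La0 (hoM La0 Hk hz) (Hw' d mq).
apply: ho_le (ho_ext _ hm); last first.
  by move=> x; rewrite deriv_termE.
rewrite cabsM cabs_ofR (cabs_zexp1 _ (cabs_phase _)) mulr1.
have w0 : 0 <= w ^+ `|q|%N by rewrite exprn_ge0 // (le_trans ler01).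
have bl : `|bessel_coef k g nu s| <= k / 2 * mr g * ((k / 2 * mr g) ^+ `|nu|%N / `|nu|%N`!%:R) *
  EB.
  apply: le_trans (bessel_coef_le1 nu (_ : 0 <= mr g <= M) hs) _;
    first by rewrite r0 (le_trans rD).
  rewrite ler_wpM2r ?expR_ge0 // ler_wpM2l // ler_wpM2r ?invr_ge0 ?ler0n //.
  by case/andP: hs => s0 s1; apply: lerXn2r; rewrite ?nnegrE //;
    [exact: (mulr_ge0 kM0 s0) | exact: (ler_piMr kM0 s1)].
have ce := @central_estimate _ (k / 2) (mr g) (center_dist g) M w n `|nu|%N `|q|%N.
have {}ce : k / 2 * mr g * ((k / 2 * mr g) ^+ `|nu|%N / `|nu|%N`!%:R) * w ^+ `|q|%N <=
    (1 + k / 2 * `|M|) * expR (k / 2 * M * w) * n.+1%:R * (mr g / center_dist g) ^+ n.+1.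
  by rewrite (ger0_norm (ltW M0)); apply: ce; rewrite ?divr_gt0 ?r0 ?rD ?D0 ?DM.
apply: (@le_trans _ _ (4 * A0 * w' ^+ `|mq|%N * EB * (k / 2 * mr g * ((k / 2 * mr g) ^+ `|nu|%N
  / `|nu|%N`!%:R) * w ^+ `|q|%N))).
  rewrite (_ : 2 * _ * _ = 4 * A0 * w' ^+ `|mq|%N * w ^+ `|q|%N * `|bessel_coef k g nu s|);
    last by ring.
  rewrite [leRHS](_ : _ = 4 * A0 * w' ^+ `|mq|%N * w ^+ `|q|%N * (k / 2 * mr g * ((k / 2 * mr g)
    ^+ `|nu|%N / `|nu|%N`!%:R) * EB)); last by ring.
  by rewrite ler_wpM2l // !mulr_ge0.
rewrite [leRHS](_ : _ = 4 * A0 * w' ^+ `|mq|%N * EB * ((1 + k / 2 * `|M|) * expR (k / 2 * M * w)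
  * n.+1%:R * (mr g / center_dist g) ^+ n.+1)); last by ring.
by rewrite ler_wpM2l.
Qed.

(** [tailb] at one fixed cutoff: the same [La] must serve for both values of [d], which a reflection
    exchanges. *)
Definition tail_at (Bd : R) (n0 : nat) (f : R -> C) (La : R) : Prop :=
  forall zm, 0 < zm -> exists2 A : R, 0 <= A &
  forall be be' X (j l : nat), 0 <= be <= Bd -> 0 <= be' <= Bd -> `|X| <= Bd -> 0 < be + be' ->
    zm <= cabs (zz be be' X) ->
    let F lam := kern k k2 be be' X lam * ofR (uu k lam ^+ j * (uu k lam)^-1 ^+ l) * f lam in
    citg `[La, +oo[ F /\
    cabs (cint `[La, +oo[ F) <= A * ((j + n0)`!%:R / (k / 2 * cabs (zz be be' X)) ^+ j).

Section Tail.
Variables (sg : R -> C) (Bd : R) (n0 : nat) (d : bool) (mq : int) (La : R).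
Hypotheses (msg : cmf sg) (Bd0 : 0 <= Bd) (kLa : k < La).
Hypothesis HT : tail_at Bd n0 (fun lam => extra_factor d mq lam * sg lam) La.
Local Notation D := `[La, +oo[.

Lemma tail_term zm : 0 < zm -> exists2 A : R, 0 <= A & forall e q be be' X,
  0 <= be <= Bd -> 0 <= be' <= Bd -> `|X| <= Bd -> 0 < be + be' -> zm <= cabs (zz be be' X) ->
  let F lam := kern k k2 be be' X lam * W k e lam ^ q * (extra_factor d mq lam * sg lam) in
  citg D F /\ exists2 j : nat, j = `|q|%N \/ j = 0%N &
    cabs (cint D F) <= A * ((j + n0)`!%:R / (k / 2 * cabs (zz be be' X)) ^+ j).
Proof.
move=> zm0; have [A A0 HA] := HT zm0; exists A => // e q be be' X h1 h2 h3 h4 h5 F.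
have [om om1 omE] := W_tail k0 e q.
have [c1 c2] := HA be be' X (wexp e q).1 (wexp e q).2 h1 h2 h3 h4 h5.
set G := (fun lam => _) in c1 c2.
have FE x : D%classic x -> om * G x = F x.
  rewrite /= in_itv /= andbT => Lx; rewrite /G /F omE ?(lt_le_trans kLa) //.
  by move: (kern _ _ _ _ _ _) (ofR _) (_ * sg x) => a b c; ring.
have c3 := citgZ om (measurable_itv _) c1.
split.
  have [e1 e2] := c3.
  by split; [apply: eq_integrable e1 | apply: eq_integrable e2] => // x /set_mem /FE /= ->.
exists (wexp e q).1; first by case: (wexp_abs e q) => ->; [left | right].
by rewrite -(eq_cint FE) cintZ // cabsM om1 mul1r.
Qed.

Lemma tail_deriv_term rm M c0 : 1 < c0 -> 0 < rm -> exists2 A : R, 0 <= A &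
  forall e g n nu q s, geo e Bd rm M c0 g -> 0 <= s <= 1 -> pair n nu q ->
    citg D (fun lam => deriv_term e d mq g nu q s lam * sg lam) /\
    cabs (cint D (fun lam => deriv_term e d mq g nu q s lam * sg lam)) <=
      A * (n.+1 + n0)%:R ^+ n0.+1 * (mr g / center_dist g) ^+ n.+1.
Proof.
move=> c01 rm0; have zm0 := zmin_gt0 c01 rm0.
have [A A0 HA] := tail_term zm0.
have ka0 : 0 < k / 2 by rewrite divr_gt0.
pose EB := expR ((k / 2 * M) ^+ 2).
pose c1 := (k / 2 * M) ^+ 2 + `|M| / zmin rm c0.
pose c2 := n0`!%:R * ((1 + k / 2 * `|M|) * expR (k / 2 * M * 1)).
have c10 : 0 <= c1 by rewrite addr_ge0 ?sqr_ge0 // divr_ge0 // ltW.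
have c20 : 0 <= c2 by rewrite !mulr_ge0 ?ler0n ?expR_ge0 // addr_ge0 // mulr_ge0 // ltW.
exists (A * EB * (c1 + c2)); first by rewrite !mulr_ge0 ?expR_ge0 // addr_ge0.
move=> e g n nu q s hg hs hp.
have r0 := mr_ge0 hg; have rD := mr_le c01 hg; have D0 := center_dist_gt0 rm0 hg;
  have DM := center_dist_le hg.
have M0 : 0 < M by apply: lt_le_trans DM.
have kM0 : 0 <= k / 2 * mr g by rewrite mulr_ge0 // ltW.
have [b1 b2 b3 b4] := geo_at hg hs.
have zl := zmin_le c01 hg hs.
have [i1 [j hj i2]] := HA e q _ _ _ b1 b2 b3 b4 zl.
have [s0 s1] := andP hs.
have bl := bessel_coef_le1 nu (_ : 0 <= mr g <= M) hs; rewrite r0 (le_trans rD) // in bl;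
  have {}bl := bl isT.
have y0 : 0 <= mr g / center_dist g by rewrite divr_ge0 // ltW.
set F := (fun lam => _) in i1 i2.
set c := ofR (bessel_coef k g nu s) * cexp (Ci R * ofR (mphi g)) ^ q.
have FE : (fun lam => deriv_term e d mq g nu q s lam * sg lam) = fun lam => c * F lam.
  apply/funext => x; rewrite deriv_termE /F /c /extra_factor.
  by move: (kern _ _ _ _ _ _) (ofR _) (W k e x ^ q) (cexp _ ^ q) (W kq d x ^ mq) => a b a' f h;
    ring.
rewrite FE; split; first exact: citgZ.
rewrite cintZ // cabsM /c cabsM cabs_ofR (cabs_zexp1 _ (cabs_phase _)) mulr1.
set z := cabs (zz _ _ _) in i2 zl.
have z0 : 0 < z by apply: lt_le_trans zl.
pose X := k / 2 * mr g * ((k / 2 * mr g * s) ^+ `|nu|%N / `|nu|%N`!%:R).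
have kMs0 := mulr_ge0 kM0 s0.
have X0 : 0 <= X by apply: (mulr_ge0 kM0); rewrite divr_ge0 ?exprn_ge0 ?ler0n.
pose Y := (j + n0)`!%:R / (k / 2 * z) ^+ j.
have Y0 : 0 <= Y by rewrite /Y mulr_ge0 ?ler0n // invr_ge0 exprn_ge0 // mulr_ge0 // ltW.
apply: (@le_trans _ _ ((X * EB) * (A * Y))); first by apply: ler_pM => //; exact: cabs_ge0.
rewrite (_ : X * EB * (A * Y) = A * EB * (X * Y)); last by ring.
rewrite [leRHS](_ : _ = A * EB * ((c1 + c2) * ((n.+1 + n0)%:R ^+ n0.+1 * (mr g / center_dist g)
  ^+ n.+1))); last by ring.
apply: ler_wpM2l; first by rewrite mulr_ge0 ?expR_ge0.
have N1 : n.+1%:R <= (n.+1 + n0)%:R ^+ n0.+1 :> R.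
  by rewrite -natrX ler_nat expnS (leq_trans (leq_addr n0 _)) // leq_pmulr // expn_gt0.
have P0 : 0 <= (n.+1 + n0)%:R ^+ n0.+1 * (mr g / center_dist g) ^+ n.+1 by rewrite mulr_ge0
  ?exprn_ge0 ?ler0n.
(* If W^q grows like u^|q|, the factorial of the tail integral is cancelled by that of J. If it
   decays, the tail integral is just bounded, and the estimate for bounded lambda applies with w =
   1. *)
case: hj => jE.
- apply: (@le_trans _ _ (c1 * ((n.+1 + n0)%:R ^+ n0.+1 * (mr g / center_dist g) ^+ n.+1)));
  last first.
    by rewrite ler_wpM2r // lerDl.
  rewrite /X /Y jE /c1 (ger0_norm (ltW M0)) [leRHS]mulrA.
  by apply: tail_estimate; rewrite ?r0 ?rD ?D0 ?DM ?zm0 ?zl //; exact: dist_at_ge hg _ hs.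
- apply: (@le_trans _ _ (c2 * ((n.+1 + n0)%:R ^+ n0.+1 * (mr g / center_dist g) ^+ n.+1)));
  last first.
    by rewrite ler_wpM2r // lerDr.
  rewrite /Y jE expr0 divr1 mulrC [leRHS](_ : _ =
    n0`!%:R * ((1 + k / 2 * `|M|) * expR (k / 2 * M * 1) *
    ((n.+1 + n0)%:R ^+ n0.+1 * (mr g / center_dist g) ^+ n.+1))); last by rewrite /c2; ring.
  apply: ler_wpM2l; first by rewrite ler0n.
  apply: (@le_trans _ _ (k / 2 * mr g * ((k / 2 * mr g) ^+ `|nu|%N / `|nu|%N`!%:R) * 1 ^+
    `|q|%N)).
    rewrite expr1n mulr1 /X ler_wpM2l // ler_wpM2r ?invr_ge0 ?ler0n //.
    by apply: lerXn2r; rewrite ?nnegrE //; exact: (ler_piMr kM0 s1).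
  apply: (@le_trans _ _ ((1 + k / 2 * M) * expR (k / 2 * M * 1) * n.+1%:R * (mr g / center_dist
    g) ^+ n.+1)).
    by apply: central_estimate; rewrite ?r0 ?rD ?D0 ?DM.
  rewrite (ger0_norm (ltW M0)) -[leLHS]mulrA; apply: ler_wpM2l.
    by rewrite mulr_ge0 ?expR_ge0 // addr_ge0 // mulr_ge0 // ltW.
  by rewrite ler_wpM2r ?exprn_ge0.
Qed.

End Tail.
End Terms.

(** As |m| < P, both P + m and P - m are positive, so the two indices of each term stay on the same
    side of 0 and differ by 1 in absolute value. The exponents n1 + 1 and n2 + 1 may fall to P -
    |m|. *)
Lemma expansion_deriv_pairs (m : int) (P : nat) : (`|m| < P)%N -> exists n1 n2 : nat,
  let A := - P%:Z - m in let B := P%:Z - m in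
  [/\ pair n1 A (A + 1) /\ pair n1 (A + 1) A, pair n2 (B - 1) B /\ pair n2 B (B - 1),
      (P - `|m| <= n1.+1 <= 2 * P)%N & (P - `|m| <= n2.+1 <= 2 * P)%N].
Proof.
move=> mP; exists `|(P%:Z + m)%R|%N.-1, `|(P%:Z - m)%R|%N.-1; rewrite /pair; split; last 2 first.
- by lia.
- by lia.
- by split; [left | right]; lia.
- by split; [right | left]; lia.
Qed.

(** * Integrating the derivative in s *)

Section Difference.
Local Open Scope classical_set_scope.
Variable R : realType.
Local Notation C := (CC R).
Local Notation mu := (@lebesgue_measure R).
Local Notation MR := (measurableTypeR R).
Implicit Types (e d : bool) (g : move R) (s lam : R) (m mq nu q : int) (n P : nat).

Lemma citg_zsum (D : set MR) P (F : int -> R -> C) : measurable D -> (forall p, citg D (F p)) ->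
  citg D (fun x => zsum P (F ^~ x)) /\ cint D (fun x => zsum P (F ^~ x)) =
    zsum P (fun p => cint D (F p)).
Proof.
move=> mD HF; have H n : citg D (fun x => F n%:Z x + F (- n%:Z) x) by apply: citgD.
have [c1 c2] := citg_sum (index_iota 1 P) mD H.
split; first exact: citgD.
rewrite /zsum cintD // c2; congr (_ + _); apply: eq_bigr => n _.
by rewrite cintD.
Qed.

Lemma citg_reim (D : set MR) (f : R -> C) : measurable D -> citg D f ->
  itg D (fun x => `|re (f x)| + `|im (f x)|).
Proof. by move=> mD [f1 f2]; apply: itgD => //; exact: integrable_norm. Qed.

Lemma kern_mono k1 k2 (be b be' X lam : R) : b <= be ->
  cabs (kern k1 k2 be be' X lam) <= cabs (kern k1 k2 b be' 0 lam).
Proof.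
move=> bb; rewrite !cabs_cexp ler_expR !(reD, reN, reM) /= !mulr0 !mul0r !subr0 !addr0.
have h1 := rsqrt_re_ge0 (lam ^+ 2 - k1 ^+ 2).
by rewrite lerD2r lerN2 ler_wpM2l.
Qed.

Variables k k2 kq : R.
Hypotheses (k0 : 0 < k) (kq0 : 0 < kq).
Local Notation deriv_term := (deriv_term k k2 kq).
Local Notation expansion := (expansion k k2 kq).
Local Notation expansion_deriv := (expansion_deriv k k2 kq).
Local Notation extra_factor := (extra_factor kq).
Local Notation kern_at := (kern_at k k2).

Lemma abs_le2 (del s : R) : 0 < del <= 1 -> - del < s < 1 + del -> `|s| <= 2.
Proof. by move=> /andP[d0 d1] /andP[s0 s1]; rewrite ler_norml; apply/andP; split; lra. Qed.

(** Both ends of the path have positive depth, so on a slightly longer path the depth stays above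
    [b], half of the smaller one; the kernel at depth [b] and offset 0 dominates. *)
Lemma kern_at_dom e Bd rm M c0 g : geo e Bd rm M c0 g ->
  exists del b : R, [/\ 0 < del <= 1, 0 < b <= Bd &
  forall s, - del < s < 1 + del -> forall lam, cabs (kern_at e g s lam) <= cabs (kern k k2 b
    (mb' g) 0 lam)].
Proof.
move=> [[/andP[h1 h1'] _ _ /andP[h2 h2'] _] _].
have hm : 0 < depth_at g 0 + mb g by rewrite addr_gt0.
pose b := Num.min (depth_at g 0) (mb g) / 2.
have mn : 0 < Num.min (depth_at g 0) (mb g) by rewrite lt_min h1 h2.
have b0 : 0 < b by rewrite divr_gt0.
have bl : Num.min (depth_at g 0) (mb g) <= depth_at g 0 by rewrite ge_min lexx.
have bl' : Num.min (depth_at g 0) (mb g) <= mb g by rewrite ge_min lexx orbT.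
have b2 : b + b <= depth_at g 0 by rewrite -splitr.
have b2' : b + b <= mb g by rewrite -splitr.
exists (b / (depth_at g 0 + mb g)), b; split.
- by rewrite divr_gt0 //= ler_pdivrMr // mul1r; lra.
- by rewrite b0 /=; lra.
move=> s /andP[s0 s1] lam; apply: kern_mono.
have dE : b / (depth_at g 0 + mb g) * (depth_at g 0 + mb g) = b by rewrite divfK // gt_eqF.
move: s0 s1 dE; set dl := b / _ => s0 s1 dE.
have E : depth_at g s = depth_at g 0 + s * (mb g - depth_at g 0) by rewrite (depth_atE _ s); ring.
have [sn|sp] := leP s 0.
  have h3 : - s * (depth_at g 0 + mb g) <= dl * (depth_at g 0 + mb g) by rewrite ler_wpM2r ?ltW
    //; lra.
  have h4 : 0 <= - s * depth_at g 0 by rewrite mulr_ge0 ?oppr_ge0 // ltW.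
  by rewrite E; move: h3 h4; rewrite dE !mulNr mulrDr mulrBr; lra.
have [sn1|sp1] := leP s 1.
  have h3 : 0 <= s * (mb g - (b + b)) by rewrite mulr_ge0 ?subr_ge0 // ltW.
  have h4 : 0 <= (1 - s) * (depth_at g 0 - (b + b)) by rewrite mulr_ge0 ?subr_ge0.
  by rewrite E; move: h3 h4; rewrite mulrBl !mulrBr mulrDr; lra.
have h3 : (s - 1) * (depth_at g 0 + mb g) <= dl * (depth_at g 0 + mb g) by rewrite ler_wpM2r
  ?ltW //; lra.
have h4 : 0 <= (s - 1) * mb g by rewrite mulr_ge0 ?subr_ge0 // ltW.
by rewrite E; move: h3 h4; rewrite dE !mulrBl mulrBr mulrDr; lra.
Qed.

Section Tail.
Variables (sg : R -> C) (Bd : R) (n0 : nat) (d : bool) (mq : int) (La : R).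
Hypotheses (msg : cmf sg) (Bd0 : 0 <= Bd) (kLa : k < La).
Hypothesis HT : tail_at k k2 Bd n0 (fun lam => extra_factor d mq lam * sg lam) La.
Local Notation D := `[La, +oo[.

Lemma citg_kernW e q be be' X : 0 < be <= Bd -> 0 < be' <= Bd -> `|X| <= Bd ->
  citg D (fun lam => kern k k2 be be' X lam * W k e lam ^ q * (extra_factor d mq lam * sg lam)).
Proof.
move=> /andP[b1 b1'] /andP[b2 b2'] b3; have bb := addr_gt0 b1 b2.
have z0 : 0 < cabs (zz be be' X).
  by rewrite lt_def cabs_ge0 andbT cabs_eq0; apply/eqP => /(congr1 (@re R)) /= E;
    rewrite E ltxx in bb.
have [A A0 HA] := tail_term k0 kLa HT z0.
by have [] := HA e q be be' X; rewrite ?b1' ?b2' ?(ltW b1) ?(ltW b2).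
Qed.

Lemma cmf_kern_at e g s : cmf (kern_at e g s). Proof. exact: cmf_kern. Qed.
Lemma cmf_extra_factor (d' : bool) : cmf (extra_factor d' mq). Proof. by apply: cmf_cont;
  apply: ccont_WX. Qed.
Lemma cmf_phase_waveX e g q : cmf (fun lam => phase_wave k e g lam ^ q).
Proof.
under eq_fun do rewrite phase_wave_zexp; apply: cmfM; last exact: cmf_cst.
by apply: cmf_cont; exact: ccont_WX.
Qed.

Section At.
Variables (e : bool) (g : move R) (b del : R).
Hypotheses (bBd : 0 < b <= Bd) (gBd : 0 < mb' g <= Bd).
Hypothesis dom : forall s, - del < s < 1 + del ->
  forall lam, cabs (kern_at e g s lam) <= cabs (kern k k2 b (mb' g) 0 lam).
Hypothesis del1 : 0 < del <= 1.

(** A majorant independent of s: the phases have modulus 1, the Bessel factor is bounded by [c1],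
    and the kernel is dominated by the one at depth [b]. *)
Lemma term_dom (c : R -> R) (c1 : R) q : 0 <= c1 -> (forall s, `|s| <= 2 -> `|c s| <= c1) ->
  exists2 G : R -> R,
  (forall lam, 0 <= G lam) /\ itg D G &
  forall s, - del < s < 1 + del -> forall lam,
    cabs (kern_at e g s lam * (ofR (c s) * phase_wave k e g lam ^ q) * extra_factor d mq lam *
      sg lam) <= G lam.
Proof.
move=> c10 cc.
have ci : citg D (fun lam => kern k k2 b (mb' g) 0 lam * W k e lam ^ q * (extra_factor d mq lam
  * sg lam)).
  by apply: citg_kernW => //; rewrite normr0.
set F := (fun lam => _) in ci.
exists (fun lam => c1 * (`|re (F lam)| + `|im (F lam)|)).
  split; first by move=> lam; rewrite mulr_ge0 // addr_ge0.
  by apply: itgZ => //; apply: citg_reim.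
move=> s hs lam; have hd := dom hs lam.
have s2 : `|s| <= 2.
  exact: abs_le2 del1 hs.
apply: (@le_trans _ _ (c1 * cabs (F lam))); last by rewrite ler_wpM2l // cabs_le.
have c5 (x1 x2 x3 x4 x5 : C) y : cabs x3 = y ->
    cabs (x1 * (x2 * x3) * x4 * x5) = cabs x1 * (cabs x2 * y) * cabs x4 * cabs x5 by move=> <-;
      rewrite !cabsM.
have c4 (x1 x2 x3 x4 : C) : cabs (x1 * x2 * (x3 * x4)) =
  cabs x1 * cabs x2 * (cabs x3 * cabs x4) by rewrite !cabsM.
have ZE : cabs (phase_wave k e g lam ^ q) = cabs (W k e lam ^ q).
  by rewrite phase_wave_zexp cabsM [X in _ * X](cabs_zexp1 q (cabs_phase (mphi g))) mulr1.
have -> : cabs (F lam) = cabs (kern k k2 b (mb' g) 0 lam) * cabs (W k e lam ^ q) * (cabs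
  (extra_factor d mq lam) * cabs (sg lam)).
  exact: c4.
rewrite (c5 _ _ _ _ _ _ ZE) cabs_ofR.
have c2 := cc _ s2.
have W0 := cabs_ge0 (W k e lam ^ q); have Q0 := cabs_ge0 (extra_factor d mq lam);
  have S0 := cabs_ge0 (sg lam).
have K0 := cabs_ge0 (kern_at e g s lam).
move: (cabs (W k e lam ^ q)) (cabs (extra_factor d mq lam)) (cabs (sg lam)) (cabs (kern _ _ _ _
  _ _)) (cabs (kern_at _ _ _ _)) W0 Q0 S0 K0 hd
  => w Q S K K' W0 Q0 S0 K0 hd.
rewrite [leLHS](_ : _ = (`|c s| * K') * (w * (Q * S))); last by ring.
rewrite [leRHS](_ : _ = (c1 * K) * (w * (Q * S))); last by ring.
by apply: ler_wpM2r; [rewrite !mulr_ge0 | apply: ler_pM].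
Qed.

Lemma cmf_term (c : R) s q : cmf (fun lam => kern_at e g s lam * (ofR c * phase_wave k e g lam ^
  q) * extra_factor d mq lam * sg lam).
Proof.
apply: cmfM => //; apply: cmfM; last exact: cmf_extra_factor; apply: cmfM;
  first exact: cmf_kern_at.
by apply: cmfM; [exact: cmf_cst | exact: cmf_phase_waveX].
Qed.

Lemma expansion_zsum m P s : (fun lam => expansion e d mq m P g s lam * sg lam) = fun lam =>
  zsum P (fun p => kern_at e g s lam * (ofR (besselJ (p - m) (k * mr g * s)) * phase_wave k e g
    lam ^ (p - m)) * extra_factor d mq lam * sg lam).
Proof.
apply/funext => lam.
transitivity (zsum P (fun p => kern_at e g s lam * extra_factor d mq lam * sg lam * (ofR
  (besselJ (p - m) (k * mr g * s)) * phase_wave k e g lam ^ (p - m)))).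
  by rewrite zsumMl /expansion; move: (kern_at _ _ _ _) (extra_factor _ _ _) (zsum _ _) (sg _)
    => ? ? ? ?; ring.
have H (z1 z2 z3 z4 : C) : z1 * z2 * z3 * z4 = z1 * z4 * z2 * z3 by ring.
by apply: zsum_ext => p; exact: H.
Qed.

Lemma citg_term c s q : - del < s < 1 + del ->
  citg D (fun lam => kern_at e g s lam * (ofR c * phase_wave k e g lam ^ q) * extra_factor d mq
    lam * sg lam).
Proof.
move=> hs; have [G [G0 Gi] Gd] := @term_dom (fun=> c) `|c| q (normr_ge0 _) (fun _ _ => lexx _).
have [] // := @citg_le _ D set0 _ G _ _ (cmf_term c s q) Gi _.
by move=> x _ _; exact: Gd.
Qed.

Lemma citg_expansion m P s : - del < s < 1 + del ->
  citg D (fun lam => expansion e d mq m P g s lam * sg lam).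
Proof.
move=> hs; rewrite expansion_zsum.
by apply: (citg_zsum P _ _).1 => // p; exact: citg_term.
Qed.

End At.

Lemma tail_difference rm M c0 : 1 < c0 -> 0 < rm -> exists2 A : R, 0 <= A &
  forall e g m P, geo e Bd rm M c0 g -> (`|m| < P)%N ->
    [/\ citg D (fun lam => expansion e d mq m P g 0 lam * sg lam),
        citg D (fun lam => expansion e d mq m P g 1 lam * sg lam) &
        cabs (cint D (fun lam => expansion e d mq m P g 0 lam * sg lam) - cint D (fun lam =>
          expansion e d mq m P g 1 lam * sg lam)) <=
        A * (2 * P + n0)%:R ^+ n0.+1 * (mr g / center_dist g) ^+ (P - `|m|)].
Proof.
move=> c01 rm0; have [A A0 HA] := tail_deriv_term k0 kLa HT M c01 rm0.
(* A factor 2 from the mean value bound and 4 for the terms of the derivative. *)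
exists (8 * A); first by rewrite mulr_ge0.
move=> e g m [//|P] hg mP.
have [del [b [hdel hb hdom]]] := kern_at_dom hg.
have gb' : 0 < mb' g <= Bd by have [[]] := hg.
have dl : 0 < del by case/andP: hdel.
have [n1 [n2 [[p1 p2] [p3 p4] hn1 hn2]]] := expansion_deriv_pairs mP.
set a := - P.+1%:Z - m in p1 p2; set b' := P.+1%:Z - m in p3 p4.
have r0 := mr_ge0 hg; have rD := mr_le c01 hg; have D0 := center_dist_gt0 rm0 hg.
have y0 : 0 <= mr g / center_dist g by rewrite divr_ge0 // ltW.
have y1 : mr g / center_dist g <= 1 by rewrite ler_pdivrMr // mul1r.
pose E := A * (2 * P.+1 + n0)%:R ^+ n0.+1 * (mr g / center_dist g) ^+ (P.+1 - `|m|).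
have Hle n : (P.+1 - `|m| <= n.+1 <= 2 * P.+1)%N ->
  A * (n.+1 + n0)%:R ^+ n0.+1 * (mr g / center_dist g) ^+ n.+1 <= E.
  move=> /andP[l1 l2]; rewrite /E -!mulrA ler_wpM2l // ler_pM ?exprn_ge0 ?ler0n //.
    by rewrite lerXn2r ?nnegrE ?ler0n // ler_nat leq_add2r.
  by rewrite ler_wiXn2l.
have t0 : - del < 0 < 1 + del by apply/andP; split; lra.
have t1 : - del < 1 < 1 + del by apply/andP; split; lra.
have cT := citg_expansion hb gb' hdom hdel.
split; [exact: cT t0 | exact: cT t1 |].
have dom n nu q : pair n nu q -> exists2 G : R -> R, (forall lam, 0 <= G lam) /\ itg D G &
    forall s, - del < s < 1 + del -> forall lam, cabs (deriv_term e d mq g nu q s lam * sg lam)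
      <= G lam.
  move=> _; have [c c0' hc] := bessel_coef_bounded k g nu (ler0n _ 2).
  exact: (term_dom hb gb' hdom hdel q c0' hc).
have [G1 [G10 G1i] G1d] := dom _ _ _ p1.
have [G2 [G20 G2i] G2d] := dom _ _ _ p2.
have [G3 [G30 G3i] G3d] := dom _ _ _ p3.
have [G4 [G40 G4i] G4d] := dom _ _ _ p4.
rewrite (_ : 8 * A * _ * _ = 2 * (4 * E)); last by rewrite /E; ring.
have dE s lam : expansion_deriv e d mq m P.+1 g s lam * sg lam =
   (deriv_term e d mq g a (a + 1) s lam * sg lam + deriv_term e d mq g (a + 1) a s lam * sg lam) +
   ((-1) * (deriv_term e d mq g (b' - 1) b' s lam * sg lam) + (-1) * (deriv_term e d mq g b' (b'
     - 1) s lam * sg lam)).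
  have H (z1 z2 z3 z4 w : C) : (z1 + z2 - z3 - z4) * w =
    z1 * w + z2 * w + ((-1) * (z3 * w) + (-1) * (z4 * w)) by ring.
  exact: H.
apply: (@integral_mvt _ D (fun s lam => expansion e d mq m P.+1 g s lam * sg lam)
   (fun s lam => expansion_deriv e d mq m P.+1 g s lam * sg lam) (fun x => (G1 x + G2 x) + (G3 x
     + G4 x)) del) => //.
- by move=> s hs; exact: cT hs.
- move=> s x hs _; have hT : cderiv (fun s => expansion e d mq m P.+1 g s x) s (expansion_deriv
  e d mq m P.+1 g s x) by exact: cderiv_expansion.
  have {}hT := cderivZ (sg x) hT.
  have E1 : (fun s => expansion e d mq m P.+1 g s x * sg x) =
    fun s => sg x * expansion e d mq m P.+1 g s x.
    by apply/funext => t; exact: mulrC.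
  by rewrite E1; apply: cderiv_eq hT _; exact: mulrC.
- by move=> x; rewrite !addr_ge0.
- by do !apply: itgD.
- move=> s x hs _; rewrite dE.
  apply: le_trans (cabsD _ _) _; rewrite lerD //; (apply: le_trans (cabsD _ _) _);
    rewrite lerD //.
  + exact: G1d.
  + exact: G2d.
  + by rewrite mulN1r cabsN; exact: G3d.
  + by rewrite mulN1r cabsN; exact: G4d.
- move=> s hs.
  have [i1 e1] := HA e g n1 _ _ s hg hs p1.
  have [i2 e2] := HA e g n1 _ _ s hg hs p2.
  have [i3 e3] := HA e g n2 _ _ s hg hs p3.
  have [i4 e4] := HA e g n2 _ _ s hg hs p4.
  under [X in cint _ X]eq_fun do rewrite dE.
  have i3' := citgZ (-1) (measurable_itv _) i3; have i4' := citgZ (-1) (measurable_itv _) i4.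
  have i12 := citgD (measurable_itv _) i1 i2; have i34 := citgD (measurable_itv _) i3' i4'.
  rewrite (cintD (measurable_itv _) i12 i34) (cintD (measurable_itv _) i1 i2) (cintD
    (measurable_itv _) i3' i4') !cintZ // !mulN1r.
  rewrite (_ : 4 * E = (E + E) + (E + E)); last by ring.
  apply: le_trans (cabsD _ _) _; rewrite lerD //; (apply: le_trans (cabsD _ _) _);
    rewrite lerD ?cabsN //.
  + exact: le_trans e1 (Hle _ hn1).
  + exact: le_trans e2 (Hle _ hn1).
  + exact: le_trans e3 (Hle _ hn2).
  + exact: le_trans e4 (Hle _ hn2).
Qed.

End Tail.
End Difference.

Section CentralDifference.
Local Open Scope classical_set_scope.
Variable R : realType.
Local Notation C := (CC R).
Implicit Types (e d : bool) (g : move R) (s lam : R) (m mq nu q : int) (n P : nat).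
Variables k k2 kq : R.
Hypotheses (k0 : 0 < k) (kq0 : 0 < kq).
Local Notation deriv_term := (deriv_term k k2 kq).
Local Notation expansion := (expansion k k2 kq).
Local Notation expansion_deriv := (expansion_deriv k k2 kq).

Lemma expansion_deriv_ho (La Bd rm M c0 : R) mq n0 : 0 < La -> 0 <= Bd -> 1 < c0 -> 0 < rm ->
  exists2 A : R, 0 <= A & forall e d g m P s, geo e Bd rm M c0 g -> 0 <= s <= 1 -> (`|m| < P)%N ->
    ho La (A * (2 * P + n0)%:R ^+ n0.+1 * (mr g / center_dist g) ^+ (P - `|m|)) (expansion_deriv
      e d mq m P g s).
Proof.
move=> La0 Bd0 c01 rm0; have [A A0 HA] := deriv_term_central k2 k0 kq0 M mq La0 Bd0 c01 rm0.
exists (4 * A); first by rewrite mulr_ge0.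
move=> e d g m [//|P] s hg hs mP.
have [n1 [n2 [[p1 p2] [p3 p4] hn1 hn2]]] := expansion_deriv_pairs mP.
have r0 := mr_ge0 hg; have rD := mr_le c01 hg; have D0 := center_dist_gt0 rm0 hg.
have y0 : 0 <= mr g / center_dist g by rewrite divr_ge0 // ltW.
have y1 : mr g / center_dist g <= 1 by rewrite ler_pdivrMr // mul1r.
pose E := A * (2 * P.+1 + n0)%:R ^+ n0.+1 * (mr g / center_dist g) ^+ (P.+1 - `|m|).
have Hle n : (P.+1 - `|m| <= n.+1 <= 2 * P.+1)%N ->
  A * n.+1%:R * (mr g / center_dist g) ^+ n.+1 <= E.
  move=> /andP[l1 l2]; rewrite /E -!mulrA ler_wpM2l // ler_pM ?exprn_ge0 ?ler0n //;
    last by rewrite ler_wiXn2l.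
  by rewrite -natrX ler_nat expnS (leq_trans (leq_trans l2 (leq_addr n0 _))) // leq_pmulr //
    expn_gt0.
have h n nu q : (P.+1 - `|m| <= n.+1 <= 2 * P.+1)%N -> pair n nu q ->
  ho La E (deriv_term e d mq g nu q s).
  by move=> hn hp; apply: ho_le (Hle _ hn) _; exact: HA.
have hN n nu q : (P.+1 - `|m| <= n.+1 <= 2 * P.+1)%N -> pair n nu q ->
  ho La E (fun x => (-1) * deriv_term e d mq g nu q s x).
  by move=> hn hp; have := hoZ (-1) (h n nu q hn hp);
    rewrite cabsN (_ : cabs 1 = 1) ?mul1r // -ofR1 cabs_ofR normr1.
rewrite (_ : 4 * A * _ * _ = (E + E) + (E + E)); last by rewrite /E; ring.
apply: ho_ext (hoD (hoD (h _ _ _ hn1 p1) (h _ _ _ hn1 p2)) (hoD (hN _ _ _ hn2 p3) (hN _ _ _ hn2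
  p4))) => lam.
have H (z1 z2 z3 z4 : C) : z1 + z2 + ((-1) * z3 + (-1) * z4) = z1 + z2 - z3 - z4 by ring.
exact: H.
Qed.

(** The mean value bound in s is used at each point, and for the Hoelder condition at each pair of
    points. Thus the finite part of the integral never has to be differentiated in s. *)
Lemma central_difference (La Bd rm M c0 : R) mq n0 : 0 < La -> 0 <= Bd -> 1 < c0 -> 0 < rm ->
  exists2 A : R, 0 <= A & forall e d g m P, geo e Bd rm M c0 g -> (`|m| < P)%N ->
    ho La (A * (2 * P + n0)%:R ^+ n0.+1 * (mr g / center_dist g) ^+ (P - `|m|))
      (fun lam => expansion e d mq m P g 0 lam - expansion e d mq m P g 1 lam).
Proof.
move=> La0 Bd0 c01 rm0; have [A A0 HA] := expansion_deriv_ho M mq n0 La0 Bd0 c01 rm0.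
exists (2 * A); first by rewrite mulr_ge0.
move=> e d g m [//|P] hg mP.
pose E := A * (2 * P.+1 + n0)%:R ^+ n0.+1 * (mr g / center_dist g) ^+ (P.+1 - `|m|).
rewrite (_ : 2 * A * _ * _ = 2 * E); last by rewrite /E; ring.
have dT lam s : cderiv (fun s => expansion e d mq m P.+1 g s lam) s (expansion_deriv e d mq m
  P.+1 g s lam) by exact: cderiv_expansion.
have H s (hs : 0 <= s <= 1) := HA e d g m P.+1 s hg hs mP.
have sw (z w : C) : cabs (z - w) = cabs (w - z) by rewrite -cabsN opprB.
split=> [x xL|x y xL yL].
  rewrite sw; have := @cmvt_bound _ (fun s => expansion e d mq m P.+1 g s x) (fun s =>
    expansion_deriv e d mq m P.+1 g s x) 0 1 E ler01.
  by rewrite subr0 mulr1; apply=> [s _|s hs] //; exact: (H s hs).1.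
have H4 (a b a' b' : C) : a - b - (a' - b') = - ((b - b') - (a - a')) by ring.
rewrite H4 cabsN.
have := @cmvt_bound _ (fun s => expansion e d mq m P.+1 g s x - expansion e d mq m P.+1 g s y)
  (fun s => expansion_deriv e d mq m P.+1 g s x - expansion_deriv e d mq m P.+1 g s y) 0 1 (E *
    Num.sqrt `|x - y|) ler01.
rewrite subr0 mulr1 mulrA; apply=> s hs; first exact: cderivB.
exact: (H s hs).2.
Qed.

End CentralDifference.

(** * The remainder integrated against sigma *)

Section Remainder.
Local Open Scope classical_set_scope.
Variable R : realType.
Local Notation C := (CC R).
Local Notation mu := (@lebesgue_measure R).
Local Notation MR := (measurableTypeR R).
Implicit Types (e d : bool) (g : move R) (s lam : R) (m mq nu q : int) (n P : nat).
Variables k k2 kq : R.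
Hypotheses (k0 : 0 < k) (kq0 : 0 < kq).
Local Notation expansion := (expansion k k2 kq).
Local Notation extra_factor := (extra_factor kq).
Local Notation kern_at := (kern_at k k2).
Variables (sg : R -> C) (side : R -> bool).
Local Notation S := (real_poles sg).
Hypotheses (msg : cmf sg) (fS : finite_set S).
Hypothesis loc : forall m : R, isq_bounded m (fun x => sg x - residue sg m / ofR (x - m)).
Hypothesis even : forall x, sg (- x) = sg x.
Hypothesis hinf : inf_expansion sg (k / 2).

Lemma tail_at_le Bd n0 n1 (f : R -> C) La : (n0 <= n1)%N -> tail_at k k2 Bd n0 f La ->
  tail_at k k2 Bd n1 f La.
Proof.
move=> nn H zm zm0; have [A A0 HA] := H zm zm0; exists A => // be be' X j l h1 h2 h3 h4 h5 F.
have [i1 i2] := HA be be' X j l h1 h2 h3 h4 h5; split=> //; apply: le_trans i2 _.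
rewrite ler_wpM2l // ler_wpM2r ?invr_ge0 ?exprn_ge0 ?mulr_ge0 ?cabs_ge0 ?(ltW k0) ?invr_ge0 //.
by rewrite ler_nat leq_fact // leq_add2l.
Qed.

(** The tail estimates hold from any large enough cutoff on, so a common one can be chosen for both
    values of [d], beyond k and beyond all poles; the larger [n0] serves for both. *)
Lemma cutoff Bd mq : 0 <= Bd -> exists n0 La, [/\ 0 < La, k < La,
  forall nu : R, S nu -> `|nu| + sep_radius S < La &
  forall d, tail_at k k2 Bd n0 (fun lam => extra_factor d mq lam * sg lam) La].
Proof.
move=> Bd0; have k20 : 0 < k / 2 by rewrite divr_gt0.
have T d : exists n0, tailb k k2 k Bd n0 (fun lam => extra_factor d mq lam * sg lam).
  apply: (@tail_bound _ k k2 k k0 Bd sg (extra_factor d mq) `|mq|%N Bd0 msg _ hinf (germ_W kq0 d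
    mq k20)).
  by apply: cmf_cont; exact: ccont_WX.
have [n1 [L1 H1]] := T true; have [n2 [L2 H2]] := T false.
have [B _ HB] := finite_bounded fS.
pose La := Num.max (Num.max L1 L2) (Num.max (k + 1) (B + sep_radius S + 1)).
have l1 : L1 <= La by rewrite !le_max lexx.
have l2 : L2 <= La by rewrite !le_max lexx orbT.
have l3 : k + 1 <= La by rewrite !le_max lexx !orbT.
have l4 : B + sep_radius S + 1 <= La by rewrite !le_max lexx !orbT.
exists (maxn n1 n2), La; split.
- by apply: lt_le_trans l3; rewrite addr_gt0.
- by apply: lt_le_trans l3; rewrite ltrDl.
- by move=> nu /HB h; apply: lt_le_trans l4; rewrite -addrA; apply: ltrD => //; rewrite ltrDl.
- by case; [apply: tail_at_le (leq_maxl _ _) (H1 La l1) | apply: tail_at_le (leq_maxr _ _) (H2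
  La l2)].
Qed.

Section At.
Variables (Bd : R) (mq : int) (n0 : nat) (La : R).
Hypotheses (Bd0 : 0 <= Bd) (La0 : 0 < La) (kLa : k < La).
Hypothesis hLa : forall nu : R, S nu -> `|nu| + sep_radius S < La.
Hypothesis HT : forall d, tail_at k k2 Bd n0 (fun lam => extra_factor d mq lam * sg lam) La.
Local Notation adm := (adm sg La).
Local Notation rint := (real_int side sg).
Local Notation D := `[La, +oo[.
Local Notation central := (central sg side La).

(** Admissibility without its constant, which is all that linearity of the integral needs. *)
Definition cadm (f : R -> C) := exists2 A : R, 0 <= A & adm A f.

Lemma cadmD f h : cadm f -> cadm h -> cadm (fun x => f x + h x).
Proof. by move=> [A A0 Af] [B B0 Bh]; exists (A + B); [rewrite addr_ge0 | exact: admD]. Qed.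

Lemma cadmZ c f : cadm f -> cadm (fun x => c * f x).
Proof. by move=> [A A0 Af]; exists (cabs c * A); [rewrite mulr_ge0 // cabs_ge0 | exact: admZ].
  Qed.

Lemma rintD f h : cadm f -> cadm h -> rint (fun x => f x + h x) = rint f + rint h.
Proof. by move=> [A A0 Af] [B B0 Bh]; exact: (real_intD side msg fS loc La0 hLa A0 B0 Af Bh). Qed.

Lemma rintZ c f : cadm f -> rint (fun x => c * f x) = c * rint f.
Proof. by move=> [A A0 Af]; exact: (real_intZ side msg fS loc La0 hLa c A0 Af). Qed.

Lemma rint_zsum P (F : int -> R -> C) : (forall p, cadm (F p)) ->
  cadm (fun x => zsum P.+1 (F ^~ x)) /\ rint (fun x => zsum P.+1 (F ^~ x)) =
    zsum P.+1 (fun p => rint (F p)).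
Proof.
move=> HF; elim: P => [|P [c1 c2]].
  under eq_fun do rewrite zsum1.
  by rewrite zsum1.
under eq_fun do rewrite zsumS.
have h := cadmD (HF P.+1%:Z) (HF (- P.+1%:Z)).
by split; [exact: cadmD | rewrite (rintD c1 h) c2 (rintD (HF _) (HF _)) zsumS].
Qed.

Lemma neg_tail (f : R -> C) : cmf f -> citg D (fun x => f (- x)) ->
  citg `]-oo, -La] f /\ cint `]-oo, -La] f = cint D (fun x => f (- x)).
Proof.
move=> mf fi.
have E : (fun x : R => 0 - x) @^-1` `]-oo, -La] = D.
  by apply/seteqP; split => x /=; rewrite !in_itv /= sub0r lerN2 ?andbT.
have F : (fun x => f (0 - x)) = fun x => f (- x) by apply/funext => x; rewrite sub0r.
have [] := @cint_reflect _ 0 `]-oo, -La] f (measurable_itv _) mf.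
  by rewrite F E.
by rewrite F E.
Qed.

Lemma neg_tail_sg (f : R -> C) : cmf f -> citg D (fun x => f (- x) * sg x) ->
  citg `]-oo, -La] (fun x => f x * sg x) /\ cint `]-oo, -La] (fun x => f x * sg x) =
    cint D (fun x => f (- x) * sg x).
Proof.
move=> mf fi; have F : (fun x => f (- x) * sg (- x)) =
  fun x => f (- x) * sg x by apply/funext => x; rewrite even.
by have := neg_tail (cmfM mf msg); rewrite F; apply.
Qed.

Lemma ho_adm A (f : R -> C) : cmf f -> ho La A f -> citg D (fun x => f x * sg x) ->
  citg D (fun x => f (- x) * sg x) -> adm A f.
Proof.
move=> mf [h1 h2] i1 i2; split=> //; last by have [] := neg_tail_sg mf i2.
move=> x nu xL nS; apply: h2 => //.
have [r0 _] := sep_radiusP fS; have := hLa nS; have := ler_norm nu; have := ler_norm (- nu);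
  rewrite normrN.
by move=> *; apply/andP; split; lra.
Qed.

(** With suitable exponents these are the integrands of L_p and A_mp, see [coefL_base] and
    [coefA_base]. *)
Definition base e d q be be' X lam : C := kern k k2 be be' X lam * W k e lam ^ q * extra_factor
  d mq lam.

Lemma baseN e d q be be' X lam : base e d q be be' X (- lam) =
  base (~~ e) (~~ d) q be be' (- X) lam.
Proof. by rewrite /base kernN /extra_factor !WN. Qed.

Lemma cmf_base e d q be be' X : cmf (base e d q be be' X).
Proof.
apply: cmfM; last exact: cmf_extra_factor; apply: cmfM; first exact: cmf_kern.
by apply: cmf_cont; exact: ccont_WX.
Qed.

Lemma citg_base e d q be be' X : 0 < be <= Bd -> 0 < be' <= Bd -> `|X| <= Bd ->
  citg D (fun lam => base e d q be be' X lam * sg lam).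
Proof.
move=> h1 h2 h3; have := citg_kernW k0 kLa (HT d) e q h1 h2 h3.
by congr (citg _ _); apply/funext => x; rewrite mulrA.
Qed.

Lemma base_ho q : exists2 A : R, 0 <= A & forall e d be be' X, 0 < be <= Bd -> 0 < be' <= Bd ->
  `|X| <= Bd ->
  adm A (base e d q be be' X).
Proof.
have [A0 H0] := ho_kern La0 k k2 Bd0.
have [w w1 Hw] := ho_W k0 La0; have [w' w'1 Hw'] := ho_W kq0 La0.
have A00 : 0 <= A0 by apply: (ho_ge0 La0 (H0 0 0 0 _ _ _)); rewrite ?lexx ?normr0.
exists (2 * (2 * A0 * w ^+ `|q|%N) * w' ^+ `|mq|%N).
  by rewrite !mulr_ge0 // exprn_ge0 // (le_trans ler01).
move=> e d be be' X h1 h2 h3; apply: ho_adm.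
- exact: cmf_base.
- have h1' : 0 <= be <= Bd by case/andP: h1 => /ltW -> ->.
  have h2' : 0 <= be' <= Bd by case/andP: h2 => /ltW -> ->.
  exact: (hoM La0 (hoM La0 (H0 _ _ _ h1' h2' h3) (Hw e q)) (Hw' d mq)).
- exact: citg_base.
- rewrite (_ : (fun x => _) = fun x => base (~~ e) (~~ d) q be be' (- X) x * sg x).
    by apply: citg_base; rewrite ?normrN.
  by apply/funext => x; rewrite baseN.
Qed.

(** A bound without decay, for the L2L remainders with P <= |m|, where the truncated sum does not
    yet contain the index m. *)
Lemma base_bound q zm : 0 < zm -> exists2 A : R, 0 <= A & forall e d be be' X, 0 < be <= Bd ->
  0 < be' <= Bd -> `|X| <= Bd ->
  zm <= cabs (zz be be' X) -> cabs (rint (base e d q be be' X)) <= A.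
Proof.
move=> zm0; have [Ac Ac0 Hc] := base_ho q.
have [K [K0 HK]] := central_bound side msg fS loc hLa.
have kz : 0 < k / 2 * zm by rewrite mulr_gt0 // divr_gt0.
have tb : exists2 A : R, 0 <= A & forall e d be be' X, 0 < be <= Bd -> 0 < be' <= Bd ->
  `|X| <= Bd ->
    zm <= cabs (zz be be' X) -> cabs (cint D (fun lam => base e d q be be' X lam * sg lam)) <= A.
  have [A1 A10 H1] := tail_term k0 kLa (HT true) zm0;
    have [A2 A20 H2] := tail_term k0 kLa (HT false) zm0.
  pose f := (`|q|%N + n0)`!%:R / (k / 2 * zm) ^+ `|q|%N + n0`!%:R : R.
  have f0 : 0 <= f by rewrite addr_ge0 ?ler0n // divr_ge0 ?ler0n // exprn_ge0 // ltW.
  exists ((A1 + A2) * f); first by rewrite mulr_ge0 // addr_ge0.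
  move=> e d be be' X /andP[h1 h1'] /andP[h2 h2'] h3 hz.
  have E : (fun lam => base e d q be be' X lam * sg lam) =
    fun lam => kern k k2 be be' X lam * W k e lam ^ q * (extra_factor d mq lam * sg lam).
    by apply/funext => x; rewrite mulrA.
  rewrite E.
  have fb j : j = `|q|%N \/ j = 0%N -> (j + n0)`!%:R / (k / 2 * cabs (zz be be' X)) ^+ j <= f.
    case=> ->; last by rewrite expr0 divr1 lerDr divr_ge0 ?ler0n // exprn_ge0 // ltW.
    apply: (@le_trans _ _ ((`|q|%N + n0)`!%:R / (k / 2 * zm) ^+ `|q|%N));
      last by rewrite lerDl ler0n.
    rewrite ler_wpM2l ?ler0n // lef_pV2 ?posrE ?exprn_gt0 //; last first.
      by rewrite mulr_gt0 ?divr_gt0 // (lt_le_trans zm0).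
    have k20 : 0 < k / 2 by rewrite divr_gt0.
    have z0 : 0 <= k / 2 * cabs (zz be be' X) by rewrite mulr_ge0 ?cabs_ge0 // ltW.
    by rewrite lerXn2r ?nnegrE // ?(ltW kz) // ler_pM2l.
  case: d {E}.
    have [_ [j hj hb]] := H1 e q be be' X (introT andP (conj (ltW h1) h1')) (introT andP (conj
      (ltW h2) h2')) h3 (addr_gt0 h1 h2) hz.
    by apply: le_trans hb _; apply: ler_pM => //; [rewrite divr_ge0 ?ler0n // exprn_ge0 //
      mulr_ge0 ?cabs_ge0 // divr_ge0 // ltW | rewrite lerDl | exact: fb].
  have [_ [j hj hb]] := H2 e q be be' X (introT andP (conj (ltW h1) h1')) (introT andP (conj
    (ltW h2) h2')) h3 (addr_gt0 h1 h2) hz.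
  by apply: le_trans hb _; apply: ler_pM => //; [rewrite divr_ge0 ?ler0n // exprn_ge0 //
    mulr_ge0 ?cabs_ge0 // divr_ge0 // ltW | rewrite lerDr | exact: fb].
have [A A0 HA] := tb.
exists (A + A + K * Ac); first by rewrite !addr_ge0 // mulr_ge0.
move=> e d be be' X h1 h2 h3 hz; have ad := Hc e d be be' X h1 h2 h3.
have h3N : `|- X| <= Bd by rewrite normrN.
have hzN : zm <= cabs (zz be be' (- X)) by move: hz; rewrite /zz /cabs /= !sqrrN.
rewrite (real_intE side msg fS loc La0 hLa Ac0 ad).
apply: le_trans (cabsD _ _) _; apply: lerD; last exact: HK.
apply: le_trans (cabsD _ _) _; apply: lerD; last exact: HA.
have E : (fun x => base e d q be be' X (- x) * sg x) =
  fun x => base (~~ e) (~~ d) q be be' (- X) x * sg x.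
  by apply/funext => x; rewrite baseN.
have [] := @neg_tail_sg (base e d q be be' X) (cmf_base e d q be be' X).
  by rewrite E; exact: citg_base.
by move=> _ ->; rewrite E; exact: HA.
Qed.

Definition approx e d m P g : C := zsum P (fun p =>
  rint (base e d (p - m) (mb g) (mb' g) (mX g)) *
  (ofR (besselJ (p - m) (k * mr g)) * cexp (Ci R * ofR (mphi g)) ^ (p - m))).

Lemma expansion_base e d m P g s lam : expansion e d mq m P g s lam =
  zsum P (fun p => ofR (besselJ (p - m) (k * mr g * s)) * cexp (Ci R * ofR (mphi g)) ^ (p - m) *
    base e d (p - m) (depth_at g s) (mb' g) (offset_at e g s) lam).
Proof.
have H (z1 z2 z3 z4 z5 : C) : z1 * z3 * (z2 * (z4 * z5)) = z2 * z5 * (z1 * z4 * z3) by ring.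
transitivity (zsum P (fun p => kern_at e g s lam * extra_factor d mq lam * (ofR (besselJ (p - m)
  (k * mr g * s)) * phase_wave k e g lam ^ (p - m)))).
  rewrite zsumMl /expansion; move: (zsum _ _) => z; exact: mulrAC.
by apply: zsum_ext => p; rewrite phase_wave_zexp; exact: H.
Qed.

Lemma expansion_int e d m P g s : 0 < depth_at g s <= Bd -> 0 < mb' g <= Bd ->
  `|offset_at e g s| <= Bd ->
  cadm (expansion e d mq m P.+1 g s) /\ rint (expansion e d mq m P.+1 g s) =
    zsum P.+1 (fun p => ofR (besselJ (p - m) (k * mr g * s)) * cexp (Ci R * ofR (mphi g)) ^ (p -
      m) *
      rint (base e d (p - m) (depth_at g s) (mb' g) (offset_at e g s))).
Proof.
move=> h1 h2 h3.
have cb q : cadm (base e d q (depth_at g s) (mb' g) (offset_at e g s)).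
  by have [A A0 HA] := base_ho q; exists A => //; exact: HA.
rewrite (_ : expansion e d mq m P.+1 g s = fun x => zsum P.+1 (fun p => ofR (besselJ (p - m) (k
  * mr g * s)) * cexp (Ci R * ofR (mphi g)) ^ (p - m) *
    base e d (p - m) (depth_at g s) (mb' g) (offset_at e g s) x)); last by apply/funext => x;
      exact: expansion_base.
have [c1 c2] := @rint_zsum P (fun p x => ofR (besselJ (p - m) (k * mr g * s)) * cexp (Ci R * ofR
  (mphi g)) ^ (p - m) *
    base e d (p - m) (depth_at g s) (mb' g) (offset_at e g s) x) (fun p => cadmZ _ (cb (p - m))).
by split=> //; rewrite c2; apply: zsum_ext => p; exact: (rintZ _ (cb _)).
Qed.

(** The tail at +oo is bounded by [tail_difference], the one at -oo by the same lemma for the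
    reflected move, and the central part by its continuity in the Hoelder size of the integrand. *)
Lemma remainder_at rm M c0 : 1 < c0 -> 0 < rm -> exists2 A : R, 0 <= A &
  forall e d g m P, geo e Bd rm M c0 g -> (`|m| < P)%N ->
    cabs (rint (fun lam => kern_at e g 0 lam * extra_factor d mq lam) - approx e d m P g) <=
      A * (2 * P + n0)%:R ^+ n0.+1 * (mr g / center_dist g) ^+ (P - `|m|).
Proof.
move=> c01 rm0.
have [A1 A10 H1] := tail_difference k0 kq0 msg Bd0 kLa (HT true) M c01 rm0.
have [A2 A20 H2] := tail_difference k0 kq0 msg Bd0 kLa (HT false) M c01 rm0.
have [A3 A30 H3] := central_difference k2 k0 kq0 M mq n0 La0 Bd0 c01 rm0.
have [K [K0 HK]] := central_bound side msg fS loc hLa.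
exists ((A1 + A2) + (A1 + A2) + K * A3); first by rewrite !addr_ge0 // mulr_ge0.
have H e d g m P : geo e Bd rm M c0 g -> (`|m| < P)%N ->
    [/\ citg D (fun lam => expansion e d mq m P g 0 lam * sg lam),
        citg D (fun lam => expansion e d mq m P g 1 lam * sg lam) &
        cabs (cint D (fun lam => expansion e d mq m P g 0 lam * sg lam) - cint D (fun lam =>
          expansion e d mq m P g 1 lam * sg lam)) <=
        (A1 + A2) * (2 * P + n0)%:R ^+ n0.+1 * (mr g / center_dist g) ^+ (P - `|m|)].
  move=> hg mP; have r0 := mr_ge0 hg; have D0 := center_dist_gt0 rm0 hg.
  have y0 : 0 <= mr g / center_dist g by rewrite divr_ge0 // ltW.
  case: d.
    have [i1 i2 i3] := H1 e g m P hg mP; split=> //; apply: le_trans i3 _.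
    by rewrite ler_wpM2r ?exprn_ge0 // ler_wpM2r ?exprn_ge0 ?ler0n // lerDl.
  have [i1 i2 i3] := H2 e g m P hg mP; split=> //; apply: le_trans i3 _.
  by rewrite ler_wpM2r ?exprn_ge0 // ler_wpM2r ?exprn_ge0 ?ler0n // lerDr.
move=> e d g m [//|P] hg mP.
have r0 := mr_ge0 hg; have D0 := center_dist_gt0 rm0 hg.
have y0 : 0 <= mr g / center_dist g by rewrite divr_ge0 // ltW.
pose Y := (2 * P.+1 + n0)%:R ^+ n0.+1 * (mr g / center_dist g) ^+ (P.+1 - `|m|).
have Y0 : 0 <= Y by rewrite mulr_ge0 ?exprn_ge0 ?ler0n.
have [[h1 h2 h3 h4 h5] _] := hg.
have [c0' _] := @expansion_int e d m P g 0 h4 h2 h5.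
have b1 : depth_at g 1 = mb g by rewrite /depth_at subrr mul0r addr0.
have X1 : offset_at e g 1 = mX g by rewrite /offset_at subrr mul0r addr0.
have [c1' e1] : cadm (expansion e d mq m P.+1 g 1) /\ rint (expansion e d mq m P.+1 g 1) =
  approx e d m P.+1 g.
  have [| | |c1 c2] := @expansion_int e d m P g 1; rewrite ?b1 ?X1 //.
  by split=> //; rewrite c2 b1 X1 mulr1 /approx; apply: zsum_ext => p; exact: mulrC.
have E0 : (fun lam => kern_at e g 0 lam * extra_factor d mq lam) = expansion e d mq m P.+1 g 0.
  by apply/funext => lam; rewrite expansion_0.
pose Del lam := expansion e d mq m P.+1 g 0 lam + (-1) * expansion e d mq m P.+1 g 1 lam.
have ED : rint Del = rint (fun lam => kern_at e g 0 lam * extra_factor d mq lam) - approx e d m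
  P.+1 g.
  by rewrite E0 /Del (rintD c0' (cadmZ _ c1')) (rintZ _ c1') e1 mulN1r.
rewrite -ED.
have [B B0 aB] : cadm Del by apply: cadmD => //; exact: cadmZ.
have mD : cmf Del by case: aB.
have dE e' d' g' x : (expansion e' d' mq m P.+1 g' 0 x + (-1) * expansion e' d' mq m P.+1 g' 1
  x) * sg x =
    expansion e' d' mq m P.+1 g' 0 x * sg x + (-1) * (expansion e' d' mq m P.+1 g' 1 x * sg x).
  have Hr (z1 z2 z3 : C) : (z1 + (-1) * z2) * z3 = z1 * z3 + (-1) * (z2 * z3) by ring.
  exact: Hr.
have tail e' d' g' : geo e' Bd rm M c0 g' -> mr g' = mr g -> center_dist g' = center_dist g ->
    let f x := (expansion e' d' mq m P.+1 g' 0 x + (-1) * expansion e' d' mq m P.+1 g' 1 x) * sg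
      x in
    citg D f /\ cabs (cint D f) <= (A1 + A2) * Y.
  move=> hg' mE DE f; have [i1 i2 i3] := H e' d' g' m P.+1 hg' mP.
  have i2' := citgZ (-1) (measurable_itv _) i2.
  have fE : f = fun x => expansion e' d' mq m P.+1 g' 0 x * sg x + (-1) * (expansion e' d' mq m
    P.+1 g' 1 x * sg x).
    by apply/funext => x; exact: dE.
  rewrite fE; split; first exact: citgD.
  by rewrite cintD // cintZ // mulN1r (le_trans i3) // mE DE -mulrA.
have [p1 p2] := tail e d g hg erefl erefl.
have DR : center_dist (reflect g) = center_dist g by rewrite /center_dist /zz /cabs /= !sqrrN.
have [q1 q2] := tail (~~ e) (~~ d) (reflect g) (geo_reflect hg) erefl DR.
have NE : (fun x => Del (- x) * sg x) = fun x => (expansion (~~ e) (~~ d) mq m P.+1 (reflect g)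
  0 x + (-1) * expansion (~~ e) (~~ d) mq m P.+1 (reflect g) 1 x) * sg x.
  by apply/funext => x; rewrite /Del !expansionN.
have [n1 n2] : citg `]-oo, -La] (fun x => Del x * sg x) /\ cint `]-oo,
  -La] (fun x => Del x * sg x) = cint D (fun x => Del (- x) * sg x).
  by apply: (neg_tail_sg mD); rewrite NE; exact: q1.
have hD : adm (A3 * Y) Del.
  apply: (ho_adm mD); [|exact: p1|by rewrite NE; exact: q1].
  rewrite /Y mulrA; apply: ho_ext (H3 e d g m P.+1 hg mP) => x; rewrite /Del mulN1r //.
rewrite (real_intE side msg fS loc La0 hLa (mulr_ge0 A30 Y0) hD).
rewrite (_ : (A1 + A2 + (A1 + A2) + K * A3) * _ * _ =
  (A1 + A2) * Y + (A1 + A2) * Y + K * (A3 * Y)); last by rewrite /Y; ring.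
apply: le_trans (cabsD _ _) _; apply: lerD; last exact: (HK _ _ (mulr_ge0 A30 Y0) hD).
apply: le_trans (cabsD _ _) _; apply: lerD; last exact: p2.
by rewrite n2 NE; exact: q2.
Qed.

End At.

Lemma remainder_bound Bd rm M c0 mq : 0 <= Bd -> 1 < c0 -> 0 < rm ->
  exists n0, exists2 A : R, 0 <= A &
  forall e d g m P, geo e Bd rm M c0 g -> (`|m| < P)%N ->
    cabs (real_int side sg (fun lam => kern_at e g 0 lam * extra_factor d mq lam) - approx mq e
      d m P g) <=
      A * (2 * P + n0)%:R ^+ n0.+1 * (mr g / center_dist g) ^+ (P - `|m|).
Proof.
move=> Bd0 c01 rm0; have [n0 [La [La0 kLa hLa HT]]] := cutoff mq Bd0.
by exists n0; exact: (remainder_at Bd0 La0 kLa hLa HT M c01 rm0).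
Qed.

Lemma base_int_bound Bd mq q zm : 0 <= Bd -> 0 < zm -> exists2 A : R, 0 <= A &
  forall e d be be' X, 0 < be <= Bd -> 0 < be' <= Bd -> `|X| <= Bd -> zm <= cabs (zz be be' X) ->
    cabs (real_int side sg (base mq e d q be be' X)) <= A.
Proof.
move=> Bd0 zm0; have [n0 [La [La0 kLa hLa HT]]] := cutoff mq Bd0.
exact: (base_bound Bd0 La0 kLa hLa HT).
Qed.

End Remainder.

(** * Application to the layered medium *)

Section Polar.
Variable R : realType.
Local Notation pt := (R * R)%type.
Implicit Types p q : pt.

Lemma dist_ge0 p q : 0 <= dist p q. Proof. exact: sqrtr_ge0. Qed.

Lemma dist_sqr p q : dist p q ^+ 2 = (p.1 - q.1) ^+ 2 + (p.2 - q.2) ^+ 2.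
Proof. by rewrite sqr_sqrtr // addr_ge0 ?sqr_ge0. Qed.

Lemma dist_gt0 p q : p <> q -> 0 < dist p q.
Proof.
move=> pq; rewrite lt_def dist_ge0 andbT -sqrf_eq0 dist_sqr.
rewrite paddr_eq0 ?sqr_ge0 // !sqrf_eq0 !subr_eq0; apply/negP => /andP[/eqP h1 /eqP h2].
by apply: pq; case: p q h1 h2 => [? ?] [? ?] /= -> ->.
Qed.

Lemma polar p q : dist p q * cos (angle p q) = p.1 - q.1 /\ dist p q * sin (angle p q) =
  p.2 - q.2.
Proof.
have d2 := dist_sqr p q; have d0 := dist_ge0 p q.
set x := p.1 - q.1 in d2 *; set y := p.2 - q.2 in d2 *; set r := dist p q in d2 d0 *.
have [r0|r0] := eqVneq r 0.
  have /eqP : x ^+ 2 + y ^+ 2 = 0 by rewrite -d2 r0 expr0n.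
  by rewrite paddr_eq0 ?sqr_ge0 // !sqrf_eq0 => /andP[/eqP-> /eqP->]; rewrite r0 !mul0r.
have {d0}rp : 0 < r by rewrite lt_def r0.
have xr : -1 <= x / r <= 1.
  rewrite -ler_norml normrM normrV ?unitfE // (gtr0_norm rp) ler_pdivrMr // mul1r.
  by rewrite -(gtr0_norm rp) -ler_sqr ?nnegrE // !real_normK ?num_real // d2 lerDl sqr_ge0.
have ca : cos (acos (x / r)) = x / r by apply: acosK; rewrite in_itv.
have sa : r * sin (acos (x / r)) = `|y|.
  rewrite sin_acos // -{1}(gtr0_norm rp) -sqrtr_sqr -sqrtrM ?sqr_ge0 //.
  by rewrite mulrBr mulr1 exprMn exprVn mulrCA mulfV ?expf_neq0 // mulr1 d2 addrC addKr sqrtr_sqr.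
rewrite /angle /carg (_ : cabs _ = r) //= -/x -/y.
case: ltP => y0.
  by rewrite ca sa (gtr0_norm y0) mulrCA mulfV ?mulr1.
by rewrite cosN sinN ca mulrN sa (ler0_norm y0) opprK mulrCA mulfV ?mulr1.
Qed.

Lemma cexp_phaseX (phi : R) (m : int) : cexp (Ci R * ofR (m%:~R * phi)) =
  cexp (Ci R * ofR phi) ^ m.
Proof.
case: m => n.
  rewrite -[LHS]/(cexp (Ci R * ofR (n%:R * phi))) -exprnP cexpX ofRM ofR_nat; congr cexp.
  by rewrite mulrCA.
rewrite NegzE -exprz_inv mulrNz mulNr ofRN mulrN cexpN -exprnP exprVn; congr (_^-1).
rewrite -[LHS]/(cexp (Ci R * ofR (n.+1%:R * phi))) cexpX ofRM ofR_nat; congr cexp.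
by rewrite mulrCA.
Qed.

Lemma besselJ_bounded nu (B : R) : 0 <= B -> exists2 c : R, 0 <= c & forall s, `|s| <= B ->
  `|besselJ nu s| <= c.
Proof.
move=> B0; exists ((B / 2) ^+ `|nu|%N / `|nu|%N`!%:R * expR ((B / 2) ^+ 2)).
  by rewrite mulr_ge0 ?expR_ge0 // divr_ge0 ?ler0n // exprn_ge0 // divr_ge0.
move=> s sB; apply: le_trans (besselJ_bound _ _) _.
apply: ler_pM; rewrite ?expR_ge0 // ?divr_ge0 ?exprn_ge0 ?divr_ge0 ?ler0n //.
  rewrite ler_wpM2r ?invr_ge0 ?ler0n // lerXn2r ?nnegrE ?divr_ge0 //.
  by rewrite ler_wpM2r ?invr_ge0 ?ler0n.
rewrite ler_expR -[(s / 2) ^+ 2]real_normK ?num_real //.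
rewrite lerXn2r ?nnegrE ?divr_ge0 // normrM (ger0_norm (_ : 0 <= 2^-1 :> R)) ?invr_ge0 //.
by rewrite ler_wpM2r ?invr_ge0.
Qed.

Lemma poly_growth_bound (A C : R) n0 : 0 <= A -> 0 <= C ->
  poly_growth (fun P => A * (2 * P + n0)%:R ^+ n0.+1 + C).
Proof.
move=> A0 C0; exists (A *: (2 *: 'X + n0%:R%:P) ^+ n0.+1 + C%:P) => n _.
rewrite hornerD hornerZ horner_exp hornerD hornerZ hornerX !hornerC ger0_norm;
  last by rewrite addr_ge0 // mulr_ge0 // exprn_ge0 // ler0n.
by rewrite natrD natrM.
Qed.

End Polar.

Section Component.
Local Open Scope classical_set_scope.
Variables (R : realType) (md : medium R) (q : component md) (side : R -> bool).
Hypothesis hwp : well_posed md (src q).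
Local Notation C := (CC R).
Local Notation pt := (R * R)%type.
Local Notation s := (src q).
Local Notation star := (srcmark q).
Local Notation t := (tgt q).
Local Notation a := (tgtmark q).
Local Notation sg := (sigq q).
Local Notation ks := (wavenum md s).
Local Notation kt := (wavenum md t).
Local Notation rint := (real_int side sg).

Let sn := src_le q.
Let tn := tgt_le q.
Let star_ok := srcmark_ok q.
Let a_ok := tgtmark_ok q.

Lemma src_wavenum_gt0 : 0 < ks. Proof. exact: wavenum_gt0. Qed.
Lemma tgt_wavenum_gt0 : 0 < kt. Proof. exact: wavenum_gt0. Qed.

Lemma cmf_sigq : cmf sg.
Proof. exact: sigma_measurable hwp sn tn star_ok a_ok. Qed.

Lemma sigq_poles : finite_set (real_poles sg).
Proof. exact: poles_finite hwp sn tn star_ok a_ok. Qed.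

Lemma sigq_loc (m : R) : isq_bounded m (fun x => sg x - residue sg m / ofR (x - m)).
Proof. exact: sigma_loc hwp sn tn star_ok a_ok m. Qed.

Lemma sigq_even x : sg (- x) = sg x.
Proof. exact: sigma_even. Qed.

Lemma sigq_inf b : (b <= nint md)%N -> inf_expansion sg (wavenum md b / 2).
Proof. exact: sigma_inf hwp sn tn star_ok a_ok. Qed.

Lemma kernelE_kern (p p' : pt) lam : kernelE q p p' lam =
  kern kt ks (tgt_depth q p) (src_depth q p') (p.1 - p'.1) lam.
Proof. by rewrite /kernelE !hrealE. Qed.

Lemma kern_swap (k1 k2 b b' X lam : R) : kern k1 k2 b b' X lam = kern k2 k1 b' b X lam.
Proof. by rewrite /kern [- _ - _]addrC. Qed.

Lemma wfun_W l lam : (l <= nint md)%N -> - Ci R * wfun md l lam = W (wavenum md l) false lam.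
Proof.
move=> ln; rewrite /wfun hrealE /W /= mulN1r ofRN.
by move: (hk (wavenum md l) lam) (ofR lam) (ofR (wavenum md l))^-1 => h L K; ring.
Qed.

Lemma wfunV_W l lam : (l <= nint md)%N -> Ci R * (wfun md l lam)^-1 = W (wavenum md l) true lam.
Proof.
move=> ln; have E : - Ci R * Ci R = 1 by rewrite mulNr CiCi opprK.
by rewrite -[true]/(~~ false) -W_inv ?wavenum_gt0 // -wfun_W // [RHS]invfM (mulr1_eq E).
Qed.

Lemma eq_rint (f h : R -> C) : (forall lam, f lam = h lam) -> rint f = rint h.
Proof. by move=> /funext ->. Qed.

Definition depths_le (Bd : R) (p p' : pt) : Prop :=
  [/\ 0 < tgt_depth q p <= Bd, 0 < src_depth q p' <= Bd & `|p.1 - p'.1| <= Bd].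

(** The sign tau is put into the angle, so that a displacement changes the depth by r sin(phi)
    whether the depth is measured upwards or downwards. *)
Definition moveK (xl xt x' : pt) : move R :=
  Move (tgt_depth q xl) (src_depth q x') (xl.1 - x'.1) (dist xt xl) (tau a * angle xt xl).
(** The displaced point always comes first. For a displaced source the two depths and the two wave
    numbers are therefore exchanged, which [kern_swap] permits. *)
Definition moveM (xl x' xc : pt) : move R :=
  Move (src_depth q xc) (tgt_depth q xl) (xl.1 - xc.1) (dist x' xc) (tau star * angle x' xc).

Lemma cabs_zzK xl xt x' : center_dist (moveK xl xt x') = polD q xl x'.
Proof. by rewrite /center_dist /polD /cabs /= sqrrN addrC. Qed.

Lemma cabs_zzM xl x' xc : center_dist (moveM xl x' xc) = polD q xl xc.
Proof. by rewrite /center_dist /polD /cabs /= sqrrN addrC (addrC (src_depth _ _)). Qed.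

Lemma tau_sin (b : mark) (th : R) : sin (tau b * th) = tau b * sin th.
Proof. by case: b; rewrite /= ?mul1r // !mulN1r sinN. Qed.
Lemma tau_cos (b : mark) (th : R) : cos (tau b * th) = cos th.
Proof. by case: b; rewrite /= ?mul1r // mulN1r cosN. Qed.

Lemma depth_move (b : mark) l (p p' : pt) :
  depth md b l p + (1 - 0) * (dist p' p * sin (tau b * angle p' p)) = depth md b l p'.
Proof.
have [_ h] := polar p' p; rewrite tau_sin subr0 mul1r mulrCA h /depth; ring.
Qed.

Lemma depth_atK xl xt x' : depth_at (moveK xl xt x') 0 = tgt_depth q xt.
Proof. exact: depth_move. Qed.
Lemma depth_atM xl x' xc : depth_at (moveM xl x' xc) 0 = src_depth q x'.
Proof. exact: depth_move. Qed.
Lemma offset_atK xl xt x' : offset_at true (moveK xl xt x') 0 = xt.1 - x'.1.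
Proof.
have [h _] := polar xt xl; rewrite /offset_at /= tau_cos h; ring.
Qed.
Lemma offset_atM xl x' xc : offset_at false (moveM xl x' xc) 0 = xl.1 - x'.1.
Proof.
have [h _] := polar x' xc; rewrite /offset_at /= tau_cos h; ring.
Qed.

Lemma geoK Bd rm M c0 xl xt x' : depths_le Bd xl x' -> depths_le Bd xt x' ->
  c0 * dist xt xl < polD q xl x' -> rm <= polD q xl x' <= M ->
    geo true Bd rm M c0 (moveK xl xt x').
Proof.
move=> [h1 h2 h3] [h4 _ h5] h6 h7; split; split; rewrite ?cabs_zzK ?depth_atK ?offset_atK //.
exact: dist_ge0.
Qed.

Lemma geoM Bd rm M c0 xl x' xc : depths_le Bd xl xc -> depths_le Bd xl x' ->
  c0 * dist x' xc < polD q xl xc -> rm <= polD q xl xc <= M ->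
    geo false Bd rm M c0 (moveM xl x' xc).
Proof.
move=> [h1 h2 h3] [_ h4 h5] h6 h7; split; split; rewrite ?cabs_zzM ?depth_atM ?offset_atM //.
exact: dist_ge0.
Qed.

Lemma coefL_kern_at (m : int) xl xt x' : coefL q side m xt x' =
  rint (fun lam => kern_at kt ks true (moveK xl xt x') 0 lam * extra_factor kt true m lam).
Proof.
rewrite /coefL; apply: eq_rint => lam.
by rewrite /kern_at depth_atK offset_atK kernelE_kern /extra_factor wfunV_W.
Qed.

Lemma coefL_kern_atM (m : int) xl x' xc : coefL q side m xl x' =
  rint (fun lam => kern_at ks kt false (moveM xl x' xc) 0 lam * extra_factor kt true m lam).
Proof.
rewrite /coefL; apply: eq_rint => lam.
by rewrite /kern_at depth_atM offset_atM kernelE_kern kern_swap /extra_factor wfunV_W.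
Qed.

Lemma coefL_base (m n : int) xl x' : coefL q side (m + n) xl x' =
  rint (base kt ks kt n true true m (tgt_depth q xl) (src_depth q x') (xl.1 - x'.1)).
Proof.
rewrite /coefL; apply: eq_rint => lam.
by rewrite /base kernelE_kern /extra_factor wfunV_W // -mulrA -expfzDr // W_neq0 //
  tgt_wavenum_gt0.
Qed.

Lemma coefA_base (m p : int) xl xc : coefA q side m p xl xc =
  rint (base ks kt kt m false true p (src_depth q xc) (tgt_depth q xl) (xl.1 - xc.1)).
Proof.
rewrite /coefA; apply: eq_rint => lam.
by rewrite /base /extra_factor kernelE_kern (kern_swap kt ks) (wfunV_W lam tn) (wfun_W lam sn).
Qed.

Lemma basisK_phase (m : int) x xl : basisK q m x xl =
  ofR (besselJ m (kt * dist x xl)) * cexp (Ci R * ofR (tau a * angle x xl)) ^ m.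
Proof. by rewrite /basisK -mulrA cexp_phaseX. Qed.

Lemma basisM_phase (p : int) x' xc : basisM q p x' xc =
  ofR (besselJ p (ks * dist x' xc)) * cexp (Ci R * ofR (tau star * angle x' xc)) ^ p.
Proof. by rewrite /basisM -mulrA cexp_phaseX. Qed.

(** The power m of i / w_t in the coefficient and the power p - m from the generating function
    combine to p. This explains the index p - m of K in the translation. *)
Lemma approxK (m : int) P (xl xt x' : pt) : approx kt ks kt sg side m true true m P (moveK xl xt
  x') =
  zsum P (fun p => coefL q side p xl x' * basisK q (p - m) xt xl).
Proof.
apply: zsum_ext => p; rewrite basisK_phase.
by have := coefL_base (p - m) m xl x'; rewrite subrK => ->.
Qed.

Lemma approxM (m : int) P (xl x' xc : pt) : approx ks kt kt sg side m false true 0 P (moveM xl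
  x' xc) =
  zsum P (fun p => coefA q side m p xl xc * basisM q p x' xc).
Proof.
by apply: zsum_ext => p; rewrite basisM_phase subr0 coefA_base.
Qed.

(** The power of i / w_t belongs to the other end of the move and stays outside as [extra_factor].
    The summation is not shifted, and the full power P is obtained. *)
Lemma M2L_uniform (Bd rm M c0 : R) (m : int) : 0 <= Bd -> 0 < rm -> 1 < c0 -> exists2 c : nat ->
  R, poly_growth c &
  forall xl x' xc, depths_le Bd xl xc -> depths_le Bd xl x' -> rm <= polD q xl xc <= M ->
    M2L_bound q side c0 x' xc xl m c.
Proof.
move=> Bd0 rm0 c01.
have [n0 [A A0 HA]] := remainder_bound kt src_wavenum_gt0 tgt_wavenum_gt0 side cmf_sigq
  sigq_poles sigq_loc sigq_even (sigq_inf sn) M m Bd0 c01 rm0.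
exists (fun P => A * (2 * P + n0)%:R ^+ n0.+1 + 0); first exact: poly_growth_bound.
move=> xl x' xc h1 h2 h3 h4 P P0; rewrite addr0.
have := HA false true (moveM xl x' xc) 0 P (geoM h1 h2 h4 h3) P0.
by rewrite approxM -coefL_kern_atM cabs_zzM subn0.
Qed.

Lemma zsum_bounded (T : Type) (Q : T -> Prop) (F : T -> int -> C) P :
  (forall p, exists2 c : R, 0 <= c & forall z, Q z -> cabs (F z p) <= c) ->
  exists2 c : R, 0 <= c & forall z, Q z -> cabs (zsum P (F z)) <= c.
Proof.
move=> H; case: P => [|P].
  have [c c0 Hc] := H 0; exists c => // z Qz; rewrite /zsum big_geq // addr0; exact: Hc.
elim: P => [|P [c c0 Hc]].
  by have [c c0 Hc] := H 0; exists c => // z Qz; rewrite zsum1; exact: Hc.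
have [c1 c10 Hc1] := H P.+1%:Z; have [c2 c20 Hc2] := H (- P.+1%:Z).
exists (c + (c1 + c2)); first by rewrite !addr_ge0.
move=> z Qz; rewrite zsumS; apply: le_trans (cabsD _ _) _; apply: lerD; first exact: Hc.
by apply: le_trans (cabsD _ _) _; apply: lerD; [exact: Hc1 | exact: Hc2].
Qed.

Lemma uniform_bounded (T : Type) (Q : T -> Prop) (F : T -> nat -> R) N :
  (forall P, exists2 c : R, 0 <= c & forall z, Q z -> F z P <= c) ->
  exists2 c : R, 0 <= c & forall z P, Q z -> (P <= N)%N -> F z P <= c.
Proof.
move=> H; elim: N => [|N [c c0 Hc]].
  by have [c c0 Hc] := H 0%N; exists c => // z P Qz; rewrite leqn0 => /eqP ->; exact: Hc.
have [c1 c10 Hc1] := H N.+1; exists (c + c1); first by rewrite addr_ge0.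
move=> z P Qz; rewrite leq_eqVlt => /predU1P[->|].
  by apply: le_trans (Hc1 z Qz) _; rewrite lerDr.
by rewrite ltnS => /(Hc z P Qz) h; apply: le_trans h _; rewrite lerDl.
Qed.

Lemma polD_gt0 xl x' : 0 < tgt_depth q xl -> 0 < src_depth q x' -> 0 < polD q xl x'.
Proof.
by move=> h1 h2; rewrite sqrtr_gt0 ltr_wpDl ?sqr_ge0 // exprn_gt0 // addr_gt0.
Qed.

Lemma coefL_bounded (Bd rm : R) (m : int) : 0 <= Bd -> 0 < rm -> exists2 c : R, 0 <= c &
  forall xl x', depths_le Bd xl x' -> rm <= polD q xl x' -> cabs (coefL q side m xl x') <= c.
Proof.
move=> Bd0 rm0.
have [c c0 Hc] := base_int_bound ks tgt_wavenum_gt0 tgt_wavenum_gt0 side cmf_sigq sigq_poles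
  sigq_loc sigq_even (sigq_inf tn) 0 m Bd0 rm0.
exists c => // xl x' [h1 h2 h3] h4; rewrite -[m]addr0 coefL_base; apply: Hc => //.
by move: h4; rewrite -(cabs_zzK xl xl x').
Qed.

(** For P > |m| the general estimate gives only the power P - |m| of y = r / D, and for the finitely
    many P <= |m| the remainder is merely bounded. The lower bound r0 on r, which gives y >= r0 / M,
    pays for both. *)
Lemma L2L_uniform (Bd rm M c0 r0 : R) (m : int) : 0 <= Bd -> 0 < rm -> 1 < c0 -> 0 < r0 ->
  exists2 c : nat -> R, poly_growth c &
  forall x' xl xt, depths_le Bd xl x' -> depths_le Bd xt x' -> rm <= polD q xl x' <= M ->
    m = 0 \/ r0 <= dist xt xl ->
    L2L_bound q side c0 x' xl xt m c.
Proof.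
move=> Bd0 rm0 c01 r00.
have [n0 [A A0 HA]] := remainder_bound ks tgt_wavenum_gt0 tgt_wavenum_gt0 side cmf_sigq
  sigq_poles sigq_loc sigq_even (sigq_inf tn) M m Bd0 c01 rm0.
pose Q (z : pt * pt * pt) := [/\ depths_le Bd z.1.2 z.1.1, depths_le Bd z.2 z.1.1,
  rm <= polD q z.1.2 z.1.1 <= M &
   c0 * dist z.2 z.1.2 < polD q z.1.2 z.1.1].
have cp : 0 < 1 - c0^-1 by rewrite subr_gt0 invf_lt1 // (lt_trans ltr01).
(* The new center is the displaced point, so this is [zmin_le] at s = 0. *)
have QD z : Q z -> rm * (1 - c0^-1) <= polD q z.2 z.1.1.
  move=> [h1 h2 h3 h4]; have hs : 0 <= (0 : R) <= 1 by rewrite lexx ler01.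
  have := zmin_le c01 (geoK h1 h2 h4 h3) hs.
  by rewrite /dist_at /zmin depth_atK offset_atK -(cabs_zzK z.2 z.2 z.1.1).
have B1 P : exists2 c : R, 0 <= c & forall z, Q z ->
    cabs (coefL q side m z.2 z.1.1 - zsum P (fun p => coefL q side p z.1.2 z.1.1 * basisK q (p -
      m) z.2 z.1.2)) <= c.
  have [c1 c10 H1] := coefL_bounded m Bd0 (mulr_gt0 rm0 cp).
  have [p|c2 c20 H2] := @zsum_bounded _ Q (fun z p => coefL q side p z.1.2 z.1.1 * basisK q (p -
    m) z.2 z.1.2) P.
    have [c3 c30 H3] := coefL_bounded p Bd0 rm0.
    have [c4 c40 H4] := @besselJ_bounded _ (p - m) (kt * `|M|) (mulr_ge0 (ltW tgt_wavenum_gt0)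
      (normr_ge0 _)).
    exists (c3 * c4) => [|z Qz]; first exact: mulr_ge0.
    have [h1 h2 /andP[h3 h3'] h4] := Qz.
    rewrite basisK_phase !cabsM cabs_ofR (cabs_zexp1 _ (cabs_phase _)) mulr1.
    apply: ler_pM; rewrite ?cabs_ge0 //; first exact: H3.
    apply: H4; rewrite normrM (gtr0_norm tgt_wavenum_gt0) ler_pM2l ?tgt_wavenum_gt0 //
      (ger0_norm (dist_ge0 _ _)).
    have d0 := dist_ge0 z.2 z.1.2.
    apply: le_trans (ler_norm _); apply: le_trans h3'; apply: le_trans (ltW h4).
    by rewrite ler_peMl // ltW.
  exists (c1 + c2); first by rewrite addr_ge0.
  move=> z Qz; have [h1 h2 h3 h4] := Qz; apply: le_trans (cabsB _ _) _; apply: lerD;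
    last exact: H2.
  by apply: H1 => //; exact: QD.
have [c2 c20 H2] := uniform_bounded `|m|%N B1.
(* For m <> 0 the product of y and max(1, M / r0) is at least 1, so |m| missing powers of y cost at
   most [kap]; for m = 0 nothing is missing and [kap] is 1. *)
pose kap := Num.max 1 (M / r0) ^+ `|m|%N.
have mx1 : 1 <= Num.max 1 (M / r0) by rewrite le_max lexx.
have mx0 : 0 <= Num.max 1 (M / r0) by apply: le_trans mx1.
have kap1 : 1 <= kap by apply: exprn_ege1.
have kap0 : 0 <= kap by apply: le_trans kap1.
exists (fun P => (kap * A) * (2 * P + n0)%:R ^+ n0.+1 + kap * c2);
  first by apply: poly_growth_bound; exact: mulr_ge0.
move=> x' xl xt h1 h2 h3 h5 h4 P P0.
have D0 : 0 < polD q xl x' by case/andP: h3 => h3 _; apply: lt_le_trans h3.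
have d0 := dist_ge0 xt xl.
set y := dist xt xl / polD q xl x'.
have y0 : 0 <= y by rewrite divr_ge0 // ltW.
have cP : 0 <= (2 * P + n0)%:R ^+ n0.+1 :> R by rewrite exprn_ge0 ?ler0n.
have ym : m <> 0 -> 1 <= y * Num.max 1 (M / r0).
  move=> m0; have {}h5 : r0 <= dist xt xl by case: h5.
  apply: (@le_trans _ _ (y * (M / r0))); last by rewrite ler_wpM2l // le_max lexx orbT.
  rewrite [leRHS](_ : _ = dist xt xl / r0 * (M / polD q xl x')); last by rewrite /y; ring.
  by apply: mulr_ege1; rewrite ler_pdivlMr // mul1r //; case/andP: h3.
have [mP|mP] := ltnP `|m|%N P.
- have := HA true true (moveK xl xt x') m P (geoK h1 h2 h4 h3) mP.
  rewrite approxK -coefL_kern_at cabs_zzK -/y => hA; apply: le_trans hA _.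
  have yP : y ^+ (P - `|m|) <= y ^+ P * kap.
    have [m0|/eqP m0] := eqVneq m 0; first by rewrite /kap m0 subn0 expr0 mulr1.
    rewrite -{2}(subnK (ltnW mP)) exprD -mulrA ler_peMr ?exprn_ge0 // /kap -exprMn.
    exact: exprn_ege1 (ym m0).
  apply: (@le_trans _ _ (A * (2 * P + n0)%:R ^+ n0.+1 * (y ^+ P * kap))).
    by apply: ler_wpM2l yP; exact: mulr_ge0.
  rewrite [leRHS](_ : _ = A * (2 * P + n0)%:R ^+ n0.+1 * (y ^+ P * kap) + kap * c2 * y ^+ P);
    last by ring.
  by rewrite lerDl !mulr_ge0 ?exprn_ge0.
- have m0 : m <> 0 by move=> m0; move: mP; rewrite m0 leqNgt P0.
  apply: (@le_trans _ _ c2); first exact: (H2 (x', xl, xt) P).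
  have yP : 1 <= y ^+ P * kap.
    apply: (@le_trans _ _ (y ^+ P * Num.max 1 (M / r0) ^+ P));
      first by rewrite -exprMn exprn_ege1 // ym.
    by rewrite ler_wpM2l ?exprn_ge0 // ler_weXn2l.
  rewrite mulrDl ler_wpDl //; first by rewrite !mulr_ge0 ?exprn_ge0.
  rewrite (_ : kap * c2 * _ = c2 * (y ^+ P * kap)); last by ring.
  by rewrite ler_peMr.
Qed.

Lemma coefL0 xl x' : coefL q side 0 xl x' = ureact q side xl x'.
Proof. by apply: eq_rint => lam; rewrite expr0z mulr1. Qed.

Lemma coefA0 p xl xc : coefA q side 0 p xl xc = coefI q side p xl xc.
Proof. by apply: eq_rint => lam; rewrite expr0z mulr1. Qed.

Lemma M2L_ME c0 x x' xc c : M2L_bound q side c0 x' xc x 0 c -> ME_bound q side c0 x x' xc c.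
Proof.
move=> H h P P0; rewrite -coefL0 (_ : zsum P _ =
  zsum P (fun p => coefA q side 0 p x xc * basisM q p x' xc)).
  exact: H.
by apply: zsum_ext => p; rewrite coefA0.
Qed.

Lemma L2L_LE c0 x x' xl c : L2L_bound q side c0 x' xl x 0 c -> LE_bound q side c0 x x' xl c.
Proof.
move=> H h P P0; rewrite -coefL0 (_ : zsum P _ =
  zsum P (fun p => coefL q side p xl x' * basisK q (p - 0) x xl)).
  exact: H.
by apply: zsum_ext => p; rewrite subr0.
Qed.

(** Two of the four expansions are special cases: with m = 0, M2L becomes ME and L2L becomes LE. *)
Lemma uniform_bounds Bd rm M c0 : 0 <= Bd -> 0 < rm -> 1 < c0 ->
  exists (cME cLE : nat -> R) (cM2L : int -> nat -> R) (cL2L : R -> int -> nat -> R),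
  [/\ poly_growth cME, poly_growth cLE, forall m, poly_growth (cM2L m) & forall r0 m, 0 < r0 ->
    poly_growth (cL2L r0 m)] /\
  forall x x' xc xl xt,
    [/\ depths_le Bd x x', depths_le Bd x xc, depths_le Bd xl x',
      depths_le Bd xl xc & depths_le Bd xt x'] ->
    [/\ rm <= polD q x xc <= M, rm <= polD q xl x' <= M & rm <= polD q xl xc <= M] ->
    [/\ ME_bound q side c0 x x' xc cME, LE_bound q side c0 x x' xl cLE,
        forall m, M2L_bound q side c0 x' xc xl m (cM2L m) &
        forall r0 m, 0 < r0 -> m = 0 \/ r0 <= dist xt xl ->
          L2L_bound q side c0 x' xl xt m (cL2L r0 m)].
Proof.
move=> Bd0 rm0 c01.
have [cME pME HME] := M2L_uniform M 0 Bd0 rm0 c01.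
have [cLE pLE HLE] := L2L_uniform M 0 Bd0 rm0 c01 ltr01.
have /boolp.choice[cM2L HM2L] : forall m : int, exists c : nat -> R, poly_growth c /\
    forall xl x' xc, depths_le Bd xl xc -> depths_le Bd xl x' -> rm <= polD q xl xc <= M ->
      M2L_bound q side c0 x' xc xl m c.
  by move=> m; have [c c1 c2] := M2L_uniform M m Bd0 rm0 c01; exists c.
have /boolp.choice[cL2L HL2L] : forall z : R * int, exists c : nat -> R, 0 < z.1 ->
  poly_growth c /\
    forall x' xl xt, depths_le Bd xl x' -> depths_le Bd xt x' -> rm <= polD q xl x' <= M ->
      z.2 = 0 \/ z.1 <= dist xt xl ->
      L2L_bound q side c0 x' xl xt z.2 c.
  move=> [r0 m] /=; have [r00|r00] := ltP 0 r0; last by exists (fun=> 0).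
  by have [c c1 c2] := L2L_uniform M m Bd0 rm0 c01 r00; exists c.
exists cME, cLE, cM2L, (fun r0 m => cL2L (r0, m)); split.
  by split=> // [m|r0 m r00]; [have [] := HM2L m | have [] := HL2L (r0, m) r00].
move=> x x' xc xl xt [h1 h2 h3 h4 h5] [d1 d2 d3]; split.
- by apply: M2L_ME; exact: HME.
- by apply: L2L_LE; apply: HLE => //; left.
- by move=> m; have [_ H] := HM2L m; exact: H.
- by move=> r0 m r00 hm; have [_ H] := HL2L (r0, m) r00; exact: H.
Qed.

Lemma depth_gt0 b l p : mark_ok md b l -> in_layer md l p -> 0 < depth md b l p.
Proof.
by case: b => /= hl [h1 h2]; rewrite /depth /= ?mul1r ?mulN1r ?opprB subr_gt0;
  [exact: h1 | exact: h2].
Qed.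

Lemma depth_le b l (p : pt) y0 y1 : y0 <= p.2 <= y1 ->
  depth md b l p <= `|y0| + `|y1| + `|dmark md b l|.
Proof.
move=> /andP[h0 h1]; apply: le_trans (ler_norm _) _;
  rewrite /depth normrM (_ : `|tau b| = 1) ?mul1r; last first.
  by case: b; rewrite /= ?normrN normr1.
apply: le_trans (ler_normB _ _) _; rewrite lerD2r ler_norml.
have := ler_norm y1; have := ler_norm (- y0); rewrite normrN; have := normr_ge0 y0;
  have := normr_ge0 y1.
by move=> *; apply/andP; split; lra.
Qed.

End Component.

Lemma le_sum_norm (R : realType) (l : seq R) v : v \in l -> `|v| <= \sum_(w <- l) `|w|.
Proof. by move=> vl; rewrite (big_rem v) //= lerDl sumr_ge0. Qed.

Theorem theorem2p5 (R : realType) (md : medium R) (q : component md)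
    (side : R -> bool)
    (hwp : well_posed md (src q)) (hside : pole_sides q side)
    (c0 : R) (hc0 : 1 < c0) :
  (forall x x' xc xl xt : R * R,
     admissible q x x' xc xl xt ->
     exists (cME cLE : nat -> R) (cM2L cL2L : int -> nat -> R),
       [/\ poly_growth cME, poly_growth cLE,
           forall m, poly_growth (cM2L m) & forall m, poly_growth (cL2L m)] /\
       [/\ ME_bound q side c0 x x' xc cME,
           LE_bound q side c0 x x' xl cLE,
           forall m, M2L_bound q side c0 x' xc xl m (cM2L m) &
           forall m, m = 0 \/ xt <> xl ->
             L2L_bound q side c0 x' xl xt m (cL2L m)])
  /\
  (forall x0 x1 y0 y1 eta rho_m rho_M : R,
     0 < eta -> 0 < rho_m <= rho_M ->
     exists (cME cLE : nat -> R) (cM2L : int -> nat -> R)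
            (cL2L : R -> int -> nat -> R),
       [/\ poly_growth cME, poly_growth cLE,
           forall m, poly_growth (cM2L m) &
           forall r0 m, 0 < r0 -> poly_growth (cL2L r0 m)] /\
       forall x x' xc xl xt : R * R,
         admissible q x x' xc xl xt ->
         [/\ in_box x0 x1 y0 y1 x, in_box x0 x1 y0 y1 x',
             in_box x0 x1 y0 y1 xc, in_box x0 x1 y0 y1 xl &
             in_box x0 x1 y0 y1 xt] ->
         [/\ eta <= src_depth q xc, eta <= tgt_depth q xl &
             eta <= tgt_depth q xt] ->
         [/\ rho_m <= polD q x xc <= rho_M,
             rho_m <= polD q xl x' <= rho_M &
             rho_m <= polD q xl xc <= rho_M] ->
         [/\ ME_bound q side c0 x x' xc cME,
             LE_bound q side c0 x x' xl cLE,
             forall m, M2L_bound q side c0 x' xc xl m (cM2L m) &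
             forall r0 m, 0 < r0 -> m = 0 \/ r0 <= dist xt xl ->
               L2L_bound q side c0 x' xl xt m (cL2L r0 m)]).
Proof.
split.
  move=> x x' xc xl xt [hx hx' hxc hxl hxt].
  have dx := depth_gt0 (tgtmark_ok q) hx; have dx' := depth_gt0 (srcmark_ok q) hx'.
  (* For given points the bounds needed by the uniform estimate are read off from the points
     themselves. *)
  pose l := [:: tgt_depth q x; tgt_depth q xl; tgt_depth q xt; src_depth q x'; src_depth q xc;
    x.1 - x'.1; x.1 - xc.1; xl.1 - x'.1; xl.1 - xc.1; xt.1 - x'.1].
  pose Bd : R := \sum_(w <- l) `|w|.
  have Bd0 : 0 <= Bd by apply: sumr_ge0.
  have HB v : v \in l -> `|v| <= Bd by exact: le_sum_norm.
  have HB' v : v \in l -> v <= Bd by move=> /HB; apply: le_trans; exact: ler_norm.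
  have ok p p' : 0 < tgt_depth q p -> 0 < src_depth q p' -> tgt_depth q p \in l ->
    src_depth q p' \in l ->
      p.1 - p'.1 \in l -> depths_le q Bd p p'.
    by move=> h1 h2 h3 h4 h5; split; rewrite ?h1 ?h2 /=; [exact: HB' | exact: HB' | exact: HB].
  pose D1 := polD q x xc; pose D2 := polD q xl x'; pose D3 := polD q xl xc.
  pose rm := Num.min D1 (Num.min D2 D3); pose M := Num.max D1 (Num.max D2 D3).
  have rm0 : 0 < rm by rewrite !lt_min !polD_gt0.
  have [cME [cLE [cM2L [cL2L [[p1 p2 p3 p4] H]]]]] := uniform_bounds side hwp M Bd0 rm0 hc0.
  (* If the two local centers coincide only m = 0 remains, and any positive value will do. *)
  pose r0 := if xt == xl then 1 else dist xt xl.
  have r00 : 0 < r0 by rewrite /r0; case: eqVneq => [|/eqP /dist_gt0].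
  exists cME, cLE, cM2L, (cL2L r0); split; first by split=> // m; exact: p4.
  have [||b1 b2 b3 b4] := H x x' xc xl xt.
  - by split; apply: ok => //; rewrite !inE eqxx ?orbT.
  - by split; rewrite /rm /M !ge_min !le_max lexx ?orbT.
  split=> // m hm; apply: b4 => //.
  by case: hm => [|xtl]; [left | right]; rewrite // /r0; case: eqVneq => //.
move=> x0 x1 y0 y1 eta rho_m rho_M eta0 /andP[rho0 _].
pose Bd : R := `|x0| + `|x1| + (`|y0| + `|y1|) + `|dmark md (tgtmark q) (tgt q)| + `|dmark md
  (srcmark q) (src q)|.
have Bd0 : 0 <= Bd by rewrite !addr_ge0.
have [cME [cLE [cM2L [cL2L [hp H]]]]] := uniform_bounds side hwp rho_M Bd0 rho0 hc0.
exists cME, cLE, cM2L, cL2L; split=> // x x' xc xl xt [hx hx' hxc hxl hxt] [bx bx' bxc bxl bxt]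
  _ hD.
have dx := depth_gt0 (tgtmark_ok q) hx; have dx' := depth_gt0 (srcmark_ok q) hx'.
have ok p p' : in_box x0 x1 y0 y1 p -> in_box x0 x1 y0 y1 p' -> 0 < tgt_depth q p ->
  0 < src_depth q p' -> depths_le q Bd p p'.
  move=> [h1 h2] [h3 h4] h5 h6.
  have n0 := normr_ge0 x0; have n1 := normr_ge0 x1.
  have n2 := normr_ge0 (dmark md (tgtmark q) (tgt q));
    have n3 := normr_ge0 (dmark md (srcmark q) (src q)).
  have n4 := normr_ge0 y0; have n5 := normr_ge0 y1.
  split; rewrite ?h5 ?h6 /=.
  - by have := @depth_le _ md (tgtmark q) (tgt q) p y0 y1 h2; rewrite /tgt_depth /Bd; lra.
  - by have := @depth_le _ md (srcmark q) (src q) p' y0 y1 h4; rewrite /src_depth /Bd; lra.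
  - have := ler_norm x1; have := ler_norm (- x0); rewrite normrN /Bd ler_norml.
    by case/andP: h1 => ? ?; case/andP: h3 => ? ? ? ?; apply/andP; split; lra.
by apply: H => //; split; exact: ok.
Qed.
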